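(* Let $T>0$, $\mu,\omega_0\in\mathbb R$, let $V\in C^1(\mathbb R)$ be real-valued and $T$-periodic, and let $\psi_0\in H^2(\mathbb R)$ be a real-valued nondegenerate solution of $-\psi''+\mu V\psi+\omega\psi-\psi^3=0$ at $\omega=\omega_0$ such that, at $\omega=\omega_0$, $L_{+,\mu}(\psi_0)$ has precisely one negative eigenvalue (counting algebraic multiplicities), $L_{-,\mu}(\psi_0)$ has no negative eigenvalues, and $\langle\partial_\omega\tilde\psi(\omega_0),\psi_0\rangle_{L^2}>0$, where $\tilde\psi$ is the continuation of $\psi_0$ in $\omega$. Suppose $\omega_0$ is larger than the spectral bound (supremum of the spectrum) of $\partial_x^2-\mu V$ acting on $L^2(\mathbb R)$. Let $\psi_{{\rm per},n}\in H^2_{\rm per}(0,nT)$ be the periodic pulse solutions associated with $\psi_0$ described in the context. Then there exists $N\in\mathbb N$ such that for all $n\ge N$ the stationary solution $\boldsymbol\psi_{{\rm per},n}=(\psi_{{\rm per},n},0)^\top$ of $$\partial_t\boldsymbol\psi=J\big(-\partial_x^2\boldsymbol\psi+\mu V(x)\boldsymbol\psi+\omega_0\boldsymbol\psi-|\boldsymbol\psi|^2\boldsymbol\psi\big),\qquad J=\begin{pmatrix}0&1\\-1&0\end{pmatrix},\quad\boldsymbol\psi(x,t)\in\mathbb R^2,\qquad(\ast)$$ is orbitally stable: for each $\varepsilon>0$ there exists $\delta>0$ such that whenever $v_0\in H^1_{\rm per}(0,nT)$ ($\mathbb R^2$-valued) satisfies $\|v_0\|_{H^1_{\rm per}(0,nT)}<\delta$,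 there exists a global mild solution $\boldsymbol\psi\in C([0,\infty),H^1_{\rm per}(0,nT))$ of $(\ast)$ with $\boldsymbol\psi(0)=\boldsymbol\psi_{{\rm per},n}+v_0$ obeying $$\inf_{\gamma\in\mathbb R}\|\boldsymbol\psi(t)-R(\gamma)\boldsymbol\psi_{{\rm per},n}\|_{H^1_{\rm per}(0,nT)}<\varepsilon\qquad\text{for all }t\ge0,$$ where $R(\gamma)=\begin{pmatrix}\cos\gamma&\sin\gamma\\-\sin\gamma&\cos\gamma\end{pmatrix}$.
   Context: For real-valued $\underline\psi\in L^\infty(\mathbb R)$ define on $L^2(\mathbb R)$, with domain $H^2(\mathbb R)$, $L_{-,\mu}(\underline\psi)\varphi=-\varphi''+\mu V\varphi+\omega\varphi-\underline\psi^2\varphi$ and $L_{+,\mu}(\underline\psi)\varphi=-\varphi''+\mu V\varphi+\omega\varphi-3\underline\psi^2\varphi$. A real-valued solution $\psi_0$ of the stationary equation $-\psi''+\mu V\psi+\omega\psi-\psi^3=0$ is nondegenerate if $L_{+,\mu}(\psi_0):H^2(\mathbb R)\to L^2(\mathbb R)$ is invertible. In that case there are $\nu>0$ and a locally unique smooth map $\tilde\psi:(\omega_0-\nu,\omega_0+\nu)\to H^2(\mathbb R)$ with $\tilde\psi(\omega_0)=\psi_0$ such that $\tilde\psi(\omega)$ solves the stationary equation at frequency $\omega$; this is the continuation in $\omega$. $H^l_{\rm per}(0,L)$: $L$-periodic, locally $H^l$ functions with the $H^l(0,L)$-norm. Periodic pulse solutions: there is $N_0\in\mathbb N$ such that for each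 $n\ge N_0$ there is an $nT$-periodic real-valued solution $\psi_{{\rm per},n}$ of the stationary equation at $\omega=\omega_0$ of the form $\psi_{{\rm per},n}=\chi_n\psi_0+a_n$ on $[-\frac n2T,\frac n2T)$, with $a_n\in H^2_{\rm per}(0,nT)$, $\|a_n\|_{H^2_{\rm per}(0,nT)}\to0$ as $n\to\infty$. Here $\chi_n:\mathbb R\to[0,1]$ is (for large $n$) a smooth $nT$-periodic cut-off with $\|\chi_n\|_{W^{2,\infty}}\le1$ (maximum of sup norms of derivatives of order $\le2$), $\chi_n=1$ on $[-\frac n6T,\frac n6T]$, $\chi_n=0$ on $[-\frac n2T,-\frac n3T]\cup[\frac n3T,\frac n2T]$. In the claim $N\ge N_0$. *)

(* Defs.v *)
From HB Require Import structures.
From mathcomp Require Import all_boot all_order all_algebra.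
From mathcomp Require Import complex.
From mathcomp Require Import all_classical all_reals all_analysis.

Set Implicit Arguments.
Unset Strict Implicit.
Unset Printing Implicit Defensive.

Import Order.TTheory GRing.Theory Num.Theory.
Import numFieldNormedType.Exports.

Local Open Scope classical_set_scope.
Local Open Scope complex_scope.
Local Open Scope ring_scope.

Notation leb R := (@lebesgue_measure R).

(* Elements of L^2, H^l and so on are represented by Borel functions, equality
   in these spaces being equality a.e. *)

Section Sobolev.
Context {R : realType}.
Implicit Types (u v g phi : R -> R) (D : set R) (l k : nat) (L : R).

Definition smooth phi := forall k (x : R), derivable (derive1n k phi) x 1.

Definition test_function phi :=
  smooth phi /\ compact (closure [set x | phi x != 0]).

Definition weak_deriv u g :=
  [/\ locally_integrable setT u, locally_integrable setT g &
      forall phi, test_function phi ->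
        (\int[leb R]_x (u x * derive1 phi x) = - \int[leb R]_x (g x * phi x))%R].

(* [wD k u] is a k-th weak derivative of [u]; it is a junk value unless
   [has_wD k u] holds, and is then unique up to equality a.e. *)
Definition wD k u : R -> R := iter k (fun v => xget (fun=> 0) (weak_deriv v)) u.

Definition has_wD l u := forall k, (k < l)%N -> weak_deriv (wD k u) (wD k.+1 u).

Definition L2 D u := (u \_ D) \in Lfun (leb R) 2%:E.

Definition L2norm D u : R := fine ('N[leb R]_2%:E[EFin \o (u \_ D)])%E.

Definition L2inner u v : R := (\int[leb R]_x (u x * v x))%R.

Definition Hline l u :=
  has_wD l u /\ forall k, (k <= l)%N -> L2 setT (wD k u).

(* Periodicity is that of the class of [u], hence a.e. *)
Definition Hper L l u :=
  [/\ {ae leb R, forall x, u (x + L) = u x},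
      has_wD l u &
      forall k M, (k <= l)%N -> L2 `[- M, M] (wD k u)].

Definition Hnorm D l u : R :=
  Num.sqrt (\sum_(k < l.+1) L2norm D (wD k u) ^+ 2).

Definition Hper_norm L l u : R := Hnorm `]0, L[ l u.

End Sobolev.

(* Operators act on L^2(R; C) with domain H^2(R; C). *)

Section Spectral.
Context {R : realType}.
Implicit Types (u f : R -> R[i]) (A : (R -> R[i]) -> (R -> R[i])).

Definition cRe u : R -> R := fun x => complex.Re (u x).
Definition cIm u : R -> R := fun x => complex.Im (u x).

Definition cL2 u := L2 setT (cRe u) /\ L2 setT (cIm u).
Definition cH2 u := Hline 2 (cRe u) /\ Hline 2 (cIm u).

Definition cL2norm u : R :=
  Num.sqrt (L2norm setT (cRe u) ^+ 2 + L2norm setT (cIm u) ^+ 2).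
Definition cH2norm u : R :=
  Num.sqrt (Hnorm setT 2 (cRe u) ^+ 2 + Hnorm setT 2 (cIm u) ^+ 2).

Definition cwD k u : R -> R[i] := fun x => wD k (cRe u) x +i* wD k (cIm u) x.

Definition aeq u v := {ae leb R, forall x, u x = v x}.

Definition opshift A (z : R[i]) : (R -> R[i]) -> (R -> R[i]) :=
  fun u x => A u x - z * u x.

Definition invertible_H2_L2 A :=
  [/\ forall f, cL2 f -> exists2 u, cH2 u & aeq (A u) f,
      forall u, cH2 u -> aeq (A u) (fun=> 0) -> aeq u (fun=> 0) &
      exists C : R, forall u, cH2 u -> cH2norm u <= C * cL2norm (A u)].

Definition spectrum A : set R[i] :=
  [set z | ~ invertible_H2_L2 (opshift A z)].

Definition spectral_bound A : \bar R :=
  ereal_sup [set (complex.Re z)%:E | z in spectrum A].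

Definition eigenvalue A (z : R[i]) :=
  exists u, [/\ cH2 u, ~ aeq u (fun=> 0) & aeq (A u) (fun x => z * u x)].

(* [gen_kernel A z k] is ker (A - z)^k, with the domain of the power taken
   into account. *)
Fixpoint gen_kernel A (z : R[i]) (k : nat) : set (R -> R[i]) :=
  if k is k'.+1 then [set u | cH2 u /\ gen_kernel A z k' (opshift A z u)]
  else [set u | aeq u (fun=> 0)].

Definition gen_eigenspace A (z : R[i]) : set (R -> R[i]) :=
  [set u | exists k, cH2 u /\ gen_kernel A z k u].

Definition alg_mult A (z : R[i]) (m : nat) :=
  exists b : 'I_m -> R -> R[i],
    [/\ forall i, gen_eigenspace A z (b i),
        forall c : 'I_m -> R[i],
          aeq (fun x => \sum_i c i * b i x) (fun=> 0) -> forall i, c i = 0 &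
        forall u, gen_eigenspace A z u ->
          exists c : 'I_m -> R[i], aeq u (fun x => \sum_i c i * b i x)].

Definition no_negative_eigenvalue A :=
  forall a : R, a < 0 -> ~ eigenvalue A a%:C.

Definition one_negative_eigenvalue A :=
  exists a : R, [/\ a < 0, alg_mult A a%:C 1 &
    forall b : R, b < 0 -> eigenvalue A b%:C -> b = a].

End Spectral.

Section Stationary.
Context {R : realType}.
Implicit Types (mu om x : R) (V psi chi : R -> R).

Definition C1 V := (forall x : R, derivable V x 1) /\ continuous (derive1 V).

Definition stationary mu V om psi :=
  {ae leb R, forall x,
    - wD 2 psi x + mu * V x * psi x + om * psi x - psi x ^+ 3 = 0}.

Definition Lminus mu V om psi (u : R -> R[i]) : R -> R[i] := fun x =>
  - cwD 2 u x + (mu * V x + om - psi x ^+ 2)%:C * u x.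

Definition Lplus mu V om psi (u : R -> R[i]) : R -> R[i] := fun x =>
  - cwD 2 u x + (mu * V x + om - 3 * psi x ^+ 2)%:C * u x.

Definition dxx_minus_muV mu V (u : R -> R[i]) : R -> R[i] := fun x =>
  cwD 2 u x - (mu * V x)%:C * u x.

Definition nondegenerate_solution mu V om psi := invertible_H2_L2 (Lplus mu V om psi).

(* [psi 0] is the continuation and [psi k] its k-th derivative in om, as a map
   from (om0 - nu, om0 + nu) to H^2(R). *)
Record continuation mu V om0 (psi0 : R -> R) (nu : R)
    (psi : nat -> R -> R -> R) : Prop := Continuation {
  cont_radius : 0 < nu ;
  cont_H2 : forall k om, `|om - om0| < nu -> Hline 2 (psi k om) ;
  cont_smooth : forall k om, `|om - om0| < nu ->
    Hnorm setT 2 (h^-1 *: (psi k (om + h) - psi k om) - psi k.+1 om)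
      @[h --> (0 : R)^'] --> (0 : R) ;
  cont_init : {ae leb R, forall x, psi 0%N om0 x = psi0 x} ;
  cont_solves : forall om, `|om - om0| < nu -> stationary mu V om (psi 0%N om) ;
  cont_unique : exists2 r : R, 0 < r & forall om phi,
    `|om - om0| < nu -> `|om - om0| < r ->
    Hline 2 phi -> stationary mu V om phi -> Hnorm setT 2 (phi - psi0) < r ->
    {ae leb R, forall x, phi x = psi 0%N om x} }.

Record cutoff (L : R) chi : Prop := Cutoff {
  cutoff_range : forall x, 0 <= chi x <= 1 ;
  cutoff_smooth : smooth chi ;
  cutoff_periodic : forall x, chi (x + L) = chi x ;
  cutoff_W2infty : forall k x, (k <= 2)%N -> `|derive1n k chi x| <= 1 ;
  cutoff_one : forall x, x \in `[- (L / 6), L / 6] -> chi x = 1 ;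
  cutoff_zero : forall x,
    x \in `[- (L / 2), - (L / 3)] \/ x \in `[L / 3, L / 2] -> chi x = 0 }.

Record periodic_pulses (T : R) mu V om0 (psi0 : R -> R) (N0 : nat)
    (chi a psi_per : nat -> R -> R) : Prop := PeriodicPulses {
  pulse_cutoff : \forall n \near \oo, cutoff (n%:R * T) (chi n) ;
  pulse_H2 : forall n, (N0 <= n)%N -> Hper (n%:R * T) 2 (psi_per n) ;
  pulse_solves : forall n, (N0 <= n)%N -> stationary mu V om0 (psi_per n) ;
  pulse_rest_H2 : forall n, (N0 <= n)%N -> Hper (n%:R * T) 2 (a n) ;
  pulse_form : forall n, (N0 <= n)%N -> {ae leb R, forall x,
    x \in `[- (n%:R / 2 * T), n%:R / 2 * T[ ->
    psi_per n x = chi n x * psi0 x + a n x} ;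
  pulse_rest_cvg :
    (fun n => Hper_norm (n%:R * T) 2 (a n)) @ \oo --> (0 : R) }.

End Stationary.

(* [nrm] is meant to be a seminorm on [X]; [u] and [v] represent the same
   element of the normed space when [nrm (u - v) = 0]. *)

Section Mild.
Context {R : realType} {E : lmodType R}.
Implicit Types (X dom : set E) (nrm : E -> R) (A N : E -> E) (F psi : R -> E)
  (S : R -> E -> E) (t s : R).

Definition riemann_integral nrm F (a b : R) (I : E) :=
  forall e : R, 0 < e -> exists2 d : R, 0 < d &
    forall (m : nat) (p tag : nat -> R), p 0%N = a -> p m = b ->
      (forall i, (i < m)%N ->
         p i <= tag i <= p i.+1 /\ p i.+1 - p i < d) ->
      nrm (\sum_(i < m) (p i.+1 - p i) *: F (tag i) - I) < e.

(* [S] is the C_0-semigroup on [X] with generator [A], [dom] being the domain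
   of [A]. *)
Record C0_semigroup X nrm dom A S : Prop := C0Semigroup {
  sg_stable : forall t u, 0 <= t -> X u -> X (S t u) ;
  sg_linear : forall t c u v, 0 <= t -> X u -> X v ->
    nrm (S t (c *: u + v) - (c *: S t u + S t v)) = 0 ;
  sg_bounded : forall t, 0 <= t ->
    exists C : R, forall u, X u -> nrm (S t u) <= C * nrm u ;
  sg_0 : forall u, X u -> nrm (S 0 u - u) = 0 ;
  sg_add : forall s t u, 0 <= s -> 0 <= t -> X u ->
    nrm (S (s + t) u - S s (S t u)) = 0 ;
  sg_continuous : forall u, X u ->
    nrm (S t u - u) @[t --> (0 : R)^'+] --> (0 : R) ;
  sg_generator : forall u f, X u -> X f ->
    nrm (h^-1 *: (S h u - u) - f) @[h --> (0 : R)^'+] --> (0 : R) <->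
    dom u /\ nrm (A u - f) = 0 }.

Definition continuous_into X nrm psi :=
  (forall t, 0 <= t -> X (psi t)) /\
  forall t, 0 <= t -> forall e : R, 0 < e -> exists2 d : R, 0 < d &
    forall s, 0 <= s -> `|s - t| < d -> nrm (psi s - psi t) < e.

(* psi' = A psi + N psi on [0, oo), in the sense of the Duhamel formula. *)
Definition global_mild_solution X nrm dom A N psi :=
  continuous_into X nrm psi /\
  exists2 S, C0_semigroup X nrm dom A S &
    forall t, 0 <= t -> exists I,
      [/\ X I, riemann_integral nrm (fun s => S (t - s) (N (psi s))) 0 t I &
          nrm (psi t - (S t (psi 0) + I)) = 0].

End Mild.

Section Evolution.
Context {R : realType}.
Implicit Types (mu om L t : R) (V : R -> R) (v w : R -> 'cV[R]_2).

Definition vec2 (a b : R) : 'cV[R]_2 := \col_i (if i == 0 then a else b).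

Definition mx2 (a b c d : R) : 'M[R]_2 :=
  \matrix_(i, j) (if i == 0 then if j == 0 then a else b
                  else if j == 0 then c else d).

Definition Jmx : 'M[R]_2 := mx2 0 1 (- 1) 0.

Definition Rot (gamma : R) : 'M[R]_2 :=
  mx2 (cos gamma) (sin gamma) (- sin gamma) (cos gamma).

Definition vcoord v (i : 'I_2) : R -> R := fun x => v x i 0.

Definition vHper L l : set (R -> 'cV[R]_2) :=
  [set v | forall i, Hper L l (vcoord v i)].

Definition vHper_norm L l v : R :=
  Num.sqrt (\sum_i Hper_norm L l (vcoord v i) ^+ 2).

Definition vwD k v : R -> 'cV[R]_2 := fun x => \col_i wD k (vcoord v i) x.

(* The norm of the library on matrices is the sup norm, not the Euclidean one. *)
Definition sqnorm (z : 'cV[R]_2) : R := \sum_i z i 0 ^+ 2.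

Definition lin mu V om v : R -> 'cV[R]_2 := fun x =>
  Jmx *m (- vwD 2 v x + (mu * V x) *: v x + om *: v x).

Definition nonlin v : R -> 'cV[R]_2 := fun x =>
  Jmx *m (- (sqnorm (v x) *: v x)).

(* In H^1_per the linear part has domain H^3_per. *)
Definition NLS_mild mu V om L (psi : R -> R -> 'cV[R]_2) :=
  global_mild_solution (vHper L 1) (vHper_norm L 1)
    (vHper L 3) (lin mu V om) nonlin psi.

Definition orbitally_stable mu V om L (phi : R -> 'cV[R]_2) :=
  forall e : R, 0 < e -> exists2 d : R, 0 < d &
    forall v0, vHper L 1 v0 -> vHper_norm L 1 v0 < d ->
      exists psi : R -> R -> 'cV[R]_2,
        [/\ NLS_mild mu V om L psi,
            {ae leb R, forall x, psi 0 x = phi x + v0 x} &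
            forall t, 0 <= t ->
              inf [set vHper_norm L 1 (fun x => psi t x - Rot gamma *m phi x)
                  | gamma in [set: R]] < e].

End Evolution.

(* Main.v *)
Require Import Defs.
From HB Require Import structures.
From mathcomp Require Import all_boot all_order all_algebra.
From mathcomp Require Import complex.
From mathcomp Require Import all_classical all_reals all_analysis.
From mathcomp Require Import measurable_realfun.
From mathcomp Require Import ring lra.
Set Implicit Arguments.
Unset Strict Implicit.
Unset Printing Implicit Defensive.
Import Order.TTheory GRing.Theory Num.Theory.
Import numFieldNormedType.Exports.
Local Open Scope classical_set_scope.
Local Open Scope ring_scope.

(* The spectral hypotheses make the forms of L- and L+ coercive on the line once
   multiples of <., psi0>^2 are added, for L+ because of the slope condition.
   An IMS partition of unity carries this over to the period nT for large n,
   where the solution is close to psi0 on one window and small elsewhere.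
   There a Galerkin scheme yields a global flow conserving charge and energy;
   energy plus a multiple of the squared charge difference is a Lyapunov
   function, once the phase makes the perturbation orthogonal to the orbit. *)

(** What can be carried from the line to a long period is a lower bound for a quadratic form, not a
    count of eigenvalues; hence all spectral information is turned into such bounds. The tool is an
    alternative for a nonnegative form that becomes coercive after adding finitely many squares of
    functionals: it is coercive or it has a kernel vector. As omega0 lies above the spectral bound,
    -d^2 + mu V + omega0 is coercive; since psi0^2 decays, L- and L+ differ from it by finitely many
    functionals up to a small error, and the eigenvalue hypotheses decide which kernels can occur.
    On the period, the form of -d^2 + mu V + omega0 is also the inner product of the energy space:
    its eigenbasis diagonalises the linear group and supplies the Galerkin spaces. The limit of the
    scheme satisfies only an energy inequality, which is the direction a Lyapunov argument needs.
    Functions are stored as an absolutely continuous function with one chosen derivative, so forms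
    are only semidefinite and many identities hold only up to null vectors. *)

Lemma normK2 {R : realType} (x : R) : `|x| ^+ 2 = x ^+ 2. exact/real_normK/num_real. Qed.

(** * Symmetric forms on a real vector space: Riesz representation, coercivity alternative, lowest
    eigenvector *)

Section Forms.
Context {R : realType} {E : lmodType R}.
Implicit Types (u v w : E) (b n l : E -> E -> R) (f : E -> R).

Record bform b : Prop := Bform {
  bDl : forall u v w, b (u + v) w = b u w + b v w;
  bZl : forall c u w, b (c *: u) w = c * b u w;
  bC : forall u v, b u v = b v u }.

Record lform f : Prop := Lform {
  fD : forall u v, f (u + v) = f u + f v;
  fZ : forall c u, f (c *: u) = c * f u }.

Definition nneg b := forall u, 0 <= b u u.
Definition bbound b n := exists2 M, 0 < M & forall u, `|b u u| <= M * n u u.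
Definition fbound f n := exists2 M, 0 < M & forall u, f u ^+ 2 <= M * n u u.
Definition coercive b n := exists2 c, 0 < c & forall u, c * n u u <= b u u.

(** In the applications [n] has nonzero null vectors, so that limits are not unique. *)
Definition complete_form n := forall w : nat -> E,
  (forall e, 0 < e -> exists N, forall p q, (N <= p)%N -> (N <= q)%N ->
     n (w p - w q) (w p - w q) < e) ->
  exists u, forall e, 0 < e -> exists N, forall p, (N <= p)%N ->
     n (w p - u) (w p - u) < e.

Section One.
Variables (b : E -> E -> R) (hb : bform b).

Lemma bDr u v w : b w (u + v) = b w u + b w v.
by rewrite bC // bDl // !(bC hb w). Qed.
Lemma bZr c u w : b w (c *: u) = c * b w u.
by rewrite bC // bZl // (bC hb w). Qed.
Lemma b0l u : b 0 u = 0.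
by rewrite -(scale0r (0 : E)) bZl // mul0r. Qed.
Lemma bNl u v : b (- u) v = - b u v.
by rewrite -scaleN1r bZl // mulN1r. Qed.
Lemma bNr u v : b v (- u) = - b v u.
by rewrite bC // bNl bC. Qed.
Lemma bBl u v w : b (u - v) w = b u w - b v w.
by rewrite bDl // bNl. Qed.
Lemma bBr u v w : b w (u - v) = b w u - b w v.
by rewrite bDr // bNr. Qed.
Lemma b_suml I (s : seq I) P (F : I -> E) v :
  b (\sum_(i <- s | P i) F i) v = \sum_(i <- s | P i) b (F i) v.
by apply: (big_morph (fun x => b x v)) => [x y|]; [exact: bDl|exact: b0l].
Qed.
Lemma b_sumr I (s : seq I) P (F : I -> E) v :
  b v (\sum_(i <- s | P i) F i) = \sum_(i <- s | P i) b v (F i).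
by rewrite bC // b_suml; apply: eq_bigr => i _; rewrite bC. Qed.

Lemma bsqD u v : b (u + v) (u + v) = b u u + 2 * b u v + b v v.
rewrite !bDl // !bDr // (bC hb v u); ring. Qed.
Lemma bsqB u v : b (u - v) (u - v) = b u u - 2 * b u v + b v v.
rewrite bsqD // bNr // bNl // bNr //; ring. Qed.
Lemma bsqZ c u : b (c *: u) (c *: u) = c ^+ 2 * b u u.
by rewrite bZl // bZr // mulrA expr2. Qed.
Lemma bsqN u : b (- u) (- u) = b u u.
by rewrite bNl // bNr // opprK. Qed.
Lemma bsqBC u v : b (u - v) (u - v) = b (v - u) (v - u).
by rewrite -bsqN opprB. Qed.

Hypothesis b0 : nneg b.

Lemma quad_disc (p q r : R) : 0 <= p -> 0 <= r ->
  (forall t, 0 <= p * t ^+ 2 + 2 * q * t + r) -> q ^+ 2 <= p * r.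
move=> p0 r0 H; have [p0e|pn0] := eqVneq p 0.
  have [->|q0] := eqVneq q 0; first by rewrite p0e expr0n mul0r.
  suff : (0:R) < 0 by rewrite ltxx.
  apply: (le_lt_trans (H (- (r + 1) / (2 * q)))).
  have q20 : 2 * q != 0 by rewrite mulf_neq0.
  by rewrite p0e mul0r add0r mulrC divfK //; lra.
have pp : 0 < p by rewrite lt_def pn0.
have := H (- q / p).
have -> : p * (- q / p) ^+ 2 + 2 * q * (- q / p) + r = (p * r - q ^+ 2) / p.
  by field.
by rewrite pmulr_lge0 ?invr_gt0// subr_ge0.
Qed.

Lemma form_CS u v : b u v ^+ 2 <= b u u * b v v.
rewrite mulrC; apply: quad_disc => // t.
have := b0 (u + t *: v); rewrite bsqD bsqZ bZr.
by rewrite (_ : _ + _ + _ = b v v * t ^+ 2 + 2 * b u v * t + b u u) //; ring.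
Qed.

Lemma bsqD_le u v : b (u + v) (u + v) <= 2 * b u u + 2 * b v v.
by have := b0 (u - v); rewrite bsqB bsqD; lra. Qed.
End One.

Section LOne.
Variables (f : E -> R) (hf : lform f).
Lemma f0 : f 0 = 0. by rewrite -(scale0r (0 : E)) fZ // mul0r. Qed.
Lemma fN u : f (- u) = - f u. by rewrite -scaleN1r fZ // mulN1r. Qed.
Lemma fB u v : f (u - v) = f u - f v. by rewrite fD // fN. Qed.
Lemma f_sum I (s : seq I) P (F : I -> E) :
  f (\sum_(i <- s | P i) F i) = \sum_(i <- s | P i) f (F i).
by apply: (big_morph f) => [x y|]; [exact: fD|exact: f0]. Qed.
End LOne.

Lemma bform_lform b v : bform b -> lform (b v).
by move=> hb; split=> *; rewrite ?bDr ?bZr. Qed.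

Lemma bformD b b' : bform b -> bform b' -> bform (fun u v => b u v + b' u v).
move=> h h'; split=> *; rewrite ?bDl ?bZl //; first ring.
  by rewrite mulrDr.
by rewrite bC // [X in _ + X]bC.
Qed.
Lemma bformZ c b : bform b -> bform (fun u v => c * b u v).
move=> h; split=> *; rewrite ?bDl ?bZl //; first ring.
  by rewrite mulrCA.
by rewrite bC.
Qed.
Lemma bform_sq f : lform f -> bform (fun u v => f u * f v).
by move=> h; split=> *; rewrite ?fD ?fZ //; ring. Qed.
Lemma bform_sum I (s : seq I) (F : I -> E -> E -> R) :
  (forall i, bform (F i)) -> bform (fun u v => \sum_(i <- s) F i u v).
move=> h; split=> [u v w|c u w|u v].
- by rewrite -big_split; apply: eq_bigr => i _; rewrite bDl.
- by rewrite mulr_sumr; apply: eq_bigr => i _; rewrite bZl.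
- by apply: eq_bigr => i _; rewrite bC.
Qed.
Lemma lformZ c f : lform f -> lform (fun u => c * f u).
move=> h; split=> *; rewrite ?fD ?fZ //; ring. Qed.

Lemma nneg0 b u v : bform b -> nneg b -> b u u = 0 -> b u v = 0.
move=> hb b0 u0; apply/eqP; rewrite -sqrf_eq0; apply/eqP/le_anti.
by rewrite sqr_ge0 andbT; apply: le_trans (form_CS hb b0 u v) _; rewrite u0 mul0r.
Qed.

Lemma complete_equiv n G : complete_form n -> bbound G n -> coercive G n ->
  complete_form G.
move=> cn [M M0 HM] [c c0 Hc] w Hw.
have Hw' : forall e, 0 < e -> exists N, forall p q, (N <= p)%N -> (N <= q)%N ->
     n (w p - w q) (w p - w q) < e.
  move=> e e0; have [N HN] := Hw (c * e) (mulr_gt0 c0 e0).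
  exists N => p q hp hq; rewrite -(ltr_pM2l c0).
  by apply: le_lt_trans (HN p q hp hq).
have [u Hu] := cn w Hw'; exists u => e e0.
have [N HN] := Hu (e / M) (divr_gt0 e0 M0); exists N => p hp.
apply: le_lt_trans (ler_norm _) _; apply: le_lt_trans (HM _) _.
by rewrite mulrC -ltr_pdivlMr // HN.
Qed.

Lemma sqr_le (x y : R) : 0 <= y -> x ^+ 2 <= y ^+ 2 -> x <= y.
by move=> y0 h; rewrite leNgt; apply/negP => lt; nra. Qed.

(** Direct method: the functional [G u u - 2 f u] is bounded below, the parallelogram identity makes
    a minimising sequence Cauchy, and its limit represents [f]. *)
Lemma riesz G f : bform G -> nneg G -> complete_form G -> lform f -> fbound f G ->
  exists r, forall v, G r v = f v.
move=> hG G0 cG hf [K K0 HK].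
pose J u := G u u - 2 * f u.
have Jlb u : - K <= J u.
  suff : 2 * f u <= G u u + K by rewrite /J; lra.
  apply: sqr_le; first by rewrite addr_ge0// ltW.
  by have := sqr_ge0 (G u u - K); have := HK u; rewrite !expr2 => ? ?; nra.
have hinf : has_inf (range J).
  by split; [exists (J 0), 0|exists (- K) => _ [u _ <-]].
set m := inf (range J).
have Jm u : m <= J u by apply: ge_inf; [case: hinf|exists u].
have [w Hw] : exists w : nat -> E, forall k, J (w k) < m + k.+1%:R^-1.
  suff h : forall k : nat, exists u, J u < m + k.+1%:R^-1 by have [w Hw] := choice h; exists w.
  move=> k.
  have k0 : 0 < k.+1%:R^-1 :> R by rewrite invr_gt0.
  by have [_ [u _ <-]] := inf_adherent k0 hinf; exists u.
have mid p q : G (w p - w q) (w p - w q) <= 2 * p.+1%:R^-1 + 2 * q.+1%:R^-1.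
  have := Jm (2^-1 *: (w p + w q)); rewrite /J (bsqZ hG) (fZ hf) (fD hf) (bsqD hG) (bsqB hG).
  have := Hw p; have := Hw q; rewrite /J => h1 h2 h3.
  have e : (2 : R)^-1 ^+ 2 = 4^-1 by field.
  move: h1 h2 h3; rewrite e; set x := p.+1%:R^-1; set y := q.+1%:R^-1; lra.
have inve e : 0 < e -> exists N, forall p, (N <= p)%N -> p.+1%:R^-1 < e :> R.
  move=> e0; have [N hN] := ltr_add_invr e0.
  exists N => p hp; move: hN; rewrite add0r; apply: le_lt_trans.
  by rewrite lef_pV2 ?posrE // ler_nat.
have [u Hu] : exists u, forall e, 0 < e -> exists N, forall p, (N <= p)%N ->
     G (w p - u) (w p - u) < e.
  apply: cG => e e0; have [N HN] := inve _ (divr_gt0 e0 (ltr0n R 4)).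
  exists N => p q hp hq; apply: le_lt_trans (mid p q) _.
  by have := HN p hp; have := HN q hq; set x := p.+1%:R^-1; set y := q.+1%:R^-1; lra.
exists u => v.
(* The discriminant of the polynomial [J (w k + t *: v) - m + (J-gap of w k)] in [t]:
   near-minimality of [w k] leaves the constant term below [k.+1%:R^-1]. *)
have D k : (G (w k) v - f v) ^+ 2 <= G v v * k.+1%:R^-1.
  apply: quad_disc => //.
  move=> t; have := Jm (w k + t *: v); have := Hw k.
  rewrite /J (bsqD hG) (bsqZ hG) (bZr hG) (fD hf) (fZ hf); set x := k.+1%:R^-1; nra.
apply/eqP; rewrite -subr_eq0 -sqrf_eq0; apply/eqP/le_anti; rewrite sqr_ge0 andbT.
apply/ler_addgt0Pl => e e0; rewrite addr0.
have gp : 0 < 4 * (G v v + 1) by have := G0 v; lra.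
have [N1 H1] := inve _ (divr_gt0 e0 gp).
have [N2 H2] := Hu _ (divr_gt0 e0 gp).
pose k := maxn N1 N2.
have h1 := H1 k (leq_maxl _ _); have h2 := H2 k (leq_maxr _ _).
have h3 := form_CS hG G0 (w k - u) v; have h4 := D k.
rewrite bBl // in h3.
have h5 : (G u v - f v) ^+ 2 <=
   2 * (G (w k) v - f v) ^+ 2 + 2 * (G (w k) v - G u v) ^+ 2.
  have := sqr_ge0 ((G (w k) v - f v) + (G (w k) v - G u v)); rewrite !expr2; nra.
rewrite ltr_pdivlMr // in h1; rewrite ltr_pdivlMr // in h2.
have := G0 v; have : 0 < k.+1%:R^-1 :> R by rewrite invr_gt0.
have := G0 (w k - u); move: h1 h2 h3 h4 h5.
set x := k.+1%:R^-1; set y := G (w k - u) _; set g := G v v; set z1 := _ ^+ 2; set z2 := _ ^+ 2; set z3 := _ ^+ 2; nra.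
Qed.

(** Induction on the functionals. If [b' = b + f^2] is coercive, let [r] represent [f] with respect
    to [b']. Nonnegativity of [b r r = f r - (f r)^2] gives [f r <= 1]. If [f r = 1], then
    [b r v = f v - f r * f v = 0]. If [f r < 1], Cauchy-Schwarz gives [f u ^+ 2 <= f r * b' u u], so
    that [b >= (1 - f r) b'] is coercive. *)
Lemma kernel_alternative n b (ls : seq (E -> R)) : nneg n -> complete_form n ->
  bform b -> nneg b -> bbound b n ->
  (forall i, (i < size ls)%N -> lform (nth 0 ls i) /\ fbound (nth 0 ls i) n) ->
  coercive (fun u v => b u v + \sum_(i < size ls) nth 0 ls i u * nth 0 ls i v) n ->
  coercive b n \/ exists2 r, 0 < n r r & forall v, b r v = 0.
move=> n0 cn; elim: ls b => [|f ls IH] b hb b0 bM hls cb.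
  left; case: cb => c c0 H; exists c => // u.
  by have := H u; rewrite big_ord0 addr0.
have [hf fM] : lform f /\ fbound f n by apply: (hls 0%N).
pose b' u v := b u v + f u * f v.
have hb' : bform b' by apply: bformD => //; exact: bform_sq.
have ff u : 0 <= f u * f u by rewrite -expr2 sqr_ge0.
have b'0 : nneg b' by move=> u; rewrite addr_ge0.
have b'M : bbound b' n.
  case: bM => M M0 HM; case: fM => K K0 HK; exists (M + K); first exact: addr_gt0.
  move=> u; apply: le_trans (ler_normD _ _) _; rewrite mulrDl lerD //.
  by rewrite ger0_norm// -expr2.
case: (IH b') => //.
- by move=> i hi; apply: (hls i.+1).
- case: cb => c c0 H; exists c => // u; apply: le_trans (H u) _.
  by rewrite big_ord_recl /= addrA.
- move=> cb'.
  have cG := complete_equiv cn b'M cb'.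
  have fM' : fbound f b'.
    exists 1 => // u; rewrite mul1r /b' expr2; have := b0 u; lra.
  have [r Hr] := riesz hb' b'0 cG hf fM'.
  have key u : f u ^+ 2 <= f r * b' u u.
    by have := form_CS hb' b'0 r u; rewrite !Hr.
  have br : 0 <= b r r by [].
  have fr : b r r = f r - f r * f r by rewrite -{1}(Hr r) /b' addrK.
  have [s1|s1] := eqVneq (f r) 1.
    right; exists r; last by move=> v; have := Hr v; rewrite /b' s1; lra.
    case: b'M => M M0 HM; have := HM r; rewrite Hr s1 normr1 => h.
    by rewrite -(pmulr_rgt0 _ M0); lra.
  have s0 : 0 <= f r by rewrite -Hr.
  have s2 : f r < 1 by rewrite lt_neqAle s1 /=; nra.
  left; case: cb' => c c0 H; exists ((1 - f r) * c); first by rewrite mulr_gt0 // subr_gt0.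
  move=> u; have := H u; have := key u; rewrite /b' expr2 => h1 h2.
  rewrite -mulrA; apply: le_trans (_ : (1 - f r) * (b u u + f u * f u) <= _).
    by rewrite ler_pM2l ?subr_gt0.
  lra.
- case=> r nr H; right; exists r => // v; apply: nneg0 => //.
  have := H r; rewrite /b' => h; apply: le_anti; rewrite b0 andbT.
  by have := ff r; lra.
Qed.

(* Relative compactness of [l], in quantitative form: [l] is small with respect
   to [n] up to finitely many functionals. *)
Definition fcompact l n := forall e, 0 < e -> exists ls : seq (E -> R),
  (forall i, (i < size ls)%N -> lform (nth 0 ls i) /\ fbound (nth 0 ls i) n) /\
  forall u, l u u <= e * n u u + \sum_(i < size ls) nth 0 ls i u ^+ 2.

(** Let [lam] be the infimum of the Rayleigh quotient. Then [b - lam l] is nonnegative and, [l]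
    being compact, coercive up to finitely many functionals. A kernel vector is a minimiser;
    coercivity would contradict the choice of [lam]. *)
Lemma min_eigenvector n l b K : nneg n -> complete_form n ->
  bform l -> nneg l -> bbound l n -> fcompact l n ->
  bform b -> bbound b n -> coercive (fun u v => b u v + K * l u v) n ->
  (exists u, 0 < l u u) ->
  exists r lam, [/\ l r r = 1, forall v, b r v = lam * l r v &
    forall u, lam * l u u <= b u u].
move=> n0 cn hl l0 [ML ML0 HML] cl hb bM [c c0 Hc] [u0 u0l].
pose A := [set b u u / l u u | u in [set u | 0 < l u u]].
have lbA : lbound A (- K).
  move=> _ [u /= lu <-]; rewrite ler_pdivlMr //; have := Hc u.
  have := n0 u; nra.
have hA : has_inf A by split; [exists (b u0 u0 / l u0 u0), u0|exists (- K)].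
set lam := inf A.
have Hlam u : lam * l u u <= b u u.
  have [lu|lu] := ltP 0 (l u u); first by rewrite -ler_pdivlMr //; apply: ge_inf; [case: hA|exists u].
  have {}lu : l u u = 0 by apply: le_anti; rewrite lu l0.
  by have := Hc u; rewrite lu !mulr0 addr0; apply: le_trans; rewrite mulr_ge0 // ltW.
pose b' u v := b u v + (- lam) * l u v.
have hb' : bform b' by apply: bformD => //; apply: bformZ.
have b'0 : nneg b' by move=> u; rewrite /b' mulNr subr_ge0.
have b'M : bbound b' n.
  case: bM => M M0 HM; exists (M + (`|lam| * ML + 1)).
    by rewrite addr_gt0 // ltr_wpDl // mulr_ge0 // ltW.
  move=> u; apply: le_trans (ler_normD _ _) _; rewrite mulrDl lerD //.
  rewrite mulNr normrN normrM mulrDl -mulrA mul1r.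
  by rewrite -[leLHS]addr0 lerD // ler_wpM2l.
(* Bounds the multiple of [l] by which [b - lam l] misses the coercive form [b + K l]; compactness
   of [l] is used at the level [c / (2 k)] so that half of [c] survives. *)
pose k := `|K + lam| + 1.
have k0 : 0 < k by rewrite ltr_wpDl.
have [ls [hls Hls]] := cl (c / (2 * k)) (divr_gt0 c0 (mulr_gt0 (ltr0n R 2) k0)).
pose sk := Num.sqrt k.
pose ls' := [seq (fun u => sk * f u) | f <- ls].
have Els' i : (i < size ls)%N -> nth 0 ls' i = fun u => sk * nth 0 ls i u.
  by move=> hi; rewrite (nth_map 0).
have := @kernel_alternative n b' ls' n0 cn hb' b'0 b'M.
rewrite size_map => /(_ _) alt; case: alt.
- move=> i hi; rewrite Els' //; have [h1 [M M0 HM]] := hls i hi; split; first exact: lformZ.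
  exists (k * M); first exact: mulr_gt0.
  by move=> u; rewrite exprMn (sqr_sqrtr (ltW k0)) -mulrA ler_pM2l.
- exists (c / 2); first by rewrite divr_gt0.
  move=> u.
  have -> : \sum_(i < size ls) nth 0 ls' i u * nth 0 ls' i u =
     k * \sum_(i < size ls) nth 0 ls i u ^+ 2.
    rewrite mulr_sumr; apply: eq_bigr => i _; rewrite Els' // -expr2 exprMn.
    by rewrite sqr_sqrtr // ltW.
  have := Hls u; have := Hc u; have := l0 u; have := n0 u.
  set S := \sum_(i < _) _; rewrite /b' => nu lu h1 h2.
  have kl : (K + lam) * l u u <= k * l u u.
    by rewrite ler_wpM2r // /k; have := ler_norm (K + lam); lra.
  have h3 : k * l u u <= c / 2 * n u u + k * S.
    have -> : c / 2 * n u u + k * S = k * (c / (2 * k) * n u u + S) by field; rewrite gt_eqF.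
    by rewrite ler_pM2l.
  nra.
- case=> c' c'0 H.
  (* A coercive remainder would raise every Rayleigh quotient by [c' / ML]. *)
  have : lam + c' / ML <= lam.
    apply: lb_le_inf; first by case: hA.
    move=> _ [u /= lu <-]; rewrite ler_pdivlMr //.
    have := H u; rewrite /b' => h; have := HML u; rewrite ger0_norm // => h'.
    have : c' / ML * l u u <= c' * n u u.
      by rewrite -mulrA ler_pM2l // mulrC ler_pdivrMr // mulrC.
    by rewrite mulrDl; lra.
  by rewrite gerDl leNgt divr_gt0.
- case=> r nr Hr.
  have lr : 0 < l r r.
    rewrite lt_def l0 andbT; apply/negP => /eqP lr.
    have := Hc r; have := Hr r; rewrite /b' lr !mulr0 !addr0 => ->.
    by rewrite leNgt mulr_gt0.
  exists ((Num.sqrt (l r r))^-1 *: r), lam; split => //.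
    rewrite bsqZ // exprVn sqr_sqrtr ?ltW // mulVf // gt_eqF //.
  move=> v; rewrite !bZl //; have := Hr v; rewrite /b' => h.
  by rewrite mulrCA; congr (_ * _); lra.
Qed.

Lemma annihilated_combination (m : nat) (ls : seq (E -> R)) (h : 'I_m -> E) :
  (size ls < m)%N -> (forall i, (i < size ls)%N -> lform (nth 0 ls i)) ->
  exists2 c : 'I_m -> R, exists i, c i != 0 &
    forall i, (i < size ls)%N -> nth 0 ls i (\sum_j c j *: h j) = 0.
move=> hm hl; pose M := \matrix_(j < m, i < size ls) nth 0 ls i (h j).
have kn0 : kermx M != 0.
  rewrite -mxrank_eq0 mxrank_ker subn_eq0 -ltnNge.
  exact: leq_ltn_trans (rank_leq_col M) hm.
have [/= i /rV0Pn [j cj]] : exists i, row i (kermx M) != 0.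
  apply/existsP; apply: contraNT kn0; rewrite negb_exists => /forallP H.
  by apply/eqP/row_matrixP => i; rewrite row0; apply/eqP; have := H i; rewrite negbK.
exists (fun j => row i (kermx M) 0 j); first by exists j.
move=> k hk; rewrite (f_sum (hl k hk)).
have : row i (kermx M) *m M = 0 by rewrite -row_mul mulmx_ker row0.
move=> /matrixP /(_ 0 (Ordinal hk)); rewrite !mxE => H; rewrite -[RHS]H.
by apply: eq_bigr => q _; rewrite (fZ (hl k hk)) [M _ _]mxE.
Qed.

End Forms.

(** * Eigenvectors of a coercive form with respect to a compact one *)

Section Eigenbasis.
Context {R : realType} {E : lmodType R}.
Implicit Types (u v w : E).
Variables (l a : E -> E -> R).
Hypotheses (hl : bform l) (l0 : nneg l) (ha : bform a) (a0 : nneg a).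
Hypotheses (ca : complete_form a) (la : bbound l a) (lc : fcompact l a).
Hypothesis inf_dim : forall m, exists h : 'I_m -> E, forall c : 'I_m -> R,
  (exists i, c i != 0) -> 0 < l (\sum_j c j *: h j) (\sum_j c j *: h j).

Let good (s : seq (E * R)) := forall i j, (i < size s)%N -> (j < size s)%N ->
  [/\ l (nth (0,0) s i).1 (nth (0,0) s j).1 = (i == j)%:R,
      (forall v, a (nth (0,0) s i).1 v = (nth (0,0) s i).2 * l (nth (0,0) s i).1 v) &
      0 < (nth (0,0) s i).2].

Let orth (s : seq (E * R)) u := forall i, (i < size s)%N -> l (nth (0,0) s i).1 u = 0.

(** The orthogonality constraint is replaced by a penalty: adding [K] times the squares of the
    coordinates found so far lifts their eigenvalues by [K], above the Rayleigh quotient of an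
    orthogonal trial vector [u0], so that the unconstrained minimiser is orthogonal to them. *)
Lemma eigen_step s : good s -> exists p, good (rcons s p) /\
   forall u, orth s u -> p.2 * l u u <= a u u.
move=> gs; pose ls := [seq l q.1 | q <- s].
have Els i : (i < size s)%N -> nth 0 ls i = l (nth (0,0) s i).1.
  by move=> hi; rewrite (nth_map (0,0)).
have [h Hh] := inf_dim (size s).+1.
have [||c cn0 Hc] := @annihilated_combination R E (size s).+1 ls h; first by rewrite size_map.
  by rewrite size_map => i hi; rewrite Els //; exact: bform_lform.
rewrite size_map in Hc; set u0 := \sum_j _ in Hc; have lu0 : 0 < l u0 u0 by apply: Hh.
have ou0 : orth s u0 by move=> i hi; rewrite -Els // Hc.
pose K := a u0 u0 / l u0 u0 + 1.
have K0 : 0 < K by rewrite ltr_wpDl // divr_ge0 // ltW.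
pose b u v := a u v + K * \sum_(i < size s) l (nth (0,0) s i).1 u * l (nth (0,0) s i).1 v.
have hb : bform b.
  apply: bformD => //; apply: bformZ; apply: bform_sum => i; apply: bform_sq.
  exact: bform_lform.
have bE u : a u u <= b u u.
  rewrite /b lerDl; apply: mulr_ge0; first exact: ltW.
  by apply: sumr_ge0 => i _; rewrite -expr2 sqr_ge0.
have [M M0 HM] := la.
have bM : bbound b a.
  exists (1 + K * \sum_(i < size s) M).
    rewrite ltr_wpDr //; apply: mulr_ge0; first exact: ltW.
    by apply: sumr_ge0 => i _; exact: ltW.
  move=> u; rewrite ger0_norm; last exact: le_trans (bE u).
  rewrite mulrDl mul1r lerD2l -mulrA ler_pM2l // mulr_suml; apply: ler_sum => i _.
  rewrite -expr2; apply: le_trans (form_CS hl l0 _ _) _.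
  by have [-> _ _] := gs i i (ltn_ord i) (ltn_ord i); rewrite eqxx mul1r (le_trans (ler_norm _)).
have cb : coercive (fun u v => b u v + 0 * l u v) a.
  by exists 1 => // u; rewrite mul1r mul0r addr0.
have [r [lam [lr br Hlam]]] := min_eigenvector a0 ca hl l0 la lc hb bM cb (ex_intro _ u0 lu0).
have lamle : lam * l u0 u0 <= a u0 u0.
  apply: le_trans (Hlam u0) _; rewrite /b big1 ?mulr0 ?addr0 // => i _.
  by rewrite ou0 // mul0r.
(* Evaluating the eigenvalue equation at an old eigenvector gives [(lam_i + K - lam) l (e_i) r = 0],
   and [lam < K]. *)
have or : orth s r.
  move=> i hi; have := br (nth (0,0) s i).1; rewrite /b (bigD1 (Ordinal hi)) //= big1 ?addr0.
    have [-> H lp] := gs i i hi hi; rewrite (bC ha) H (bC hl r) eqxx mulr1 => /eqP.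
    rewrite -mulrDl -subr_eq0 -mulrBl mulf_eq0 => /orP [|/eqP //].
    rewrite gt_eqF // /K subr_gt0; rewrite -ler_pdivlMr // in lamle.
    by apply: le_lt_trans lamle _; lra.
  move=> j /negP ji; have [-> _ _] := gs j i (ltn_ord j) hi.
  by case: eqP => [e|]; [case: ji; apply/eqP/val_inj|rewrite mulr0].
have bo u v : orth s u -> b u v = a u v.
  by move=> ou; rewrite /b big1 ?mulr0 ?addr0 // => i _; rewrite ou // mul0r.
have rp : 0 < lam.
  have h1 := br r; rewrite bo // lr mulr1 in h1; rewrite -h1.
  have := HM r; rewrite lr normr1 => h2; rewrite -(pmulr_rgt0 _ M0); lra.
exists (r, lam); split=> [i j|u ou] /=; last by rewrite -(bo u u) .
rewrite size_rcons !ltnS !nth_rcons => hi hj.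
have nl i' : (i' <= size s)%N -> (i' < size s)%N = false -> i' = size s.
  by move=> h1 /negbT; rewrite -leqNgt => h2; apply/eqP; rewrite eqn_leq h1.
case: (boolP (i < size s)%N) => [si|/negbTE /(nl i hi) ei]; case: (boolP (j < size s)%N) => [sj|/negbTE /(nl j hj) ej].
- exact: gs.
- have [_ h1 h2] := gs i i si si; split=> //.
  by rewrite ej eqxx /= or // -ej; case: eqP => // e; rewrite e ej ltnn in si.
- split; rewrite ei eqxx //=; last by move=> v; rewrite -br bo.
  by rewrite (bC hl) or // -ei; case: eqP => // e; rewrite -e ei ltnn in sj.
- by rewrite ei ej !eqxx /=; split => // v; rewrite -br bo.
Qed.

(** Iterates [eigen_step]; its minimality clause gives the min-max inequality, hence monotonicity.
    Unboundedness of [lam] comes from compactness of [l]. *)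
Lemma eigenbasis : exists (e : nat -> E) (lam : nat -> R),
  [/\ forall i j, l (e i) (e j) = (i == j)%:R,
      forall i v, a (e i) v = lam i * l (e i) v,
      forall i, 0 < lam i,
      {homo lam : i j / (i <= j)%N >-> i <= j} &
      (forall i u, (forall j, (j < i)%N -> l (e j) u = 0) -> lam i * l u u <= a u u)
      /\ forall B, exists N, forall i, (N <= i)%N -> B <= lam i].
have [g Hg] : exists g, forall s, good s -> good (rcons s (g s)) /\
   forall u, orth s u -> (g s).2 * l u u <= a u u.
  suff h : forall s, exists p, good s -> good (rcons s p) /\
    forall u, orth s u -> p.2 * l u u <= a u u by have [g Hg] := choice h; exists g.
  move=> s; have [gs|ns] := pselect (good s); last by exists (0,0).
  by have [p hp] := eigen_step gs; exists p.
pose S := fix S n := if n is n'.+1 then rcons (S n') (g (S n')) else [::].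
have Sg n : good (S n) by elim: n => [|n IH] //=; have [] := Hg _ IH.
have Ss n : size (S n) = n by elim: n => //= n IH; rewrite size_rcons IH.
pose p n := g (S n).
have Sn n i : (i < n)%N -> nth (0,0) (S n) i = p i.
  elim: n => // n IH; rewrite ltnS /= nth_rcons Ss => hi.
  case: ltngtP hi => // [h _|-> _ //]; exact: IH.
exists (fun n => (p n).1), (fun n => (p n).2).
have A i j : l (p i).1 (p j).1 = (i == j)%:R.
  have hi : (i < (maxn i j).+1)%N by rewrite ltnS leq_maxl.
  have hj : (j < (maxn i j).+1)%N by rewrite ltnS leq_maxr.
  by have := Sg (maxn i j).+1 i j; rewrite Ss !Sn // => /(_ hi hj) [].
have B i : (forall v, a (p i).1 v = (p i).2 * l (p i).1 v) /\ 0 < (p i).2.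
  by have := Sg i.+1 i i; rewrite Ss !Sn // => /(_ (leqnn _) (leqnn _)) [].
have C i u : (forall j, (j < i)%N -> l (p j).1 u = 0) -> (p i).2 * l u u <= a u u.
  move=> H; have [_] := Hg _ (Sg i); apply => j; rewrite Ss => hj; rewrite Sn //; exact: H.
have D : {homo (fun n => (p n).2) : i j / (i <= j)%N >-> i <= j}.
  apply: homo_leq => [x|x y z|i]; [exact: lexx|exact: le_trans|].
  have := C i (p i.+1).1; have [-> _] := B i.+1; rewrite A eqxx !mulr1; apply.
  by move=> j hj; rewrite A; case: eqP => // e; rewrite e ltnNge leqnSn in hj.
split => //; [by move=> i; have [] := B i|by move=> i; have [] := B i|split => // Bd].
(* Compactness at this level produces [ls]. Among the first [size ls + 1] eigenvectors some
   combination [u] is annihilated by [ls], so [l u u <= (|Bd| + 1)^-1 a u u], while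
   [a u u <= lam (size ls) l u u]. *)
have e0 : 0 < (`|Bd| + 1)^-1 by rewrite invr_gt0 ltr_wpDl.
have [ls [hls Hls]] := lc e0.
exists (size ls) => i hi; apply: le_trans (D _ _ hi).
have [||c [i0 ci0] Hc] := @annihilated_combination R E (size ls).+1 ls (fun j => (p j).1) => //.
  by move=> k hk; have [] := hls k hk.
set u := \sum_j _ in Hc.
have lu : l u u = \sum_j c j ^+ 2.
  rewrite {1}/u b_suml //; apply: eq_bigr => j _; rewrite bZl // expr2; congr (_ * _).
  rewrite /u b_sumr // (bigD1 j) //= big1 ?addr0 => [|k /negP kj].
    by rewrite bZr // A eqxx mulr1.
  by rewrite bZr // A; case: eqP => [e|]; [case: kj; apply/eqP/val_inj|rewrite mulr0].
have au : a u u = \sum_(j < (size ls).+1) (p j).2 * c j ^+ 2.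
  rewrite {1}/u b_suml //; apply: eq_bigr => j _; rewrite bZl // expr2 mulrCA; congr (_ * _).
  have [-> _] := B j; congr (_ * _).
  rewrite /u b_sumr // (bigD1 j) //= big1 ?addr0 => [|k /negP kj].
    by rewrite bZr // A eqxx mulr1.
  by rewrite bZr // A; case: eqP => [e|]; [case: kj; apply/eqP/val_inj|rewrite mulr0].
have up : 0 < l u u.
  rewrite lu (bigD1 i0) //= ltr_wpDr //; first by apply: sumr_ge0 => *; rewrite sqr_ge0.
  by rewrite lt_def sqrf_eq0 ci0 sqr_ge0.
have h1 : a u u <= (p (size ls)).2 * l u u.
  rewrite au lu mulr_sumr; apply: ler_sum => j _; rewrite ler_wpM2r ?sqr_ge0 //.
  by apply: D; rewrite -ltnS.
have h2 := Hls u; rewrite big1 ?addr0 in h2; last by move=> j _; rewrite Hc // expr0n.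
have h3 : l u u * (`|Bd| + 1) <= a u u by rewrite -ler_pdivlMr ?ltr_wpDl // mulrC.
have h4 := ler_norm Bd.
rewrite -(ler_pM2r up); nra.
Qed.

End Eigenbasis.

(** * Derivatives of real functions, mean value estimates, Gronwall *)

Section RealCalculus.
Context {R : realType}.
Implicit Types (f g : R -> R) (t s x y d : R).

Lemma cvg_epsP f x : {for x, continuous f} <->
  forall e : R, 0 < e -> exists2 d, 0 < d & forall y, `|y - x| < d -> `|f y - f x| < e.
split=> [fc e e0|H].
  have /cvgrPdist_lt /(_ e e0) := fc.
  move=> /nbhs_ballP [d /= d0 Hd]; exists d => // y hy.
  by rewrite distrC; apply: Hd; rewrite /ball /= distrC.
apply/cvgrPdist_lt => e e0; have [d d0 Hd] := H e e0.
apply/nbhs_ballP; exists d => //= y; rewrite /ball /= => hy.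
by rewrite distrC; apply: Hd; rewrite distrC.
Qed.

Lemma is_derive1_epsP f x df : is_derive x 1 f df <->
  forall e : R, 0 < e -> exists2 d, 0 < d & forall h, `|h| < d ->
    `|f (x + h) - f x - df * h| <= e * `|h|.
split=> [fd e e0|H].
  have [/cvg_ex /= [l Hl] E] := fd.
  have {Hl}: h^-1 *: (f (h *: (1:R) + x) - f x) @[h --> (0:R)^'] --> df.
    by rewrite -E; move: Hl => /[dup] /cvg_lim <-.
  move=> /cvgrPdist_lt /(_ e e0) /nbhs_ballP [d /= d0 Hd]; exists d => // h hd.
  have [->|h0] := eqVneq h 0; first by rewrite addr0 subrr mulr0 subrr normr0 mulr0.
  have := Hd h; rewrite /ball /= sub0r normrN => /(_ hd h0).
  rewrite distrC /GRing.scale /= mulr1 [h + x]addrC => /ltW.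
  rewrite -(ler_pM2r (_ : 0 < `|h|)) ?normr_gt0 // -normrM mulrBl.
  by rewrite -mulrA [X in _ * X]mulrC mulrA mulVf // mul1r.
have C : h^-1 *: (f (h *: (1:R) + x) - f x) @[h --> (0:R)^'] --> df.
  apply/cvgrPdist_le => e e0; have [d d0 Hd] := H e e0.
  apply/nbhs_ballP; exists d => //= h; rewrite /ball /= sub0r normrN => hd h0.
  have := Hd h hd; rewrite distrC /GRing.scale /= mulr1 [h + x]addrC => h1.
  rewrite -(ler_pM2r (_ : 0 < `|h|)) ?normr_gt0 // -normrM mulrBl.
  by rewrite [h^-1 * _ * h]mulrAC mulVf // mul1r.
split; first by apply/cvg_ex; exists df.
exact: cvg_lim C.
Qed.

Lemma is_derive_cont f x df : is_derive x 1 f df -> {for x, continuous f}.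
by move=> [fd _]; apply: differentiable_continuous; apply/derivable1_diffP.
Qed.

Lemma cont_within f (A : set R) : continuous f -> {within A, continuous f}.
by move=> fc; apply: continuous_subspaceT. Qed.

(** Solutions are extended to negative times by their initial value, so continuity is asked
    everywhere and differentiability at positive times only. *)
Definition curve f df := continuous f /\ forall t, 0 < t -> is_derive t 1 f (df t).

Lemma curve_mvt f df t s : curve f df -> 0 <= s -> s < t ->
  exists2 c, s < c < t & f t - f s = df c * (t - s).
move=> [fc fd] s0 st; have [||c] := @MVT R f df s t st.
- by move=> x; rewrite in_itv /= => /andP[sx _]; apply: fd; apply: le_lt_trans sx.
- exact: cont_within.
- by rewrite in_itv /= => ? ?; exists c.
Qed.

Lemma curve_le f df g dg t : curve f df -> curve g dg -> 0 <= t ->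
  (forall s, 0 < s -> s < t -> df s <= dg s) -> f t - f 0 <= g t - g 0.
move=> [fc fd] [gc gd]; rewrite le_eqVlt => /orP [/eqP <-|t0] H.
  by rewrite !subrr.
have [|c /andP [c0 ct] E] := @curve_mvt (g \- f) (fun s => dg s - df s) t 0 _ (lexx 0) t0.
  split=> [x|s s0]; first by apply: continuousB; [exact: gc|exact: fc].
  by have := fd s s0; have := gd s s0 => ? ?; apply: is_deriveB.
have : 0 <= (g \- f) t - (g \- f) 0.
  by rewrite E mulr_ge0 // ?subr_ge0 ?H // ltW.
rewrite /=; lra.
Qed.

Lemma curve_abs_le f df g dg t : curve f df -> curve g dg -> 0 <= t ->
  (forall s, 0 < s -> s < t -> `|df s| <= dg s) -> `|f t - f 0| <= g t - g 0.
move=> cf cg t0 H; rewrite ler_norml; apply/andP; split; last first.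
  by apply: curve_le cf cg t0 _ => s s0 st; apply: le_trans (H s s0 st); rewrite ler_norm.
have cNf : curve (\- f) (fun s => - df s).
  case: cf => fc fd; split=> [x|s s0]; first by apply: continuousN; exact: fc.
  by have := fd s s0 => ?; apply: is_deriveN.
have := curve_le cNf cg t0; rewrite /= => /(_ _); rewrite lerNl => h.
suff : - f t - - f 0 <= g t - g 0 by lra.
apply: h => s s0 st; apply: le_trans (H s s0 st); by rewrite -normrN ler_norm.
Qed.

Lemma antiderivative f : continuous f ->
  exists2 F, F 0 = 0 & forall t, 0 <= t -> is_derive t 1 F (f t).
(* Starting the integral at -1 makes 0 an interior point, so that the derivative also exists at
   [t = 0]. *)
move=> fc; pose F t := \int[leb R]_(x in `[-1, t]) f x.
have D t : 0 <= t -> is_derive t 1 F (f t).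
  move=> t0; have [||||h1 h2] := @continuous_FTC1 R f (BLeft (-1)) t (t + 1).
  - by rewrite ltrDl.
  - apply: continuous_compact_integrable; first exact: segment_compact.
    exact: cont_within.
  - by rewrite /Order.lt /=; lra.
  - exact: fc.
  - split; first exact: h1.
    rewrite -derive1E; exact: h2.
exists (fun t => F t - F 0); first by rewrite subrr.
move=> t t0; have d := D t t0; have d0 := is_derive_cst (F 0) t (1:R).
by rewrite -[f t]subr0; apply: is_deriveB.
Qed.

(** Increments of [g] are compared with those of one [f N], to which the mean value theorem applies;
    continuity of [dg] then yields the derivative. *)
Lemma limit_curve (f df : nat -> R -> R) g dg :
  (forall n, curve (f n) (df n)) ->
  (forall t, t <= 0 -> g t = g 0) -> (forall t, t <= 0 -> dg t = dg 0) ->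
  (forall n, continuous (df n)) ->
  (forall T e : R, 0 <= T -> 0 < e -> exists N, forall n t, (N <= n)%N -> 0 <= t <= T ->
     `|f n t - g t| <= e /\ `|df n t - dg t| <= e) ->
  curve g dg /\ continuous dg.
move=> Hf g0 dg0 cdf H.
have C (f1 : nat -> R -> R) (g1 : R -> R) : (forall t, t <= 0 -> g1 t = g1 0) ->
    (forall n, continuous (f1 n)) ->
    (forall T e : R, 0 <= T -> 0 < e -> exists N, forall n t, (N <= n)%N -> 0 <= t <= T ->
     `|f1 n t - g1 t| <= e) -> continuous g1.
  move=> g10 cf1 H1 x; apply/cvg_epsP => e e0.
  have [|N HN] := H1 (`|x| + 1) (e / 3) _ (divr_gt0 e0 (ltr0n R 3)).
    by rewrite addr_ge0.
  (* Convergence is assumed on [[0, T]] only; [g1] factors through this projection, being constant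
     at negative times. *)
  pose p (y : R) := Num.max y 0.
  have gp y : g1 y = g1 (p y).
    by rewrite /p; case: (leP y 0) => // h; rewrite g10.
  have [d d0 Hd] := (cvg_epsP (f1 N) (p x)).1 (cf1 N (p x)) _ (divr_gt0 e0 (ltr0n R 3)).
  exists (Num.min d 1); first by rewrite lt_min d0 ltr01.
  move=> y; rewrite lt_min => /andP [yd y1].
  have pd : `|p y - p x| <= `|y - x|.
    rewrite /p; case: (leP y 0) => h1; case: (leP x 0) => h2; rewrite ?subrr ?normr0 ?normr_ge0 //.
    - by rewrite sub0r normrN (gtr0_norm h2) ler0_norm; lra.
    - by rewrite subr0 !ger0_norm; lra.
  have px : 0 <= p x <= `|x| + 1.
    rewrite /p le_max lexx orbT /= ge_max; have := ler_norm x; have := normr_ge0 x; lra.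
  have py : 0 <= p y <= `|x| + 1.
    rewrite /p le_max lexx orbT /= ge_max; have := ler_norm (y - x); have := ler_norm x; have := normr_ge0 x; lra.
  have := Hd (p y) (le_lt_trans pd yd).
  have h1 := HN N (p x) (leqnn _) px; have h2 := HN N (p y) (leqnn _) py.
  rewrite (gp y) (gp x).
  rewrite !ltr_norml !ler_norml in h1 h2 *; move: h1 h2; lra.
have cg : continuous g.
  apply: (C f) => // [n|T e T0 e0]; first by have [] := Hf n.
  by have [N HN] := H T e T0 e0; exists N => n t hn ht; have [] := HN n t hn ht.
have cdg : continuous dg.
  apply: (C df) => // T e T0 e0.
  by have [N HN] := H T e T0 e0; exists N => n t hn ht; have [] := HN n t hn ht.
split => //; split=> // t t0; apply/is_derive1_epsP => e e0.
have [d d0 Hd] := (cvg_epsP dg t).1 (cdg t) _ (divr_gt0 e0 (ltr0n R 2)).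
exists (Num.min d t); first by rewrite lt_min d0.
move=> h; rewrite lt_min => /andP [hd ht].
apply/ler_addgt0Pl => e1 e10.
pose e2 := Num.min (e1 / 2) (e / 2).
have e20 : 0 < e2 by rewrite lt_min !divr_gt0.
have [|N HN] := H (t + `|h|) e2 _ e20; first by rewrite addr_ge0 // ltW.
have M : exists2 c, `|c - t| < d /\ 0 <= c <= t + `|h| &
    f N (t + h) - f N t = df N c * h.
  have [h0|h0|->] := ltgtP h 0.
  - have [||c /andP [c1 c2] E] := @curve_mvt (f N) (df N) t (t + h) (Hf N); [|lra|].
      by move: ht; rewrite ltr0_norm //; lra.
    exists c; last by lra.
    move: (hd) (ht); rewrite (ltr0_norm h0) => ? ?; split; last by lra.
    by rewrite ltr_norml; lra.
  - have [||c /andP [c1 c2] E] := @curve_mvt (f N) (df N) (t + h) t (Hf N); [lra|lra|].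
    exists c; last by rewrite E; ring.
    move: (hd) (ht); rewrite (gtr0_norm h0) => ? ?; split; last by lra.
    by rewrite ltr_norml; lra.
  - by exists t; [rewrite subrr normr0; split => //; lra|rewrite addr0 mulr0 subrr].
have [c [cd cI] E] := M.
have th : 0 <= t + h <= t + `|h|.
  by have := ler_norm h; have := ler_norm (- h); rewrite normrN; lra.
have tt : 0 <= t <= t + `|h| by have := normr_ge0 h; lra.
have [h1 _] := HN N (t + h) (leqnn _) th; have [h2 _] := HN N t (leqnn _) tt.
have [_ h3] := HN N c (leqnn _) cI.
have h4 := ltW (Hd c cd).
have h5 : `|(df N c - dg t) * h| <= e * `|h|.
  rewrite normrM ler_wpM2r //.
  have : e2 <= e / 2 by rewrite /e2 ge_min lexx orbT.
  by have := ler_distD (dg c) (df N c) (dg t); lra.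
have e2e : e2 <= e1 / 2 by rewrite /e2 ge_min lexx.
have -> : g (t + h) - g t - dg t * h =
  (df N c - dg t) * h - (f N (t + h) - g (t + h)) + (f N t - g t).
  by rewrite mulrBl -E; ring.
apply: le_trans (ler_normD _ _) _; have := ler_normB ((df N c - dg t) * h) (f N (t + h) - g (t + h)).
lra.
Qed.

Lemma gronwall f df C k t : curve f df -> 0 < C -> 0 <= t ->
  (forall s, 0 < s -> df s <= C * f s + k) -> f t + k / C <= (f 0 + k / C) * expR (C * t).
move=> [fc fd] C0 t0 H.
have ed s : is_derive s 1 (fun x => expR (- C * x)) (- C * expR (- C * s)).
  have h1 : is_derive s 1 (fun x : R => - C * x) (- C).
    by apply: is_derive_eq; rewrite /GRing.scale /= mulr1.
  by apply: is_derive_eq; rewrite /GRing.scale /= mulrC.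
pose G x := (f x + k / C) * expR (- C * x).
pose dG x := (df x - C * (f x + k / C)) * expR (- C * x).
have cG : curve G dG.
  split=> [x|s s0].
    rewrite /continuous_at /G; apply: cvgM; last by apply: is_derive_cont (ed x).
    by apply: cvgD; [exact: fc|exact: cvg_cst].
  have := fd s s0 => h1; have := ed s => h2; have h3 := is_derive_cst (k / C) s (1:R).
  have h4 : is_derive s 1 (fun x => f x + k / C) (df s).
    by rewrite -[df s]addr0; apply: is_deriveD.
  by apply: is_derive_eq; rewrite /GRing.scale /= /dG; ring.
have c0 : curve (fun=> 0 : R) (fun=> 0).
  by split=> [x|s s0]; [exact: cst_continuous|exact: is_derive_cst].
have := curve_le cG c0 t0; rewrite subrr => /(_ _).
rewrite /G mulr0 expR0 mulr1 subr_le0 => h.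
rewrite -ler_pdivrMr ?expR_gt0 // -expRN -mulNr; apply: h => s s0 st.
rewrite /dG pmulr_lle0 ?expR_gt0 // subr_le0.
apply: le_trans (H s s0) _; rewrite mulrDr mulrCA divff ?mulr1 // gt_eqF //.
Qed.

End RealCalculus.

Lemma expr_half_small {R : realType} (A e : R) : 0 < e ->
  exists N, forall k, (N <= k)%N -> A * 2^-1 ^+ k < e.
move=> e0; have A0 : 0 < `|A| + 1 by rewrite ltr_wpDl.
have [N hN] := ltr_add_invr (divr_gt0 e0 A0); exists N => k hk.
rewrite add0r ltr_pdivlMr // mulrC in hN; apply: le_lt_trans hN.
apply: le_trans (_ : (`|A| + 1) * 2^-1 ^+ k <= _).
  by rewrite ler_wpM2r ?exprn_ge0 ?invr_ge0 //; have := ler_norm A; lra.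
rewrite ler_pM2l // exprVn lef_pV2 ?posrE ?exprn_gt0 // -natrX ler_nat.
by apply: leq_trans (_ : (k.+1 <= _)%N); rewrite ?ltnS // ltn_expl.
Qed.

(** * Bounded Lipschitz functions of many variables and the global Picard theorem *)

Section ODE.
Context {R : realType} {I : Type}.
Implicit Types (y z : I -> R) (P : (I -> R) -> R).

(** Lipschitz in the sup norm and bounded: without the bound the class would not be closed under
    products. *)
Definition lipb P := exists2 K : R, 0 <= K &
  (forall y z (d : R), (forall j, `|y j - z j| <= d) -> `|P y - P z| <= K * d) /\
  (forall y, `|P y| <= K).

Lemma lipb_ge0 y z (d : R) (i : I) : (forall j, `|y j - z j| <= d) -> 0 <= d.
by move=> /(_ i); apply: le_trans. Qed.

Variable (i0 : I).

Lemma lipb_cst (c : R) : lipb (fun=> c).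
exists `|c| => //; split=> // y z d hd; have d0 := lipb_ge0 i0 hd; rewrite subrr normr0.
by rewrite mulr_ge0.
Qed.

Lemma lipbD P Q : lipb P -> lipb Q -> lipb (fun y => P y + Q y).
move=> [K K0 [H1 H2]] [M M0 [H3 H4]]; exists (K + M); first exact: addr_ge0.
split=> [y z d hd|y]; last by apply: le_trans (ler_normD _ _) _; rewrite lerD.
rewrite mulrDl (_ : _ - _ = (P y - P z) + (Q y - Q z)); last by ring.
by apply: le_trans (ler_normD _ _) _; rewrite lerD ?H1 ?H3.
Qed.

Lemma lipbM P Q : lipb P -> lipb Q -> lipb (fun y => P y * Q y).
move=> [K K0 [H1 H2]] [M M0 [H3 H4]]; exists (2 * K * M + K * M).
  by rewrite addr_ge0 // ?mulr_ge0.
split=> [y z d hd|y].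
  have d0 := lipb_ge0 i0 hd.
  rewrite (_ : _ - _ = (P y - P z) * Q y + P z * (Q y - Q z)); last by ring.
  apply: le_trans (ler_normD _ _) _; rewrite !normrM.
  have h1 : `|P y - P z| * `|Q y| <= (K * d) * M by rewrite ler_pM // H1.
  have h2 : `|P z| * `|Q y - Q z| <= K * (M * d) by rewrite ler_pM // H3.
  have := mulr_ge0 (mulr_ge0 K0 M0) d0; nra.
rewrite normrM; have : `|P y| * `|Q y| <= K * M by rewrite ler_pM.
have := mulr_ge0 K0 M0; nra.
Qed.

Lemma lipb_sum J (s : seq J) (F : J -> (I -> R) -> R) :
  (forall j, lipb (F j)) -> lipb (fun y => \sum_(j <- s) F j y).
move=> H; elim: s => [|j s IH].
  have [K K0 HK] := lipb_cst 0; exists K => //; split=> [y z d|y]; rewrite !big_nil; [exact: HK.1|exact: (HK.2 y)].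
have [K K0 HK] := lipbD (H j) IH; exists K => //.
by split=> [y z d hd|y]; rewrite !big_cons; [exact: HK.1|exact: (HK.2 y)].
Qed.

Lemma lipb_prod J (s : seq J) (F : J -> (I -> R) -> R) :
  (forall j, lipb (F j)) -> lipb (fun y => \prod_(j <- s) F j y).
move=> H; elim: s => [|j s IH].
  have [K K0 HK] := lipb_cst 1; exists K => //; split=> [y z d|y]; rewrite !big_nil; [exact: HK.1|exact: (HK.2 y)].
have [K K0 HK] := lipbM (H j) IH; exists K => //.
by split=> [y z d hd|y]; rewrite !big_cons; [exact: HK.1|exact: (HK.2 y)].
Qed.

Definition clip (M x : R) := if x <= - M then - M else if M <= x then M else x.

Lemma clip_lip M x x' : 0 <= M -> `|clip M x - clip M x'| <= `|x - x'|.
rewrite /clip => M0; case: (leP x (- M)) => h1; case: (leP x' (- M)) => h2;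
case: (leP M x) => h3; case: (leP M x') => h4; rewrite ?subrr ?normr0 ?normr_ge0 //;
rewrite ler_norml; case: (ger0P (x - x')) => h5; lra.
Qed.

Lemma clip_bound M x : 0 <= M -> `|clip M x| <= M.
rewrite /clip => M0; case: (leP x (- M)) => h1; case: (leP M x) => h3; rewrite ler_norml; lra.
Qed.

Lemma clip_id M x : `|x| <= M -> clip M x = x.
rewrite ler_norml /clip => /andP [h1 h2]; case: (leP x (- M)) => h3; case: (leP M x) => h4; lra.
Qed.

Lemma lipb_clip M (i : I) : 0 <= M -> lipb (fun y => clip M (y i)).
move=> M0; exists (M + 1); first by rewrite addr_ge0.
split=> [y z d hd|y]; last by rewrite (le_trans (clip_bound _ M0)) // lerDl.
have := clip_lip (y i) (z i) M0; have := hd i; have := lipb_ge0 i hd; nra.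
Qed.

(* Equal to 1 on [-M, M] and to 0 outside ]-2M, 2M[. *)
Definition plateau (M x : R) := clip 1 (Num.max 0 (2 - clip (3 * M) `|x| / M)).

Lemma lipb_plateau M (i : I) : 0 < M -> lipb (fun y => plateau M (y i)).
move=> M0; have Mi : 0 <= M^-1 by rewrite invr_ge0 ltW.
exists (M^-1 + 1); first by rewrite addr_ge0.
split=> [y z d hd|y]; last first.
  by apply: le_trans (clip_bound _ ler01) _; rewrite lerDr.
apply: le_trans (clip_lip _ _ ler01) _.
have d0 := lipb_ge0 i hd.
have h : `|clip (3 * M) `|y i| / M - clip (3 * M) `|z i| / M| <= M^-1 * d.
  rewrite -mulrBl normrM [in leRHS]mulrC (ger0_norm Mi) ler_wpM2r //.
  apply: le_trans (clip_lip _ _ _) _; first by lra.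
  by apply: le_trans (ler_dist_dist _ _) _; exact: hd.
have M1 : 0 <= M^-1 * d by rewrite mulr_ge0.
move: h; set p := _ / M; set q := _ / M; rewrite ler_norml => /andP [h1 h2].
rewrite ler_norml; case: (leP 0 (2 - p)) => h3; case: (leP 0 (2 - q)) => h4; nra.
Qed.

Lemma plateau1 M x : 0 < M -> `|x| <= M -> plateau M x = 1.
move=> M0 h; rewrite /plateau (_ : clip (3 * M) `|x| = `|x|); last by rewrite clip_id // normr_id; lra.
have : `|x| / M <= 1 by rewrite ler_pdivrMr ?mul1r.
set q := _ / M => hq; have -> : Num.max 0 (2 - q) = 2 - q by case: (leP 0 (2 - q)); lra.
by rewrite /clip; case: (leP (2 - q) (- 1)) => h3; case: (leP 1 (2 - q)) => h4; lra.
Qed.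

Lemma plateau0 M x : 0 < M -> 2 * M <= `|x| -> plateau M x = 0.
move=> M0 h; rewrite /plateau.
have : 2 <= clip (3 * M) `|x| / M.
  rewrite ler_pdivlMr // /clip; case: (leP _ (- _)) => h3; [|case: (leP (3 * M) _) => h4]; lra.
set q := _ / M => hq; have -> : Num.max 0 (2 - q) = 0 by case: (leP 0 (2 - q)); lra.
by rewrite clip_id // normr0.
Qed.

Lemma dominated_cauchy (u b : nat -> R) :
  (forall e : R, 0 < e -> exists N, forall k, (N <= k)%N -> b k < e) ->
  (forall k m, (k <= m)%N -> `|u m - u k| <= b k) ->
  exists l, forall k, `|l - u k| <= b k.
move=> b0 H; have : cvg (u n @[n --> \oo]).
  apply/cauchy_cvgP/cauchy_exP => e e0; have [N HN] := b0 e e0.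
  exists (u N); exists N => // n /= hn; rewrite /ball /= distrC.
  by apply: le_lt_trans (H _ _ hn) _; exact: HN.
move=> /cvg_ex [/= l Hl]; exists l => k; rewrite distrC.
apply/ler_addgt0Pl => e e0.
have /cvgrPdist_lt /(_ e e0) [N _ HN] := Hl.
have h1 := HN (maxn N k) (leq_maxl _ _); have h2 := H k (maxn N k) (leq_maxr _ _).
rewrite /= in h1; have := ler_distD (u (maxn N k)) (u k) l.
rewrite [`|u k - u _|]distrC [`|u (maxn N k) - l|]distrC; lra.
Qed.

(** Picard iteration with the weight [expR (2 C t)]: integrating against it halves the distance of
    successive iterates, which gives convergence on the whole half-line with no gluing of local
    solutions. *)
Theorem global_ode (F : (I -> R) -> I -> R) (K : R) (y0 : I -> R) : 0 <= K ->
  (forall y z (d : R), (forall j, `|y j - z j| <= d) -> forall i, `|F y i - F z i| <= K * d) ->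
  (forall y i, `|F y i| <= K) ->
  exists y : R -> I -> R, [/\ forall t, t <= 0 -> y t = y0,
    forall i, curve (fun t => y t i) (fun t => F (y t) i) &
    forall i, continuous (fun t => F (y t) i)].
move=> K0 FL FB.
pose good (y : R -> I -> R) := forall t s i, `|y t i - y s i| <= K * `|t - s|.
(* Freezing time at 0 keeps every iterate equal to [y0] for [t <= 0] and Lipschitz on the whole
   axis. *)
pose p (t : R) := Num.max t 0.
have pd t s : `|p t - p s| <= `|t - s|.
  rewrite /p; case: (leP t 0) => h1; case: (leP s 0) => h2; rewrite ?subrr ?normr0 ?normr_ge0 //;
  rewrite ler_norml; case: (ger0P (t - s)) => h3; lra.
have p0 t : 0 <= p t by rewrite /p le_max lexx orbT.
have pp t : 0 <= t -> p t = t by rewrite /p => h; case: leP => // h2; lra.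
have lipc (f : R -> R) (C : R) : (forall t s, `|f t - f s| <= C * `|t - s|) -> continuous f.
  move=> H x; apply/cvg_epsP => e e0; have C0 : 0 < `|C| + 1 by rewrite ltr_wpDl.
  exists (e / (`|C| + 1)); first by rewrite divr_gt0.
  move=> y; rewrite ltr_pdivlMr // mulrC; apply: le_lt_trans; apply: le_trans (H y x) _.
  by rewrite ler_wpM2r //; have := ler_norm C; lra.
have Fc (y : R -> I -> R) i : good y -> continuous (fun t => F (y t) i).
  move=> gy; apply: (lipc _ (K * K)) => t s; rewrite -mulrA; apply: FL => j; exact: gy.
have step (y : R -> I -> R) : exists z : R -> I -> R, good y ->
    [/\ good z, forall t, t <= 0 -> z t = y0 & forall i, curve (fun t => z t i) (fun t => F (y t) i)].
  have [gy|ngy] := pselect (good y); last by exists y.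
  have H (i : I) : exists Phi : R -> R, Phi 0 = 0 /\ forall t : R, 0 <= t -> is_derive t 1 Phi (F (y t) i).
    by have [Phi h1 h2] := antiderivative (Fc y i gy); exists Phi.
  have [Phi HPhi] := choice H.
  have cur i : curve (fun t => y0 i + Phi i (p t)) (fun t => F (y t) i).
    have [Ph0 Phd] := HPhi i; split=> [x|t t0].
      apply: cvgD; first exact: cvg_cst.
      apply: (@continuous_comp _ _ _ p (Phi i)); first by apply: (lipc _ 1) => t s; rewrite mul1r.
      exact: is_derive_cont (Phd (p x) (p0 x)).
    have : is_derive t 1 (fun t => y0 i + Phi i t) (F (y t) i).
      have h1 := Phd t (ltW t0); have h2 := is_derive_cst (y0 i) t (1:R).
      by rewrite -[F (y t) i]add0r; apply: is_deriveD.
    apply: near_eq_is_derive; near=> s; rewrite pp // ltW //; near: s; exact: lt_nbhsr.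

  exists (fun t i => y0 i + Phi i (p t)) => _; split=> //; last first.
    by move=> t t0; apply/funext => i; rewrite /p max_r // (HPhi i).1 addr0.
  move=> t s i.
  have L a b : 0 <= a -> a <= b -> `|(y0 i + Phi i (p b)) - (y0 i + Phi i (p a))| <= K * (b - a).
    move=> a0; rewrite le_eqVlt => /orP [/eqP ->|ab]; first by rewrite !subrr normr0 mulr0.
    have [c _ ->] := curve_mvt (cur i) a0 ab.
    by rewrite normrM (gtr0_norm (_ : 0 < b - a)) ?subr_gt0 // ler_wpM2r // subr_ge0 ltW.
  have ppp a : p (p a) = p a by apply: pp.
  have := L (Num.min (p s) (p t)) (Num.max (p s) (p t)).
  case: (leP (p s) (p t)) => h; rewrite ?minElt ?maxElt !ppp.
    move=> /(_ (p0 s) h) h1; apply: le_trans h1 _; apply: ler_wpM2l => //.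
    by apply: le_trans (pd t s); rewrite ler_norm.
  move=> /(_ (p0 t) (ltW h)) h1; rewrite distrC; apply: le_trans h1 _; apply: ler_wpM2l => //.
  by rewrite distrC; apply: le_trans (pd s t); rewrite ler_norm.
have [g Hg] := choice step.
pose Y k := iter k g (fun=> y0).
have gY k : good (Y k).
  elim: k => [|k IH]; first by move=> t s i; rewrite subrr normr0 mulr_ge0.
  by have [] := Hg _ IH.
have Y0 k t : t <= 0 -> Y k t = y0 by case: k => // k; have [_ H _] := Hg _ (gY k); exact: H.
have Yc k i : curve (fun t => Y k.+1 t i) (fun t => F (Y k t) i) by have [_ _ H] := Hg _ (gY k); exact: H.
pose C := K + 1; have C1 : 1 <= C by rewrite lerDr.
(* The derivative of [E A] is [E (A * 2 C)], so a Lipschitz factor at most [C] is absorbed with a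
   factor [1 / 2] to spare. *)
pose E (A : R) t := A * expR (2 * C * t).
have cE A : curve (E A) (E (A * (2 * C))).
  have D (t : R) : is_derive t 1 (E A) (E (A * (2 * C)) t).
    have h1 : is_derive t 1 (fun x : R => 2 * C * x) (2 * C).
      by apply: is_derive_eq; rewrite /GRing.scale /= mulr1.
    by apply: is_derive_eq; rewrite /GRing.scale /= /E; ring.
  by split=> [x|t _]; [exact: is_derive_cont (D x)|exact: D].
have E0 A t : 0 <= A -> 0 <= E A t by move=> A0; rewrite /E mulr_ge0 // expR_ge0.
have c0 : curve (fun=> 0 : R) (fun=> 0).
  by split=> [x|s s0]; [exact: cst_continuous|exact: is_derive_cst].
have diff k t i : 0 <= t -> `|Y k.+1 t i - Y k t i| <= E (C * 2^-1 ^+ k) t.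
  elim: k t i => [|k IH] t i t0.
    have := curve_abs_le (Yc 0%N i) (cE C) t0; rewrite (Y0 1%N 0) // => /(_ _) h.
    rewrite expr0 mulr1; apply: le_trans (h _) _; last by rewrite gerDl lerNl oppr0 E0 //; lra.
    move=> s s0 st; apply: le_trans (FB _ _) _; rewrite /E.
    have : 1 <= expR (2 * C * s) by rewrite -[leLHS](expR0 R) ler_expR !mulr_ge0 //; lra.
    by set x := expR _ => x1; rewrite /C in C1 *; nra.
  have cD : curve (fun t => Y k.+2 t i - Y k.+1 t i) (fun t => F (Y k.+1 t) i - F (Y k t) i).
    have [a1 a2] := Yc k.+1 i; have [a3 a4] := Yc k i.
    split=> [x|s s0]; first by apply: cvgB; [exact: a1|exact: a3].
    by have := a2 s s0; have := a4 s s0 => ? ?; apply: is_deriveB.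
  have := curve_abs_le cD (cE (C * 2^-1 ^+ k.+1)) t0; rewrite (Y0 k.+2 0) // (Y0 k.+1 0) // subrr subr0 => /(_ _) h.
  have A0 : 0 <= C * 2^-1 ^+ k.+1 by rewrite mulr_ge0 ?exprn_ge0 ?invr_ge0 //; lra.
  apply: le_trans (h _) _; last by rewrite gerDl lerNl oppr0 E0.
  move=> s s0 st; apply: le_trans (FL _ _ _ (fun j => IH s j (ltW s0)) i) _.
  rewrite /E exprS; have := expR_ge0 (2 * C * s); set x := expR _ => x0.
  have : 0 <= C * 2^-1 ^+ k by rewrite mulr_ge0 ?exprn_ge0 ?invr_ge0 //; lra.
  set w := C * _ => w0; rewrite (_ : C * (2^-1 * 2^-1 ^+ k) * (2 * C) * x = C * (w * x)).
    by rewrite ler_wpM2r ?mulr_ge0 // /C; lra.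
  by rewrite /w; field.
(* The sum of the geometric series of successive differences from index [k] on, whence the factor
   2. *)
pose b t k := E (C * 2^-1 ^+ k) (p t) * 2.
have bb t k m i : (k <= m)%N -> `|Y m t i - Y k t i| <= b t k.
  move=> km; have [t0|/ltW t0] := leP t 0.
    rewrite !Y0 // subrr normr0 /b mulr_ge0 // E0 // mulr_ge0 ?exprn_ge0 ?invr_ge0 //; lra.
  suff : `|Y m t i - Y k t i| <= b t k - b t m.
    have : 0 <= b t m by rewrite /b mulr_ge0 // E0 // mulr_ge0 ?exprn_ge0 ?invr_ge0 //; lra.
    by lra.
  elim: m km => [|m IH]; first by rewrite leqn0 => /eqP ->; rewrite !subrr normr0.
  rewrite leq_eqVlt => /orP [/eqP ->|]; first by rewrite !subrr normr0.
  rewrite ltnS => /IH h1; have := diff m t i t0.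
  have := ler_distD (Y m t i) (Y m.+1 t i) (Y k t i).
  suff : E (C * 2^-1 ^+ m) t = b t m - b t m.+1 by lra.
  by rewrite /b /E pp // exprS; set x := expR _; set w := _ ^+ m; field.
have b0 t (e : R) : 0 < e -> exists N, forall k, (N <= k)%N -> b t k < e.
  move=> e0; have := expr_half_small (C * expR (2 * C * p t) * 2) e0 => -[N HN].
  by exists N => k hk; apply: le_lt_trans (HN k hk); rewrite /b /E le_eqVlt; apply/orP; left; apply/eqP; ring.
have lim t i : exists l, forall k, `|l - Y k t i| <= b t k.
  by apply: dominated_cauchy (b0 t) _ => k m km; exact: bb.
pose y t i := xget 0 [set l | forall k, `|l - Y k t i| <= b t k].
have yb t i k : `|y t i - Y k t i| <= b t k.
  by rewrite /y; case: xgetP => [l _|]; [apply|have [l Hl] := lim t i => /(_ l)].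
have yy t : t <= 0 -> y t = y0.
  move=> t0; apply/funext => i; apply/eqP; rewrite -subr_eq0 -normr_le0.
  apply/ler_addgt0Pl => e e0; rewrite addr0.
  by have [N HN] := b0 t e e0; have := yb t i N; rewrite Y0 // => h; rewrite (le_trans h) // ltW // HN.
exists y.
have cc i : curve (fun t => y t i) (fun t => F (y t) i) /\ continuous (fun t => F (y t) i).
  apply: (@limit_curve R (fun k t => Y k.+1 t i) (fun k t => F (Y k t) i)).
  - by move=> n; exact: Yc.
  - by move=> t t0; rewrite !yy.
  - by move=> t t0; rewrite !yy.
  - by move=> n; apply: Fc.
  move=> T e T0 e0; have [N HN] := b0 T (e / C) (divr_gt0 e0 (lt_le_trans ltr01 C1)).
  exists N => n t hn /andP [t0 tT].
  have bm k : b t k <= b T k.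
    rewrite /b /E !pp // ler_wpM2r // ler_wpM2l ?mulr_ge0 ?exprn_ge0 ?invr_ge0 //; first by lra.
    by rewrite ler_expR ler_wpM2l //; lra.
  have h2 k : (N <= k)%N -> b t k <= e / C by move=> hk; rewrite (le_trans (bm k)) // ltW // HN.
  have eC : e / C <= e by rewrite ler_pdivrMr ?(lt_le_trans ltr01 C1) //; nra.
  split.
    by rewrite distrC; apply: le_trans (yb t i n.+1) _; apply: le_trans (h2 _ (leqW hn)) eC.
  apply: le_trans (FL _ _ (e / C) _ i) _.
    by move=> j; rewrite distrC; apply: le_trans (yb t j n) _; exact: h2.
  rewrite mulrCA; apply: ler_piMr; first exact: ltW.
  by rewrite ler_pdivrMr ?(lt_le_trans ltr01 C1) // mul1r /C lerDl.
by split => // i; have [] := cc i.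
Unshelve. all: end_near.
Qed.
End ODE.

(** * Coordinates in an eigenbasis and the linear group *)

Module Modes.
Lemma sum_cut (V : zmodType) (f : nat -> V) q p : (q <= p)%N ->
  \sum_(i < p) (if (i < q)%N then 0 else f i) = \sum_(i < p) f i - \sum_(i < q) f i.
move=> qp; rewrite -(big_mkord xpredT f) -(big_mkord xpredT f).
rewrite -(big_mkord xpredT (fun i => if (i < q)%N then 0 else f i)).
rewrite (big_cat_nat (n := q)) //= [in RHS](big_cat_nat (n := q)) //= addrAC subrr add0r.
rewrite big_nat_cond big1 ?add0r; last by move=> i /andP [/andP [_ ->]].
by rewrite big_nat [in RHS]big_nat; apply: eq_bigr => i /andP [h _]; rewrite ltnNge h.
Qed.

Lemma cvg_sqD {R : realType} (T : Type) (F : set_system T) (f g : T -> R) (b c : R) :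
  f @ F --> b -> g @ F --> c -> Filter F -> f x ^+ 2 + g x ^+ 2 @[x --> F] --> b ^+ 2 + c ^+ 2.
by move=> hf hg FF; apply: cvgD; apply: cvgM. Qed.

Section Coordinates.
Context {R : realType} {E : lmodType R}.
Implicit Types (u v w : E).
Variables (l a : E -> E -> R) (e : nat -> E) (lam : nat -> R).

(** The forms are semidefinite; [es_def] and [es_la] say that [l] and [a] have the same null
    vectors, which takes the place of definiteness. *)
Record eigensystem : Prop := Eigensystem {
  es_l : bform l; es_l0 : nneg l; es_a : bform a; es_a0 : nneg a;
  es_complete : complete_form a;
  es_la : exists2 M, 0 < M & forall u, l u u <= M * a u u;
  es_def : forall u, l u u = 0 -> a u u = 0;
  es_orth : forall i j, l (e i) (e j) = (i == j)%:R;
  es_eig : forall i v, a (e i) v = lam i * l (e i) v;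
  es_pos : forall i, 0 < lam i;
  es_min : forall i u, (forall j, (j < i)%N -> l (e j) u = 0) -> lam i * l u u <= a u u;
  es_unb : forall B, exists N, forall i, (N <= i)%N -> B <= lam i }.

Hypothesis H : eigensystem.
Let hl := es_l H. Let l0 := es_l0 H. Let ha := es_a H. Let a0 := es_a0 H.

Definition synth (c : nat -> R) n := \sum_(i < n) c i *: e i.
Definition crd u i := l (e i) u.
Definition proj n u := synth (crd u) n.

Lemma crd_synth c n i : crd (synth c n) i = if (i < n)%N then c i else 0.
rewrite /crd /synth b_sumr //; have [hi|hi] := ltnP i n.
  rewrite (bigD1 (Ordinal hi)) //= big1 ?addr0 => [|j /negP ji].
    by rewrite bZr // es_orth // eqxx mulr1.
  rewrite bZr // es_orth //; case: eqP => [ij|]; last by rewrite mulr0.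
  by case: ji; apply/eqP/val_inj.
rewrite big1 // => j _; rewrite bZr // es_orth //; case: eqP => [ij|]; last by rewrite mulr0.
by have := ltn_ord j; rewrite -ij ltnNge hi.
Qed.

Lemma l_synth c n u : l (synth c n) u = \sum_(i < n) c i * crd u i.
by rewrite /synth b_suml //; apply: eq_bigr => i _; rewrite bZl. Qed.

Lemma a_synth c n u : a (synth c n) u = \sum_(i < n) lam i * c i * crd u i.
rewrite /synth b_suml //; apply: eq_bigr => i _; rewrite bZl // es_eig // /crd; ring.
Qed.

Lemma synth_sub (c : nat -> R) p q : (q <= p)%N ->
  synth c p - synth c q = synth (fun i => if (i < q)%N then 0 else c i) p.
move=> qp; rewrite /synth -(sum_cut (fun i => c i *: e i) qp).
by apply: eq_bigr => i _; case: ifP; rewrite ?scale0r.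
Qed.

Lemma a_synthsq c n : a (synth c n) (synth c n) = \sum_(i < n) lam i * c i ^+ 2.
by rewrite a_synth; apply: eq_bigr => i _; rewrite crd_synth ltn_ord expr2 mulrA.
Qed.

Lemma l_synthsq c n : l (synth c n) (synth c n) = \sum_(i < n) c i ^+ 2.
by rewrite l_synth; apply: eq_bigr => i _; rewrite crd_synth ltn_ord expr2.
Qed.

Lemma crdB u v i : crd (u - v) i = crd u i - crd v i.
by rewrite /crd bBr. Qed.
Lemma crdD u v i : crd (u + v) i = crd u i + crd v i.
by rewrite /crd bDr. Qed.
Lemma crdZ c u i : crd (c *: u) i = c * crd u i.
by rewrite /crd bZr. Qed.

Lemma crd_bound u i : crd u i ^+ 2 <= l u u.
by have := form_CS hl l0 (e i) u; rewrite es_orth // eqxx mul1r. Qed.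

Lemma synth_exists (c : nat -> R) B : (forall n, \sum_(i < n) lam i * c i ^+ 2 <= B) ->
  exists u, (forall i, crd u i = c i) /\
    forall eps : R, 0 < eps -> exists N, forall n, (N <= n)%N ->
      a (synth c n - u) (synth c n - u) < eps.
move=> HB; pose S n := \sum_(i < n) lam i * c i ^+ 2.
have Snd : nondecreasing_seq S.
  apply/nondecreasing_seqP => n; rewrite /S big_ord_recr /= lerDl.
  by rewrite mulr_ge0 ?sqr_ge0 // ltW // es_pos.
have /nondecreasing_cvgn /(_ (ex_intro _ B _)) cS := Snd.
have {}cS : S n @[n --> \oo] --> sup (range S) by apply: cS => _ [n _ <-]; exact: HB.
have Sle n : S n <= sup (range S).
  by apply: ub_le_sup; [exists B => _ [k _ <-]; exact: HB|exists n].
have D p q : (q <= p)%N -> a (synth c p - synth c q) (synth c p - synth c q) = S p - S q.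
  move=> qp; rewrite synth_sub // a_synthsq /S -(sum_cut (fun i => lam i * c i ^+ 2) qp).
  by apply: eq_bigr => i _; case: ifP; rewrite // expr0n mulr0.
have Cau eps : 0 < eps -> exists N, forall p q, (N <= p)%N -> (N <= q)%N ->
     a (synth c p - synth c q) (synth c p - synth c q) < eps.
  move=> eps0; move/cvgrPdist_lt : cS => /(_ eps eps0) [N _ HN].
  exists N => p q hp hq; wlog qp : p q hp hq / (q <= p)%N.
    by move=> W; case: (leqP q p) => h; [apply: W|rewrite bsqBC //; apply: W => //; exact: ltnW].
  rewrite D //; have := HN q hq; rewrite /= ger0_norm ?subr_ge0 //.
  by apply: le_lt_trans; rewrite lerB.
have [u Hu] := es_complete H Cau.
exists u; split => // i; apply/eqP; rewrite -subr_eq0 -sqrf_eq0; apply/eqP/le_anti.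
rewrite sqr_ge0 andbT; apply/ler_addgt0Pl => eps eps0; rewrite addr0.
have [M M0 HM] := es_la H.
have [N HN] := Hu (eps / M) (divr_gt0 eps0 M0).
have -> : c i = crd (synth c (maxn N i.+1)) i by rewrite crd_synth leq_max ltnSn orbT.
rewrite -crdB; apply: le_trans (crd_bound _ _) _; rewrite bsqBC //.
apply: le_trans (HM _) _; apply/ltW; rewrite mulrC -ltr_pdivlMr // HN //.
exact: leq_maxl.
Qed.

(** The difference is orthogonal to every eigenvector, so [es_min] gives [lam N * l <= a] for it for
    all [N], and [lam] is unbounded. *)
Lemma coord_inj u v : (forall i, crd u i = crd v i) -> a (u - v) (u - v) = 0.
move=> h; apply: (es_def H); apply: le_anti; rewrite l0 andbT.
rewrite leNgt; apply/negP => lp.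
have [N HN] := es_unb H ((a (u - v) (u - v) + 1) / l (u - v) (u - v)).
have : lam N * l (u - v) (u - v) <= a (u - v) (u - v).
  by apply: es_min => // j _; rewrite -/(crd _ _) crdB h subrr.
have := HN N (leqnn _); rewrite ler_pdivrMr // => h1 h2; lra.
Qed.

Lemma a_split u n : a u u = \sum_(i < n) lam i * crd u i ^+ 2 + a (u - proj n u) (u - proj n u).
rewrite (bsqB ha) a_synthsq (bC ha u) a_synth.
under [X in 2 * X]eq_bigr do rewrite -mulrA -expr2.
ring.
Qed.

Lemma l_split u n : l u u = \sum_(i < n) crd u i ^+ 2 + l (u - proj n u) (u - proj n u).
rewrite (bsqB hl) l_synthsq (bC hl u) l_synth.
under [X in 2 * X]eq_bigr do rewrite -expr2.
ring.
Qed.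

Lemma a_partial u n : \sum_(i < n) lam i * crd u i ^+ 2 <= a u u.
by rewrite (a_split u n) lerDl. Qed.

(** The projections of [u] converge to some vector with the coordinates of [u]; it differs from [u]
    by a null vector. *)
Lemma a_tail u (eps : R) : 0 < eps -> exists N, forall n, (N <= n)%N ->
  a (u - proj n u) (u - proj n u) < eps.
move=> eps0; have [w [Hc Hw]] := synth_exists (a_partial u).
have [N HN] := Hw eps eps0; exists N => n hn; rewrite bsqBC //.
apply: le_lt_trans (HN n hn).
have z : a (u - w) (u - w) = 0 by apply: coord_inj => i; rewrite Hc.
have -> : proj n u - u = (synth (crd u) n - w) - (u - w).
  by rewrite opprB addrA subrK.
rewrite (bsqB ha) z (bC ha) (nneg0 _ ha a0 z); lra.
Qed.

Lemma l_tail u n : lam n * l (u - proj n u) (u - proj n u) <= a u u.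
apply: le_trans (_ : a (u - proj n u) (u - proj n u) <= _).
  by apply: es_min => // j jn; rewrite -/(crd _ _) crdB crd_synth jn subrr.
rewrite (a_split u n) lerDr; apply: sumr_ge0 => i _.
by rewrite mulr_ge0 ?sqr_ge0 // ltW // es_pos.
Qed.

Definition a2 (x y : E * E) := a x.1 y.1 + a x.2 y.2.
Definition l2 (x y : E * E) := l x.1 y.1 + l x.2 y.2.
Local Notation aa x := (a2 x x).
Local Notation ll x := (l2 x x).

Lemma bform_pair b : bform b -> bform (fun x y : E * E => b x.1 y.1 + b x.2 y.2).
move=> hb; split=> [x y z|c x z|x y] /=; first by rewrite !(bDl hb) addrACA.
  by rewrite !(bZl hb) mulrDr.
by rewrite (bC hb x.1) (bC hb x.2).
Qed.
Lemma ha2 : bform a2. exact: bform_pair. Qed.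
Lemma hl2 : bform l2. exact: bform_pair. Qed.
Lemma a20 : nneg a2. by move=> x; rewrite addr_ge0. Qed.
Lemma l20 : nneg l2. by move=> x; rewrite addr_ge0. Qed.

Definition sq2 (x : E * E) i := crd x.1 i ^+ 2 + crd x.2 i ^+ 2.

Lemma sq20 x i : 0 <= sq2 x i. by rewrite addr_ge0 ?sqr_ge0. Qed.

Lemma a2_split x n : aa x = \sum_(i < n) lam i * sq2 x i +
  aa (x - (proj n x.1, proj n x.2)).
rewrite /a2 /= (a_split x.1 n) (a_split x.2 n).
under [in RHS]eq_bigr do rewrite mulrDr.
by rewrite big_split /=; ring.
Qed.

Lemma a2_partial x n : \sum_(i < n) lam i * sq2 x i <= aa x.
by rewrite (a2_split x n) lerDl a20. Qed.

Lemma a2_tail x (eps : R) : 0 < eps -> exists N, forall n, (N <= n)%N ->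
  aa (x - (proj n x.1, proj n x.2)) < eps.
move=> eps0; have e2 := divr_gt0 eps0 (ltr0n R 2).
have [N1 H1] := a_tail x.1 e2; have [N2 H2] := a_tail x.2 e2.
exists (maxn N1 N2) => n; rewrite geq_max => /andP [h1 h2].
by have := H1 n h1; have := H2 n h2; rewrite /a2 /=; lra.
Qed.

Lemma a2_le x B : (forall n, \sum_(i < n) lam i * sq2 x i <= B) -> aa x <= B.
move=> h; apply/ler_addgt0Pr => eps eps0; have [N HN] := a2_tail x eps0.
by rewrite (a2_split x N) lerD // ltW // HN.
Qed.

Lemma coord2_inj x y : (forall i, crd x.1 i = crd y.1 i /\ crd x.2 i = crd y.2 i) ->
  aa (x - y) = 0.
by move=> h; rewrite /a2 /= !coord_inj ?addr0 // => i; have [] := h i.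
Qed.

Lemma synth2_exists (x : E * E) (K : R) (c d : nat -> R) :
  (forall i, c i ^+ 2 + d i ^+ 2 <= K * sq2 x i) ->
  exists y : E * E, forall i, crd y.1 i = c i /\ crd y.2 i = d i.
move=> h; have K1 i : c i ^+ 2 <= K * sq2 x i /\ d i ^+ 2 <= K * sq2 x i.
  by have := h i; have := sqr_ge0 (c i); have := sqr_ge0 (d i) => ? ? ?; split; lra.
have B (f : nat -> R) : (forall i, f i ^+ 2 <= K * sq2 x i) ->
    forall n, \sum_(i < n) lam i * f i ^+ 2 <= `|K| * aa x.
  move=> hf n; apply: le_trans (_ : `|K| * \sum_(i < n) lam i * sq2 x i <= _); last first.
    by rewrite ler_wpM2l // a2_partial.
  rewrite mulr_sumr; apply: ler_sum => i _; rewrite [leRHS]mulrCA (ler_wpM2l (ltW (es_pos H i))) //.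
  by apply: le_trans (hf i) _; rewrite ler_wpM2r ?sq20 // ler_norm.
have [u [Hu _]] := synth_exists (B c (fun i => (K1 i).1)).
have [w [Hw _]] := synth_exists (B d (fun i => (K1 i).2)).
by exists (u, w) => i.
Qed.

(** Dominated convergence over the modes, with dominating sequence [K * sq2 x i]: the tail is small
    uniformly in [h], the finite part tends to 0 mode by mode. *)
Lemma modes_cvg0 (T : Type) (F : set_system T) (z : T -> E * E) (x : E * E) (K : R) :
  Filter F ->
  (\forall h \near F, forall i, sq2 (z h) i <= K * sq2 x i) ->
  (forall i, sq2 (z h) i @[h --> F] --> (0 : R)) ->
  aa (z h) @[h --> F] --> (0 : R).
move=> FF HK Hi; apply/cvgrPdist_lt => eps eps0.
have K0 : 0 < `|K| + 1 by rewrite ltr_wpDl.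
have [N HN] := a2_tail x (divr_gt0 (divr_gt0 eps0 (ltr0n R 4)) K0).
have tailx n : (N <= n)%N -> \sum_(N <= i < n) lam i * sq2 x i < eps / 4 / (`|K| + 1).
  move=> hn; apply: le_lt_trans (HN N (leqnn _)).
  have := a2_split x N; have := a2_partial x n.
  by rewrite -(big_mkord xpredT (fun i => lam i * sq2 x i)) (big_cat_nat (n := N)) //= big_mkord; lra.
have fin : \sum_(i < N) lam i * sq2 (z h) i @[h --> F] --> (0 : R).
  elim: (N) => [|n IH].
    by under eq_fun do rewrite big_ord0; exact: cvg_cst.
  under eq_fun do rewrite big_ord_recr /=.
  by have := cvgD IH (cvgM (cvg_cst (lam n)) (Hi n)); rewrite mulr0 addr0; apply.
move/cvgrPdist_lt : fin => /(_ (eps / 4) (divr_gt0 eps0 (ltr0n R 4))).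
apply: filterS2 HK => h HKh; rewrite !sub0r !normrN => /ltr_normlP [_ hN].
rewrite ger0_norm ?a20 //; apply: le_lt_trans (_ : eps / 2 < _); last by lra.
apply: a2_le => n.
have mono : \sum_(i < n) lam i * sq2 (z h) i <= \sum_(i < maxn N n) lam i * sq2 (z h) i.
  rewrite -!(big_mkord xpredT (fun i => lam i * sq2 (z h) i)) [leRHS](big_cat_nat (n := n)) ?leq_maxr //=.
  by rewrite lerDl; apply: sumr_ge0 => i _; rewrite mulr_ge0 ?sq20 // ltW // es_pos.
apply: le_trans mono _.
rewrite -(big_mkord xpredT (fun i => lam i * sq2 (z h) i)) (big_cat_nat (n := N)) ?leq_maxl //=.
rewrite big_mkord.
have : \sum_(N <= i < maxn N n) lam i * sq2 (z h) i <= (`|K| + 1) * \sum_(N <= i < maxn N n) lam i * sq2 x i.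
  rewrite mulr_sumr; apply: ler_sum => i _; rewrite [leRHS]mulrCA (ler_wpM2l (ltW (es_pos H i))) //.
  apply: le_trans (HKh i) _; rewrite ler_wpM2r ?sq20 //; have := ler_norm K; lra.
have := tailx _ (leq_maxl N n); rewrite ltr_pdivlMr // mulrC; lra.
Qed.

(** The group generated by [J A], where [A] has eigenvalues [lam i]: the two components of mode [i]
    rotate with angular speed [lam i]. *)
Definition flow_rel t (x y : E * E) := forall i,
  crd y.1 i = cos (lam i * t) * crd x.1 i + sin (lam i * t) * crd x.2 i /\
  crd y.2 i = - sin (lam i * t) * crd x.1 i + cos (lam i * t) * crd x.2 i.

(** The coordinates fix the image up to null vectors only, so one solution of [flow_rel] is chosen;
    the group laws therefore hold in the seminorm. *)
Definition flow t x : E * E := xget 0 (flow_rel t x).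

Lemma rot_sq (t x y : R) :
  (cos t * x + sin t * y) ^+ 2 + (- sin t * x + cos t * y) ^+ 2 = x ^+ 2 + y ^+ 2.
transitivity ((cos t ^+ 2 + sin t ^+ 2) * (x ^+ 2 + y ^+ 2)); first ring.
by rewrite cos2Dsin2 mul1r.
Qed.

Lemma flowP t x : flow_rel t x (flow t x).
have [|y Hy] := @synth2_exists x 1
    (fun i => cos (lam i * t) * crd x.1 i + sin (lam i * t) * crd x.2 i)
    (fun i => - sin (lam i * t) * crd x.1 i + cos (lam i * t) * crd x.2 i).
  by move=> i; rewrite rot_sq mul1r.
by rewrite /flow; case: xgetP => [z _ //|/(_ y)].
Qed.

Lemma sq2_flow t x i : sq2 (flow t x) i = sq2 x i.
by rewrite /sq2; have [-> ->] := flowP t x i; rewrite rot_sq. Qed.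

Lemma flow_le t x : aa (flow t x) <= aa x.
apply: a2_le => n; rewrite (eq_bigr (fun i : 'I_n => lam i * sq2 x i)) ?a2_partial //.
by move=> i _; rewrite sq2_flow.
Qed.

Lemma flow_uniq t x y : flow_rel t x y -> aa (flow t x - y) = 0.
move=> h; apply: coord2_inj => i; have [-> ->] := h i; by have [-> ->] := flowP t x i.
Qed.

Lemma flow0 x : aa (flow 0 x - x) = 0.
by apply: flow_uniq => i; rewrite mulr0 cos0 sin0; split; ring. Qed.

Lemma flowD s t x : aa (flow (s + t) x - flow s (flow t x)) = 0.
apply: flow_uniq => i; have [-> ->] := flowP s (flow t x) i; have [-> ->] := flowP t x i.
by rewrite [lam i * (s + t)]mulrDr cosD sinD; split; ring.
Qed.

Lemma flow_linear t (c : R) x y : aa (flow t (c *: x + y) - (c *: flow t x + flow t y)) = 0.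
apply: flow_uniq => i /=; rewrite !crdD !crdZ.
have [-> ->] := flowP t x i; have [-> ->] := flowP t y i; split; ring.
Qed.

Lemma flowB t x y : aa (flow t x - flow t y - flow t (x - y)) = 0.
apply: coord2_inj => i /=; rewrite !crdB.
have [-> ->] := flowP t x i; have [-> ->] := flowP t y i; have [-> ->] := flowP t (x - y) i.
by rewrite /= !crdB; split; ring.
Qed.

Lemma a2_eq0 x y : aa (x - y) = 0 -> aa x = aa y.
move=> h; have h1 z : a2 (x - y) z = 0 by apply: nneg0 => //; [exact: ha2|exact: a20].
have := h1 x; have := h1 y; rewrite !(bBl ha2) (bC ha2 y x); lra.
Qed.

Lemma flowB_le t x y : aa (flow t x - flow t y) <= aa (x - y).
by rewrite (a2_eq0 (flowB t x y)) flow_le. Qed.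

Lemma flow_cvg x : aa (flow t x - x) @[t --> (0 : R)] --> (0 : R).
apply: (@modes_cvg0 _ _ _ x 4) => [|i].
  apply: nearW => t i.
  rewrite /sq2 /= !crdB -!/(crd _ _).
  have h := sq2_flow t x i; rewrite /sq2 in h.
  set p := crd _ i in h *; set q := crd _ i in h *.
  have := sqr_ge0 (p + crd x.1 i); have := sqr_ge0 (q + crd x.2 i); rewrite !expr2 in h *; nra.
have h0 : lam i * t @[t --> (0 : R)] --> (0 : R).
  by have := cvgM (cvg_cst (lam i)) (@cvg_id _ (nbhs (0 : R))); rewrite mulr0; apply.
have cc : cos (lam i * t) @[t --> (0 : R)] --> (1 : R).
  by have := continuous_cvg _ (@continuous_cos R 0) h0; rewrite cos0; apply.
have ss : sin (lam i * t) @[t --> (0 : R)] --> (0 : R).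
  by have := continuous_cvg _ (@continuous_sin R 0) h0; rewrite sin0; apply.
have T1 : cos (lam i * t) * crd x.1 i + sin (lam i * t) * crd x.2 i - crd x.1 i
    @[t --> (0 : R)] --> 1 * crd x.1 i + 0 * crd x.2 i - crd x.1 i.
  by apply: cvgB; [apply: cvgD; apply: cvgM => //; exact: cvg_cst|exact: cvg_cst].
have T2 : - sin (lam i * t) * crd x.1 i + cos (lam i * t) * crd x.2 i - crd x.2 i
    @[t --> (0 : R)] --> - 0 * crd x.1 i + 1 * crd x.2 i - crd x.2 i.
  by apply: cvgB; [apply: cvgD; apply: cvgM => //; [exact: cvgN|exact: cvg_cst|exact: cvg_cst]|exact: cvg_cst].
have := cvg_sqD T1 T2 _; set L := (X in _ --> X); have -> : L = 0 by rewrite /L; ring.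
move=> U; apply: cvg_trans (U _); apply: near_eq_cvg; apply: nearW => t.
by rewrite /sq2 /= !crdB (flowP t x i).1 (flowP t x i).2.
Qed.

Lemma right_derivative (f : R -> R) df : is_derive (0 : R) 1 f df ->
  h^-1 * (f h - f 0) @[h --> (0 : R)^'+] --> df.
move=> /is_derive1_epsP fd; apply/cvgrPdist_le => eps eps0.
have [d d0 Hd] := fd eps eps0; near=> h.
have h0 : 0 < h by near: h; exact: nbhs_right_gt.
have hd : `|h| < d by rewrite gtr0_norm //; near: h; exact: nbhs_right_lt.
have := Hd h hd; rewrite add0r -(ler_pM2l (_ : 0 < h^-1)) ?invr_gt0 //.
rewrite mulrCA (gtr0_norm h0) mulVf ?gt_eqF // mulr1 -[X in X * _](@gtr0_norm _ h^-1) ?invr_gt0 //.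
by rewrite -normrM distrC mulrBr mulrCA mulVf ?gt_eqF // mulr1.
Unshelve. all: end_near.
Qed.

Lemma is_derive_lin (c x : R) : is_derive x 1 (fun t : R => c * t) c.
by apply: is_derive_eq; rewrite /GRing.scale /= mulr1. Qed.
Lemma is_derive_cosM (c x : R) : is_derive x 1 (fun t => cos (c * t)) (- c * sin (c * x)).
by have h1 := is_derive_lin c x; apply: is_derive_eq; rewrite /GRing.scale /=; ring.
Qed.
Lemma is_derive_sinM (c x : R) : is_derive x 1 (fun t => sin (c * t)) (c * cos (c * x)).
by have h1 := is_derive_lin c x; apply: is_derive_eq; rewrite /GRing.scale /=; ring.
Qed.

Lemma trig_bound (c t : R) : 0 <= t -> 0 <= c ->
  `|cos (c * t) - 1| <= c * t /\ `|sin (c * t)| <= c * t.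
move=> t0 c0.
have cid : curve (fun s : R => c * s) (fun=> c).
  have D (s : R) : is_derive s 1 (fun s : R => c * s) c.
    by apply: is_derive_eq; rewrite /GRing.scale /= mulr1.
  by split=> [x|s _]; [exact: is_derive_cont (D x)|exact: D].
have ccos : curve (fun s : R => cos (c * s)) (fun s => - c * sin (c * s)).
  by split=> [x|s _]; [exact: is_derive_cont (is_derive_cosM c x)|exact: is_derive_cosM].
have csin : curve (fun s : R => sin (c * s)) (fun s => c * cos (c * s)).
  by split=> [x|s _]; [exact: is_derive_cont (is_derive_sinM c x)|exact: is_derive_sinM].
have trig1 (x : R) : `|cos x| <= 1 /\ `|sin x| <= 1.
  have := cos2Dsin2 x; have := sqr_ge0 (sin x); have := sqr_ge0 (cos x) => h1 h2 h3.
  by split; rewrite -(expr_le1 (n := 2)) // normK2 //; lra.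
split.
  have := curve_abs_le ccos cid t0; rewrite !mulr0 cos0 subr0; apply => s _ _.
  by rewrite normrM normrN (ger0_norm c0) ler_piMr // (trig1 _).2.
have := curve_abs_le csin cid t0; rewrite !mulr0 sin0 !subr0; apply => s _ _.
by rewrite normrM (ger0_norm c0) ler_piMr // (trig1 _).1.
Qed.

Lemma rot_right_derivative (c p q : R) :
  h^-1 * (cos (c * h) * p + sin (c * h) * q - p) @[h --> (0 : R)^'+] --> c * q.
have D : is_derive (0 : R) 1 (fun h => cos (c * h) * p + sin (c * h) * q) (c * q).
  have := is_deriveD (is_deriveM (is_derive_cosM c 0) (is_derive_cst p (0 : R) (1 : R))) (is_deriveM (is_derive_sinM c 0) (is_derive_cst q (0 : R) (1 : R))).
  by move=> h; apply: is_derive_eq h _; rewrite /GRing.scale /= !mulr0 sin0 cos0; ring.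
have := right_derivative D; apply: cvg_trans; apply: near_eq_cvg; apply: nearW => h.
by rewrite !mulr0 sin0 cos0 mul1r mul0r addr0.
Qed.

(** [g] plays the role of [A x], so that [(g.2, - g.1)] is [J A x]. The errors of the difference
    quotient are dominated by the modes of [g], and [modes_cvg0] applies. *)
Lemma flow_generator x (g : E * E) :
  (forall i, crd g.1 i = lam i * crd x.1 i /\ crd g.2 i = lam i * crd x.2 i) ->
  aa (h^-1 *: (flow h x - x) - (g.2, - g.1))
    @[h --> (0 : R)^'+] --> (0 : R).
move=> hg; apply: (@modes_cvg0 _ _ _ g 20) => [|i]; last first.
  have D1 := @rot_right_derivative (lam i) (crd x.1 i) (crd x.2 i).
  have D2 := @rot_right_derivative (lam i) (crd x.2 i) (- crd x.1 i).
  have T1 : h^-1 * (cos (lam i * h) * crd x.1 i + sin (lam i * h) * crd x.2 i - crd x.1 i) - crd g.2 i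
     @[h --> (0 : R)^'+] --> lam i * crd x.2 i - crd g.2 i by apply: cvgB => //; exact: cvg_cst.
  have T2 : h^-1 * (cos (lam i * h) * crd x.2 i + sin (lam i * h) * - crd x.1 i - crd x.2 i) + crd g.1 i
     @[h --> (0 : R)^'+] --> lam i * - crd x.1 i + crd g.1 i by apply: cvgD => //; exact: cvg_cst.
  have := cvg_sqD T1 T2 _; rewrite (hg i).1 (hg i).2.
  set L := (X in _ --> X); have -> : L = 0 by rewrite /L; ring.
  move=> U; apply: cvg_trans (U _); apply: near_eq_cvg; apply: nearW => h.
  rewrite /sq2 /= !crdB crdZ crdB crdZ crdB (flowP h x i).1 (flowP h x i).2 /=.
  by rewrite -scaleN1r crdZ (hg i).1 (hg i).2; ring.
near=> h => i; have h0 : 0 < h by near: h; exact: nbhs_right_gt.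
rewrite /sq2 /= !crdB crdZ crdB crdZ crdB (flowP h x i).1 (flowP h x i).2 /=.
rewrite -scaleN1r crdZ (hg i).1 (hg i).2.
have [h1 h2] := trig_bound (ltW h0) (ltW (es_pos H i)).
set p := crd x.1 i; set q := crd x.2 i; set L := lam i; have L0 : 0 < L := es_pos H i.
rewrite -/L in h1 h2.
pose al := (cos (L * h) - 1) / (L * h); pose be := sin (L * h) / (L * h).
have Lh : 0 < L * h by rewrite mulr_gt0.
have al1 : `|al| <= 1 by rewrite normrM normfV (gtr0_norm Lh) ler_pdivrMr // mul1r.
have be1 : `|be| <= 1 by rewrite normrM normfV (gtr0_norm Lh) ler_pdivrMr // mul1r.
have -> : h^-1 * (cos (L * h) * p + sin (L * h) * q - p) - L * q = al * (L * p) + (be - 1) * (L * q).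
  by rewrite /al /be; field; rewrite !gt_eqF.
have -> : h^-1 * (- sin (L * h) * p + cos (L * h) * q - q) - -1 * (L * p) = - (be - 1) * (L * p) + al * (L * q).
  by rewrite /al /be; field; rewrite !gt_eqF.
move: al1 be1; rewrite !ler_norml => /andP [a1 a2'] /andP [b1 b2].
set P := L * p; set Q := L * q.
(* The error in this mode is a scaled rotation of [(P, Q)]; with [|al|, |be| <= 1] the factor is at
   most 5, well below the 20 asked for. *)
have -> : (al * P + (be - 1) * Q) ^+ 2 + (- (be - 1) * P + al * Q) ^+ 2 = (al ^+ 2 + (be - 1) ^+ 2) * (P ^+ 2 + Q ^+ 2) by ring.
by rewrite ler_wpM2r ?addr_ge0 ?sqr_ge0 //; nra.
Unshelve. all: end_near.
Qed.

(** Each coordinate is bounded by the seminorm, so convergence of the quotient passes to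
    coordinates, where the derivative at 0 is known. This identifies the domain of the generator. *)
Lemma flow_generator_inv x f :
  aa (h^-1 *: (flow h x - x) - f) @[h --> (0 : R)^'+] --> (0 : R) ->
  forall i, crd f.1 i = lam i * crd x.2 i /\ crd f.2 i = - (lam i * crd x.1 i).
move=> hf i; have [M M0 HM] := es_la H.
have C (c : R -> R) : (\forall h \near (0 : R)^'+, c h ^+ 2 <= M * aa (h^-1 *: (flow h x - x) - f)) ->
    c h @[h --> (0 : R)^'+] --> (0 : R).
  move=> hc; apply/cvgrPdist_lt => eps eps0.
  have e2 : 0 < eps ^+ 2 / M by rewrite divr_gt0 // exprn_gt0.
  move/cvgrPdist_lt : hf => /(_ _ e2); apply: filterS2 hc => h hc.
  rewrite !sub0r !normrN (ger0_norm (a20 _)) ltr_pdivlMr // mulrC => h1.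
  rewrite ltNge; apply/negP => h2; have : eps ^+ 2 <= `|c h| ^+ 2 by rewrite lerXn2r ?nnegrE ?(ltW eps0).
  by rewrite normK2 //; lra.
have B u : crd u i ^+ 2 <= M * a u u by apply: le_trans (crd_bound _ _) _; exact: HM.
pose d h := h^-1 *: (flow h x - x) - f.
have D1 := @rot_right_derivative (lam i) (crd x.1 i) (crd x.2 i).
have D2 := @rot_right_derivative (lam i) (crd x.2 i) (- crd x.1 i).
have C1 : crd (d h).1 i @[h --> (0 : R)^'+] --> (0 : R).
  apply: C; apply: nearW => h; apply: le_trans (B _) _; rewrite ler_pM2l // /a2 lerDl a0 //.
have C2 : crd (d h).2 i @[h --> (0 : R)^'+] --> (0 : R).
  apply: C; apply: nearW => h; apply: le_trans (B _) _; rewrite ler_pM2l // /a2 lerDr a0 //.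
have U1 : h^-1 * (cos (lam i * h) * crd x.1 i + sin (lam i * h) * crd x.2 i - crd x.1 i)
    @[h --> (0 : R)^'+] --> crd f.1 i.
  have := cvgD C1 (cvg_cst (crd f.1 i)) => U; rewrite add0r in U.
  apply: cvg_trans (U _ _); apply: near_eq_cvg; apply: nearW => h.
  transitivity (crd (d h).1 i + crd f.1 i) => //.
  by rewrite /d /= crdB crdZ crdB (flowP h x i).1 /= subrK.
have U2 : h^-1 * (cos (lam i * h) * crd x.2 i + sin (lam i * h) * - crd x.1 i - crd x.2 i)
    @[h --> (0 : R)^'+] --> crd f.2 i.
  have := cvgD C2 (cvg_cst (crd f.2 i)) => U; rewrite add0r in U.
  apply: cvg_trans (U _ _); apply: near_eq_cvg; apply: nearW => h.
  transitivity (crd (d h).2 i + crd f.2 i) => //.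
  by rewrite /d /= crdB crdZ crdB (flowP h x i).2 /= subrK; ring.
split; first exact: (norm_cvg_unique U1 D1).
by rewrite -mulrN; exact: (norm_cvg_unique U2 D2).
Qed.

End Coordinates.
End Modes.
Import Modes.

(** * The cubic equation in abstract form and its Galerkin approximations *)

Module Cubic.
Section Curves.
Context {R : realType}.
Implicit Types (f g df dg : R -> R).

Lemma curve_ext f df dg : curve f df -> (forall t, 0 < t -> df t = dg t) -> curve f dg.
by move=> [fc fd] h; split => // t t0; rewrite -h //; exact: fd. Qed.

Lemma curve_cst (c : R) : curve (fun=> c) (fun=> 0).
by split=> [x|s s0]; [exact: cst_continuous|exact: is_derive_cst]. Qed.

Lemma curveD f df g dg : curve f df -> curve g dg ->
  curve (fun t => f t + g t) (fun t => df t + dg t).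
move=> [fc fd] [gc gd]; split=> [x|s s0]; first by apply: cvgD; [exact: fc|exact: gc].
by have := fd s s0; have := gd s s0 => ? ?; apply: is_deriveD.
Qed.

Lemma curveM f df g dg : curve f df -> curve g dg ->
  curve (fun t => f t * g t) (fun t => df t * g t + f t * dg t).
move=> [fc fd] [gc gd]; split=> [x|s s0]; first by apply: cvgM; [exact: fc|exact: gc].
have := fd s s0; have := gd s s0 => ? ?; apply: is_derive_eq; rewrite /GRing.scale /=; ring.
Qed.

Lemma curve_sum I (s : seq I) (f df : I -> R -> R) : (forall i, curve (f i) (df i)) ->
  curve (fun t => \sum_(i <- s) f i t) (fun t => \sum_(i <- s) df i t).
move=> h; elim: s => [|i s IH].
  have -> : (fun t => \sum_(i <- [::]) f i t) = fun=> 0 by apply/funext => t; rewrite big_nil.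
  have -> : (fun t => \sum_(i <- [::]) df i t) = fun=> 0 by apply/funext => t; rewrite big_nil.
  exact: curve_cst.
have -> : (fun t => \sum_(j <- i :: s) f j t) = fun t => f i t + \sum_(j <- s) f j t.
  by apply/funext => t; rewrite big_cons.
have -> : (fun t => \sum_(j <- i :: s) df j t) = fun t => df i t + \sum_(j <- s) df j t.
  by apply/funext => t; rewrite big_cons.
exact: curveD.
Qed.

Lemma curve_const f df t : curve f df -> (forall s, 0 < s -> df s = 0) -> 0 <= t -> f t = f 0.
move=> hf h t0; apply/eqP; rewrite -subr_eq0 -normr_le0.
have := curve_abs_le hf (curve_cst 0) t0; rewrite subrr; apply => s s0 _.
by rewrite h // normr0.
Qed.

(** A curve in the span of finitely many vectors: forms and products can be differentiated along it
    without a topology on [E]. *)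
Definition vcurve {E : lmodType R} (U dU : R -> E) := exists (K : finType) (x : K -> E) (f df : K -> R -> R),
  [/\ forall k, curve (f k) (df k), forall t, U t = \sum_k f k t *: x k &
      forall t, dU t = \sum_k df k t *: x k].

Lemma vcurve_form {E : lmodType R} (b : E -> E -> R) (U dU W dW : R -> E) : bform b ->
  vcurve U dU -> vcurve W dW ->
  curve (fun t => b (U t) (W t)) (fun t => b (dU t) (W t) + b (U t) (dW t)).
move=> hb [K [x [f [df [cf Uf dUf]]]]] [L [y [g [dg [cg Wg dWg]]]]].
have bE (p : K -> R) (q : L -> R) : b (\sum_k p k *: x k) (\sum_j q j *: y j) =
    \sum_k \sum_j p k * q j * b (x k) (y j).
  rewrite b_suml //; apply: eq_bigr => k _; rewrite b_sumr //; apply: eq_bigr => j _.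
  by rewrite bZl // bZr // mulrA.
have -> : (fun t => b (U t) (W t)) = fun t => \sum_k \sum_j f k t * g j t * b (x k) (y j).
  by apply/funext => t; rewrite Uf Wg bE.
apply: (@curve_ext _ (fun t => \sum_k \sum_j ((df k t * g j t + f k t * dg j t) * b (x k) (y j) + (f k t * g j t) * 0))).
  apply: curve_sum => k; apply: curve_sum => j; apply: curveM; last exact: curve_cst.
  by apply: curveM.
move=> t _; rewrite Uf Wg dUf dWg !bE -big_split /=; apply: eq_bigr => k _.
rewrite -big_split /=; apply: eq_bigr => j _; ring.
Qed.

End Curves.

Section NLS.
Context {R : realType} {E : lmodType R}.
Implicit Types (u v w : E) (x : E * E).
Variables (l a : E -> E -> R) (e : nat -> E) (lam : nat -> R) (m : E -> E -> E -> E).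

(* [m] stands for the product of three functions. *)
Record nls_space : Prop := NlsSpace {
  ns_es : eigensystem l a e lam;
  ns_D : forall u u' v w, m (u + u') v w = m u v w + m u' v w;
  ns_Z : forall c u v w, m (c *: u) v w = c *: m u v w;
  ns_12 : forall u v w, m u v w = m v u w;
  ns_23 : forall u v w, m u v w = m u w v;
  ns_T : forall u v w z, l (m u v w) z = l (m u v z) w;
  ns_a : exists2 C, 0 < C & forall u v w, a (m u v w) (m u v w) <= C * (a u u * a v v * a w w);
  ns_l : exists2 C, 0 < C & forall u v w, l (m u v w) (m u v w) <= C * (a u u * a v v * l w w);
  ns_gn : exists2 C, 0 < C & forall u v, l (m v v u) u <= C * Num.sqrt (l v v * a v v) * l u u }.

Hypothesis H : nls_space.
Let HE := ns_es H.
Let hl := es_l HE. Let l0 := es_l0 HE. Let ha := es_a HE. Let a0 := es_a0 HE.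
Local Notation crd := (crd l e).
Local Notation synth := (synth e).
Local Notation proj := (proj l e).
Local Notation a2 := (a2 a).
Local Notation aa x := (a2 x x).
Local Notation l2 := (l2 l).
Local Notation ll x := (l2 x x).

Lemma m_D2 u v v' w : m u (v + v') w = m u v w + m u v' w.
by rewrite (ns_12 H) (ns_D H) !(ns_12 H _ u). Qed.
Lemma m_Z2 c u v w : m u (c *: v) w = c *: m u v w.
by rewrite (ns_12 H) (ns_Z H) (ns_12 H). Qed.
Lemma m_D3 u v w w' : m u v (w + w') = m u v w + m u v w'.
by rewrite (ns_23 H) m_D2 !(ns_23 H _ v). Qed.
Lemma m_Z3 c u v w : m u v (c *: w) = c *: m u v w.
by rewrite (ns_23 H) m_Z2 (ns_23 H). Qed.
Lemma m_N3 u v w : m u v (- w) = - m u v w.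
by rewrite -scaleN1r m_Z3 scaleN1r. Qed.

Lemma m_sum1 (K : finType) (x : K -> E) (c : K -> R) v w :
  m (\sum_k c k *: x k) v w = \sum_k c k *: m (x k) v w.
rewrite (big_morph (fun u => m u v w) (fun u u' => ns_D H u u' v w) (_ : m 0 v w = 0)).
  by apply: eq_bigr => k _; rewrite (ns_Z H).
by rewrite -(scale0r (0 : E)) (ns_Z H) !scale0r.
Qed.
Lemma m_sum2 (K : finType) (x : K -> E) (c : K -> R) u w :
  m u (\sum_k c k *: x k) w = \sum_k c k *: m u (x k) w.
by rewrite (ns_12 H) m_sum1; apply: eq_bigr => k _; rewrite (ns_12 H). Qed.
Lemma m_sum3 (K : finType) (x : K -> E) (c : K -> R) u v :
  m u v (\sum_k c k *: x k) = \sum_k c k *: m u v (x k).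
by rewrite (ns_23 H) m_sum2; apply: eq_bigr => k _; rewrite (ns_23 H). Qed.

Lemma vcurve_m (U dU V dV W dW : R -> E) : vcurve U dU -> vcurve V dV -> vcurve W dW ->
  vcurve (fun t => m (U t) (V t) (W t))
    (fun t => m (dU t) (V t) (W t) + m (U t) (dV t) (W t) + m (U t) (V t) (dW t)).
move=> [K [x [f [df [cf Uf dUf]]]]] [L [y [g [dg [cg Vg dVg]]]]] [M [z [h [dh [ch Wh dWh]]]]].
have mE (p : K -> R) (q : L -> R) (r : M -> R) :
    m (\sum_k p k *: x k) (\sum_j q j *: y j) (\sum_i r i *: z i) =
    \sum_(s : K * L * M) (p s.1.1 * q s.1.2 * r s.2) *: m (x s.1.1) (y s.1.2) (z s.2).
  rewrite m_sum1 -(pair_bigA _ (fun s i => (p s.1 * q s.2 * r i) *: m (x s.1) (y s.2) (z i))) /=.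
  rewrite -(pair_bigA _ (fun k j => \sum_i (p k * q j * r i) *: m (x k) (y j) (z i))) /=.
  apply: eq_bigr => k _; rewrite m_sum2 scaler_sumr; apply: eq_bigr => j _.
  rewrite m_sum3 !scaler_sumr; by apply: eq_bigr => i _; rewrite !scalerA.
exists (K * L * M)%type, (fun s => m (x s.1.1) (y s.1.2) (z s.2)),
  (fun s t => f s.1.1 t * g s.1.2 t * h s.2 t),
  (fun s t => (df s.1.1 t * g s.1.2 t + f s.1.1 t * dg s.1.2 t) * h s.2 t + f s.1.1 t * g s.1.2 t * dh s.2 t).
split=> [s|t|t]; first by apply: curveM => //; apply: curveM.
  by rewrite Uf Vg Wh mE.
rewrite Uf Vg Wh dUf dVg dWh !mE -!big_split /=; apply: eq_bigr => s _.
by rewrite -!scalerDl; congr (_ *: _); ring.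
Qed.

Lemma T_14 u v w z : l (m u v w) z = l (m z v w) u.
by rewrite (ns_12 H) (ns_23 H) (ns_T H) (ns_23 H) (ns_12 H). Qed.

Definition cubic x : E * E := (m x.1 x.1 x.1 + m x.2 x.2 x.1, m x.1 x.1 x.2 + m x.2 x.2 x.2).
Definition quartic x := l2 (cubic x) x.
(** The Hamiltonian of the equation; potential and frequency are contained in [a]. *)
Definition energy x := 2^-1 * aa x - 4^-1 * quartic x.

(** Orthogonality of [J |x|^2 x] and [x], which is behind the conservation of charge. *)
Lemma l_cubic_orth x : l x.1 (cubic x).2 = l x.2 (cubic x).1.
rewrite /cubic /= !(bDr hl) !(bC hl x.1) !(bC hl x.2) !(ns_T H _ _ x.1 x.2).
by congr (_ + _); rewrite (ns_T H).
Qed.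

Section TriBound.
Variable b : E -> E -> R.
Hypotheses (hb : bform b) (b0 : nneg b) (C : R) (C0 : 0 < C).
Hypothesis HC : forall u v w, b (m u v w) (m u v w) <= C * (a u u * a v v * b w w).

(** Stated for a general [b]: the case [b = l] serves the convergence of the Galerkin scheme, the
    case [b = a] the continuity of the Duhamel integrand. *)
Lemma m_diff u v w u' v' w' A :
  a u u <= A -> a v v <= A -> a w w <= A -> a u' u' <= A -> a v' v' <= A -> a w' w' <= A ->
  b (m u v w - m u' v' w') (m u v w - m u' v' w') <=
   3 * C * A ^+ 2 * (b (u - u') (u - u') + b (v - v') (v - v') + b (w - w') (w - w')).
move=> uA vA wA uA' vA' wA'.
have A0 : 0 <= A by apply: le_trans uA.
have key p q r : a p p <= A -> a q q <= A -> b (m p q r) (m p q r) <= C * A ^+ 2 * b r r.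
  move=> pA qA; apply: le_trans (HC _ _ _) _; rewrite -[leRHS]mulrA (ler_pM2l C0).
  by rewrite ler_wpM2r // expr2 ler_pM.
have -> : m u v w - m u' v' w' = m u v (w - w') + m u w' (v - v') + m v' w' (u - u').
  rewrite !m_D3 !m_N3 (ns_23 H u w' v) (ns_23 H u w' v') (ns_12 H v' w' u) (ns_23 H w' v' u).
  rewrite (ns_12 H w' u v') (ns_23 H u w' v').
  rewrite (ns_12 H v' w' u') (ns_23 H w' v' u') (ns_12 H w' u' v') (ns_23 H u' w' v').
  by rewrite [X in _ = X + _]addrA subrK addrA subrK.
set p := m u v _; set q := m u w' _; set r := m v' w' _.
have h1 : b p p <= _ := key _ _ (w - w') uA vA.
have h2 : b q q <= _ := key _ _ (v - v') uA wA'.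
have h3 : b r r <= _ := key _ _ (u - u') vA' wA'.
have h4 : b (p + q + r) (p + q + r) <= 3 * (b p p + b q q + b r r).
  have := b0 (p - q); have := b0 (p - r); have := b0 (q - r).
  rewrite !(bsqB hb) !(bsqD hb) (bDl hb); lra.
apply: le_trans h4 _; move: h1 h2 h3; set X := C * A ^+ 2.
have -> : 3 * C * A ^+ 2 = 3 * X by rewrite /X mulrA.
nra.
Qed.

Lemma cubic_diff x (y : E * E) A : aa x <= A -> aa y <= A ->
  b (cubic x - cubic y).1 (cubic x - cubic y).1 + b (cubic x - cubic y).2 (cubic x - cubic y).2
   <= 36 * C * A ^+ 2 * (b (x - y).1 (x - y).1 + b (x - y).2 (x - y).2).
rewrite /a2 => xA yA.
have [x1 x2 y1 y2] : [/\ a x.1 x.1 <= A, a x.2 x.2 <= A, a y.1 y.1 <= A & a y.2 y.2 <= A].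
  by have := a0 x.1; have := a0 x.2; have := a0 y.1; have := a0 y.2; split; lra.
have D (p q p' q' : E) : b (p + q - (p' + q')) (p + q - (p' + q')) <=
    2 * b (p - p') (p - p') + 2 * b (q - q') (q - q').
  by rewrite opprD addrACA; apply: bsqD_le.
have h1 := D (m x.1 x.1 x.1) (m x.2 x.2 x.1) (m y.1 y.1 y.1) (m y.2 y.2 y.1).
have h2 := D (m x.1 x.1 x.2) (m x.2 x.2 x.2) (m y.1 y.1 y.2) (m y.2 y.2 y.2).
have g1 := m_diff x1 x1 x1 y1 y1 y1; have g2 := m_diff x2 x2 x1 y2 y2 y1.
have g3 := m_diff x1 x1 x2 y1 y1 y2; have g4 := m_diff x2 x2 x2 y2 y2 y2.
rewrite /cubic /=; set X := C * A ^+ 2 in g1 g2 g3 g4 *.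
have EX : 3 * C * A ^+ 2 = 3 * X by rewrite /X mulrA.
have -> : 36 * C * A ^+ 2 = 36 * X by rewrite /X mulrA.
rewrite EX in g1 g2 g3 g4.
have X0 : 0 <= X by rewrite mulr_ge0 ?sqr_ge0 // ltW.
have := b0 (x.1 - y.1); have := b0 (x.2 - y.2); nra.
Qed.
End TriBound.

Section Galerkin.
Variable n : nat.
Implicit Types (c d : nat -> R) (y : nat * bool -> R).

Definition fld x i : R * R :=
  (lam i * crd x.2 i - crd (cubic x).2 i, - (lam i * crd x.1 i) + crd (cubic x).1 i).

Definition gal y : E * E := (synth (fun i => y (i, false)) n, synth (fun i => y (i, true)) n).

(** An unknown is a mode together with a component ([false] for the first, [true] for the second);
    the modes from [n] on do not move. *)
Definition gfld y (s : nat * bool) : R :=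
  if (s.1 < n)%N then (if s.2 then (fld (gal y) s.1).2 else (fld (gal y) s.1).1) else 0.

Lemma gal_coord y i : (i < n)%N -> crd (gal y).1 i = y (i, false) /\ crd (gal y).2 i = y (i, true).
by move=> hi; rewrite !(crd_synth HE) hi. Qed.

Lemma eq_gal y z : (forall i b, (i < n)%N -> y (i, b) = z (i, b)) -> gal y = gal z.
by move=> h; rewrite /gal /synth; congr pair; apply: eq_bigr => i _; rewrite h.
Qed.

Lemma gfld_orth y : \sum_(i < n) (y (nat_of_ord i, false) * gfld y (nat_of_ord i, false) + y (nat_of_ord i, true) * gfld y (nat_of_ord i, true)) = 0.
transitivity (l (gal y).2 (cubic (gal y)).1 - l (gal y).1 (cubic (gal y)).2); last first.
  by rewrite l_cubic_orth subrr.
rewrite /gal /= !(l_synth HE) -sumrB; apply: eq_bigr => i _.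
rewrite /gfld /= ltn_ord /fld; have [-> ->] := gal_coord y (ltn_ord i).
rewrite /gal /=; ring.
Qed.

Lemma lipb_m M (p q r : bool) i : 0 <= M ->
  lipb (fun y => crd (m (synth (fun i => clip M (y (i, p))) n)
    (synth (fun i => clip M (y (i, q))) n) (synth (fun i => clip M (y (i, r))) n)) i).
move=> M0; pose s0 := (0%N, true).
have : lipb (fun y => \sum_(j < n) clip M (y (nat_of_ord j, p)) * \sum_(k < n) clip M (y (nat_of_ord k, q)) *
   \sum_(h < n) clip M (y (nat_of_ord h, r)) * crd (m (e j) (e k) (e h)) i).
  apply: lipb_sum => // j; apply: lipbM => //; first exact: lipb_clip.
  apply: lipb_sum => // k; apply: lipbM => //; first exact: lipb_clip.
  apply: lipb_sum => // h; apply: lipbM => //; first exact: lipb_clip.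
  exact: lipb_cst.
congr lipb; apply/funext => y; rewrite /synth m_sum1 /Modes.crd b_sumr //.
apply: eq_bigr => j _; rewrite bZr //; congr (_ * _); rewrite m_sum2 b_sumr //.
apply: eq_bigr => k _; rewrite bZr //; congr (_ * _); rewrite m_sum3 b_sumr //.
by apply: eq_bigr => h _; rewrite bZr.
Qed.

Local Notation cs M b y := (synth (fun i => clip (2 * M) (y (i, b))) n).
(** Clipping makes the polynomial field bounded and Lipschitz. The plateau factor is one scalar for
    the whole field, so the truncated field is still orthogonal to [y] and conserves charge. *)
Definition cutoff_fld M y s : R :=
  (\prod_(i < n) (plateau M (y (nat_of_ord i, false)) * plateau M (y (nat_of_ord i, true)))) *
  gfld (fun s => clip (2 * M) (y s)) s.

Lemma lipb_cutoff_fld M s : 0 < M -> lipb (fun y => cutoff_fld M y s).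
move=> M0; have M2 : 0 <= 2 * M by rewrite mulr_ge0 // ltW.
pose s0 := (0%N, true); case: s => i b.
apply: lipbM => //.
  by apply: lipb_prod => // j; apply: lipbM => //; exact: lipb_plateau.
rewrite /gfld /=; have [hi|hi] := ltnP i n; last exact: lipb_cst.
have T p q r := lipb_m p q r i M2.
case: b; rewrite /fld.
  have : lipb (fun y => (- lam i) * clip (2 * M) (y (i, false)) +
     (crd (m (cs M false y) (cs M false y) (cs M false y)) i +
      crd (m (cs M true y) (cs M true y) (cs M false y)) i)).
    apply: lipbD => //; last exact: lipbD.
    by apply: lipbM => //; [exact: lipb_cst|exact: lipb_clip].
  congr lipb; apply/funext => y /=; rewrite (crd_synth HE) hi mulNr; congr (_ + _).
  by rewrite (crdD HE).
have : lipb (fun y => lam i * clip (2 * M) (y (i, true)) + (-1) *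
     (crd (m (cs M false y) (cs M false y) (cs M true y)) i +
      crd (m (cs M true y) (cs M true y) (cs M true y)) i)).
  apply: lipbD => //; first by apply: lipbM => //; [exact: lipb_cst|exact: lipb_clip].
  by apply: lipbM => //; [exact: lipb_cst|exact: lipbD].
congr lipb; apply/funext => y /=; rewrite (crd_synth HE) hi mulN1r; congr (_ - _).
by rewrite (crdD HE).
Qed.

Lemma cutoff_fld_eq M y s : 0 < M -> (forall i b, (i < n)%N -> `|y (i, b)| <= M) ->
  cutoff_fld M y s = gfld y s.
move=> M0 h; rewrite /cutoff_fld big1 ?mul1r => [|i _]; last by rewrite !plateau1 ?mulr1 // h.
rewrite /gfld; case: ifP => // _; suff -> : gal (fun s0 => clip (2 * M) (y s0)) = gal y by [].
by apply: eq_gal => i b hi; apply: clip_id; apply: le_trans (h i b hi) _; lra.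
Qed.

(** Where the scalar factor is nonzero all active coordinates are below [2 M] in modulus, so that
    clipping does nothing and [gfld_orth] applies. *)
Lemma cutoff_fld_orth M y : 0 < M ->
  \sum_(i < n) (y (nat_of_ord i, false) * cutoff_fld M y (nat_of_ord i, false) + y (nat_of_ord i, true) * cutoff_fld M y (nat_of_ord i, true)) = 0.
move=> M0; rewrite /cutoff_fld; set P := \prod_(i < n) _.
have [P0|Pn0] := eqVneq P 0; first by rewrite big1 // => i _; rewrite P0 !mul0r !mulr0 addr0.
have h i b : (i < n)%N -> clip (2 * M) (y (i, b)) = y (i, b).
  move=> hi; apply: clip_id; rewrite leNgt; apply/negP => lt; move: Pn0.
  rewrite /P (bigD1 (Ordinal hi)) //=.
  by case: b lt => /ltW lt; rewrite (plateau0 M0 lt) ?mul0r ?mulr0 ?mul0r eqxx.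
transitivity (P * \sum_(i < n) (y (nat_of_ord i, false) * gfld y (nat_of_ord i, false) + y (nat_of_ord i, true) * gfld y (nat_of_ord i, true))); last first.
  by rewrite gfld_orth mulr0.
have E0 s : gfld (fun s => clip (2 * M) (y s)) s = gfld y s.
  rewrite /gfld; case: ifP => // _; suff -> : gal (fun s0 => clip (2 * M) (y s0)) = gal y by [].
  by apply: eq_gal => i b hi; apply: h.
by rewrite mulr_sumr; apply: eq_bigr => i _; rewrite !E0; ring.
Qed.

(** The truncated system has a global solution that conserves charge; the charge bounds every active
    coordinate by [M], where the truncation is inactive, so the solution solves the original
    system. *)
Lemma galerkin (x0 : E * E) : exists x : R -> E * E,
  [/\ forall t, t <= 0 -> x t = (proj n x0.1, proj n x0.2),
      forall i, (n <= i)%N -> forall t, crd (x t).1 i = 0 /\ crd (x t).2 i = 0,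
      forall i, (i < n)%N -> curve (fun t => crd (x t).1 i) (fun t => (fld (x t) i).1) /\
         curve (fun t => crd (x t).2 i) (fun t => (fld (x t) i).2) &
      [/\ forall i, (i < n)%N -> continuous (fun t => (fld (x t) i).1) /\ continuous (fun t => (fld (x t) i).2),
      forall t, 0 <= t -> ll (x t) = ll (x 0) &
      forall t, 0 <= t -> energy (x t) = energy (x 0)]].
pose y0 (s : nat * bool) := crd (if s.2 then x0.2 else x0.1) s.1.
pose S y := \sum_(i < n) (y (nat_of_ord i, false) ^+ 2 + y (nat_of_ord i, true) ^+ 2).
have S0 y : 0 <= S y by apply: sumr_ge0 => i _; rewrite addr_ge0 ?sqr_ge0.
have SM y i b : (i < n)%N -> y (i, b) ^+ 2 <= S y.
  move=> hi; rewrite /S (bigD1 (Ordinal hi)) //=; apply: le_trans (_ : y (i, false) ^+ 2 + y (i, true) ^+ 2 <= _).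
    by case: b; rewrite ?lerDl ?lerDr sqr_ge0.
  by rewrite lerDl; apply: sumr_ge0 => j _; rewrite addr_ge0 ?sqr_ge0.
(* A squared coordinate is at most the charge [S y0], and [S y0 <= M ^+ 2]. *)
pose M := S y0 + 1; have M0 : 0 < M by rewrite ltr_wpDl.
have HK s : exists K : R, 0 <= K /\ ((forall y z (d : R), (forall j, `|y j - z j| <= d) -> `|cutoff_fld M y s - cutoff_fld M z s| <= K * d) /\
  (forall y, `|cutoff_fld M y s| <= K)).
  by have [K K0 HK] := lipb_cutoff_fld s M0; exists K.
have [Kf HKf] := choice HK.
pose K := \sum_(i < n) (Kf (nat_of_ord i, false) + Kf (nat_of_ord i, true)).
have Kf0 s : 0 <= Kf s by have [] := HKf s.
have KK i b : (i < n)%N -> Kf (i, b) <= K.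
  move=> hi; rewrite /K (bigD1 (Ordinal hi)) //=; apply: le_trans (_ : Kf (i, false) + Kf (i, true) <= _).
    by case: b; rewrite ?lerDl ?lerDr.
  by rewrite lerDl; apply: sumr_ge0 => j _; rewrite addr_ge0.
have K0 : 0 <= K by apply: sumr_ge0 => i _; rewrite addr_ge0.
have F0 y i b : (n <= i)%N -> cutoff_fld M y (i, b) = 0.
  by move=> hi; rewrite /cutoff_fld /gfld /= ltnNge hi mulr0.
have [||y [y00 yc yd]] := @global_ode R (nat * bool)%type (cutoff_fld M) K y0 K0.
- move=> y z d hd [i b]; have d0 := lipb_ge0 (0%N, true) hd.
  have [hi|hi] := ltnP i n; last by rewrite !F0 // subrr normr0 mulr_ge0.
  have [_ [h _]] := HKf (i, b); apply: le_trans (h _ _ _ hd) _.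
  by rewrite ler_wpM2r // KK.
- move=> y [i b]; have [hi|hi] := ltnP i n; last by rewrite !F0 // normr0.
  have [_ [_ h]] := HKf (i, b); apply: le_trans (h _) _; exact: KK.
have Sc t : 0 <= t -> S (y t) = S (y 0).
  pose dS t := \sum_(i < n) 2 * (y t (nat_of_ord i, false) * cutoff_fld M (y t) (nat_of_ord i, false) + y t (nat_of_ord i, true) * cutoff_fld M (y t) (nat_of_ord i, true)).
  move=> t0; apply: (@curve_const _ (fun t => S (y t)) dS) => // [|s _]; last first.
    by rewrite /dS -mulr_sumr cutoff_fld_orth // mulr0.
  apply: (@curve_sum _ 'I_n _ (fun i t => y t (nat_of_ord i, false) ^+ 2 + y t (nat_of_ord i, true) ^+ 2)) => i.
  have c1 := yc (nat_of_ord i, false); have c2 := yc (nat_of_ord i, true).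
  by apply: curve_ext (curveD (curveM c1 c1) (curveM c2 c2)) _ => s _ /=; ring.
have yM t i b : 0 <= t -> (i < n)%N -> `|y t (i, b)| <= M.
  move=> t0 hi; have := SM (y t) i b hi; rewrite Sc // (y00 0) // => h.
  apply: sqr_le; first exact: ltW.
  by rewrite normK2 // (le_trans h) // /M; have := S0 y0; nra.
have Fy t s : 0 <= t -> cutoff_fld M (y t) s = gfld (y t) s.
  by move=> t0; apply: cutoff_fld_eq => // i b hi; apply: yM.
pose p (t : R) := Num.max t 0.
have p0 t : 0 <= p t by rewrite /p le_max lexx orbT.
have yp t : y t = y (p t) by rewrite /p; case: leP => // t0; rewrite !y00.
have Fy' t s : cutoff_fld M (y t) s = gfld (y t) s by rewrite yp Fy.
pose x t := gal (y t).
have xc i : (i < n)%N -> forall t, crd (x t).1 i = y t (i, false) /\ crd (x t).2 i = y t (i, true).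
  by move=> hi t; exact: gal_coord.
have xF i t : (i < n)%N -> (fld (x t) i).1 = cutoff_fld M (y t) (i, false) /\ (fld (x t) i).2 = cutoff_fld M (y t) (i, true).
  by move=> hi; rewrite !Fy' /gfld /= hi.
have cur i : (i < n)%N -> curve (fun t => crd (x t).1 i) (fun t => (fld (x t) i).1) /\
         curve (fun t => crd (x t).2 i) (fun t => (fld (x t) i).2).
  move=> hi; split.
    have -> : (fun t => crd (x t).1 i) = fun t => y t (i, false) by apply/funext => t; rewrite (xc i hi t).1.
    by apply: curve_ext (yc (i, false)) _ => t _; rewrite (xF i t hi).1.
  have -> : (fun t => crd (x t).2 i) = fun t => y t (i, true) by apply/funext => t; rewrite (xc i hi t).2.
  by apply: curve_ext (yc (i, true)) _ => t _; rewrite (xF i t hi).2.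
exists x; split => //.
- by move=> t t0; rewrite /x y00.
- by move=> i hi t; rewrite !(crd_synth HE) ltnNge hi.
split.
- move=> i hi; split.
    have -> : (fun t => (fld (x t) i).1) = fun t => cutoff_fld M (y t) (i, false) by apply/funext => t; rewrite (xF i t hi).1.
    exact: yd.
  have -> : (fun t => (fld (x t) i).2) = fun t => cutoff_fld M (y t) (i, true) by apply/funext => t; rewrite (xF i t hi).2.
  exact: yd.
- have lx t : ll (x t) = S (y t) by rewrite /Modes.l2 !(l_synthsq HE) -big_split.
  by move=> t t0; rewrite !lx Sc.
move=> t t0.
pose dx t := (synth (fun i => (fld (x t) i).1) n, synth (fun i => (fld (x t) i).2) n).
have v1 : vcurve (fun t => (x t).1) (fun t => (dx t).1).
  exists 'I_n, (fun i : 'I_n => e i), (fun (i : 'I_n) t => crd (x t).1 i), (fun (i : 'I_n) t => (fld (x t) i).1).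
  split => // [k|s]; first by have [] := cur k (ltn_ord k).
  by rewrite /x /gal /synth /=; apply: eq_bigr => i _; have [<- _] := xc i (ltn_ord i) s.
have v2 : vcurve (fun t => (x t).2) (fun t => (dx t).2).
  exists 'I_n, (fun i : 'I_n => e i), (fun (i : 'I_n) t => crd (x t).2 i), (fun (i : 'I_n) t => (fld (x t) i).2).
  split => // [k|s]; first by have [] := cur k (ltn_ord k).
  by rewrite /x /gal /synth /=; apply: eq_bigr => i _; have [_ <-] := xc i (ltn_ord i) s.
have c1 := vcurve_form ha v1 v1; have c2 := vcurve_form ha v2 v2.
have q1 := vcurve_form hl (vcurve_m v1 v1 v1) v1; have q2 := vcurve_form hl (vcurve_m v2 v2 v2) v2.
have q3 := vcurve_form hl (vcurve_m v2 v2 v1) v1; have q4 := vcurve_form hl (vcurve_m v1 v1 v2) v2.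
have cE := curveD (curveM (curve_cst (2^-1 : R)) (curveD c1 c2))
   (curveM (curve_cst (- 4^-1 : R)) (curveD (curveD q1 q3) (curveD q4 q2))).
have EE s : energy (x s) = 2^-1 * (a (x s).1 (x s).1 + a (x s).2 (x s).2) +
   - 4^-1 * ((l (m (x s).1 (x s).1 (x s).1) (x s).1 + l (m (x s).2 (x s).2 (x s).1) (x s).1)
     + (l (m (x s).1 (x s).1 (x s).2) (x s).2 + l (m (x s).2 (x s).2 (x s).2) (x s).2)).
  by rewrite /energy /quartic /Modes.a2 /Modes.l2 /cubic /= !(bDl hl) mulNr.
rewrite !EE; apply: (curve_const cE) => // s s0 /=.
set X := x s; set D := dx s.
rewrite !mul0r !add0r !(bDl hl).
have r1 : l (m D.1 X.1 X.1) X.1 = l (m X.1 X.1 X.1) D.1 by rewrite T_14.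
have r2 : l (m X.1 D.1 X.1) X.1 = l (m X.1 X.1 X.1) D.1 by rewrite (ns_12 H) T_14.
have r3 : l (m X.1 X.1 D.1) X.1 = l (m X.1 X.1 X.1) D.1 by rewrite (ns_T H).
have r4 : l (m D.2 X.2 X.2) X.2 = l (m X.2 X.2 X.2) D.2 by rewrite T_14.
have r5 : l (m X.2 D.2 X.2) X.2 = l (m X.2 X.2 X.2) D.2 by rewrite (ns_12 H) T_14.
have r6 : l (m X.2 X.2 D.2) X.2 = l (m X.2 X.2 X.2) D.2 by rewrite (ns_T H).
have r7 : l (m D.2 X.2 X.1) X.1 = l (m X.1 X.1 X.2) D.2 by rewrite T_14 (ns_23 H).
have r8 : l (m X.2 D.2 X.1) X.1 = l (m X.1 X.1 X.2) D.2 by rewrite (ns_12 H) r7.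
have r9 : l (m X.2 X.2 D.1) X.1 = l (m X.2 X.2 X.1) D.1 by rewrite (ns_T H).
have r10 : l (m D.1 X.1 X.2) X.2 = l (m X.2 X.2 X.1) D.1 by rewrite T_14 (ns_23 H).
have r11 : l (m X.1 D.1 X.2) X.2 = l (m X.2 X.2 X.1) D.1 by rewrite (ns_12 H) r10.
have r12 : l (m X.1 X.1 D.2) X.2 = l (m X.1 X.1 X.2) D.2 by rewrite (ns_T H).
rewrite r1 r2 r3 r4 r5 r6 r7 r8 r9 r10 r11 r12 (bC ha X.1) (bC ha X.2).
(* The energy gradient has modes [lam i * x_i - cubic_i], and [D] is [J] applied to it in each
   active mode, hence orthogonal to it. *)
have : a D.1 X.1 + a D.2 X.2 = l D.1 (cubic X).1 + l D.2 (cubic X).2.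
  rewrite /D /dx /= !(a_synth HE) !(l_synth HE) -!big_split /=; apply: eq_bigr => i _.
  by rewrite /fld /=; ring.
rewrite /cubic /= !(bDr hl) !(bC hl D.1) !(bC hl D.2); lra.
Qed.
End Galerkin.
End NLS.
End Cubic.
Import Cubic.

(** * Passage to the limit in the Galerkin scheme *)

Lemma cvg_finsum {R : realType} (T : Type) (F : set_system T) (f : nat -> T -> R) (g : nat -> R) N :
  Filter F -> (forall i, f i @ F --> g i) -> \sum_(i < N) f i x @[x --> F] --> \sum_(i < N) g i.
move=> FF h; elim: N => [|N IH].
  by rewrite big_ord0; under eq_fun do rewrite big_ord0; exact: cvg_cst.
rewrite big_ord_recr /=; under eq_fun do rewrite big_ord_recr /=.
by apply: cvgD => //; exact: h.
Qed.

Lemma cvgn_le {R : realType} (u : nat -> R) (c B : R) N : u @ \oo --> c ->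
  (forall n, (N <= n)%N -> u n <= B) -> c <= B.
move=> /cvgrPdist_lt cu h; apply/ler_addgt0Pr => eps eps0.
have [M _ HM] := cu eps eps0; have := HM (maxn N M) (leq_maxr _ _).
have := h (maxn N M) (leq_maxl _ _); rewrite /= ltr_norml => h1 /andP [h2 h3]; lra.
Qed.

Lemma curveB {R : realType} (f df g dg : R -> R) : curve f df -> curve g dg ->
  curve (fun t => f t - g t) (fun t => df t - dg t).
move=> [fc fd] [gc gd]; split=> [x|s s0]; first by apply: cvgB; [exact: fc|exact: gc].
by have := fd s s0; have := gd s s0 => ? ?; apply: is_deriveB.
Qed.

Section NLSFlow.
Context {R : realType} {E : lmodType R}.
Implicit Types (u v w : E) (x y : E * E).
Variables (l a : E -> E -> R) (e : nat -> E) (lam : nat -> R) (m : E -> E -> E -> E).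
Hypothesis H : nls_space l a e lam m.
Let HE := ns_es H.
Let hl := es_l HE. Let l0 := es_l0 HE. Let ha := es_a HE. Let a0 := es_a0 HE.
Local Notation crd := (crd l e).
Local Notation synth := (synth e).
Local Notation proj := (proj l e).
Local Notation a2 := (a2 a).
Local Notation aa x := (a2 x x).
Local Notation l2 := (l2 l).
Local Notation ll x := (l2 x x).
Local Notation sq2 := (sq2 l e).
Local Notation cubic := (cubic m).
Local Notation quartic := (quartic l m).
Local Notation energy := (energy l a m).
Local Notation fld := (fld l e lam m).
Let ha2 := ha2 HE. Let hl2 := hl2 HE. Let a20 := a20 HE. Let l20 := l20 HE.

Lemma l2_partial x n : \sum_(i < n) sq2 x i <= ll x.
rewrite /Modes.l2 (l_split HE x.1 n) (l_split HE x.2 n) /Modes.sq2 big_split /=.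
have := l0 (x.1 - proj n x.1); have := l0 (x.2 - proj n x.2); lra.
Qed.

Lemma l2_le x B : (forall n, \sum_(i < n) sq2 x i <= B) -> ll x <= B.
move=> h; have [M M0 HM] := es_la HE; apply/ler_addgt0Pr => eps eps0.
have [N HN] := a2_tail HE x (divr_gt0 eps0 M0); have := h N; have := HN N (leqnn _).
rewrite ltr_pdivlMr // /Modes.l2 (l_split HE x.1 N) (l_split HE x.2 N) /Modes.sq2 big_split /= /Modes.a2 /=.
have := HM (x.1 - proj N x.1); have := HM (x.2 - proj N x.2); lra.
Qed.

Lemma l2_coords x n : (forall i, (n <= i)%N -> crd x.1 i = 0 /\ crd x.2 i = 0) ->
  ll x = \sum_(i < n) sq2 x i.
move=> h; apply: le_anti; rewrite l2_partial andbT; apply: l2_le => k.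
rewrite -!(big_mkord xpredT (fun i => sq2 x i)).
have [kn|/ltnW nk] := leqP k n.
  rewrite [leRHS](big_cat_nat (n := k)) //= lerDl; apply: sumr_ge0 => i _; exact: sq20.
rewrite (big_cat_nat (n := n)) //= gerDl big_nat big1 // => i /andP [hi _].
by rewrite /Modes.sq2; have [-> ->] := h i hi; rewrite !expr0n addr0.
Qed.

(** The gain [1 / lam n] on modes beyond [n] is the convergence rate of the scheme. *)
Lemma tail_modes x n k : \sum_(n <= i < k) sq2 x i <= aa x / lam n.
rewrite ler_pdivlMr ?(es_pos HE) // mulrC.
have h : \sum_(n <= i < k) sq2 x i <= l (x.1 - proj n x.1) (x.1 - proj n x.1) + l (x.2 - proj n x.2) (x.2 - proj n x.2).
  have := l2_partial (x - (proj n x.1, proj n x.2)) k; apply: le_trans.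
  rewrite -(big_mkord xpredT (fun i => sq2 (x - (proj n x.1, proj n x.2)) i)).
  have [nk|kn] := leqP n k; last first.
    by rewrite [leLHS]big_geq ?(ltnW kn) //; apply: sumr_ge0 => i _; exact: sq20.
  rewrite [leRHS](big_cat_nat (n := n)) //= -[leLHS]add0r lerD //.
    by apply: sumr_ge0 => i _; exact: sq20.
  rewrite big_nat [leRHS]big_nat; apply: ler_sum => i /andP [hi _].
  by rewrite /Modes.sq2 /= !(crdB HE) !(crd_synth HE) ltnNge hi /= !subr0.
apply: le_trans (_ : lam n * _ <= _).
  by rewrite (ler_pM2l (es_pos HE n)); exact: h.
by rewrite mulrDr /Modes.a2 lerD // (l_tail HE).
Qed.

(** Gagliardo-Nirenberg: the quartic term grows only linearly in the square root of [aa x]. *)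
Lemma quartic_bound : exists2 C, 0 < C & forall x,
  quartic x <= C * ll x * Num.sqrt (ll x * aa x).
have [C C0 HC] := ns_gn H; exists (2 * C); first by rewrite mulr_gt0.
move=> x; pose s := Num.sqrt (ll x * aa x).
have K u v : l v v <= ll x -> a v v <= aa x -> l (m v v u) u <= C * s * l u u.
  move=> h1 h2; apply: le_trans (HC _ _) _; rewrite ler_wpM2r // ler_pM2l //.
  by rewrite ler_sqrt ?mulr_ge0 // ler_pM.
have [h1 h2] : l x.1 x.1 <= ll x /\ l x.2 x.2 <= ll x by rewrite /Modes.l2 lerDl lerDr.
have [g1 g2] : a x.1 x.1 <= aa x /\ a x.2 x.2 <= aa x by rewrite /Modes.a2 lerDl lerDr.
have := K x.1 x.1 h1 g1; have := K x.1 x.2 h2 g2; have := K x.2 x.1 h1 g1; have := K x.2 x.2 h2 g2.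
rewrite -/s => e1 e2 e3 e4.
have -> : quartic x = l (m x.1 x.1 x.1) x.1 + l (m x.2 x.2 x.1) x.1 + (l (m x.1 x.1 x.2) x.2 + l (m x.2 x.2 x.2) x.2).
  by rewrite /Cubic.quartic /Modes.l2 /= !(bDl hl).
have -> : 2 * C * ll x * s = C * s * l x.1 x.1 + C * s * l x.1 x.1 + (C * s * l x.2 x.2 + C * s * l x.2 x.2).
  by rewrite /Modes.l2; ring.
lra.
Qed.

Definition Cl := sval (cid2 (ns_l H)).
Lemma Cl0 : 0 < Cl. by rewrite /Cl; case: cid2. Qed.
Lemma HCl u v w : l (m u v w) (m u v w) <= Cl * (a u u * a v v * l w w).
by rewrite /Cl; case: cid2 => ? ? h; exact: h. Qed.
Definition Ca := sval (cid2 (ns_a H)).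
Lemma Ca0 : 0 < Ca. by rewrite /Ca; case: cid2. Qed.
Lemma HCa u v w : a (m u v w) (m u v w) <= Ca * (a u u * a v v * a w w).
by rewrite /Ca; case: cid2 => ? ? h; exact: h. Qed.

Lemma cubic_l x y A : aa x <= A -> aa y <= A ->
  ll (cubic x - cubic y) <= 36 * Cl * A ^+ 2 * ll (x - y).
by move=> hx hy; exact: (cubic_diff H hl l0 Cl0 HCl hx hy). Qed.
Lemma cubic_a x y A : aa x <= A -> aa y <= A ->
  aa (cubic x - cubic y) <= 36 * Ca * A ^+ 2 * aa (x - y).
by move=> hx hy; exact: (cubic_diff H ha a0 Ca0 HCa hx hy). Qed.

Lemma cubic0 : cubic 0 = 0.
rewrite /Cubic.cubic /=; have z v w : m 0 v w = 0 by rewrite -(scale0r (0 : E)) (ns_Z H) !scale0r.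
by rewrite !z !addr0.
Qed.

Lemma cubic_bound_a x A : aa x <= A -> aa (cubic x) <= 36 * Ca * A ^+ 3.
move=> hx; have A0 : 0 <= A by apply: le_trans hx.
have := @cubic_a x 0 A hx; rewrite cubic0 !subr0 (b0l ha2) => /(_ A0) h.
by apply: le_trans h _; rewrite [A ^+ 3]exprSr [leRHS]mulrA ler_wpM2l // !mulr_ge0 ?sqr_ge0 // ltW // Ca0.
Qed.
Lemma cubic_bound_l x A : aa x <= A -> ll (cubic x) <= 36 * Cl * A ^+ 2 * ll x.
move=> hx; have A0 : 0 <= A by apply: le_trans hx.
by have := @cubic_l x 0 A hx; rewrite cubic0 !subr0 (b0l ha2) => /(_ A0).
Qed.

Lemma l2_cts x y : (ll x - ll y) ^+ 2 <= ll (x - y) * (2 * ll x + 2 * ll y).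
have -> : ll x - ll y = l2 (x - y) (x + y).
  by rewrite (bBl hl2) !(bDr hl2) (bC hl2 y x); ring.
apply: le_trans (form_CS hl2 l20 _ _) _; rewrite ler_wpM2l //; exact: bsqD_le.
Qed.

Lemma quartic_cts x y A : aa x <= A -> aa y <= A ->
  (quartic x - quartic y) ^+ 2 <= 72 * Cl * A ^+ 2 * ll (x - y) * (ll x + ll y).
move=> hx hy; have -> : quartic x - quartic y = l2 (cubic x - cubic y) x + l2 (cubic y) (x - y).
  by rewrite /Cubic.quartic (bBl hl2) (bBr hl2); ring.
have h1 := form_CS hl2 l20 (cubic x - cubic y) x; have h2 := form_CS hl2 l20 (cubic y) (x - y).
have g1 := cubic_l hx hy; have g2 := cubic_bound_l hy.
set p := l2 _ x in h1 *; set q := l2 _ (x - y) in h2 *.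
have -> : 72 * Cl * A ^+ 2 = 2 * (36 * Cl * A ^+ 2) by ring.
set X := 36 * Cl * A ^+ 2 in g1 g2 *.
have k1 : p ^+ 2 <= X * ll (x - y) * ll x by apply: le_trans h1 _; rewrite ler_wpM2r.
have k2 : q ^+ 2 <= X * ll y * ll (x - y) by apply: le_trans h2 _; rewrite ler_wpM2r.
have := sqr_ge0 (p - q); rewrite !expr2 in k1 k2 *; nra.
Qed.

(** The cubic nonlinearity is subcritical in one dimension: charge and energy together bound the
    energy norm, whatever the size of the data. *)
Lemma energy_bound : exists B : R -> R -> R, forall x (A q : R), 0 <= q ->
  ll x <= q -> energy x <= A -> aa x <= B A q.
have [C C0 HC] := quartic_bound; exists (fun A q => 4 * `|A| + C ^+ 2 * q ^+ 3).
move=> x A q q0 xq; rewrite /Cubic.energy => hE; have := HC x; set s := Num.sqrt _ => hQ.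
have s0 : 0 <= s by exact: sqrtr_ge0.
have ss : s ^+ 2 = ll x * aa x by rewrite sqr_sqrtr // mulr_ge0.
have hA := ler_norm A.
(* Young's inequality; multiplied by [ll x] it reads [0 <= (s - C (ll x)^2)^2]. *)
have K : 2 * (C * ll x * s) <= aa x + C ^+ 2 * ll x ^+ 3.
  have [l0'|ln0] := eqVneq (ll x) 0.
    by rewrite l0' expr0n !mulr0 mul0r mulr0 addr0.
  have lp : 0 < ll x by rewrite lt_def ln0 l20.
  rewrite -(ler_pM2l lp); have := sqr_ge0 (s - C * ll x ^+ 2).
  rewrite sqrrB ss; set L := ll x; set P := aa x => h.
  have e1 : L * (2 * (C * L * s)) = s * (C * L ^+ 2) *+ 2 by ring.
  have e2 : L * (P + C ^+ 2 * L ^+ 3) = L * P + C ^+ 2 * L ^+ (2 * 2) by ring.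
  have e3 : (C * L ^+ 2) ^+ 2 = C ^+ 2 * L ^+ (2 * 2) by ring.
  have e4 : s * (C * L ^+ 2) *+ 2 = 2 * (s * (C * L ^+ 2)) by ring.
  rewrite e1 e2 -e3; rewrite e4 in h *; lra.
have : C ^+ 2 * ll x ^+ 3 <= C ^+ 2 * q ^+ 3.
  by rewrite ler_wpM2l ?sqr_ge0 // lerXn2r ?nnegrE.
have : 0 <= C ^+ 2 * q ^+ 3 by rewrite mulr_ge0 ?sqr_ge0 ?exprn_ge0.
have := normr_ge0 A; move: K hQ hE.
set z1 := C ^+ 2 * ll x ^+ 3; set z2 := C ^+ 2 * q ^+ 3; set z3 := C * _ * s; lra.
Qed.

Section Limit.
Variable x0 : E * E.

Let X n := sval (cid (galerkin H n x0)).
Let HX n := svalP (cid (galerkin H n x0)).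

Lemma X_init n t : t <= 0 -> X n t = (proj n x0.1, proj n x0.2).
by have [h _ _ _] := HX n; exact: h. Qed.
Lemma X_coord0 n i t : (n <= i)%N -> crd (X n t).1 i = 0 /\ crd (X n t).2 i = 0.
by move=> hi; have [_ h _ _] := HX n; exact: h. Qed.
Lemma X_curve n i : (i < n)%N -> curve (fun t => crd (X n t).1 i) (fun t => (fld (X n t) i).1) /\
  curve (fun t => crd (X n t).2 i) (fun t => (fld (X n t) i).2).
by move=> hi; have [_ _ h _] := HX n; exact: h. Qed.
Lemma X_cont n i : (i < n)%N -> continuous (fun t => (fld (X n t) i).1) /\ continuous (fun t => (fld (X n t) i).2).
by move=> hi; have [_ _ _ [h _ _]] := HX n; exact: h. Qed.
Lemma X_charge n t : 0 <= t -> ll (X n t) = ll (X n 0).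
by move=> hi; have [_ _ _ [_ h _]] := HX n; exact: h. Qed.
Lemma X_energy n t : 0 <= t -> energy (X n t) = energy (X n 0).
by move=> hi; have [_ _ _ [_ _ h]] := HX n; exact: h. Qed.

Lemma X0_a n : aa (X n 0) <= aa x0.
apply: (a2_le HE) => k; apply: le_trans (a2_partial HE x0 k); apply: ler_sum => i _.
rewrite (ler_pM2l (es_pos HE i)) X_init // /Modes.sq2 /= !(crd_synth HE).
by case: ifP => // _; rewrite expr0n addr0 addr_ge0 ?sqr_ge0.
Qed.
Lemma X0_l n : ll (X n 0) <= ll x0.
apply: l2_le => k; apply: le_trans (l2_partial x0 k); apply: ler_sum => i _.
rewrite X_init // /Modes.sq2 /= !(crd_synth HE).
by case: ifP => // _; rewrite expr0n addr0 addr_ge0 ?sqr_ge0.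
Qed.

Lemma X_bounded : exists2 A, 0 < A & forall n t, 0 <= t -> aa (X n t) <= A.
have [B HB] := energy_bound.
(* Bounds the initial energies of all approximations. A sign of [quartic] is not among the axioms of
   [nls_space], so [- quartic] is estimated by Young's inequality, which turns the factor 1/4 into
   1/8. *)
pose A0 := 2^-1 * aa x0 + 8^-1 * (36 * Cl * aa x0 ^+ 2 * ll x0 + ll x0).
exists (`|B A0 (ll x0)| + 1); first by rewrite ltr_wpDl.
move=> n t t0; have q0 : 0 <= ll x0 by exact: l20.
suff : aa (X n t) <= B A0 (ll x0) by have := ler_norm (B A0 (ll x0)); lra.
apply: HB => //; first by rewrite X_charge // X0_l.
rewrite X_energy // /Cubic.energy /A0; have h1 := X0_a n; have h2 := X0_l n.
have h3 := cubic_bound_l h1.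
have h4 : - quartic (X n 0) <= 2^-1 * (ll (cubic (X n 0)) + ll (X n 0)).
  by rewrite /Cubic.quartic; have := l20 (cubic (X n 0) + X n 0); rewrite (bsqD hl2); lra.
have h5 : 36 * Cl * aa x0 ^+ 2 * ll (X n 0) <= 36 * Cl * aa x0 ^+ 2 * ll x0.
  by rewrite ler_wpM2l // !mulr_ge0 ?sqr_ge0 // ltW // Cl0.
lra.
Qed.
Let A := sval (cid2 X_bounded).
Lemma A_gt0 : 0 < A. by rewrite /A; case: cid2. Qed.
Lemma X_a n t : 0 <= t -> aa (X n t) <= A.
by rewrite /A; case: cid2 => ? ? h; exact: h. Qed.

(** Constants of the Gronwall estimate below: [C] collects the Lipschitz constant of the cubic term
    and the Young terms, [K / lam n] the modes beyond [n] of the initial value and of the cubic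
    term. *)
Let C := 36 * Cl * A ^+ 2 + 3.
Let K := aa x0 + 36 * Ca * A ^+ 3.
Let rate n t := K / lam n * expR (C * t).

(** Gronwall for the squared [l]-distance. The only sources are the modes between [n] and [k] of the
    initial value and of the cubic term; they are of order [1 / lam n] since both are bounded in
    [aa]. *)
Lemma X_diff n k t : (n <= k)%N -> 0 <= t -> ll (X n t - X k t) <= rate n t.
move=> nk t0; pose d i b s := if b then crd (X n s).2 i - crd (X k s).2 i else crd (X n s).1 i - crd (X k s).1 i.
pose g i b s := (if (i < n)%N then (if b then (fld (X n s) i).2 else (fld (X n s) i).1) else 0)
   - (if b then (fld (X k s) i).2 else (fld (X k s) i).1).
pose f s := \sum_(i < k) (d i false s ^+ 2 + d i true s ^+ 2).
pose df s := \sum_(i < k) 2 * (d i false s * g i false s + d i true s * g i true s).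
have lf s : ll (X n s - X k s) = f s.
  rewrite (@l2_coords _ k) => [|i hi].
    by apply: eq_bigr => i _; rewrite /Modes.sq2 /= !(crdB HE).
  rewrite /= !(crdB HE); have [-> ->] := X_coord0 s hi.
  by have [-> ->] := X_coord0 s (leq_trans nk hi); rewrite subrr.
have dc i b : (i < k)%N -> curve (d i b) (g i b).
  move=> hi; have [k1 k2] := X_curve hi; rewrite /d /g.
  have [hn|hn] := ltnP i n.
    have [n1 n2] := X_curve hn.
    by case: b; apply: curveB.
  have Xn t' : crd (X n t').1 i = 0 /\ crd (X n t').2 i = 0 by exact: X_coord0.
  case: b.
    have -> : (fun s => crd (X n s).2 i - crd (X k s).2 i) = fun s => 0 - crd (X k s).2 i.
      by apply/funext => s; rewrite (Xn s).2.
    by apply: curveB => //; exact: curve_cst.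
  have -> : (fun s => crd (X n s).1 i - crd (X k s).1 i) = fun s => 0 - crd (X k s).1 i.
    by apply/funext => s; rewrite (Xn s).1.
  by apply: curveB => //; exact: curve_cst.
have cf : curve f df.
  apply: (@curve_sum _ 'I_k _ (fun i t => d i false t ^+ 2 + d i true t ^+ 2)) => i.
  have c1 := dc i false (ltn_ord i); have c2 := dc i true (ltn_ord i).
  by apply: curve_ext (curveD (curveM c1 c1) (curveM c2 c2)) _ => s _ /=; ring.
have A0 := A_gt0; have Cl0 := Cl0; have Ca0 := Ca0.
have C0 : 0 < C by rewrite /C ltr_wpDl // !mulr_ge0 ?sqr_ge0 // ltW.
pose ka := 36 * Ca * A ^+ 3 / lam n.
have gron s : 0 < s -> df s <= C * f s + ka.
  move=> s0; have Xa := X_a _ (ltW s0).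
  pose c1 i := crd (cubic (X n s)).1 i; pose c2 i := crd (cubic (X n s)).2 i.
  pose D1 i := crd (cubic (X n s) - cubic (X k s)).1 i.
  pose D2 i := crd (cubic (X n s) - cubic (X k s)).2 i.
  pose h i := if (i < n)%N then 0 else sq2 (cubic (X n s)) i.
  (* The terms with [lam i] cancel between the two components; the remaining products are split by
     Young's inequality. *)
  have term (i : 'I_k) : 2 * (d i false s * g i false s + d i true s * g i true s)
      <= 2 * (d i false s ^+ 2 + d i true s ^+ 2) + sq2 (cubic (X n s) - cubic (X k s)) i + h i.
    rewrite /Modes.sq2 -/(D1 i) -/(D2 i).
    set d1 := d _ false s; set d2 := d _ true s.
    have E1 : g i false s = lam i * d2 - D2 i + (if (i < n)%N then 0 else c2 i).
      rewrite /g /d2 /d /D2 /c2 /fld /= (crdB HE); case: ltnP => hi; first by ring.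
      by have [_ ->] := X_coord0 s hi; ring.
    have E2 : g i true s = - (lam i * d1) + D1 i - (if (i < n)%N then 0 else c1 i).
      rewrite /g /d1 /d /D1 /c1 /fld /= (crdB HE); case: ltnP => hi; first by ring.
      by have [-> _] := X_coord0 s hi; ring.
    rewrite E1 E2 /h; case: ltnP => hi.
      rewrite addr0 subr0.
      have := sqr_ge0 (d1 + D2 i); have := sqr_ge0 (d2 - D1 i); have := sqr_ge0 d1; have := sqr_ge0 d2.
      by rewrite !expr2; nra.
    rewrite /Modes.sq2 -/(c1 i) -/(c2 i).
    have := sqr_ge0 (d1 + D2 i); have := sqr_ge0 (d2 - D1 i).
    have := sqr_ge0 (d1 - c2 i); have := sqr_ge0 (d2 + c1 i).
    by rewrite !expr2; nra.
  have S1 : \sum_(i < k) sq2 (cubic (X n s) - cubic (X k s)) i <= 36 * Cl * A ^+ 2 * f s.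
    apply: le_trans (l2_partial _ _) _; rewrite -lf; apply: cubic_l; exact: Xa.
  have S2 : \sum_(i < k) h i <= ka.
    apply: le_trans (_ : aa (cubic (X n s)) / lam n <= _); last first.
      by rewrite ler_pM2r ?invr_gt0 ?(es_pos HE) // cubic_bound_a.
    apply: le_trans (tail_modes (cubic (X n s)) n k).
    rewrite -(big_mkord xpredT h) (big_cat_nat (n := n)) //= big_nat big1 ?add0r => [|i /andP [_ hi]]; last by rewrite /h hi.
    rewrite big_nat [leRHS]big_nat; apply: ler_sum => i /andP [hi _].
    by rewrite /h ltnNge hi.
  apply: le_trans (ler_sum _ (fun i _ => term i)) _.
  rewrite big_split big_split /= -mulr_sumr -/(f s).
  have -> : C * f s = 36 * Cl * A ^+ 2 * f s + 3 * f s by rewrite /C; ring.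
  have fs0 : 0 <= f s by rewrite -lf l20.
  apply: le_trans (lerD (lerD (lexx _) S1) S2) _.
  by rewrite lerD2r addrC lerD2l ler_wpM2r // ler_nat.
have := gronwall cf C0 t0 gron.
have f0 : f 0 <= aa x0 / lam n.
  rewrite /f; apply: le_trans (tail_modes x0 n k).
  rewrite -(big_mkord xpredT (fun i => d i false 0 ^+ 2 + d i true 0 ^+ 2)) (big_cat_nat (n := n)) //=.
  rewrite big_nat big1 ?add0r => [|i /andP [_ hi]].
    rewrite big_nat [leRHS]big_nat; apply: ler_sum => i /andP [hi hk].
    rewrite /d !X_init // /= !(crd_synth HE) hk ltnNge hi /= /Modes.sq2; lra.
  rewrite /d !X_init // /= !(crd_synth HE) hi (leq_trans hi nk); ring.
have ka0 : 0 <= ka by rewrite /ka !mulr_ge0 ?exprn_ge0 ?invr_ge0 // ltW // (es_pos HE).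
have C1 : 1 <= C.
  have : 0 <= 36 * Cl * A ^+ 2 by rewrite !mulr_ge0 ?sqr_ge0 // ltW.
  by rewrite /C; set w := _ * A ^+ 2; lra.
have kC : ka / C <= ka by rewrite ler_pdivrMr // ler_peMr.
have kC0 : 0 <= ka / C by rewrite divr_ge0 // ltW.
move=> h; rewrite lf; apply: le_trans (_ : f t + ka / C <= _); first by rewrite lerDl.
apply: le_trans h _; rewrite /rate ler_wpM2r ?expR_ge0 //.
rewrite /K mulrDl; rewrite -/ka; lra.
Qed.

Lemma rate_ge0 n t : 0 <= rate n t.
have A0 := A_gt0; have Ca0 := Ca0; rewrite /rate !mulr_ge0 ?expR_ge0 ?invr_ge0 ?(ltW (es_pos HE n)) //.
by rewrite /K addr_ge0 // !mulr_ge0 ?exprn_ge0 // ltW.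
Qed.

Lemma rate_small T eps : 0 < eps -> exists N, forall n t, (N <= n)%N -> 0 <= t <= T -> rate n t < eps.
move=> eps0; have A0 := A_gt0; have Ca0 := Ca0; have Cl0 := Cl0.
have [N HN] := es_unb HE ((K * expR (C * T)) / eps + 1).
exists N => n t hn /andP [t0 tT]; have lp := es_pos HE n.
rewrite /rate mulrAC ltr_pdivrMr //; have := HN n hn => h.
have K0 : 0 <= K by rewrite /K addr_ge0 // !mulr_ge0 ?exprn_ge0 // ltW.
have C0 : 0 <= C by rewrite /C addr_ge0 // !mulr_ge0 ?sqr_ge0 // ltW.
apply: le_lt_trans (_ : K * expR (C * T) < _).
  by rewrite ler_wpM2l // ler_expR ler_wpM2l.
by rewrite -ltr_pdivrMl // mulrC; lra.
Qed.

Lemma coord2_l2 x i : crd x.1 i ^+ 2 <= ll x /\ crd x.2 i ^+ 2 <= ll x.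
have h1 := crd_bound HE x.1 i; have h2 := crd_bound HE x.2 i.
by rewrite /Modes.l2; have := l0 x.1; have := l0 x.2; split; lra.
Qed.

Lemma abs_le_sqrt (z B : R) : 0 <= B -> z ^+ 2 <= B -> `|z| <= Num.sqrt B.
by move=> B0 h; apply: sqr_le; rewrite ?sqrtr_ge0 // normK2 // sqr_sqrtr.
Qed.

(** The coordinates converge by [X_diff]; the uniform bound on [aa] makes the limits the coordinates
    of an element of the space. *)
Lemma X_limit : exists x : R -> E * E, (forall t, t <= 0 -> x t = x0) /\
  forall t i, 0 <= t -> crd (X n t).1 i @[n --> \oo] --> crd (x t).1 i /\
    crd (X n t).2 i @[n --> \oo] --> crd (x t).2 i.
have L t : 0 <= t -> exists y : E * E, forall i, crd (X n t).1 i @[n --> \oo] --> crd y.1 i /\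
    crd (X n t).2 i @[n --> \oo] --> crd y.2 i.
  move=> t0; pose b n := Num.sqrt (rate n t).
  have b0 eps : 0 < eps -> exists N, forall k, (N <= k)%N -> b k < eps.
    move=> eps0; have [N HN] := @rate_small t (eps ^+ 2) (exprn_gt0 2 eps0).
    exists N => k hk; rewrite /b -[ltRHS](@ger0_norm _ eps) ?ltW // -sqrtr_sqr ltr_sqrt ?exprn_gt0 //.
    by apply: HN => //; rewrite t0 lexx.
  have lim (p : E * E -> E) : (forall x i, crd (p x) i ^+ 2 <= ll x) -> (forall x y, p (x - y) = p x - p y) ->
      exists c : nat -> R, forall i, crd (p (X n t)) i @[n --> \oo] --> c i.
    move=> hp pB; suff h i : exists c : R, crd (p (X n t)) i @[n --> \oo] --> c by have [c Hc] := choice h; exists c.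
    have [||c Hc] := @dominated_cauchy R (fun n => crd (p (X n t)) i) b; first exact: b0.
      move=> n k nk; rewrite distrC -(crdB HE) -pB; apply: abs_le_sqrt; first exact: rate_ge0.
      by apply: le_trans (hp _ _) _; exact: X_diff.
    exists c; apply/cvgrPdist_lt => eps eps0; have [N HN] := b0 eps eps0.
    by exists N => // n /= hn; apply: le_lt_trans (Hc n) _; exact: HN.
  have [c1 Hc1] := lim fst (fun x i => (coord2_l2 x i).1) (fun x y => erefl).
  have [c2 Hc2] := lim snd (fun x i => (coord2_l2 x i).2) (fun x y => erefl).
  have B (c : nat -> R) (p : E * E -> E) : (forall i, crd (p (X n t)) i @[n --> \oo] --> c i) ->
     (forall x, a (p x) (p x) <= aa x) -> forall k, \sum_(i < k) lam i * c i ^+ 2 <= A.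
    move=> hc pa k; apply: (@cvgn_le R (fun n => \sum_(i < k) lam i * crd (p (X n t)) i ^+ 2) _ A 0%N).
      apply: (@cvg_finsum R nat _ (fun i n => lam i * crd (p (X n t)) i ^+ 2) (fun i => lam i * c i ^+ 2)) => i.
      by apply: cvgM; [exact: cvg_cst|apply: cvgM; exact: hc].
    move=> n _; apply: le_trans (a_partial HE _ _) _; apply: le_trans (pa _) _; exact: X_a.
  have a1 x : a x.1 x.1 <= aa x by rewrite /Modes.a2 lerDl.
  have a2' x : a x.2 x.2 <= aa x by rewrite /Modes.a2 lerDr.
  have [u [Hu _]] := synth_exists HE (B c1 fst Hc1 a1).
  have [w [Hw _]] := synth_exists HE (B c2 snd Hc2 a2').
  by exists (u, w) => i /=; rewrite Hu Hw.
have [x Hx] : exists x : R -> E * E, forall t, 0 <= t -> forall i, crd (X n t).1 i @[n --> \oo] --> crd (x t).1 i /\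
    crd (X n t).2 i @[n --> \oo] --> crd (x t).2 i.
  suff h t : exists y : E * E, 0 <= t -> forall i, crd (X n t).1 i @[n --> \oo] --> crd y.1 i /\
    crd (X n t).2 i @[n --> \oo] --> crd y.2 i by have [x Hx] := choice h; exists x.
  by have [t0|t0] := leP 0 t; [have [y Hy] := L t t0; exists y|exists 0].
(* At [t <= 0] the value is [x0] itself; the coordinate limits would give it only up to a null
   vector. *)
exists (fun t => if t <= 0 then x0 else x t); split=> [t ->//|t i t0].
case: ifP => [t1|_]; last exact: Hx.
have ce (c : R) (f : nat -> R) : (forall n, (i < n)%N -> f n = c) -> f @ \oo --> c.
  move=> h; apply/cvgrPdist_lt => eps eps0; exists i.+1 => // n /= hn.
  by rewrite h // subrr normr0.
by split; apply: ce => n hn; rewrite X_init //= (crd_synth HE) hn.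
Qed.

Let x := sval (cid X_limit).
Lemma x_init t : t <= 0 -> x t = x0.
by have [h _] := svalP (cid X_limit); exact: h. Qed.
Lemma x_lim t i : 0 <= t -> crd (X n t).1 i @[n --> \oo] --> crd (x t).1 i /\
    crd (X n t).2 i @[n --> \oo] --> crd (x t).2 i.
by have [_ h] := svalP (cid X_limit); exact: h. Qed.

Lemma x_a t : 0 <= t -> aa (x t) <= A.
move=> t0; apply: (a2_le HE) => k.
apply: (@cvgn_le R (fun n => \sum_(i < k) lam i * sq2 (X n t) i) _ A 0%N).
  apply: (@cvg_finsum R nat _ (fun i n => lam i * sq2 (X n t) i) (fun i => lam i * sq2 (x t) i)) => i.
  have [h1 h2] := x_lim i t0.
  by apply: cvgM; [exact: cvg_cst|apply: cvgD; apply: cvgM].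
by move=> n _; apply: le_trans (a2_partial HE _ _) _; exact: X_a.
Qed.

Lemma x_rate n t : 0 <= t -> ll (X n t - x t) <= rate n t.
move=> t0; apply: l2_le => k.
apply: (@cvgn_le R (fun j => \sum_(i < k) sq2 (X n t - X j t) i) _ _ n).
  apply: (@cvg_finsum R nat _ (fun i j => sq2 (X n t - X j t) i) (fun i => sq2 (X n t - x t) i)) => i.
  have [h1 h2] := x_lim i t0; rewrite /Modes.sq2 /= !(crdB HE).
  under eq_fun do rewrite !(crdB HE).
  by apply: cvgD; apply: cvgM; apply: cvgB => //; exact: cvg_cst.
by move=> j nj; apply: le_trans (l2_partial _ _) _; exact: X_diff.
Qed.

Lemma es_lM : exists2 M, 0 < M & forall y, ll y <= M * aa y.
have [M M0 HM] := es_la HE; exists M => // y; rewrite /Modes.l2 /Modes.a2 mulrDr lerD //; exact: HM.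
Qed.

Lemma small_of_sq (z B r : R) eps : 0 < eps -> 0 <= B -> z ^+ 2 <= r * B -> r < eps ^+ 2 / (B + 1) -> `|z| < eps.
move=> eps0 B0 h; rewrite ltr_pdivlMr ?ltr_wpDl // => h2.
rewrite ltNge; apply/negP => h3.
have : eps ^+ 2 <= `|z| ^+ 2 by rewrite lerXn2r ?nnegrE // ltW.
rewrite normK2 // => h4.
have [r0|r0] := leP 0 r; first by nra.
have : 0 < eps ^+ 2 by rewrite exprn_gt0.
nra.
Qed.

Lemma X_l2_cvg t eps : 0 <= t -> 0 < eps -> exists N, forall n, (N <= n)%N ->
  `|ll (X n t) - ll (x t)| < eps /\ `|quartic (X n t) - quartic (x t)| < eps.
move=> t0 eps0; have A0 := A_gt0; have Cl0 := Cl0; have [M M0 HM] := es_lM.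
have lX n : ll (X n t) <= M * A by apply: le_trans (HM _) _; rewrite ler_pM2l // X_a.
have lx : ll (x t) <= M * A by apply: le_trans (HM _) _; rewrite ler_pM2l // x_a.
have MA : 0 <= M * A by rewrite mulr_ge0 // ltW.
pose B1 := 4 * (M * A); pose B2 := 72 * Cl * A ^+ 2 * (2 * (M * A)).
have B10 : 0 <= B1 by rewrite mulr_ge0.
have B20 : 0 <= B2 by rewrite !mulr_ge0 ?sqr_ge0 // ltW.
have e1 : 0 < eps ^+ 2 / (B1 + 1) by rewrite divr_gt0 ?exprn_gt0 // ltr_wpDl.
have e2 : 0 < eps ^+ 2 / (B2 + 1) by rewrite divr_gt0 ?exprn_gt0 // ltr_wpDl.
have [N1 H1] := @rate_small t _ e1; have [N2 H2] := @rate_small t _ e2.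
exists (maxn N1 N2) => n; rewrite geq_max => /andP [n1 n2].
have tt : 0 <= t <= t by rewrite t0 lexx.
have rx := x_rate n t0; have d0 := l20 (X n t - x t); have r0 := rate_ge0 n t; split.
  apply: (@small_of_sq _ B1 (rate n t)) => //; last exact: H1.
  apply: le_trans (l2_cts _ _) _; apply: ler_pM => //; first by rewrite addr_ge0 // mulr_ge0.
  by have := lX n; rewrite /B1; lra.
apply: (@small_of_sq _ B2 (rate n t)) => //; last exact: H2.
apply: le_trans (quartic_cts (X_a n t0) (x_a t0)) _.
rewrite mulrAC mulrC; apply: ler_pM => //; first by rewrite !mulr_ge0 ?sqr_ge0 ?addr_ge0 // ltW.
rewrite /B2 ler_wpM2l ?mulr_ge0 ?sqr_ge0 ?(ltW Cl0) //; by have := lX n; lra.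
Qed.

Lemma x_charge t : 0 <= t -> ll (x t) = ll x0.
move=> t0; apply/eqP; rewrite -subr_eq0 -normr_le0; apply/ler_addgt0Pl => eps eps0; rewrite addr0.
have e2 := divr_gt0 eps0 (ltr0n R 2).
have [N1 H1] := X_l2_cvg t0 e2; have [N2 H2] := X_l2_cvg (lexx (0:R)) e2.
have [h1 _] := H1 (maxn N1 N2) (leq_maxl _ _); have [h2 _] := H2 (maxn N1 N2) (leq_maxr _ _).
move: h1 h2; rewrite X_charge // (x_init (lexx 0)) !ltr_norml ler_norml; lra.
Qed.

(** [quartic] converges because the scheme converges in [ll], whereas [aa] is only lower
    semicontinuous; hence an inequality. *)
Lemma x_energy t : 0 <= t -> energy (x t) <= energy x0.
move=> t0; rewrite /Cubic.energy.
suff : aa (x t) <= aa x0 - 2^-1 * quartic x0 + 2^-1 * quartic (x t) by lra.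
apply/ler_addgt0Pr => eps eps0.
have [N1 H1] := X_l2_cvg t0 eps0; have [N2 H2] := X_l2_cvg (lexx (0:R)) eps0.
apply: (a2_le HE) => k.
apply: (@cvgn_le R (fun n => \sum_(i < k) lam i * sq2 (X n t) i) _ _ (maxn N1 N2)).
  apply: (@cvg_finsum R nat _ (fun i n => lam i * sq2 (X n t) i) (fun i => lam i * sq2 (x t) i)) => i.
  have [h1 h2] := x_lim i t0.
  by apply: cvgM; [exact: cvg_cst|apply: cvgD; apply: cvgM].
move=> n; rewrite geq_max => /andP [n1 n2]; apply: le_trans (a2_partial HE _ _) _.
have [_ h1] := H1 n n1; have [_ h2] := H2 n n2; have := X_energy n t0; have := X0_a n.
rewrite /Cubic.energy; move: h1 h2; rewrite (x_init (lexx 0)) !ltr_norml; lra.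
Qed.

Lemma x_curve i : curve (fun t => crd (x t).1 i) (fun t => (fld (x t) i).1) /\
  curve (fun t => crd (x t).2 i) (fun t => (fld (x t) i).2).
have A0 := A_gt0; have Cl0 := Cl0; have lp := es_pos HE i.
pose c2 := 36 * Cl * A ^+ 2.
have c20 : 0 <= c2 by rewrite !mulr_ge0 ?sqr_ge0 // ltW.
have unif T eps : 0 <= T -> 0 < eps -> exists N, forall n t, (N <= n)%N -> 0 <= t <= T ->
    [/\ `|crd (X n t).1 i - crd (x t).1 i| <= eps, `|crd (X n t).2 i - crd (x t).2 i| <= eps,
        `|(fld (X n t) i).1 - (fld (x t) i).1| <= eps & `|(fld (X n t) i).2 - (fld (x t) i).2| <= eps].
  move=> T0 eps0.
  pose B := 1 + 2 * lam i ^+ 2 + 2 * c2.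
  have B0 : 0 <= B by rewrite /B; have := sqr_ge0 (lam i); lra.
  have e1 : 0 < eps ^+ 2 / (B + 1) by rewrite divr_gt0 ?exprn_gt0 // ltr_wpDl.
  have [N HN] := @rate_small T _ e1; exists N => n t hn tT; have r1 := HN n t hn tT.
  have t0 : 0 <= t by case/andP: tT.
  have rx := x_rate n t0; have r0 := rate_ge0 n t.
  have [k1 k2] := coord2_l2 (X n t - x t) i.
  have k3 : ll (cubic (X n t) - cubic (x t)) <= c2 * rate n t.
    by apply: le_trans (cubic_l (X_a n t0) (x_a t0)) _; rewrite ler_wpM2l.
  have [k4 k5] := coord2_l2 (cubic (X n t) - cubic (x t)) i.
  rewrite /= !(crdB HE) in k1 k2 k4 k5.
  have small z : z ^+ 2 <= rate n t * B -> `|z| <= eps.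
    by move=> h; apply/ltW; exact: (small_of_sq eps0 B0 h).
  have l2' : 0 <= lam i ^+ 2 by exact: sqr_ge0.
  have nl (p q r s : R) : (p - q) ^+ 2 <= rate n t -> (r - s) ^+ 2 <= c2 * rate n t ->
      (lam i * p - r - (lam i * q - s)) ^+ 2 <= rate n t * B.
    move=> h1 h2; have := ler_wpM2l l2' h1; have := sqr_ge0 (lam i * (p - q) + (r - s)).
    by rewrite /B; nra.
  split; apply: small; rewrite ?/B; [nra|nra|exact: nl (le_trans k2 rx) (le_trans k5 k3)|].
  rewrite /Cubic.fld /= -sqrrN; have := nl _ _ _ _ (le_trans k1 rx) (le_trans k4 k3).
  by apply: le_trans; rewrite le_eqVlt; apply/orP; left; apply/eqP; congr (_ ^+ 2); ring.
split.
  (* The sequence starts at index [i.+1], so that mode [i] is active in every approximation. *)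
  have [] // := @limit_curve R (fun n t => crd (X (n + i.+1) t).1 i) (fun n t => (fld (X (n + i.+1) t) i).1) (fun t => crd (x t).1 i) (fun t => (fld (x t) i).1).
  - by move=> n; have [] := @X_curve (n + i.+1) i; rewrite ?addnS ?ltnS ?leq_addl.
  - by move=> t t0; rewrite !x_init.
  - by move=> t t0; rewrite !x_init.
  - by move=> n; have [] := @X_cont (n + i.+1) i; rewrite ?addnS ?ltnS ?leq_addl.
  move=> T eps T0 eps0; have [N HN] := unif T eps T0 eps0; exists N => n t hn tT.
  by have [] := HN (n + i.+1)%N t (leq_trans hn (leq_addr _ _)) tT.
have [] // := @limit_curve R (fun n t => crd (X (n + i.+1) t).2 i) (fun n t => (fld (X (n + i.+1) t) i).2) (fun t => crd (x t).2 i) (fun t => (fld (x t) i).2).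
- by move=> n; have [] := @X_curve (n + i.+1) i; rewrite ?addnS ?ltnS ?leq_addl.
- by move=> t t0; rewrite !x_init.
- by move=> t t0; rewrite !x_init.
- by move=> n; have [] := @X_cont (n + i.+1) i; rewrite ?addnS ?ltnS ?leq_addl.
move=> T eps T0 eps0; have [N HN] := unif T eps T0 eps0; exists N => n t hn tT.
by have [] := HN (n + i.+1)%N t (leq_trans hn (leq_addr _ _)) tT.
Qed.

End Limit.

Theorem weak_flow (x0 : E * E) : exists (x : R -> E * E) (A : R),
  [/\ x 0 = x0, forall t, 0 <= t -> aa (x t) <= A,
      forall t, 0 <= t -> ll (x t) = ll x0,
      forall t, 0 <= t -> energy (x t) <= energy x0 &
      forall i, curve (fun t => crd (x t).1 i) (fun t => (fld (x t) i).1) /\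
        curve (fun t => crd (x t).2 i) (fun t => (fld (x t) i).2)].
eexists; eexists; split; [by apply: x_init|exact: x_a|exact: x_charge|exact: x_energy|exact: x_curve].
Qed.

End NLSFlow.

(** * Continuation along the half-line *)

Section Connectedness.
Context {R : realType}.

(** Connectedness of the half-line, in the form used for all continuation arguments below. *)
Lemma locally_constant_pred (G : R -> Prop) : G 0 ->
  (forall t, 0 <= t -> exists2 d : R, 0 < d & forall s, 0 <= s -> `|s - t| < d -> (G s <-> G t)) ->
  forall t, 0 <= t -> G t.
move=> G0 loc T T0; pose S := [set t | 0 <= t <= T /\ forall s, 0 <= s <= t -> G s].
have hS : has_sup S.
  split; last by exists T => t [/andP [_ ?] _].
  exists 0; split; first by rewrite lexx T0.
  by move=> s /andP [s0 s1]; have -> : s = 0 by apply: le_anti; rewrite s0 s1.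
have S0 : 0 <= sup S.
  apply: ub_le_sup; first by case: hS.
  split; first by rewrite lexx T0.
  by move=> s /andP [s0 s1]; have -> : s = 0 by apply: le_anti; rewrite s0 s1.
have ST : sup S <= T by apply: ge_sup; [case: hS|move=> t [/andP [_ ?] _]].
have [d d0 Hd] := loc _ S0.
have [t1 [/andP [t10 t1T] Ht1] lt1] := sup_adherent d0 hS.
have t1S : t1 <= sup S by apply: ub_le_sup; [case: hS|split => //; rewrite t10].
have Gs : G (sup S).
  apply/(Hd t1) => //; last by apply: Ht1; rewrite t10 lexx.
  by rewrite ltr_norml; lra.
pose u := Num.min T (sup S + d / 2).
have Su : S u.
  split; first by rewrite /u ge_min lexx /= le_min T0 /= addr_ge0 // divr_ge0 // ltW.
  move=> s /andP [s0 su]; have [st|st] := leP s t1; first by apply: Ht1; rewrite s0.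
  apply/(Hd s) => //; rewrite ltr_norml.
  have : s <= sup S + d / 2 by apply: le_trans su _; rewrite /u ge_min lexx orbT.
  lra.
have uS : u <= sup S by apply: ub_le_sup => //; case: hS.
have uT : u = T.
  rewrite /u; move: uS; rewrite /u; case: (leP T (sup S + d / 2)) => // h; lra.
by case: Su => _ H; apply: H; rewrite T0 uT lexx.
Qed.

(** [D] will be a squared seminorm of a difference, hence the factors 2 in its triangle inequality.
    Uniform continuity on [[0, t]] is a locally constant property of [t]. *)
Lemma uniform_on_segment (D : R -> R -> R) (T : R) : 0 <= T ->
  (forall r s, D r s = D s r) -> (forall r s t, D r t <= 2 * D r s + 2 * D s t) ->
  (forall t, 0 <= t -> forall e : R, 0 < e -> exists2 d : R, 0 < d &
     forall s, 0 <= s -> `|s - t| < d -> D s t < e) ->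
  forall e : R, 0 < e -> exists2 d : R, 0 < d & forall r s, 0 <= r <= T -> 0 <= s <= T ->
    `|r - s| < d -> D r s < e.
move=> T0 Dsym Dtri Dc e e0.
pose G t := exists2 d : R, 0 < d & forall r s, 0 <= r <= t -> 0 <= s <= t -> `|r - s| < d -> D r s < e.
have near t : 0 <= t -> exists2 d : R, 0 < d & forall r s, 0 <= r -> 0 <= s -> `|r - t| < d -> `|s - t| < d -> D r s < e.
  move=> t0; have [d d0 Hd] := Dc t t0 (e / 4) (divr_gt0 e0 (ltr0n R 4)).
  exists d => // r s r0 s0 rt st; apply: le_lt_trans (Dtri r t s) _.
  by have := Hd r r0 rt; have := Hd s s0 st; rewrite (Dsym t s); lra.
apply: (@locally_constant_pred G) => // [|t t0].
  have [d d0 Hd] := near 0 (lexx 0); exists d => // r s /andP [r0 r1] /andP [s0 s1] _.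
  by apply: Hd => //; rewrite subr0 ger0_norm //; lra.
have [d d0 Hd] := near t t0; exists (d / 2); first by rewrite divr_gt0.
have key p q : 0 <= p -> 0 <= q -> `|p - t| < d / 2 -> `|q - t| < d / 2 -> G p -> G q.
  move=> p0 q0 pt qt [d1 d10 Hd1]; exists (Num.min d1 (d / 2)); first by rewrite lt_min d10 divr_gt0.
  move=> r s /andP [r0 rq] /andP [s0 sq]; rewrite lt_min => /andP [h1 h2].
  have [/andP [rp sp]|] := boolP ((r <= p) && (s <= p)).
    by apply: Hd1 => //; apply/andP.
  rewrite negb_and -!ltNge => rs; apply: Hd => //; move: pt qt h2; rewrite !ltr_norml;
  case/orP: rs => h; lra.
move=> s s0 st; have tt : `|t - t| < d / 2 by rewrite subrr normr0 divr_gt0.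
by split; apply: key.
Qed.

End Connectedness.

(** * The Duhamel formula with Riemann sums *)

Section Duhamel.
Context {R : realType} {E : lmodType R}.
Variables (l a : E -> E -> R) (e : nat -> E) (lam : nat -> R) (m : E -> E -> E -> E).
Hypothesis H : nls_space l a e lam m.
Let HE := ns_es H.
Local Notation crd := (crd l e).
Local Notation a2 := (a2 a).
Local Notation aa x := (a2 x x).
Local Notation sq2 := (sq2 l e).
Local Notation cubic := (cubic m).
Local Notation fld := (fld l e lam m).
Local Notation flow := (flow l e lam).
Let ha2 := ha2 HE. Let a20 := a20 HE.

(** The inner product of [a2] cut to [n] modes. Testing against it makes vector identities scalar,
    and bounds uniform in [n] pass to [aa] by [a2_le]. *)
Definition ip n (w y : E * E) :=
  \sum_(i < n) lam i * (crd w.1 i * crd y.1 i + crd w.2 i * crd y.2 i).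

Lemma bform_ip n : bform (ip n).
split=> [u v w|c u w|u v].
- rewrite /ip -big_split; apply: eq_bigr => i _ /=; rewrite !(crdD HE); ring.
- rewrite /ip mulr_sumr; apply: eq_bigr => i _ /=; rewrite !(crdZ HE); ring.
- by apply: eq_bigr => i _; ring.
Qed.

Lemma ip_sq n w : ip n w w = \sum_(i < n) lam i * sq2 w i.
by apply: eq_bigr => i _; rewrite /Modes.sq2 !expr2. Qed.

Lemma ip_ge0 n : nneg (ip n).
by move=> w; rewrite ip_sq; apply: sumr_ge0 => i _; rewrite mulr_ge0 ?sq20 // ltW // (es_pos HE).
Qed.

Lemma ip_CS n w y : ip n w y <= Num.sqrt (ip n w w) * Num.sqrt (aa y).
have h := form_CS (bform_ip n) (@ip_ge0 n) w y.
apply: sqr_le; first by rewrite mulr_ge0 ?sqrtr_ge0.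
rewrite exprMn !sqr_sqrtr ?a20 ?ip_ge0 //; apply: le_trans h _.
by rewrite ler_wpM2l ?ip_ge0 // ip_sq a2_partial.
Qed.

Definition nonl (x : E * E) : E * E := (- (cubic x).2, (cubic x).1).

Lemma nonl_a2 x y : aa (nonl x - nonl y) = aa (cubic x - cubic y).
rewrite /nonl /Modes.a2 /=; have -> : - (cubic x).2 - - (cubic y).2 = - ((cubic x).2 - (cubic y).2) by rewrite [RHS]opprD.
by rewrite (bsqN (es_a HE)) addrC.
Qed.

Lemma coordN u i : crd (- u) i = - crd u i.
by rewrite -scaleN1r (crdZ HE) mulN1r. Qed.

Variable x : R -> E * E.
Hypothesis xc : forall i, curve (fun t => crd (x t).1 i) (fun t => (fld (x t) i).1) /\
        curve (fun t => crd (x t).2 i) (fun t => (fld (x t) i).2).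
Variable A : R.
Hypothesis xA : forall t, 0 <= t -> aa (x t) <= A.

(** Interaction picture: along [flow (tau - t) (x t)] the linear part of the equation cancels, so
    that the derivative is the transported nonlinearity alone. *)
Lemma flow_mvt tau n w s t : 0 <= s -> s < t -> exists2 c, s < c < t &
  ip n w (flow (tau - t) (x t) - flow (tau - s) (x s)) = (t - s) * ip n w (flow (tau - c) (nonl (x c))).
move=> s0 st.
have ccos i : curve (fun r => cos (lam i * (tau - r))) (fun r => lam i * sin (lam i * (tau - r))).
  have D (r : R) : is_derive r 1 (fun r => cos (lam i * (tau - r))) (lam i * sin (lam i * (tau - r))).
    have h1 : is_derive r 1 (fun t : R => lam i * (tau - t)) (- lam i).
      by apply: is_derive_eq; rewrite /GRing.scale /=; ring.
    by apply: is_derive_eq; rewrite /GRing.scale /=; ring.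
  by split=> [r|r _]; [exact: is_derive_cont (D r)|exact: D].
have csin i : curve (fun r => sin (lam i * (tau - r))) (fun r => - lam i * cos (lam i * (tau - r))).
  have D (r : R) : is_derive r 1 (fun r => sin (lam i * (tau - r))) (- lam i * cos (lam i * (tau - r))).
    have h1 : is_derive r 1 (fun t : R => lam i * (tau - t)) (- lam i).
      by apply: is_derive_eq; rewrite /GRing.scale /=; ring.
    by apply: is_derive_eq; rewrite /GRing.scale /=; ring.
  by split=> [r|r _]; [exact: is_derive_cont (D r)|exact: D].
have c1 i : curve (fun r => crd (flow (tau - r) (x r)).1 i) (fun r => crd (flow (tau - r) (nonl (x r))).1 i).
  have -> : (fun r => crd (flow (tau - r) (x r)).1 i) = fun r =>
     cos (lam i * (tau - r)) * crd (x r).1 i + sin (lam i * (tau - r)) * crd (x r).2 i.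
    by apply/funext => r; rewrite (flowP HE (tau - r) (x r) i).1.
  have [x1 x2] := xc i.
  apply: curve_ext (curveD (curveM (ccos i) x1) (curveM (csin i) x2)) _ => r _ /=.
  by rewrite (flowP HE (tau - r) (nonl (x r)) i).1 /= coordN /Cubic.fld /=; ring.
have c2 i : curve (fun r => crd (flow (tau - r) (x r)).2 i) (fun r => crd (flow (tau - r) (nonl (x r))).2 i).
  have -> : (fun r => crd (flow (tau - r) (x r)).2 i) = fun r =>
     0 - sin (lam i * (tau - r)) * crd (x r).1 i + cos (lam i * (tau - r)) * crd (x r).2 i.
    by apply/funext => r; rewrite (flowP HE (tau - r) (x r) i).2; ring.
  have [x1 x2] := xc i.
  apply: curve_ext (curveD (curveB (curve_cst 0) (curveM (csin i) x1)) (curveM (ccos i) x2)) _ => r _ /=.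
  by rewrite (flowP HE (tau - r) (nonl (x r)) i).2 /= coordN /Cubic.fld /=; ring.
have cip : curve (fun r => ip n w (flow (tau - r) (x r))) (fun r => ip n w (flow (tau - r) (nonl (x r)))).
  apply: (@curve_ext _ _ (fun r => \sum_(i < n) (0 * (crd w.1 i * crd (flow (tau - r) (x r)).1 i + crd w.2 i * crd (flow (tau - r) (x r)).2 i) +
     lam i * ((0 * crd (flow (tau - r) (x r)).1 i + crd w.1 i * crd (flow (tau - r) (nonl (x r))).1 i) +
       (0 * crd (flow (tau - r) (x r)).2 i + crd w.2 i * crd (flow (tau - r) (nonl (x r))).2 i))))).
    apply: (@curve_sum _ 'I_n _ (fun i r => lam i * (crd w.1 i * crd (flow (tau - r) (x r)).1 i + crd w.2 i * crd (flow (tau - r) (x r)).2 i))) => i.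
    apply: curveM (curve_cst (lam i)) _.
    by apply: curveD; apply: curveM => //; exact: curve_cst.
  by move=> r _; apply: eq_bigr => i _; ring.
have [c hc Ec] := curve_mvt cip s0 st; exists c => //.
by rewrite (bBr (bform_ip n)) Ec mulrC.
Qed.

Lemma nonl_bound t : 0 <= t -> aa (nonl (x t)) <= 36 * Ca H * A ^+ 3.
move=> t0; apply: le_trans (cubic_bound_a H (xA t0)).
by rewrite /nonl /Modes.a2 /= (bsqN (es_a HE)) addrC.
Qed.

Let M := 36 * Ca H * A ^+ 3.

(** Turns scalar mean values into a norm estimate: the test vector is the increment itself, which
    leaves its seminorm on the right. *)
Lemma self_bound (p q : R) : 0 <= p -> 0 <= q -> p <= Num.sqrt p * q -> p <= q ^+ 2.
move=> p0 q0 h; have s0 := sqrtr_ge0 p; have ss := sqr_sqrtr p0.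
set s := Num.sqrt p in h s0 ss; rewrite -ss in h *.
have [->|sn] := eqVneq s 0; first by rewrite expr0n sqr_ge0.
have sp : 0 < s by rewrite lt_def sn.
have : s <= q by rewrite -(ler_pM2l sp) -expr2.
by move=> sq; rewrite lerXn2r ?nnegrE.
Qed.

Lemma x_flow_close s t : 0 <= s -> s <= t ->
  aa (x t - flow (t - s) (x s)) <= (t - s) ^+ 2 * M.
move=> s0; rewrite le_eqVlt => /orP [/eqP <-|st].
  by rewrite subrr expr0n mul0r bsqBC // flow0.
have t0 : 0 <= t by apply: ltW; apply: le_lt_trans st.
have M0 : 0 <= M by apply: le_trans (nonl_bound t0).
apply: (a2_le HE) => n; rewrite -ip_sq; set w := x t - _.
have [c /andP [sc ct] Ec] := flow_mvt t n w s0 st.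
have E1 : ip n w w = ip n w (flow (t - t) (x t) - flow (t - s) (x s)).
  rewrite subrr /ip; apply: eq_bigr => i _ /=; rewrite !(crdB HE).
  have [-> ->] := flowP HE 0 (x t) i; rewrite mulr0 cos0 sin0; ring.
have -> : (t - s) ^+ 2 * M = ((t - s) * Num.sqrt M) ^+ 2 by rewrite exprMn sqr_sqrtr.
apply: self_bound; first exact: ip_ge0.
  by rewrite mulr_ge0 ?sqrtr_ge0 // subr_ge0 ltW.
have ts0 : 0 <= t - s by rewrite subr_ge0 ltW.
rewrite {1}E1 Ec mulrCA ler_wpM2l //.
apply: le_trans (ip_CS _ _ _) _; rewrite ler_wpM2l ?sqrtr_ge0 // ler_sqrt //.
apply: le_trans (flow_le HE _ _) _; apply: nonl_bound.
by apply: ltW; apply: le_lt_trans sc.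
Qed.

Lemma a2_triangle (u v w : E * E) : aa (u - w) <= 2 * aa (u - v) + 2 * aa (v - w).
by rewrite -(subrKA v); apply: bsqD_le. Qed.

Lemma x_continuous t : 0 <= t -> forall eps : R, 0 < eps -> exists2 d : R, 0 < d &
  forall s, 0 <= s -> `|s - t| < d -> aa (x s - x t) < eps.
move=> t0 eps eps0; have M0 : 0 <= M by apply: le_trans (nonl_bound t0).
have e4 := divr_gt0 eps0 (ltr0n R 4).
have /cvgrPdist_lt /(_ _ e4) /nbhs_ballP [d1 /= d10 Hd1] := flow_cvg HE (x t).
have Hf h : `|h| < d1 -> aa (flow h (x t) - x t) < eps / 4.
  move=> hd; have := Hd1 h; rewrite /ball /= !sub0r !normrN => /(_ hd).
  by rewrite ger0_norm ?a20.
have C0 : 0 < 4 * (M + 1) by lra.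
pose d2 := Num.min 1 (eps / (4 * (M + 1))).
have d20 : 0 < d2 by rewrite lt_min ltr01 divr_gt0.
have Hq r : `|r| < d2 -> r ^+ 2 * M < eps / 4.
  rewrite lt_min => /andP [r1]; rewrite ltr_pdivlMr // => r2.
  have : r ^+ 2 <= `|r| by rewrite -normK2 // expr2 ler_piMl // ltW.
  have := normr_ge0 r; nra.
exists (Num.min d1 d2); first by rewrite lt_min d10.
move=> s s0; rewrite lt_min => /andP [sd1 sd2].
have [ts|st] := leP t s.
  apply: le_lt_trans (a2_triangle _ (flow (s - t) (x t)) _) _.
  have := x_flow_close t0 ts; have := Hq (s - t) sd2; have := Hf (s - t) sd1; lra.
apply: le_lt_trans (a2_triangle _ (flow (s - t) (x t)) _) _.
have h1 := Hf (s - t) sd1; have h2 := x_flow_close s0 (ltW st).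
have h3 : (t - s) ^+ 2 * M < eps / 4 by apply: Hq; rewrite distrC.
(* For [s < t] the group is run backwards from [t], so that both cases compare with a fixed vector
   [x t]. *)
have h4 : aa (x s - flow (s - t) (x t)) <= (t - s) ^+ 2 * M.
  have z : aa (x s - flow (s - t) (flow (t - s) (x s))) = 0.
    apply: (coord2_inj HE) => i.
    have [-> ->] := flowP HE (s - t) (flow (t - s) (x s)) i.
    have [-> ->] := flowP HE (t - s) (x s) i.
    have -> : lam i * (s - t) = - (lam i * (t - s)) by ring.
    rewrite cosN sinN; have cs := cos2Dsin2 (lam i * (t - s)).
    set c := cos _ in cs *; set k := sin _ in cs *; split.
      transitivity ((c ^+ 2 + k ^+ 2) * crd (x s).1 i); [by rewrite cs mul1r|ring].
    transitivity ((c ^+ 2 + k ^+ 2) * crd (x s).2 i); [by rewrite cs mul1r|ring].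
  set p := x s - flow (s - t) (flow (t - s) (x s)) in z.
  set q := flow (s - t) (flow (t - s) (x s)) - flow (s - t) (x t).
  have -> : x s - flow (s - t) (x t) = p + q by rewrite /p /q addrA subrK.
  rewrite (bsqD ha2) z (nneg0 _ ha2 a20 z) mulr0 !add0r.
  by apply: le_trans (flowB_le HE _ _ _) _; rewrite bsqBC.
lra.
Qed.

(** No vector integral is formed. The error [w] of a Riemann sum is tested against itself; on each
    cell the mean value theorem replaces the increment by the integrand at some [c], which is close
    to its value at the tag by uniform continuity. *)
Lemma duhamel tau : 0 <= tau -> forall eps : R, 0 < eps -> exists2 d : R, 0 < d &
  forall (k : nat) (p tag : nat -> R), p 0%N = 0 -> p k = tau ->
      (forall i, (i < k)%N -> p i <= tag i <= p i.+1 /\ p i.+1 - p i < d) ->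
  let w := \sum_(i < k) (p i.+1 - p i) *: flow (tau - tag i) (nonl (x (tag i))) - (x tau - flow tau (x 0)) in
  aa w < eps.
move=> tau0 eps eps0.
pose F r := flow (tau - r) (nonl (x r)).
have Fc t : 0 <= t -> forall ep : R, 0 < ep -> exists2 d : R, 0 < d &
     forall s, 0 <= s -> `|s - t| < d -> aa (F s - F t) < ep.
  move=> t0 ep ep0; have e4 := divr_gt0 ep0 (ltr0n R 4).
  have /cvgrPdist_lt /(_ _ e4) /nbhs_ballP [d1 /= d10 Hd1] := flow_cvg HE (flow (tau - t) (nonl (x t))).
  have Hf h : `|h| < d1 -> aa (flow h (F t) - F t) < ep / 4.
    move=> hd; have := Hd1 h; rewrite /ball /= !sub0r !normrN => /(_ hd).
    by rewrite ger0_norm ?a20.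
  have A0 : 0 <= A by apply: le_trans (xA t0).
  have L0 : 0 < 4 * (36 * Ca H * A ^+ 2 + 1).
    by rewrite mulr_gt0 // ltr_wpDl // !mulr_ge0 ?sqr_ge0 // ltW // Ca0.
  have [d2 d20 Hd2] := x_continuous t0 (divr_gt0 ep0 L0).
  exists (Num.min d1 d2); first by rewrite lt_min d10.
  move=> s s0; rewrite lt_min => /andP [sd1 sd2].
  have h1 : aa (nonl (x s) - nonl (x t)) < ep / 4.
    rewrite nonl_a2; apply: le_lt_trans (cubic_a H (xA s0) (xA t0)) _.
    have := Hd2 s s0 sd2; rewrite ltr_pdivlMr // => h.
    have := a20 (x s - x t); rewrite ltr_pdivlMr //.
    have : 0 <= 36 * Ca H * A ^+ 2 by rewrite !mulr_ge0 ?sqr_ge0 // ltW // Ca0.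
    set L := 36 * _ * _ in h *; nra.
  apply: le_lt_trans (a2_triangle _ (flow (tau - s) (nonl (x t))) _) _.
  have h2 := flowB_le HE (tau - s) (nonl (x s)) (nonl (x t)).
  have h3 : aa (flow (tau - s) (nonl (x t)) - F t) < ep / 4.
    have -> : tau - s = (t - s) + (tau - t) by ring.
    have z := flowD HE (t - s) (tau - t) (nonl (x t)).
    set q := flow (t - s) (flow (tau - t) (nonl (x t))) in z.
    rewrite -(subrKA q) (bsqD ha2) z (nneg0 _ ha2 a20 z) mulr0 !add0r.
    by apply: Hf; rewrite distrC.
  rewrite /F; rewrite /F in h3; lra.
have t1 : 0 < (tau + 1) ^+ 2 by rewrite exprn_gt0 // ltr_wpDl.
(* The tolerance [eps / (2 (tau + 1)^2)] is multiplied by [tau ^+ 2] at the end; using [tau + 1]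
   avoids dividing by zero. *)
have [d d0 Hd] := @uniform_on_segment R (fun r s => aa (F r - F s)) tau tau0
   (fun r s => bsqBC ha2 (F r) (F s)) (fun r s t => a2_triangle (F r) (F s) (F t)) Fc _ (divr_gt0 eps0 (mulr_gt0 (ltr0n R 2) t1)).
exists d => // k p tag p0 pk Hp; cbv zeta; set w := (_ - (x tau - _)).
have pmono i : (i < k)%N -> p i <= p i.+1.
  by move=> hi; have [/andP [h1 h2] _] := Hp i hi; apply: le_trans h2.
have plow i : (i <= k)%N -> 0 <= p i.
  elim: i => [_|i IH hi]; first by rewrite p0.
  by apply: le_trans (pmono i hi); apply: IH; exact: ltnW.
have phigh i : (i <= k)%N -> p i <= tau.
  move=> hi; rewrite -pk -(subnKC hi).
  have : (i + (k - i) <= k)%N by rewrite subnKC.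
  elim: (k - i)%N => [|j IH]; first by rewrite addn0.
  rewrite addnS => hj; apply: le_trans (IH (ltnW hj)) _; exact: pmono.
pose ep := eps / (2 * (tau + 1) ^+ 2).
have ep0 : 0 < ep by rewrite divr_gt0 // mulr_gt0.
suff : aa w <= eps / 2 by lra.
apply: (a2_le HE) => n; rewrite -ip_sq.
apply: le_trans (_ : (tau * Num.sqrt ep) ^+ 2 <= _); last first.
  rewrite exprMn (sqr_sqrtr (ltW ep0)) /ep.
  have -> : tau ^+ 2 * (eps / (2 * (tau + 1) ^+ 2)) = (eps / 2) * (tau ^+ 2 / (tau + 1) ^+ 2).
    by field; rewrite gt_eqF // ltr_wpDl.
  apply: ler_piMr; first by rewrite divr_ge0 // ltW.
  by rewrite ler_pdivrMr // mul1r lerXn2r ?nnegrE ?addr_ge0 // lerDl.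
apply: self_bound; [exact: ip_ge0|by rewrite mulr_ge0 ?sqrtr_ge0|].
pose g r := ip n w (flow (tau - r) (x r)).
have gE : ip n w (x tau - flow tau (x 0)) = \sum_(i < k) (g (p i.+1) - g (p i)).
  rewrite -(big_mkord xpredT (fun i => g (p i.+1) - g (p i))) telescope_sumr // pk p0 /g !subr0 subrr.
  rewrite (bBr (bform_ip n)); congr (_ - _); rewrite /ip; apply: eq_bigr => i _.
  have [-> ->] := flowP HE 0 (x tau) i; rewrite mulr0 cos0 sin0; ring.
have ipE : ip n w w = \sum_(i < k) ((p i.+1 - p i) * ip n w (F (tag i)) - (g (p i.+1) - g (p i))).
  rewrite {2}/w (bBr (bform_ip n)) gE (b_sumr (bform_ip n)) -sumrB; apply: eq_bigr => i _.
  by rewrite (bZr (bform_ip n)).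
have tauE : tau = \sum_(i < k) (p i.+1 - p i).
  by rewrite -(big_mkord xpredT (fun i => p i.+1 - p i)) telescope_sumr // pk p0 subr0.
rewrite [leLHS]ipE {1}tauE mulrA [Num.sqrt (ip n w w) * _]mulrC -mulrA mulr_suml; apply: ler_sum => i _.
have hi := ltn_ord i; have [/andP [t0 t2] dd] := Hp i hi.
have := pmono i hi; rewrite le_eqVlt => /orP [/eqP ->|lt].
  by rewrite !subrr !mul0r subrr.
have [c /andP [c1 c2] Ec] := flow_mvt tau n w (plow i (ltnW hi)) lt.
have -> : g (p i.+1) - g (p i) = (p i.+1 - p i) * ip n w (F c).
  by rewrite /g -(bBr (bform_ip n)) Ec.
have ts0 : 0 <= p i.+1 - p i by rewrite subr_ge0 ltW.
rewrite -mulrBr -(bBr (bform_ip n)) ler_wpM2l //.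
apply: le_trans (ip_CS _ _ _) _; rewrite ler_wpM2l ?sqrtr_ge0 // ler_sqrt; last exact: ltW.
apply/ltW; apply: Hd.
- by have := plow i (ltnW hi); have := phigh i.+1 hi; lra.
- by have := plow i (ltnW hi); have := phigh i.+1 hi; lra.
- by rewrite ltr_norml; lra.
Qed.
End Duhamel.

(** * Lyapunov argument around the orbit of a stationary solution *)

Section Stability.
Context {R : realType} {E : lmodType R}.
Variables (l a : E -> E -> R) (e : nat -> E) (lam : nat -> R) (m : E -> E -> E -> E).
Hypothesis H : nls_space l a e lam m.
Let HE := ns_es H.
Let hl := es_l HE. Let l0 := es_l0 HE. Let ha := es_a HE. Let a0 := es_a0 HE.
Local Notation a2 := (a2 a).
Local Notation aa x := (a2 x x).
Local Notation l2 := (l2 l).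
Local Notation ll x := (l2 x x).
Local Notation cubic := (cubic m).
Local Notation quartic := (quartic l m).
Local Notation energy := (energy l a m).
Let ha2 := ha2 HE. Let hl2 := hl2 HE. Let a20 := a20 HE. Let l20 := l20 HE.
Implicit Types (u v w p q : E) (x y : E * E).

Definition T4 u v w q := l (m u v w) q.

Lemma T4_12 u v w q : T4 u v w q = T4 v u w q. by rewrite /T4 (ns_12 H). Qed.
Lemma T4_23 u v w q : T4 u v w q = T4 u w v q. by rewrite /T4 (ns_23 H). Qed.
Lemma T4_34 u v w q : T4 u v w q = T4 u v q w. by rewrite /T4 (ns_T H). Qed.

Lemma T4_lin (b c : R) u p v w q : T4 (b *: u + c *: p) v w q = b * T4 u v w q + c * T4 p v w q.
by rewrite /T4 (ns_D H) !(ns_Z H) (bDl hl) !(bZl hl). Qed.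

Section Mixed.
Variables u w : E.
Let t40 := T4 u u u u. Let t31 := T4 u u u w. Let t22 := T4 u u w w.
Let t13 := T4 u w w w. Let t04 := T4 w w w w.

(** By full symmetry of [T4] only the number of entries [w] matters. Rotation invariance of
    [quartic] and the energy expansion are both read off from this formula. *)
Lemma T4_mixed (b c d f : R) :
  T4 (b *: u + c *: w) (b *: u + c *: w) (d *: u + f *: w) (d *: u + f *: w) =
  b ^+ 2 * d ^+ 2 * t40 + (2 * b * c * d ^+ 2 + 2 * b ^+ 2 * d * f) * t31 +
  (b ^+ 2 * f ^+ 2 + c ^+ 2 * d ^+ 2 + 4 * b * c * d * f) * t22 +
  (2 * b * c * f ^+ 2 + 2 * c ^+ 2 * d * f) * t13 + c ^+ 2 * f ^+ 2 * t04.
have L2 v p q : T4 v (b *: u + c *: w) p q = b * T4 v u p q + c * T4 v w p q.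
  by rewrite T4_12 T4_lin !(T4_12 _ v).
have L3 v p q : T4 v p (d *: u + f *: w) q = d * T4 v p u q + f * T4 v p w q.
  by rewrite T4_23 T4_12 T4_lin !(T4_12 _ v) !(T4_23 v _ p).
have L4 v p q : T4 v p q (d *: u + f *: w) = d * T4 v p q u + f * T4 v p q w.
  by rewrite T4_34 L3 !(T4_34 v p _ q).
have a1 : T4 u u w u = t31 by rewrite T4_34.
have a2 : T4 u w u u = t31 by rewrite T4_23 a1.
have a3 : T4 w u u u = t31 by rewrite T4_12 a2.
have b1 : T4 u w u w = t22 by rewrite T4_23.
have b2 : T4 u w w u = t22 by rewrite T4_34 b1.
have b3 : T4 w u u w = t22 by rewrite T4_12 b1.
have b4 : T4 w u w u = t22 by rewrite T4_12 b2.
have b5 : T4 w w u u = t22 by rewrite T4_23 b4.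
have c1 : T4 w u w w = t13 by rewrite T4_12.
have c2 : T4 w w u w = t13 by rewrite T4_23 c1.
have c3 : T4 w w w u = t13 by rewrite T4_34 c2.
rewrite T4_lin !L2 !L3 !L4 a1 a2 a3 b1 b2 b3 b4 b5 c1 c2 c3 -/t40 -/t31 -/t22 -/t13 -/t04; ring.
Qed.
End Mixed.

Lemma quarticE x : quartic x = T4 x.1 x.1 x.1 x.1 + 2 * T4 x.1 x.1 x.2 x.2 + T4 x.2 x.2 x.2 x.2.
rewrite /Cubic.quartic /Modes.l2 /Cubic.cubic /= !(bDl hl) -!/(T4 _ _ _ _).
have -> : T4 x.2 x.2 x.1 x.1 = T4 x.1 x.1 x.2 x.2.
  by rewrite T4_23 T4_12 T4_34 T4_23.
ring.
Qed.

Definition rot (g : R) x : E * E := (cos g *: x.1 + sin g *: x.2, - sin g *: x.1 + cos g *: x.2).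

Lemma bform_rot b g x : bform b -> b (rot g x).1 (rot g x).1 + b (rot g x).2 (rot g x).2 = b x.1 x.1 + b x.2 x.2.
move=> hb; rewrite /rot /= !(bDl hb) !(bDr hb) !(bZl hb) !(bZr hb) (bC hb x.2 x.1).
transitivity ((cos g ^+ 2 + sin g ^+ 2) * (b x.1 x.1 + b x.2 x.2)); first ring.
by rewrite cos2Dsin2 mul1r.
Qed.

Lemma a2_rot g x : aa (rot g x) = aa x. exact: bform_rot. Qed.
Lemma l2_rot g x : ll (rot g x) = ll x. exact: bform_rot. Qed.

Lemma rotD g x y : rot g (x + y) = rot g x + rot g y.
by rewrite /rot /=; congr pair; rewrite !scalerDr addrACA. Qed.
Lemma rotB g x y : rot g (x - y) = rot g x - rot g y.
rewrite rotD; congr (_ + _); rewrite /rot /=; apply/pair_equal_spec; split => /=;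
by rewrite !scalerN opprD.
Qed.
Lemma rot_add g h x : rot g (rot h x) = rot (g + h) x.
rewrite /rot /= cosD sinD; congr pair; rewrite !scalerDr !scalerA addrACA -!scalerDl;
congr (_ *: _ + _ *: _); ring.
Qed.
Lemma rot0 x : rot 0 x = x.
by rewrite /rot cos0 sin0 oppr0 !scale0r !scale1r addr0 add0r; case: x. Qed.

Lemma quartic_rot g x : quartic (rot g x) = quartic x.
rewrite !quarticE /rot /=; set c := cos g; set s := sin g.
rewrite !T4_mixed; set A := T4 _ _ _ _; set B := T4 x.1 x.1 x.1 x.2; set C := T4 x.1 x.1 x.2 x.2.
set D := T4 x.1 x.2 x.2 x.2; set F := T4 x.2 x.2 x.2 x.2.
transitivity ((c ^+ 2 + s ^+ 2) ^+ 2 * (A + 2 * C + F)); first ring.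
by rewrite cos2Dsin2 expr1n mul1r.
Qed.

Lemma energy_rot g x : energy (rot g x) = energy x.
by rewrite /Cubic.energy quartic_rot a2_rot. Qed.

Lemma angle_exists (X Y : R) : 0 < X ^+ 2 + Y ^+ 2 ->
  exists g, cos g * Num.sqrt (X ^+ 2 + Y ^+ 2) = X /\ sin g * Num.sqrt (X ^+ 2 + Y ^+ 2) = Y.
move=> r20; set r := Num.sqrt _; have r0 : 0 < r by rewrite sqrtr_gt0.
have rr : r ^+ 2 = X ^+ 2 + Y ^+ 2 by rewrite sqr_sqrtr // ltW.
have h1 : (X / r) ^+ 2 + (Y / r) ^+ 2 = 1.
  by rewrite !expr_div_n -mulrDl -rr divff // expf_neq0 // gt_eqF.
have hX : -1 <= X / r <= 1.
  by rewrite -ler_norml; apply: sqr_le => //; rewrite normK2 // expr1n -h1 lerDl sqr_ge0.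
have hs : Num.sqrt (1 - (X / r) ^+ 2) = `|Y / r|.
  by rewrite -h1 addrAC subrr add0r sqrtr_sqr.
have [Y0|Y0] := leP 0 Y.
  exists (acos (X / r)); rewrite acosK ?in_itv //= sin_acos // hs (ger0_norm (divr_ge0 Y0 (ltW r0))) //.
  by rewrite !divfK ?gt_eqF.
exists (- acos (X / r)); rewrite cosN sinN acosK ?in_itv //= sin_acos // hs normrM ltr0_norm //.
have -> : `|r^-1| = r^-1 by rewrite gtr0_norm ?invr_gt0.
by split; field; rewrite gt_eqF.
Qed.

Variable phi : E.
Hypothesis phi_eq : forall v, a phi v = T4 phi phi phi v.
Variables (c K : R).
Hypotheses (c0 : 0 < c) (K0 : 0 <= K).
Hypothesis coercP : forall p, c * a p p - K * l p phi ^+ 2 <= a p p - 3 * T4 phi phi p p.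
Hypothesis coercM : forall q, c * a q q - K * l q phi ^+ 2 <= a q q - T4 phi phi q q.
Hypothesis phi_pos : 0 < l phi phi.
Let ph : E * E := (phi, 0).

(** The linear terms vanish by [phi_eq]; the quadratic ones split into the form of L+ on the first
    component and that of L- on the second. *)
Lemma energy_expand (z : E * E) : energy (ph + z) = energy ph +
  2^-1 * (a z.1 z.1 - 3 * T4 phi phi z.1 z.1) + 2^-1 * (a z.2 z.2 - T4 phi phi z.2 z.2)
  - (T4 phi z.1 z.1 z.1 + T4 phi z.1 z.2 z.2 + 4^-1 * quartic z).
rewrite /Cubic.energy !quarticE /Modes.a2 /= !add0r (b0l ha) !(bDl ha) !(bDr ha) (bC ha z.1) !phi_eq.
have E1 := T4_mixed phi z.1 1 1 1 1; rewrite !scale1r in E1; rewrite E1.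
have z1 v w q : T4 0 v w q = 0 by rewrite -(scale0r (0 : E)) -[_ *: _]addr0 -(scale0r (0 : E)) T4_lin !mul0r addr0.
have z2 v w q : T4 v w 0 q = 0 by rewrite T4_23 T4_12 z1.
have L v p q : T4 (phi + z.1) v p q = T4 phi v p q + T4 z.1 v p q.
  by have := T4_lin 1 1 phi z.1 v p q; rewrite !scale1r !mul1r.
by rewrite !z2 !L !(T4_12 phi (phi + z.1)) !(T4_12 z.1 (phi + z.1)) !L (T4_12 z.1 phi); field.
Qed.

Lemma T4_bound : exists2 B, 0 < B & forall u v w q A1 A2 A3 A4,
  0 <= A1 -> 0 <= A2 -> 0 <= A3 -> 0 <= A4 ->
  a u u <= A1 ^+ 2 -> a v v <= A2 ^+ 2 -> a w w <= A3 ^+ 2 -> a q q <= A4 ^+ 2 -> `|T4 u v w q| <= B * (A1 * A2 * A3 * A4).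
have [C C0 HC] := ns_a H; have [M M0 HM] := es_la HE.
exists (M * Num.sqrt C + 1); first by rewrite ltr_wpDl // mulr_ge0 ?sqrtr_ge0 // ltW.
move=> u v w q A1 A2 A3 A4 p1 p2 p3 p4 h1 h2 h3 h4.
have P0 : 0 <= A1 * A2 * A3 * A4 by rewrite !mulr_ge0.
apply: le_trans (_ : M * Num.sqrt C * (A1 * A2 * A3 * A4) <= _); last by rewrite ler_wpM2r // lerDl.
apply: sqr_le; first by rewrite !mulr_ge0 ?sqrtr_ge0 // ltW.
rewrite normK2 //; apply: le_trans (form_CS hl l0 _ _) _.
have k1 : l (m u v w) (m u v w) <= M * (C * (A1 ^+ 2 * A2 ^+ 2 * A3 ^+ 2)).
  apply: le_trans (HM _) _; rewrite ler_pM2l //; apply: le_trans (HC _ _ _) _; rewrite ler_pM2l //.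
  by rewrite ler_pM ?mulr_ge0 // ler_pM.
have k2 : l q q <= M * A4 ^+ 2 by apply: le_trans (HM _) _; rewrite ler_pM2l.
apply: le_trans (ler_pM _ _ k1 k2) _ => //.
have sC : Num.sqrt C ^+ 2 = C by rewrite sqr_sqrtr // ltW.
by rewrite -{1}sC le_eqVlt; apply/orP; left; apply/eqP; ring.
Qed.

Lemma rest_bound : exists2 B, 0 < B & forall z, aa z <= 1 ->
  `|T4 phi z.1 z.1 z.1 + T4 phi z.1 z.2 z.2 + 4^-1 * quartic z| <= B * Num.sqrt (aa z) ^+ 3 /\
  `|T4 phi phi z.1 z.1| <= B * aa z /\ `|T4 phi phi z.2 z.2| <= B * aa z.
have [B B0 HB] := T4_bound; pose P := Num.sqrt (a phi phi).
have P0 : 0 <= P by exact: sqrtr_ge0.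
have PP : P ^+ 2 = a phi phi by rewrite sqr_sqrtr.
exists (B * (2 * P + 1 + P ^+ 2)); first by rewrite mulr_gt0 //; have := sqr_ge0 P; lra.
move=> z z1; pose s := Num.sqrt (aa z); have s0 : 0 <= s by exact: sqrtr_ge0.
have ss : s ^+ 2 = aa z by rewrite sqr_sqrtr.
have s1 : s <= 1 by apply: sqr_le => //; rewrite ss expr1n.
have h1 : a z.1 z.1 <= s ^+ 2 by rewrite ss /Modes.a2 lerDl.
have h2 : a z.2 z.2 <= s ^+ 2 by rewrite ss /Modes.a2 lerDr.
have hp : a phi phi <= P ^+ 2 by rewrite PP.
rewrite -/s -ss; split; last first.
  have k1 := HB _ _ _ _ _ _ _ _ P0 P0 s0 s0 hp hp h1 h1; have k2 := HB _ _ _ _ _ _ _ _ P0 P0 s0 s0 hp hp h2 h2.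
  have Q : B * (P * P * s * s) <= B * (2 * P + 1 + P ^+ 2) * s ^+ 2.
    have -> : B * (P * P * s * s) = (B * P ^+ 2) * s ^+ 2 by ring.
    by rewrite ler_wpM2r ?sqr_ge0 // ler_pM2l //; lra.
  by split; [exact: le_trans k1 Q|exact: le_trans k2 Q].
have k1 := HB _ _ _ _ _ _ _ _ P0 s0 s0 s0 hp h1 h1 h1.
have k2 := HB _ _ _ _ _ _ _ _ P0 s0 s0 s0 hp h1 h2 h2.
have k3 := HB _ _ _ _ _ _ _ _ s0 s0 s0 s0 h1 h1 h1 h1.
have k4 := HB _ _ _ _ _ _ _ _ s0 s0 s0 s0 h1 h1 h2 h2.
have k5 := HB _ _ _ _ _ _ _ _ s0 s0 s0 s0 h2 h2 h2 h2.
have e1 : B * (P * s * s * s) = B * P * s ^+ 3 by ring.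
have e2 : B * (s * s * s * s) <= B * s ^+ 3.
  rewrite ler_pM2l //; have -> : s * s * s * s = s ^+ 3 * s by ring.
  by rewrite ler_piMr // exprn_ge0.
have e3 : 0 <= B * P ^+ 2 * s ^+ 3 by rewrite !mulr_ge0 ?exprn_ge0 // ltW.
rewrite quarticE; rewrite e1 in k1 k2.
have -> : B * (2 * P + 1 + P ^+ 2) * s ^+ 3 = 2 * (B * P * s ^+ 3) + B * s ^+ 3 + B * P ^+ 2 * s ^+ 3 by ring.
move: k1 k2 k3 k4 k5 e2 e3; set w := B * s ^+ 3; set w1 := B * P * s ^+ 3; set w2 := B * P ^+ 2 * s ^+ 3; set w3 := B * (s * s * s * s).
rewrite !ler_norml; lra.
Qed.

(** The phase is the polar angle of [(l phi (phi + w.1), l phi w.2)]: rotating it away makes the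
    second component orthogonal to [phi], which is the tangent direction of the orbit. *)
Lemma normalize_phase : exists B d : R, [/\ 0 < B, 0 < d & forall w : E * E, aa w < d ->
  exists g z, [/\ ph + w = rot g (ph + z), l z.2 phi = 0 & aa z <= B * aa w]].
have [M M0 HM] := es_la HE; pose L := l phi phi.
(* The radius [L / (4 M)] keeps the first polar coordinate above [L / 2], hence the cosine
   nonnegative and [1 - cos <= sin^2 <= 4 M aa w / L]. With [aa (rot g ph - ph) = 2 (1 - cos) a phi
   phi] and the factor 2 of [bsqD_le] this gives 16. *)
exists (2 + 16 * (a phi phi * M / L)), (L / (4 * M)).
have B0 : 0 < 2 + 16 * (a phi phi * M / L) by rewrite ltr_wpDr // mulr_ge0 // divr_ge0 ?mulr_ge0 // ltW.
split=> // [|w]; first by rewrite divr_gt0 // mulr_gt0.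
rewrite ltr_pdivlMr ?mulr_gt0 // => hw.
pose X := l phi (phi + w.1); pose Y := l phi w.2.
have Y2 : Y ^+ 2 <= L * (M * aa w).
  apply: le_trans (form_CS hl l0 _ _) _; rewrite ler_pM2l //; apply: le_trans (HM _) _.
  by rewrite ler_pM2l // /Modes.a2 lerDr.
have X2 : L / 2 <= X.
  have h1 : l phi w.1 ^+ 2 <= L * (M * aa w).
    apply: le_trans (form_CS hl l0 _ _) _; rewrite ler_pM2l //; apply: le_trans (HM _) _.
    by rewrite ler_pM2l // /Modes.a2 lerDl.
  rewrite /X (bDr hl) -/L; set p := l phi w.1 in h1 *.
  have h2 : p ^+ 2 <= (L / 2) ^+ 2 by apply: le_trans h1 _; have := phi_pos; rewrite -/L; nra.
  have : - p <= L / 2 by apply: sqr_le; rewrite ?sqrrN // divr_ge0 // ltW.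
  lra.
have Xp : 0 < X by apply: lt_le_trans X2; rewrite divr_gt0.
have r20 : 0 < X ^+ 2 + Y ^+ 2 by rewrite ltr_wpDr ?sqr_ge0 // exprn_gt0.
have [g [gX gY]] := angle_exists r20; set r := Num.sqrt _ in gX gY.
have r0 : 0 < r by rewrite sqrtr_gt0.
have rr : r ^+ 2 = X ^+ 2 + Y ^+ 2 by rewrite sqr_sqrtr // ltW.
pose y := rot g (ph + w); exists (- g), (y - ph).
rewrite [ph + (y - ph)]addrC subrK; split.
- by rewrite /y rot_add addNr rot0.
- rewrite /= subr0 (bC hl) (bDr hl) !(bZr hl) add0r -/X -/Y.
  have rn : r != 0 by rewrite gt_eqF.
  apply: (mulfI rn); rewrite mulr0.
  transitivity (- (sin g * r) * X + (cos g * r) * Y); first ring.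
  by rewrite gX gY; ring.
have -> : y - ph = rot g w + (rot g ph - ph) by rewrite /y rotD addrAC addrC addrA.
apply: le_trans (bsqD_le ha2 a20 _ _) _; rewrite (a2_rot g w) [leRHS]mulrDl; apply: lerD; first exact: lexx.
have c1 : cos g = X / r by rewrite -gX mulfK // gt_eqF.
have s1 : sin g = Y / r by rewrite -gY mulfK // gt_eqF.
have E1 : aa (rot g ph - ph) = 2 * (1 - cos g) * a phi phi.
  rewrite /Modes.a2 /rot /= !scaler0 !addr0 subr0 -[X in _ - X](scale1r phi) -scalerBl !(bZl ha) !(bZr ha).
  transitivity ((cos g ^+ 2 + sin g ^+ 2 + 1 - 2 * cos g) * a phi phi); first ring.
  by rewrite cos2Dsin2; ring.
rewrite E1.
have r1 : X <= r by apply: sqr_le; [exact: ltW|rewrite rr lerDl sqr_ge0].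
have cg0 : 0 <= cos g by rewrite c1 divr_ge0 // ltW.
have cg1 : cos g <= 1 by rewrite c1 ler_pdivrMr // mul1r.
have h3 : 1 - cos g <= sin g ^+ 2 by have := cos2Dsin2 g; nra.
have h4 : sin g ^+ 2 <= 4 * (M * aa w) / L.
  rewrite s1 expr_div_n ler_pdivrMr ?exprn_gt0 // mulrAC ler_pdivlMr //.
  have : (L / 2) ^+ 2 <= r ^+ 2 by rewrite lerXn2r ?nnegrE ?divr_ge0 ?(ltW r0) // ?(le_trans X2) // ltW.
  have w0 := a20 w; have Mw : 0 <= M * aa w by rewrite mulr_ge0 // ltW.
  have Lp : 0 < L := phi_pos; nra.
have : (1 - cos g) * a phi phi <= 4 * (M * aa w) / L * a phi phi by rewrite ler_wpM2r // (le_trans h3).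
have -> : 16 * (a phi phi * M / L) * aa w = 4 * (4 * (M * aa w) / L * a phi phi) by ring.
rewrite -mulrA mulrA; lra.
Qed.

(** The charge difference equals [2 l z.1 phi + ll z], so it controls the one direction in which the
    form of L+ may be negative; on the second component the direction [phi] is excluded by the
    choice of phase. [e0] is only an upper bound because energy may decrease. *)
Lemma lyapunov : exists s1 C : R, [/\ 0 < s1, 0 < C & forall z e0, aa z <= s1 -> l z.2 phi = 0 -> 0 <= e0 ->
  energy (ph + z) - energy ph <= e0 -> aa z <= C * (e0 + (ll (ph + z) - ll ph) ^+ 2)].
have [B B0 HB] := rest_bound; have [M M0 HM] := es_lM H.
(* [Q] gathers the coefficients of all terms of order at least three in the norm [t] of [z]; for
   [t <= s] they are absorbed by half of [c / 2 * t ^+ 2]. *)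
pose Q := K * M ^+ 2 / 4 + B; have Q0 : 0 < Q by rewrite /Q ltr_wpDl // divr_ge0 // mulr_ge0 ?sqr_ge0.
pose s := Num.min 1 (c / (4 * Q)); have s0 : 0 < s by rewrite lt_min ltr01 divr_gt0 // mulr_gt0.
have s1 : s <= 1 by rewrite ge_min lexx.
have sQ : s * Q <= c / 4.
  have : s <= c / (4 * Q) by rewrite ge_min lexx orbT.
  by rewrite ler_pdivlMr ?mulr_gt0 //; lra.
exists (s ^+ 2), ((4 + K) / c); split; [exact: exprn_gt0|by rewrite divr_gt0 // ltr_wpDr|].
move=> z e0 hz zo e00 hE; pose t := Num.sqrt (aa z).
have t0 : 0 <= t by exact: sqrtr_ge0.
have tt : t ^+ 2 = aa z by rewrite sqr_sqrtr.
have ts : t <= s by apply: sqr_le; [exact: ltW|rewrite tt].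
have z1 : aa z <= 1 by apply: le_trans hz _; rewrite expr_le1 // ltW.
have [k1 [k2 k3]] := HB z z1; rewrite -/t in k1.
have g1 := coercP z.1; have g2 := coercM z.2; rewrite zo expr0n /= mulr0 subr0 in g2.
pose dE := energy (ph + z) - energy ph; pose dQ := ll (ph + z) - ll ph.
rewrite -/dQ; rewrite -/dE in hE.
have EQ : dQ = 2 * l z.1 phi + ll z.
  rewrite /dQ (bsqD hl2) {2}/Modes.l2 /= (b0l hl) addr0 (bC hl phi); ring.
have EE : dE = 2^-1 * (a z.1 z.1 - 3 * T4 phi phi z.1 z.1) + 2^-1 * (a z.2 z.2 - T4 phi phi z.2 z.2)
  - (T4 phi z.1 z.1 z.1 + T4 phi z.1 z.2 z.2 + 4^-1 * quartic z).
  by rewrite /dE energy_expand; ring.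
have hl2z : ll z <= M * t ^+ 2 by rewrite tt; exact: HM.
have lz0 := l20 z.
have hsq : l z.1 phi ^+ 2 <= 2^-1 * (dQ ^+ 2 + M ^+ 2 * t ^+ 4).
  have e1 : 2 * l z.1 phi = dQ - ll z by rewrite EQ; ring.
  have e2 : (2 * l z.1 phi) ^+ 2 <= 2 * dQ ^+ 2 + 2 * (ll z) ^+ 2.
    by rewrite e1; have := sqr_ge0 (dQ + ll z); rewrite !expr2; lra.
  have e3 : ll z ^+ 2 <= M ^+ 2 * t ^+ 4.
    have -> : M ^+ 2 * t ^+ 4 = (M * t ^+ 2) ^+ 2 by ring.
    by rewrite lerXn2r ?nnegrE // mulr_ge0 ?sqr_ge0 // ltW.
  rewrite exprMn in e2; lra.
have hK : K * l z.1 phi ^+ 2 <= K * (2^-1 * (dQ ^+ 2 + M ^+ 2 * t ^+ 4)) by rewrite ler_wpM2l.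
have az : a z.1 z.1 + a z.2 z.2 = t ^+ 2 by rewrite tt.
have h1 : dE >= c / 2 * t ^+ 2 - K / 4 * dQ ^+ 2 - K * M ^+ 2 / 4 * t ^+ 4 - B * t ^+ 3.
  rewrite EE -az; move: k1; rewrite ler_norml => /andP [_ k1]; nra.
have t43 : t ^+ 4 <= t ^+ 3 by rewrite exprS ler_piMl ?exprn_ge0 // (le_trans ts).
have KM : 0 <= K * M ^+ 2 / 4 by rewrite divr_ge0 // mulr_ge0 ?sqr_ge0.
have h2 : K * M ^+ 2 / 4 * t ^+ 4 + B * t ^+ 3 <= Q * t ^+ 3.
  by rewrite /Q mulrDl lerD2r ler_wpM2l.
have h3 : Q * t ^+ 3 <= c / 4 * t ^+ 2.
  have -> : Q * t ^+ 3 = (t * Q) * t ^+ 2 by ring.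
  rewrite ler_wpM2r ?sqr_ge0 //; apply: le_trans sQ; by rewrite ler_wpM2r // ltW.
have h4 : c / 4 * t ^+ 2 <= dE + K / 4 * dQ ^+ 2 by lra.
rewrite -tt mulrC mulrA ler_pdivlMr // mulrC.
have d20 := sqr_ge0 dQ; have Ke : 0 <= K * e0 by rewrite mulr_ge0.
have Kd : K / 4 * dQ ^+ 2 = K * dQ ^+ 2 / 4 by ring.
rewrite Kd in h4; have -> : t ^+ 2 * c = 4 * (c / 4 * t ^+ 2) by field.
rewrite mulrDr !mulrDl; move: h4; set w1 := c / 4 * _; set w2 := K * dQ ^+ 2; set w3 := K * e0 in Ke *; set w4 := dQ ^+ 2 in d20 *; lra.
Qed.

Lemma energy_near : exists2 C : R, 0 < C & forall z, aa z <= 1 ->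
  `|energy (ph + z) - energy ph| + (ll (ph + z) - ll ph) ^+ 2 <= C * aa z.
have [B B0 HB] := rest_bound; have [M M0 HM] := es_lM H; pose L := l phi phi.
exists (1 + 4 * B + B + (8 * L * M + 2 * M ^+ 2)).
  have : 0 <= L * M by rewrite mulr_ge0 // ltW.
  by have := sqr_ge0 M; nra.
move=> z z1; have [k1 [k2 k3]] := HB z z1.
set t := Num.sqrt _ in k1; have t0 : 0 <= t by exact: sqrtr_ge0.
have tt : t ^+ 2 = aa z by rewrite sqr_sqrtr.
have t1 : t <= 1 by apply: sqr_le => //; rewrite tt expr1n.
have t3 : t ^+ 3 <= aa z by rewrite -tt exprS ler_piMl ?sqr_ge0.
rewrite mulrDl lerD //.
  have -> : energy (ph + z) - energy ph = 2^-1 * (a z.1 z.1 - 3 * T4 phi phi z.1 z.1) + 2^-1 * (a z.2 z.2 - T4 phi phi z.2 z.2)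
  - (T4 phi z.1 z.1 z.1 + T4 phi z.1 z.2 z.2 + 4^-1 * quartic z) by rewrite energy_expand; ring.
  have Bt : B * t ^+ 3 <= B * aa z by rewrite ler_pM2l.
  have az : aa z = a z.1 z.1 + a z.2 z.2 by [].
  have p1 := a0 z.1; have p2 := a0 z.2.
  have -> : (1 + 4 * B + B) * aa z = aa z + 5 * (B * aa z) by ring.
  have BA : 0 <= B * aa z by rewrite mulr_ge0 ?a20 // ltW.
  move: k1 k2 k3 Bt; set w1 := _ + _ + _ * quartic z; set w2 := T4 _ _ _ _; set w3 := T4 _ _ z.2 _.
  move: BA; set BAz := B * aa z; set Bt3 := B * t ^+ 3; move: az.
  by rewrite !ler_norml; lra.
have -> : ll (ph + z) - ll ph = 2 * l z.1 phi + ll z.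
  rewrite (bsqD hl2) {2}/Modes.l2 /= (b0l hl) addr0 (bC hl phi); ring.
have lz := HM z; have lz0 := l20 z.
have h1 : l z.1 phi ^+ 2 <= L * (M * aa z).
  apply: le_trans (form_CS hl l0 _ _) _; rewrite mulrC ler_pM2l //.
  by apply: le_trans lz; rewrite /Modes.l2 lerDl.
have h2 : ll z ^+ 2 <= M ^+ 2 * aa z.
  apply: le_trans (_ : (M * aa z) ^+ 2 <= _); first by rewrite lerXn2r ?nnegrE // mulr_ge0 ?a20 // ltW.
  by rewrite exprMn ler_pM2l ?exprn_gt0 // expr2 ler_piMr.
have := sqr_ge0 (2 * l z.1 phi - ll z).
have -> : (8 * L * M + 2 * M ^+ 2) * aa z = 8 * (L * (M * aa z)) + 2 * (M ^+ 2 * aa z) by ring.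
move: h1 h2; set w1 := L * _; set w2 := M ^+ 2 * _; rewrite !expr2; set p := l z.1 phi; set q := ll z; nra.
Qed.

(** Continuity argument: being in the tube of squared radius [eta] around the orbit already implies
    being in the smaller one of squared radius [kap], so the latter property is locally constant in
    time. *)
Theorem stability (eps : R) : 0 < eps -> exists2 d : R, 0 < d &
  forall x0, aa (x0 - ph) < d -> forall x : R -> E * E, x 0 = x0 ->
   (forall t, 0 <= t -> ll (x t) = ll x0) ->
   (forall t, 0 <= t -> energy (x t) <= energy x0) ->
   (forall t, 0 <= t -> forall ep : R, 0 < ep -> exists2 d : R, 0 < d &
      forall s, 0 <= s -> `|s - t| < d -> aa (x s - x t) < ep) ->
   forall t, 0 <= t -> exists g, aa (x t - rot g ph) < eps.
move=> eps0; have [B [d [B0 d0 Hd]]] := normalize_phase.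
have [s1 [C [s10 C0 HC]]] := lyapunov; have [C2 C20 HC2] := energy_near.
pose eta := Num.min d (s1 / B); have eta0 : 0 < eta by rewrite lt_min d0 divr_gt0.
(* With the triangle inequality with factors 2, a step of squared length [eta / 4] from within
   [kap <= eta / 8] stays below [eta]. *)
pose kap := Num.min (eps / 2) (eta / 8); have kap0 : 0 < kap by rewrite lt_min !divr_gt0.
have ke : kap <= eps / 2 by rewrite ge_min lexx.
have kh : kap <= eta / 8 by rewrite ge_min lexx orbT.
move: kap kap0 ke kh => kap kap0 ke kh.
exists (Num.min (Num.min 1 kap) (kap / (C * C2))).
  by rewrite !lt_min ltr01 kap0 divr_gt0 // mulr_gt0.
move=> x0; rewrite !lt_min => /andP [/andP [z1 zk] zC] x xx0 hch hen hct.
set z0 := x0 - ph in z1 zk zC; have x0E : x0 = ph + z0 by rewrite /z0 addrC subrK.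
have h0 := HC2 z0 (ltW z1); rewrite -x0E in h0.
set e0 := `|_| in h0; set dQ := ll x0 - _ in h0.
have hk : C * (e0 + dQ ^+ 2) <= kap.
  apply: le_trans (_ : C * (C2 * aa z0) <= _); first by rewrite ler_pM2l.
  by rewrite mulrA mulrC -ler_pdivlMr ?mulr_gt0 // ltW.
pose G t := exists g, aa (x t - rot g ph) <= kap.
(* The state is rotated back near [ph], its phase normalised, and the Lyapunov estimate applied to
   the remainder; charge and energy do not see the rotations. *)
have PG t : 0 <= t -> (exists g, aa (x t - rot g ph) < eta) -> G t.
  move=> t0 [g hg]; pose w := rot (- g) (x t) - ph.
  have wE : aa w = aa (x t - rot g ph).
    rewrite -(a2_rot (- g) (x t - rot g ph)) rotB rot_add addNr rot0 //.
  have wd : aa w < d by rewrite wE; apply: lt_le_trans hg _; rewrite ge_min lexx.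
  have [g' [z [wz zo az]]] := Hd w wd.
  have xtE : x t = rot (g + g') (ph + z).
    by rewrite -rot_add -wz /w [ph + _]addrC subrK rot_add subrr rot0.
  have as1 : aa z <= s1.
    apply: le_trans az _; rewrite wE mulrC -ler_pdivlMr //; apply: le_trans (ltW hg) _.
    by rewrite ge_min lexx orbT.
  have hE : energy (ph + z) - energy ph <= e0.
    apply: le_trans (_ : energy x0 - energy ph <= _); last exact: ler_norm.
    by rewrite lerD2r -(energy_rot (g + g')) -xtE; exact: hen.
  have := HC z e0 as1 zo (normr_ge0 _) hE.
  have -> : ll (ph + z) = ll x0 by rewrite -(l2_rot (g + g')) -xtE hch.
  rewrite -/dQ => h; exists (g + g'); rewrite xtE -rotB addrAC subrr add0r a2_rot.
  exact: le_trans hk.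
have PGs t s : 0 <= s -> aa (x s - x t) < eta / 4 -> G t -> G s.
  move=> s0 h [g hg]; apply: PG => //; exists g.
  have := bsqD_le ha2 a20 (x s - x t) (x t - rot g ph); rewrite addrA subrK; lra.
have GG : forall t, 0 <= t -> G t.
  apply: locally_constant_pred.
    by exists 0; rewrite rot0 xx0; exact: ltW.
  move=> t t0; have [d1 d10 Hd1] := hct t t0 _ (divr_gt0 eta0 (ltr0n R 4)).
  exists d1 => // s s0 st; have h := Hd1 s s0 st; split; last exact: PGs.
  by apply: PGs => //; rewrite bsqBC.
by move=> t t0; have [g hg] := GG t t0; exists g; apply: le_lt_trans hg _; lra.
Qed.

End Stability.

(** * Real-valued Lebesgue integrals *)

Section Integrals.
Context {R : realType}.
Implicit Types (f g : R -> R) (D : set R) (a b c : R).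

Definition ms D := @measurable _ (measurableTypeR R) D.
Definition mf f := measurable_fun [set: R] f.
Definition ig D f := (leb R).-integrable D (EFin \o f).
Definition I D f : R := \int[leb R]_(x in D) f x.

Lemma ms_itv (i : interval R) : ms [set` i]. exact: measurable_itv. Qed.
Lemma ms_T : ms setT. exact: measurableT. Qed.
Hint Resolve ms_itv ms_T : core.

Lemma ae_and (P Q : R -> Prop) : {ae leb R, forall x, P x} -> {ae leb R, forall x, Q x} ->
  {ae leb R, forall x, P x /\ Q x}.
by have F := ae_filter_ringOfSetsType (leb R) => hP hQ; apply: filterI. Qed.
Lemma ae_imp (P Q : R -> Prop) : (forall x, P x -> Q x) -> {ae leb R, forall x, P x} ->
  {ae leb R, forall x, Q x}.
by have F := ae_filter_ringOfSetsType (leb R) => h; apply: filterS. Qed.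
Lemma aeW (P : R -> Prop) : (forall x, P x) -> {ae leb R, forall x, P x}.
by have F := ae_filter_ringOfSetsType (leb R) => h; apply: nearW. Qed.

Lemma mfD f g : mf f -> mf g -> mf (fun x => f x + g x).
by move=> hf hg; exact: measurable_funD. Qed.
Lemma mfM f g : mf f -> mf g -> mf (fun x => f x * g x).
by move=> hf hg; exact: measurable_funM. Qed.
Lemma mfB f g : mf f -> mf g -> mf (fun x => f x - g x).
by move=> hf hg; exact: measurable_funB. Qed.
Lemma mfC c : mf (fun=> c).
exact: measurable_cst. Qed.
Lemma mfN f : mf f -> mf (fun x => - f x).
by move=> hf; apply: measurableT_comp => //; exact: oppr_measurable. Qed.
Lemma mfX f n : mf f -> mf (fun x => f x ^+ n).
by move=> hf; exact: measurable_funX. Qed.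
Lemma mf_abs f : mf f -> mf (fun x => `|f x|).
by move=> hf; exact: measurableT_comp. Qed.
Lemma mf_cont f : continuous f -> mf f.
by move=> hf; exact: continuous_measurable_fun. Qed.
Lemma mf_shift f c : mf f -> mf (fun x => f (x + c)).
move=> hf; apply: (measurableT_comp hf); apply: mf_cont => x.
by apply: cvgD; [exact: cvg_id|exact: cvg_cst].
Qed.

Lemma ig_eq D f g : (forall x, D x -> f x = g x) -> ig D f -> ms D -> ig D g.
move=> h i mD; apply: (@eq_integrable _ _ _ (leb R) D mD (EFin \o f)) i => x /set_mem Dx /=; by rewrite h.
Qed.
Lemma ig0 D : ig D (fun=> 0). exact: integrable0. Qed.
Lemma igD D f g : ms D -> ig D f -> ig D g -> ig D (fun x => f x + g x).
by move=> mD hf hg; refine (integrableD mD hf hg). Qed.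
Lemma igB D f g : ms D -> ig D f -> ig D g -> ig D (fun x => f x - g x).
by move=> mD hf hg; refine (integrableB mD hf hg). Qed.
Lemma igZ D f c : ms D -> ig D f -> ig D (fun x => c * f x).
by move=> mD hf; refine (integrableZl mD c hf). Qed.
Lemma ig_sub D D' f : ms D -> ms D' -> D' `<=` D -> ig D f -> ig D' f.
by move=> mD mD' h hf; refine (integrableS mD mD' h hf). Qed.
Lemma ig_abs D f : ms D -> ig D f -> ig D (fun x => `|f x|).
by move=> mD hf; refine (integrable_abse hf). Qed.
Lemma ig_le D f g : ms D -> mf f -> ig D g -> (forall x, D x -> `|f x| <= g x) -> ig D f.
move=> mD hf hg h; refine (le_integrable mD _ _ hg).
  by apply/measurable_EFinP; exact: measurable_funS hf.
move=> x Dx /=; rewrite lee_fin; apply: le_trans (h x Dx) (ler_norm _).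
Qed.
Lemma ig_itv_cont a b f : continuous f -> ig `[a, b] f.
move=> hf; apply: continuous_compact_integrable; first exact: segment_compact.
exact: continuous_subspaceT.
Qed.

Lemma I_eq D f g : (forall x, D x -> f x = g x) -> I D f = I D g.
by move=> h; apply: eq_Rintegral => x /set_mem /h. Qed.
Lemma I_D D f g : ms D -> ig D f -> ig D g -> I D (fun x => f x + g x) = I D f + I D g.
by move=> mD hf hg; exact: RintegralD. Qed.
Lemma I_B D f g : ms D -> ig D f -> ig D g -> I D (fun x => f x - g x) = I D f - I D g.
by move=> mD hf hg; exact: RintegralB. Qed.
Lemma I_Z D f c : ms D -> ig D f -> I D (fun x => c * f x) = c * I D f.
by move=> mD hf; exact: RintegralZl. Qed.
Lemma I_N D f : ms D -> ig D f -> I D (fun x => - f x) = - I D f.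
by move=> mD hf; rewrite -mulN1r -I_Z //; apply: I_eq => x _; rewrite mulN1r. Qed.
Lemma I_0 D : I D (fun=> 0) = 0.
by rewrite /I /Rintegral integral0. Qed.
Lemma I_ge0 D f : (forall x, D x -> 0 <= f x) -> 0 <= I D f.
by move=> h; exact: Rintegral_ge0. Qed.
Lemma I_le D f g : ms D -> ig D f -> ig D g -> (forall x, D x -> f x <= g x) -> I D f <= I D g.
by move=> mD hf hg h; exact: le_Rintegral. Qed.
Lemma I_abs D f : ms D -> ig D f -> `|I D f| <= I D (fun x => `|f x|).
by move=> mD hf; exact: le_normr_Rintegral. Qed.
Lemma I_abs_le D f g : ms D -> ig D f -> ig D g -> (forall x, D x -> `|f x| <= g x) ->
  `|I D f| <= I D g.
move=> mD hf hg h; apply: le_trans (I_abs mD hf) _; apply: I_le => //; exact: ig_abs.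
Qed.
Lemma I_cst a b c : a <= b -> I `[a, b] (fun=> c) = c * (b - a).
move=> ab; rewrite /I (Rintegral_cst (leb R) (measurable_itv `[a, b])).
congr (_ * _); transitivity (fine (if (a%:E < b%:E)%E then (b%:E - a%:E)%E else 0%E)).
  by congr fine; exact: (lebesgue_measure_itv `[a, b]).
rewrite lte_fin.
by move: ab; rewrite le_eqVlt => /orP[/eqP->|->]; rewrite ?ltxx ?subrr.
Qed.
Lemma I_cat a b c f : a <= b -> b <= c -> ig `[a, c] f -> I `[a, c] f = I `[a, b] f + I `[b, c] f.
move=> ab bc hf; have h : ig `]b, c] f.
  by apply: (ig_sub _ _ _ hf) => // x /=; rewrite !in_itv /= => /andP[xb ->]; rewrite andbT; apply: le_trans (ltW xb).
have := @Rintegral_itvB R f (BLeft a) (BRight c) b hf ab bc.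
rewrite (@Rintegral_itv_obnd_cbnd R b (BRight c) f h) /I => <-; ring.
Qed.
Lemma I_subset D D' f : ms D -> ms D' -> D' `<=` D -> ig D f ->
  (forall x, D x -> 0 <= f x) -> I D' f <= I D f.
move=> mD mD' h hf f0; rewrite /I /Rintegral fine_le //.
- by apply: integrable_fin_num => //; exact: (ig_sub mD mD' h hf).
- exact: integrable_fin_num.
- apply: ge0_subset_integral => //; first exact: (measurable_int (leb R) hf).
Qed.
Lemma I_ae D f g : ms D -> mf f -> mf g ->
  {ae leb R, forall x, f x = g x} -> I D f = I D g.
move=> mD hf hg h; rewrite /I /Rintegral; congr fine; apply: ae_eq_integral => //.
- by apply/measurable_EFinP; exact: measurable_funS hf.
- by apply/measurable_EFinP; exact: measurable_funS hg.
- by apply: ae_imp h => x -> _.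
Qed.
Lemma ig_ae D f g : ms D -> mf f -> mf g ->
  {ae leb R, forall x, f x = g x} -> ig D f -> ig D g.
move=> mD hf hg h /integrableP [_ i]; apply/integrableP; split.
  by apply/measurable_EFinP; exact: measurable_funS hg.
move: i; congr (_ < _)%E; apply: ae_eq_integral => //.
- by apply: measurableT_comp => //; apply/measurable_EFinP; exact: measurable_funS hf.
- by apply: measurableT_comp => //; apply/measurable_EFinP; exact: measurable_funS hg.
- by apply: ae_imp h => x /= -> _.
Qed.
Lemma I_eq0 D f : ms D -> mf f -> ig D f -> (forall x, D x -> 0 <= f x) -> I D f = 0 ->
  {ae leb R, forall x, D x -> f x = 0}.
move=> mD hf i f0 h0.
have mE : measurable_fun D (EFin \o f) by apply/measurable_EFinP; exact: measurable_funS hf.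
have /(ae_eq_integral_abs (leb R) mD mE) : (\int[leb R]_(x in D) `|(EFin \o f) x| = 0)%E.
  transitivity (\int[leb R]_(x in D) (f x)%:E)%E.
    by apply: eq_integral => x /set_mem Dx /=; rewrite ger0_norm // f0.
  by rewrite -[LHS]fineK ?integrable_fin_num //; congr EFin.
by apply: ae_imp => x /= h Dx; have := h Dx; case.
Qed.

End Integrals.
#[export] Hint Resolve ms_itv ms_T : core.

(** * Absolutely continuous functions with a chosen derivative *)

Section AbsoluteContinuity.
Context {R : realType}.
Implicit Types (u v g h : R -> R) (a b c : R).

Definition loc g := mf g /\ forall a b, ig `[a, b] g.
(** The derivative [g] is an everywhere defined datum, determined by [u] only almost everywhere. *)
Definition AC u g := loc g /\ forall a b, a <= b -> u b - u a = I `[a, b] g.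

Lemma cont_bounded u a b : continuous u -> exists2 M : R, 0 < M & forall x, a <= x <= b -> `|u x| <= M.
move=> uc; have [ab|ba] := leP a b; last by exists 1 => // x; lra.
have [|c _ H] := @EVT_max R (fun x => `|u x|) a b ab.
  by apply: cont_within => x; apply: cvg_norm; exact: uc.
exists (`|u c| + 1); first by rewrite ltr_wpDl.
by move=> x hx; apply: le_trans (H x _) _; rewrite ?in_itv // lerDl.
Qed.

Lemma loc_cont g : continuous g -> loc g.
by move=> gc; split; [exact: mf_cont|move=> a b; exact: ig_itv_cont]. Qed.
Lemma locD g h : loc g -> loc h -> loc (fun x => g x + h x).
by move=> [g1 g2] [h1 h2]; split=> [|a b]; [exact: mfD|exact: igD]. Qed.
Lemma locB g h : loc g -> loc h -> loc (fun x => g x - h x).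
by move=> [g1 g2] [h1 h2]; split=> [|a b]; [exact: mfB|exact: igB]. Qed.
Lemma loc_abs g : loc g -> loc (fun x => `|g x|).
by move=> [g1 g2]; split=> [|a b]; [exact: mf_abs|exact: ig_abs]. Qed.
Lemma locM u g : continuous u -> loc g -> loc (fun x => u x * g x).
move=> uc [g1 g2]; split=> [|a b]; first by apply: mfM => //; exact: mf_cont.
have [M M0 HM] := cont_bounded a b uc.
apply: (@ig_le _ _ _ (fun x => M * `|g x|)) => //.
- by apply: mfM => //; exact: mf_cont.
- by apply: igZ => //; exact: ig_abs.
by move=> x; rewrite /= in_itv /= => hx; rewrite normrM ler_wpM2r // HM.
Qed.
Lemma locZ c g : loc g -> loc (fun x => c * g x).
by apply: locM => x; exact: cst_continuous. Qed.

Lemma loc_intP g : loc g <-> locally_integrable setT g.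
split=> [[g1 g2]|[g1 _ g2]].
  split=> //; first exact: openT.
  move=> K _ cK; have [M [_ HM]] := compact_bounded cK.
  have KM : K `<=` `[- (`|M| + 1), `|M| + 1].
    move=> x /HM /= h; have := h (`|M| + 1); rewrite in_itv /= -ler_norml; apply.
    by apply: le_lt_trans (ler_norm M) _; rewrite ltrDl.
  have mK := compact_measurable cK.
  have /integrableP [_ h] := ig_sub (ms_itv _) mK KM (g2 (- (`|M| + 1)) (`|M| + 1)).
  by move: h; apply: le_lt_trans; apply: le_refl.
split=> // a b; apply/integrableP; split.
  by apply/measurable_EFinP; exact: measurable_funS g1.
have := g2 [set` `[a, b]] (@subsetT _ _) (@segment_compact _ a b).
by apply: le_lt_trans; apply: le_refl.
Qed.

Definition prim g x := if 0 <= x then I `[0, x] g else - I `[x, 0] g.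

Lemma prim_AC g : loc g -> AC (prim g) g.
move=> [g1 g2]; split=> // a b ab; rewrite /prim.
case: (leP 0 a) => a0; case: (leP 0 b) => b0; try lra.
- by rewrite (I_cat a0 ab (g2 _ _)); ring.
- by rewrite opprK (I_cat (ltW a0) b0 (g2 _ _)); ring.
- by rewrite (I_cat ab (ltW b0) (g2 _ _)); ring.
Qed.

Lemma AC_cont u g : AC u g -> continuous u.
move=> [[g1 g2] H] x; have ab : x - 1 < x + 1 by lra.
have /(continuous_within_itvP _ ab) [h _ _] :=
  parameterized_integral_continuous (ltW ab) (g2 (x - 1) (x + 1)).
have hx : {for x, continuous (fun y => parameterized_integral (leb R) (x - 1) y g)}.
  by apply: h; rewrite in_itv /=; lra.
apply/cvg_epsP => e e0; have /cvg_epsP /(_ e e0) [d d0 Hd] := hx.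
exists (Num.min d 1); first by rewrite lt_min d0 ltr01.
move=> y; rewrite lt_min => /andP [yd y1]; have {Hd} := Hd y yd.
have y1' : x - 1 <= y by move: y1; rewrite ltr_norml; lra.
rewrite /parameterized_integral -/(I _ _) -/(I _ _) -!H //; last lra.
by rewrite (_ : _ - _ - _ = u y - u x) //; ring.
Qed.

Lemma AC_ext u g u' g' : AC u g -> u =1 u' -> g =1 g' -> AC u' g'.
by move=> h /funext <- /funext <-. Qed.
Lemma AC_cst c : AC (fun=> c) (fun=> 0).
split; first by apply: loc_cont => x; exact: cst_continuous.
by move=> a b _; rewrite subrr I_0.
Qed.
Lemma ACD u g v h : AC u g -> AC v h -> AC (fun x => u x + v x) (fun x => g x + h x).
move=> [lg ug] [lh vh]; split; first exact: locD.
move=> a b ab; rewrite I_D //; [|exact: lg.2|exact: lh.2].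
by rewrite -ug // -vh //; ring.
Qed.
Lemma ACZ c u g : AC u g -> AC (fun x => c * u x) (fun x => c * g x).
move=> [lg ug]; split; first exact: locZ.
by move=> a b ab; rewrite I_Z //; [rewrite -ug // mulrBr|exact: lg.2].
Qed.

(** Replaces differentiation almost everywhere: for every [k > 0] the bound of increments of [u] by
    [k] times those of [v] propagates from [a] along the half-line. *)
Lemma const_of_small u v : (forall a b, a <= b -> v a <= v b) ->
  (forall x e : R, 0 < e -> exists2 d : R, 0 < d & forall y z, `|y - x| < d -> `|z - x| < d ->
     y <= z -> `|u z - u y| <= e * (v z - v y)) -> forall a b, a <= b -> u a = u b.
move=> nd H a b ab; apply/eqP; rewrite eq_sym -subr_eq0 -normr_le0; apply/ler_addgt0Pr => e e0.
rewrite add0r; have v0 : 0 <= v b - v a by rewrite subr_ge0 nd.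
have e1 : 0 < e / (v b - v a + 1) by rewrite divr_gt0 // ltr_wpDl.
set k := e / _ in e1; apply: (@le_trans _ _ (k * (v b - v a))); last first.
  by rewrite /k mulrAC ler_pdivrMr ?ltr_wpDl // ler_pM2l // lerDl.
have : forall t, 0 <= t -> forall r : R, 0 <= r <= t -> `|u (a + r) - u a| <= k * (v (a + r) - v a).
  apply: locally_constant_pred.
    by move=> r; rewrite -eq_le => /eqP <-; rewrite addr0 !subrr mulr0 normr0.
  move=> t t0; have [d d0 Hd] := H (a + t) k e1; exists d => // s s0 st.
  suff key p q : 0 <= p -> 0 <= q -> `|p - t| < d -> `|q - t| < d ->
      (forall r : R, 0 <= r <= p -> `|u (a + r) - u a| <= k * (v (a + r) - v a)) ->
      (forall r : R, 0 <= r <= q -> `|u (a + r) - u a| <= k * (v (a + r) - v a)).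
    by split; apply: key => //; rewrite subrr normr0.
  move=> p0 q0 pt qt hp r /andP [r0 rq]; have [rp|pr] := leP r p; first by apply: hp; rewrite r0.
  have h1 := hp p; have {h1} h1 : `|u (a + p) - u a| <= k * (v (a + p) - v a) by apply: h1; rewrite p0 /=.
  have h2 : `|u (a + r) - u (a + p)| <= k * (v (a + r) - v (a + p)).
    apply: Hd; last by rewrite lerD2l ltW.
      by rewrite (_ : _ - _ = p - t) //; ring.
    by rewrite (_ : _ - _ = r - t); [move: pt qt; rewrite !ltr_norml; lra|ring].
  rewrite (_ : _ - u a = (u (a + r) - u (a + p)) + (u (a + p) - u a)); last by ring.
  by apply: le_trans (ler_normD _ _) _; move: h1 h2; rewrite !mulrBr; lra.
move=> /(_ (b - a)); rewrite subr_ge0 => /(_ ab (b - a)).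
by rewrite [a + _]addrC subrK; apply; rewrite subr_ge0 ab lexx.
Qed.

(** [u v] minus the primitive of the expected derivative is constant by [const_of_small], the
    control function being a primitive of [|g| + |h|]. *)
Lemma ACM u g v h : AC u g -> AC v h ->
  AC (fun x => u x * v x) (fun x => g x * v x + u x * h x).
move=> ug vh; have uc := AC_cont ug; have vc := AC_cont vh; case: (ug) => lg Hu; case: (vh) => lh Hv.
have lF : loc (fun x => g x * v x + u x * h x).
  by apply: locD; [under eq_fun do rewrite mulrC|]; exact: locM.
have [_ HP] := prim_AC lF; have [_ HG] := prim_AC (locD (loc_abs lg) (loc_abs lh)).
split=> // a b ab; set w := fun x => _.
set P := prim _ in HP; set G := prim _ in HG.
suff : u a * v a - P a = u b * v b - P b by have := HP a b ab; lra.
apply: (@const_of_small (fun x => u x * v x - P x) G) => //.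
  move=> y z yz; rewrite -subr_ge0 HG //; apply: I_ge0 => x _; exact: addr_ge0.
move=> x e e0; have e2 : 0 < e / 2 by rewrite divr_gt0.
have /cvg_epsP /(_ _ e2) [d d0 Hd] := uc x.
have /cvg_epsP /(_ _ e2) [d' d0' Hd'] := vc x.
exists (Num.min d d'); first by rewrite lt_min d0.
move=> y z; rewrite !lt_min => /andP [y1 y2] /andP [z1 z2] yz.
have osc (s : R) : y <= s <= z -> `|u z - u s| <= e /\ `|v y - v s| <= e.
  move=> hs; have s1 : `|s - x| < d by move: y1 z1; rewrite !ltr_norml; lra.
  have s2 : `|s - x| < d' by move: y2 z2; rewrite !ltr_norml; lra.
  move: (Hd z z1) (Hd s s1) (Hd' y y2) (Hd' s s2); rewrite !ltr_norml !ler_norml; lra.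
(* Freezing [u] at the right end and [v] at the left end of [[y, z]] leaves only their oscillations,
   which are small by continuity. *)
have E : u z * v z - P z - (u y * v y - P y) =
    I `[y, z] (fun s => (u z - u s) * h s + (v y - v s) * g s).
  transitivity (I `[y, z] (fun s => (u z * h s + v y * g s) - (g s * v s + u s * h s))); last first.
    by apply: I_eq => s _; ring.
  rewrite I_B //; [|by apply: igD => //; apply: igZ => //; [exact: lh.2|exact: lg.2]|exact: lF.2].
  rewrite -HP // I_D //; [|by apply: igZ => //; exact: lh.2|by apply: igZ => //; exact: lg.2].
  rewrite !I_Z //; [|exact: lg.2|exact: lh.2].
  by rewrite -Hu // -Hv //; ring.
rewrite E HG // -I_Z //; last by apply: igD => //; apply: ig_abs => //; [exact: lg.2|exact: lh.2].
have cB k w' : continuous w' -> continuous (fun s : R => k - w' s : R).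
  by move=> wc s; apply: continuousB; [exact: cst_continuous|exact: wc].
apply: I_abs_le => //.
- by apply: (locD (locM (cB _ _ uc) lh) (locM (cB _ _ vc) lg)).2.
- by apply: igZ => //; apply: igD => //; apply: ig_abs => //; [exact: lg.2|exact: lh.2].
move=> s /=; rewrite in_itv /= => hs; have [q1 q2] := osc s hs.
apply: le_trans (ler_normD _ _) _.
by rewrite !normrM mulrDr addrC lerD // ler_wpM2r.
Qed.

Lemma AC_deriv_leb u g x : AC u g -> lebesgue_pt g x -> is_derive x 1 u (g x).
move=> [[g1 g2] H] gx; have hx : x < x + 1 by lra.
have [|d1 d2] := @FTC1_lebesgue_pt R g (BLeft (x - 1)) x (x + 1) hx (g2 _ _) _ gx.
  by rewrite /Order.lt /=; lra.
have h : is_derive x 1 (fun y => u (x - 1) + I `[x - 1, y] g) (g x).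
  have {d1 d2} h : is_derive x 1 (fun y => I `[x - 1, y] g) (g x).
    by apply: DeriveDef; [exact: d1|rewrite -derive1E; exact: d2].
  by have d0 := is_derive_cst (u (x - 1)) x (1 : R); rewrite -[g x]add0r; apply: is_deriveD.
apply: near_eq_is_derive h; apply/nbhs_ballP; exists 1 => //= y; rewrite /ball /= ltr_norml => hy.
rewrite -H; [ring|lra].
Qed.

Lemma AC_deriv u g x : AC u g -> {for x, continuous g} -> is_derive x 1 u (g x).
move=> ug gx; apply: AC_deriv_leb (ug) _; case: ug => [[mg _] _].
by apply: (@continuous_lebesgue_pt _ g x setT) => //; split; [exact: openT|].
Qed.

Lemma AC_C1 u g : (forall x : R, is_derive x 1 u (g x)) -> continuous g -> AC u g.
move=> ud gc; split; first exact: loc_cont.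
move=> a b; rewrite le_eqVlt => /orP [/eqP <-|ab].
  by rewrite subrr /I set_itv1 Rintegral_set1.
have uc : continuous u by move=> x; apply: (is_derive_cont (ud x)).
have := @continuous_FTC2 R g u a b ab (cont_within gc).
have D : derivable_oo_LRcontinuous u a b.
  split; [by move=> x _; case: (ud x)| |].
  - by apply: cvg_at_right_filter; exact: uc.
  - by apply: cvg_at_left_filter; exact: uc.
move=> /(_ D) h; rewrite /I /Rintegral h //.
by move=> x _; rewrite derive1E; case: (ud x).
Qed.

(** The zero function is a primitive of [g - h], and at each Lebesgue point its derivative is the
    value of [g - h]. *)
Lemma AC_uniq u g h : AC u g -> AC u h -> {ae leb R, forall x, g x = h x}.
move=> [lg Hg] [lh Hh]; have ld := locB lg lh.
have /loc_intP /lebesgue_differentiation := ld.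
apply: ae_imp => x hx; have A0 : AC (fun=> 0) (fun x => g x - h x).
  split=> // a b ab; rewrite subrr I_B //; [|exact: lg.2|exact: lh.2].
  by rewrite -Hg // -Hh // subrr.
have [_ E] := AC_deriv_leb A0 hx; apply/eqP; rewrite -subr_eq0 -E; apply/eqP.
by have [_ ->] := is_derive_cst (0 : R) x (1 : R).
Qed.

End AbsoluteContinuity.

(** * Smooth functions of compact support *)

Section Bump.
Context {R : realType}.
Implicit Types (f g u w : R -> R) (x a b c d r : R) (n : nat).

(** The family [x^-n exp (-1/x)] is closed under differentiation up to linear combinations, which
    spares the computation of the higher derivatives of [exp (-1/x)]. *)
Definition flat n x := if 0 < x then x^-1 ^+ n * expR (- x^-1) else 0.

Lemma flat_ge0 n x : 0 <= flat n x.
by rewrite /flat; case: ltP => // x0; rewrite mulr_ge0 ?expR_ge0 // exprn_ge0 // invr_ge0 ltW. Qed.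

Lemma pow_expRN n x : 0 <= x -> x ^+ n.+1 * expR (- x) <= (n.+1)`!%:R.
move=> x0; have := expR_ge1Dxn n x0; rewrite expRN ler_pdivrMr ?expR_gt0 // => h.
have f0 : 0 < (n.+1)`!%:R :> R by rewrite ltr0n fact_gt0.
by rewrite mulrC -ler_pdivrMr //; apply: le_trans h; rewrite lerDr.
Qed.

(** A quadratic bound at 0 is what makes the derivative vanish there. *)
Lemma flat_bound n x : flat n x <= (n.+2)`!%:R * x ^+ 2.
rewrite /flat; case: ltP => x0; last by rewrite mulr_ge0 ?sqr_ge0.
have h := @pow_expRN n.+1 x^-1; rewrite invr_ge0 (ltW x0) in h; have {}h := h isT.
have -> : x^-1 ^+ n * expR (- x^-1) = (x^-1 ^+ n.+2 * expR (- x^-1)) * x ^+ 2.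
  by rewrite 2!exprS; field; rewrite gt_eqF.
by rewrite ler_wpM2r // sqr_ge0.
Qed.

Lemma flat_derive n x : is_derive x 1 (flat n) (flat n.+2 x - n%:R * flat n.+1 x).
have [x0|x0|x0] := ltrgtP x 0.
- have -> : flat n.+2 x - n%:R * flat n.+1 x = 0.
    by rewrite /flat (ltNge 0 x) (ltW x0) /= mulr0 subrr.
  apply: near_eq_is_derive (is_derive_cst (0 : R) x (1 : R)).
  apply/nbhs_ballP; exists (- x); first by rewrite /= oppr_gt0.
  move=> y; rewrite /ball /= ltr_norml /flat => hy.
  by case: ltP => // y0; lra.
- have -> : flat n.+2 x - n%:R * flat n.+1 x =
     (- (n%:R * x^-1 ^+ n.+1) + x^-1 ^+ n.+2) * expR (- x^-1).
    by rewrite /flat x0; ring.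
  have xn : x != 0 by rewrite gt_eqF.
  have d1 : is_derive x 1 (fun y : R => y^-1) (- x ^- 2).
    by have := @is_deriveV R id x 1 1 xn (is_derive_id _ _); rewrite /GRing.scale /= mulr1.
  have d2 : is_derive x 1 (fun y : R => y^-1 ^+ n) ((n%:R * x^-1 ^+ n.-1) * - x ^- 2).
    have := is_deriveX n d1; congr (is_derive _ _ _ _).
    by apply/funext => y; rewrite exprfctE.
  have d3 : is_derive x 1 (fun y => expR (- y^-1)) (expR (- x^-1) * x ^- 2).
    apply: (@is_derive1_comp _ expR (fun y => - y^-1)).
    by rewrite -[x ^- 2]opprK; apply: is_deriveN.
  have d5 : is_derive x 1 (fun y : R => y^-1 ^+ n * expR (- y^-1))
      ((- (n%:R * x^-1 ^+ n.+1) + x^-1 ^+ n.+2) * expR (- x^-1)).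
    apply: is_derive_eq (is_deriveM d2 d3) _; rewrite /GRing.scale /= -[x ^- 2]exprVn.
    by case: n {d2} => [|n] /=; rewrite ?expr0 !exprS ?expr0; ring.
  apply: near_eq_is_derive d5.
  apply/nbhs_ballP; exists x => //.
  move=> y; rewrite /ball /= ltr_norml /flat => hy.
  by case: ltP => // y0; lra.
rewrite x0; have -> : flat n.+2 0 - n%:R * flat n.+1 0 = 0 by rewrite /flat ltxx mulr0 subrr.
apply/is_derive1_epsP => e e0; have F0 : 0 < (n.+2)`!%:R :> R by rewrite ltr0n fact_gt0.
exists (e / (n.+2)`!%:R); first exact: divr_gt0.
move=> h he; rewrite add0r mul0r {2}/flat ltxx !subr0 (ger0_norm (flat_ge0 _ _)).
apply: le_trans (flat_bound n h) _; rewrite -normK2 // expr2 mulrA ler_wpM2r //.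
by rewrite mulrC -ler_pdivlMr // ltW.
Qed.

(** A class of functions closed under differentiation, so that smoothness follows by induction on
    the order. *)
Inductive bumpy : (R -> R) -> Prop :=
| bumpy_flat n c d : bumpy (fun x => flat n (c * x + d))
| bumpy_cst c : bumpy (fun=> c)
| bumpyD f g : bumpy f -> bumpy g -> bumpy (fun x => f x + g x)
| bumpyM f g : bumpy f -> bumpy g -> bumpy (fun x => f x * g x).

Lemma bumpy_derive f : bumpy f -> exists2 g, bumpy g & forall x, is_derive x 1 f (g x).
elim=> [n c d|c|{}f g _ [f' bf Hf] _ [g' bg Hg]|{}f g bf0 [f' bf Hf] bg0 [g' bg Hg]].
- exists (fun x => (flat n.+2 (c * x + d) + (- n%:R) * flat n.+1 (c * x + d)) * c).
    by repeat constructor.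
  move=> x; apply: (@is_derive1_comp _ (flat n) (fun x => c * x + d)).
    by apply: is_derive_eq (flat_derive n _) _; rewrite mulNr.
  have h : is_derive x 1 (fun x : R => c * x) c.
    by apply: is_derive_eq; rewrite /GRing.scale /= mulr1.
  by have d0 := is_derive_cst d x (1 : R); rewrite -[c in is_derive _ _ _ c]addr0; apply: is_deriveD.
- by exists (fun=> 0); [constructor|move=> x; exact: is_derive_cst].
- by exists (fun x => f' x + g' x); [constructor|move=> x; apply: is_deriveD].
exists (fun x => f x * g' x + g x * f' x); first by repeat constructor.
by move=> x; apply: is_deriveM.
Qed.

Lemma bumpy_cont f : bumpy f -> continuous f.
by move=> /bumpy_derive [g _ h] x; apply: is_derive_cont (h x). Qed.

Lemma bumpy_derive1n f n : bumpy f -> bumpy (derive1n n f).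
elim: n f => [|n IH] f bf //; rewrite derive1Sn; apply: IH.
have [g bg hg] := bumpy_derive bf; suff -> : (derive1 f) = g by [].
by apply/funext => x; rewrite derive1E; case: (hg x).
Qed.

Lemma smooth_primitive u f : bumpy f -> (forall x, is_derive x 1 u (f x)) -> smooth u.
move=> bf hu [|n] x; first by rewrite derive1n0; case: (hu x).
rewrite derive1Sn (_ : (derive1 u) = f); last by apply/funext => y; rewrite derive1E; case: (hu y).
by have [g _ hg] := bumpy_derive (bumpy_derive1n n bf); case: (hg x).
Qed.

(** The arguments are [1 + (x - a) / r] and [1 - (x - a) / r], so that one factor vanishes outside
    the interval of radius [r] around [a]. *)
Definition bump a r x := flat 0 (r^-1 * x + (1 - a / r)) * flat 0 (- r^-1 * x + (1 + a / r)).

Lemma bump_bumpy a r : bumpy (bump a r). by repeat constructor. Qed.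

Lemma flat0_le1 x : flat 0 x <= 1.
rewrite /flat; case: ltP => // x0; rewrite expr0 mul1r -expR0 ler_expR oppr_le0 invr_ge0.
exact: ltW.
Qed.

Lemma bump_range a r x : 0 <= bump a r x <= 1.
by rewrite mulr_ge0 ?flat_ge0 //= mulr_ile1 ?flat_ge0 ?flat0_le1. Qed.

Lemma bump_supp a r x : 0 < r -> r <= `|x - a| -> bump a r x = 0.
move=> r0 h; rewrite /bump; have E1 : r^-1 * x + (1 - a / r) = (r + (x - a)) / r by field; rewrite gt_eqF.
have E2 : - r^-1 * x + (1 + a / r) = (r - (x - a)) / r by field; rewrite gt_eqF.
rewrite E1 E2; move: h; rewrite ler_normr => /orP [h|h].
  rewrite [X in _ * X]/flat ltNge (_ : _ <= 0) ?mulr0 //.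
  by rewrite pmulr_lle0 ?invr_gt0 //; lra.
rewrite /flat ltNge (_ : _ <= 0) ?mul0r //.
by rewrite pmulr_lle0 ?invr_gt0 //; lra.
Qed.

Lemma bump_lower a r x : 0 < r -> `|x - a| <= r / 2 -> expR (- 4) <= bump a r x.
move=> r0; rewrite ler_norml => h; rewrite /bump.
have E1 : r^-1 * x + (1 - a / r) = (r + (x - a)) / r by field; rewrite gt_eqF.
have E2 : - r^-1 * x + (1 + a / r) = (r - (x - a)) / r by field; rewrite gt_eqF.
have F y : 2^-1 <= y -> expR (- 2) <= flat 0 y.
  move=> y2; have y0 : 0 < y by apply: lt_le_trans y2; rewrite invr_gt0.
  rewrite /flat y0 expr0 mul1r ler_expR lerN2 -[2]invrK lef_pV2 ?posrE ?invr_gt0 //.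
have -> : - 4 = - 2 + - 2 :> R by ring.
rewrite expRD E1 E2; apply: ler_pM; rewrite ?expR_ge0 //; apply: F;
by rewrite ler_pdivlMr //; lra.
Qed.

Lemma bump_mass a r : 0 < r -> r * expR (- 4) <= I `[a - r, a + r] (bump a r).
move=> r0; have c := bumpy_cont (bump_bumpy a r).
apply: le_trans (_ : I `[a - r / 2, a + r / 2] (bump a r) <= _); last first.
  apply: I_subset => //; [|exact: ig_itv_cont|by move=> x _; case/andP: (bump_range a r x)].
  by move=> x /=; rewrite !in_itv /=; lra.
have <- : I `[a - r / 2, a + r / 2] (fun=> expR (- 4)) = r * expR (- 4).
  by rewrite I_cst; [field|lra].
apply: I_le => //; [by apply: ig_itv_cont => x; exact: cst_continuous|exact: ig_itv_cont|].
by move=> x /=; rewrite in_itv /= => hx; apply: bump_lower => //; rewrite ler_norml; lra.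
Qed.

End Bump.

(** * Weak derivatives and absolutely continuous representatives *)

Section WeakDerivative.
Context {R : realType}.
Implicit Types (f g u w v h phi : R -> R) (x a b c d r M : R).

Lemma I_supp M f : (forall x, M < `|x| -> f x = 0) -> \int[leb R]_x f x = I `[- M, M] f.
move=> h; rewrite /I [RHS]Rintegral_mkcond; apply: eq_Rintegral => x _.
rewrite patchE; case: ifPn => //; rewrite notin_setE /= in_itv /= => /negP.
by rewrite -ler_norml -ltNge => /h.
Qed.

Lemma test_AC phi : test_function phi -> AC phi (derive1 phi).
move=> [sm _]; have d1 x : derivable phi x 1 by have := sm 0%N x; rewrite derive1n0.
have d2 x : derivable (derive1 phi) x 1 by have := sm 1%N x; rewrite derive1n1.
apply: AC_C1.
  by move=> x; rewrite derive1E; apply: DeriveDef.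
by move=> x; apply: differentiable_continuous; apply/derivable1_diffP.
Qed.

Lemma test_supp phi : test_function phi ->
  exists2 M : R, 0 < M & forall x, M < `|x| -> phi x = 0 /\ derive1 phi x = 0.
move=> [sm cp]; have [M [_ HM]] := compact_bounded cp.
have M1 : M < `|M| + 1 by apply: le_lt_trans (ler_norm _) _; rewrite ltrDl.
exists (`|M| + 1); first by rewrite ltr_wpDl.
have z x : `|M| + 1 < `|x| -> phi x = 0.
  move=> hx; apply/eqP/negPn/negP => n0.
  by have := HM _ M1 x (@subset_closure _ [set y | phi y != 0] x n0); rewrite /= leNgt hx.
move=> x hx; split; first exact: z.
have h : is_derive x 1 phi 0.
  apply: near_eq_is_derive (is_derive_cst (0 : R) x (1 : R)).
  apply/nbhs_ballP; exists (`|x| - (`|M| + 1)); first by rewrite /= subr_gt0.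
  move=> y; rewrite /ball /= => hy; rewrite z //.
  by have := ler_distD y x 0; rewrite !subr0; lra.
by rewrite derive1E; case: h.
Qed.

Lemma AC_weak u g : AC u g -> weak_deriv u g.
move=> ug; have uc := AC_cont ug; split.
- by apply/loc_intP; exact: loc_cont.
- by apply/loc_intP; case: ug.
move=> phi tp; have [M M0 HM] := test_supp tp; have ap := test_AC tp.
have M' : - (M + 1) <= M + 1 by lra.
have [_ /(_ _ _ M')] := ACM ug ap.
have z : M < `|M + 1| by rewrite ger0_norm; lra.
have z' : M < `|- (M + 1)| by rewrite normrN.
rewrite (HM _ z).1 (HM _ z').1 !mulr0 subrr => /esym.
have l1 : loc (fun x => g x * phi x).
  by under eq_fun do rewrite mulrC; apply: locM; [exact: AC_cont ap|case: ug].
have l2 : loc (fun x => u x * derive1 phi x) by apply: locM => //; case: ap.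
rewrite I_D //; [|exact: l1.2|exact: l2.2].
rewrite -!(I_supp (M := M + 1)).
- by move=> h; apply/eqP; rewrite -addr_eq0 addrC; apply/eqP.
- by move=> x hx; rewrite (HM _ _).2 ?mulr0 //; lra.
- by move=> x hx; rewrite (HM _ _).1 ?mulr0 //; lra.
Qed.

Lemma lebesgue_pt_avg w a : loc w -> lebesgue_pt w a -> forall e : R, 0 < e ->
  exists2 r : R, 0 < r & I `[a - r, a + r] (fun x => `|w x - w a|) <= e * r.
move=> lw hw e e0.
have N : nbhs (0 : \bar R)%E [set y | (y < (e / 4)%:E)%E].
  by apply: (@nbhs_open_ereal_lt _ 0 (fun=> e / 4)); rewrite divr_gt0.
have [r r0 hr] : exists2 r : R, 0 < r & (davg w a r < (e / 4)%:E)%E.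
  near ((0 : R)^'+) => r; exists r; near: r; [exact: nbhs_right_gt|exact: (hw _ N)].
(* The closed interval of radius [r / 2] lies in the open ball of radius [r]; [e / 4] times the
   length [2 r] of that ball is [e] times [r / 2]. *)
exists (r / 2); first exact: divr_gt0.
have mB : ms (ball a r) by rewrite ball_itv.
have ci : ig (ball a r) (fun x => `|w x - w a|).
  rewrite ball_itv; apply: (ig_sub (ms_itv `[a - r, a + r])) => //.
    by move=> x /=; rewrite !in_itv /=; lra.
  by apply: (loc_abs (locB lw _)).2; apply: loc_cont => x; exact: cst_continuous.
apply: (@le_trans _ _ (I (ball a r) (fun x => `|w x - w a|))).
  apply: I_subset => //; rewrite ball_itv => x /=; rewrite !in_itv /=; lra.
move: hr; rewrite /davg /iavg lebesgue_measure_ball ?(ltW r0) //.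
have -> : (\int[leb R]_(y in ball a r) `|((center (w a) \o w) y)%:E|)%E =
    (I (ball a r) (fun x => `|w x - w a|))%:E.
  by rewrite /I /Rintegral fineK //; exact: integrable_fin_num.
have r2 : 0 < r *+ 2 by rewrite mulrn_wgt0.
rewrite inver gt_eqF // -EFinM lte_fin ltr_pdivrMl // => h; apply: le_trans (ltW h) _.
by rewrite -mulr_natr; lra.
Unshelve. all: by end_near. Qed.

(* du Bois-Reymond: the averages of [w] against all bumps coincide, and they
   converge to [w a] at every Lebesgue point [a]. *)
Lemma weak_deriv0 w : loc w ->
  (forall phi, test_function phi -> \int[leb R]_x (w x * derive1 phi x) = 0) ->
  exists c, {ae leb R, forall x, w x = c}.
move=> lw Hw; pose m a r := I `[a - r, a + r] (bump a r).
have m0 a r : 0 < r -> 0 < m a r.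
  by move=> r0; apply: lt_le_trans (bump_mass a r0); rewrite mulr_gt0 ?expR_gt0.
have [av avE] : exists av : R -> R -> R, forall a r,
    av a r = I `[a - r, a + r] (fun x => w x * bump a r x) / m a r.
  by exists (fun a r => I `[a - r, a + r] (fun x => w x * bump a r x) / m a r).
have bc a r := bumpy_cont (bump_bumpy a r).
have full (f : R -> R) a r M : 0 < r -> `|a| + r <= M -> loc f -> (forall x, r <= `|x - a| -> f x = 0) ->
    I `[- M, M] f = I `[a - r, a + r] f.
  move=> r0 hM lf hf; have h1 : - M <= a - r by have := ler_norm (- a); rewrite normrN; lra.
  have h2 : a + r <= M by have := ler_norm a; lra.
  rewrite (@I_cat _ (- M) (a - r)) //; [|lra|exact: lf.2].
  rewrite (@I_cat _ (a - r) (a + r) M) //; [|lra|exact: lf.2].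
  rewrite (_ : I `[- M, a - r] f = 0) ?add0r; last first.
    rewrite -[RHS](I_0 `[- M, a - r]); apply: I_eq => x /=; rewrite in_itv /= => hx; apply: hf.
    by rewrite ler_normr; lra.
  rewrite (_ : I `[a + r, M] f = 0) ?addr0 //.
  rewrite -[RHS](I_0 `[a + r, M]); apply: I_eq => x /=; rewrite in_itv /= => hx; apply: hf.
  by rewrite ler_normr; lra.
have same a r : 0 < r -> av a r = av 0 1.
  move=> r0; pose M := `|a| + r + 1.
  have M1 : `|a| + r <= M by rewrite /M lerDl.
  have M2 : `|0 : R| + 1 <= M by rewrite normr0 add0r /M lerDr addr_ge0 // ltW.
  have M0 : 0 < M by have := normr_ge0 a; rewrite /M; lra.
  (* The difference of the two normalised bumps has integral 0, so its primitive has compact support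
     and is a test function; testing with it equates the two averages. *)
  pose k1 := (m a r)^-1; pose k2 := - (m 0 1)^-1.
  have [f fE] : exists f : R -> R, f =1 fun x => k1 * bump a r x + k2 * bump 0 1 x.
    by exists (fun x => k1 * bump a r x + k2 * bump 0 1 x).
  have bf : bumpy f by rewrite (funext fE); repeat constructor.
  have fc := bumpy_cont bf.
  pose phi x := prim f x - prim f (- M).
  have [_ HP] := prim_AC (loc_cont fc).
  have fz x : M <= `|x| -> f x = 0.
    move=> hx; rewrite fE !bump_supp ?mulr0 ?addr0 //.
      by rewrite subr0; have := normr_ge0 a; move: hx; rewrite /M; lra.
    by have := ler_normB x a; move: hx; rewrite /M; have := ler_distD a x 0; rewrite !subr0; lra.
  have Bint : I `[- M, M] f = 0.
    rewrite (I_eq (fun x _ => fE x)) I_D //; try by apply: igZ => //; exact: ig_itv_cont.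
    rewrite !I_Z //; try exact: ig_itv_cont.
    rewrite (full _ a r) //; [|exact: loc_cont|by move=> x; exact: bump_supp].
    rewrite (full _ 0 1) //; [|exact: loc_cont|by move=> x; exact: bump_supp].
    by rewrite /k1 /k2 -/(m a r) -/(m 0 1) mulNr !mulVf ?subrr // gt_eqF // m0.
  have dphi x : is_derive x 1 phi (f x).
    have h := AC_deriv (prim_AC (loc_cont fc)) (fc x).
    by have d0 := is_derive_cst (prim f (- M)) x (1 : R); rewrite -[f x]subr0; apply: is_deriveB.
  have phz x : M < `|x| -> phi x = 0.
    rewrite lter_normr => /orP [h|h].
      rewrite /phi HP; last lra.
      rewrite (@I_cat _ (- M) M) //; [|lra|lra|exact: ig_itv_cont].
      rewrite Bint add0r -[RHS](I_0 `[M, x]); apply: I_eq => y /=; rewrite in_itv /= => hy.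
      by apply: fz; rewrite ler_normr; lra.
    rewrite /phi -opprB HP; last lra.
    rewrite -[RHS]oppr0; congr (- _); rewrite -[RHS](I_0 `[x, - M]); apply: I_eq => y /=.
    by rewrite in_itv /= => hy; apply: fz; rewrite ler_normr; lra.
  have tp : test_function phi.
    split; first exact: smooth_primitive dphi.
    apply: (subclosed_compact (@closed_closure _ _) (@segment_compact _ (- M) M)).
    have /closure_id -> : closed (`[- M, M] : set R) by exact: itv_closed.
    apply: closure_subset => x /= /eqP px; rewrite in_itv /= -ler_norml leNgt.
    by apply/negP => /phz.
  have /= := Hw phi tp; have -> : derive1 phi = f.
    by apply/funext => x; rewrite derive1E; case: (dphi x).
  have lb b s : loc (fun x => w x * bump b s x).
    by under eq_fun do rewrite mulrC; apply: locM.
  rewrite (I_supp (M := M)); last by move=> x /ltW /fz ->; rewrite mulr0.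
  pose W1 x := w x * bump a r x; pose W2 x := w x * bump 0 1 x.
  have l1 : loc W1 := lb a r; have l2 : loc W2 := lb 0 1.
  have e1 : I `[- M, M] W1 = I `[a - r, a + r] W1.
    by apply: full => // x h; rewrite /W1 bump_supp ?mulr0.
  have e2 : I `[- M, M] W2 = I `[0 - 1, 0 + 1] W2.
    by apply: full => // x h; rewrite /W2 bump_supp ?mulr0.
  have -> : I `[- M, M] (fun x => w x * f x) = I `[- M, M] (fun x => k1 * W1 x + k2 * W2 x).
    by apply: I_eq => x _; rewrite fE /W1 /W2; ring.
  rewrite (@I_D _ _ (fun x => k1 * W1 x) (fun x => k2 * W2 x)) //; [|exact: (locZ k1 l1).2|exact: (locZ k2 l2).2].
  rewrite (@I_Z _ _ W1) //; last exact: l1.2.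
  rewrite (@I_Z _ _ W2) //; last exact: l2.2.
  rewrite e1 e2 !avE -/W1 -/W2 /k1 /k2.
  move: (I _ W1) (I _ W2) (m a r)^-1 (m 0 1)^-1 => p q s t.
  by rewrite mulNr => /eqP; rewrite subr_eq0 => /eqP; rewrite mulrC => ->; rewrite mulrC.
exists (av 0 1).
have := lebesgue_differentiation ((loc_intP _).1 lw); apply: ae_imp => a ha.
apply/eqP; rewrite -subr_eq0 -normr_le0; apply/ler_addgt0Pr => e e0; rewrite add0r.
have E4 : 0 < expR (- 4) :> R by rewrite expR_gt0.
have [r r0 hr] := lebesgue_pt_avg lw ha (mulr_gt0 e0 E4).
rewrite -(same a r r0) avE; have mp := m0 a r r0.
have lb : loc (fun x => w x * bump a r x) by under eq_fun do rewrite mulrC; apply: locM.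
have lc : loc (fun x => w x - w a) by apply: locB => //; apply: loc_cont => x; exact: cst_continuous.
have E : (w a - I `[a - r, a + r] (fun x => w x * bump a r x) / m a r) * m a r =
    - I `[a - r, a + r] (fun x => bump a r x * (w x - w a)).
  rewrite mulrBl divfK ?gt_eqF // /m -I_Z //; last exact: ig_itv_cont.
  rewrite -I_B //; [|by apply: igZ => //; exact: ig_itv_cont|exact: lb.2].
  rewrite -I_N //; last exact: (locM (bc _ _) lc).2.
  by apply: I_eq => x _; ring.
have := congr1 (fun z : R => `|z|) E; rewrite normrM normrN (gtr0_norm mp) => E'.
rewrite -(ler_pM2r mp) E'.
apply: le_trans (_ : I `[a - r, a + r] (fun x => `|w x - w a|) <= _).
  apply: I_abs_le => //; [exact: (locM (bc _ _) lc).2|exact: (loc_abs lc).2|].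
  move=> x _; have /andP [b0 b1] := bump_range a r x.
  by rewrite normrM (ger0_norm b0) ler_piMl.
apply: le_trans hr _; rewrite -mulrA ler_pM2l // mulrC.
exact: bump_mass.
Qed.

(** A primitive of [g] also has weak derivative [g]; its difference with [u] has weak derivative 0
    and is constant almost everywhere. *)
Lemma weak_AC u g : weak_deriv u g -> exists2 U, AC U g & {ae leb R, forall x, u x = U x}.
move=> [/loc_intP lu /loc_intP lg Hug].
have AP := prim_AC lg; have [_ _ HP] := AC_weak AP.
have lP := loc_cont (AC_cont AP).
have [||c hc] := @weak_deriv0 (fun x => u x - prim g x); first exact: locB.
  move=> phi tp; have [M M0 HM] := test_supp tp; have [[mp _] _] := test_AC tp.
  have cp : continuous (derive1 phi).
    move=> x; apply: differentiable_continuous; apply/derivable1_diffP.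
    by have [sm _] := tp; have := sm 1%N x; rewrite derive1n1.
  have l1 v : loc v -> loc (fun x => v x * derive1 phi x).
    by move=> lv; under eq_fun do rewrite mulrC; apply: locM.
  rewrite (I_supp (M := M)); last by move=> x /HM [_ ->]; rewrite mulr0.
  rewrite (_ : I _ _ = I `[- M, M] (fun x => u x * derive1 phi x - prim g x * derive1 phi x)).
    rewrite I_B //; [|exact: (l1 _ lu).2|exact: (l1 _ lP).2].
    rewrite -!(I_supp (M := M)).
    - by rewrite Hug // HP // subrr.
    - by move=> x /HM [_ ->]; rewrite mulr0.
    - by move=> x /HM [_ ->]; rewrite mulr0.
  by apply: I_eq => x _; ring.
exists (fun x => prim g x + c).
  by apply: AC_ext (ACD AP (AC_cst c)) _ _ => x //; rewrite addr0.
by apply: ae_imp hc => x <-; rewrite addrC subrK.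
Qed.

Lemma weak_ae u g u' g' : weak_deriv u g -> loc u' -> loc g' ->
  {ae leb R, forall x, u x = u' x} -> {ae leb R, forall x, g x = g' x} -> weak_deriv u' g'.
move=> [/loc_intP [mu _] /loc_intP [mg _] Hug] lu' lg' hu hg.
split; [exact/loc_intP|exact/loc_intP|].
move=> phi tp; have [[mp' _] _] := test_AC tp; have mp := mf_cont (AC_cont (test_AC tp)).
have [mu' _] := lu'; have [mg' _] := lg'.
have E1 : \int[leb R]_x (u x * derive1 phi x) = \int[leb R]_x (u' x * derive1 phi x).
  by apply: I_ae => //; [exact: mfM|exact: mfM|by apply: ae_imp hu => x ->].
have E2 : \int[leb R]_x (g x * phi x) = \int[leb R]_x (g' x * phi x).
  by apply: I_ae => //; [exact: mfM|exact: mfM|by apply: ae_imp hg => x ->].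
by rewrite -E1 -E2 Hug.
Qed.

Lemma cont_ae0 f : continuous f -> {ae leb R, forall x, f x = 0} -> forall x, f x = 0.
move=> fc f0 x; have A : AC (fun=> 0) f.
  split; first exact: loc_cont.
  move=> a b _; rewrite subrr -[LHS](I_0 `[a, b]); apply: I_ae => //; [exact: mfC|exact: mf_cont|].
  by apply: ae_imp f0 => y ->.
have [_ <-] := AC_deriv A (fc x); by have [_ ->] := is_derive_cst (0 : R) x (1 : R).
Qed.

Lemma cont_ae_eq f g : continuous f -> continuous g -> {ae leb R, forall x, f x = g x} -> f =1 g.
move=> fc gc h x; apply/eqP; rewrite -subr_eq0; apply/eqP.
apply: (@cont_ae0 (fun y => f y - g y)); last by apply: ae_imp h => y ->; rewrite subrr.
by move=> y; apply: continuousB; [exact: fc|exact: gc].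
Qed.

Lemma weak_uniq u g v h : weak_deriv u g -> weak_deriv v h ->
  {ae leb R, forall x, u x = v x} -> {ae leb R, forall x, g x = h x}.
move=> ug vh huv; have [U AU hU] := weak_AC ug; have [W AW hW] := weak_AC vh.
have UW : U =1 W.
  apply: cont_ae_eq; [exact: AC_cont AU|exact: AC_cont AW|].
  by apply: ae_imp (ae_and huv (ae_and hU hW)) => x [h1 [<- <-]].
by apply: AC_uniq AU _; apply: AC_ext AW _ _ => x //; rewrite UW.
Qed.

End WeakDerivative.

(** * Square integrable functions *)

Section SquareIntegrable.
Context {R : realType}.
Implicit Types (f g u v : R -> R) (D : set R) (c : R).

Definition sq D f := mf f /\ ig D (fun x => f x ^+ 2).

Lemma sqM D f g : ms D -> sq D f -> sq D g -> ig D (fun x => f x * g x).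
move=> mD [f1 f2] [g1 g2]; apply: (@ig_le _ _ _ (fun x => f x ^+ 2 + g x ^+ 2)) => //.
- exact: mfM.
- exact: igD.
move=> x _; rewrite ler_norml; have := sqr_ge0 (f x - g x); have := sqr_ge0 (f x + g x).
by rewrite sqrrB sqrrD; have := sqr_ge0 (f x); have := sqr_ge0 (g x); lra.
Qed.

Lemma sqD D f g : ms D -> sq D f -> sq D g -> sq D (fun x => f x + g x).
move=> mD hf hg; have [f1 f2] := hf; have [g1 g2] := hg; split; first exact: mfD.
apply: (@ig_eq _ _ (fun x => (f x ^+ 2 + 2 * (f x * g x)) + g x ^+ 2)) => //.
  by move=> x _; ring.
by apply: igD => //; apply: igD => //; apply: igZ => //; exact: sqM.
Qed.

Lemma sqZ D c f : ms D -> sq D f -> sq D (fun x => c * f x).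
move=> mD [f1 f2]; split; first by apply: mfM => //; exact: mfC.
by apply: (@ig_eq _ _ (fun x => c ^+ 2 * f x ^+ 2)) => // [x _|]; [rewrite exprMn|exact: igZ].
Qed.

Lemma sqB D f g : ms D -> sq D f -> sq D g -> sq D (fun x => f x - g x).
move=> mD hf hg; have := sqD mD hf (sqZ (-1) mD hg); congr (sq D _).
by apply/funext => x; rewrite mulN1r.
Qed.

Lemma sq0 D : sq D (fun=> 0).
by split; [exact: mfC|rewrite expr0n; exact: ig0]. Qed.

Lemma sq_bounded D f g (M : R) : ms D -> mf g -> (forall x, D x -> `|g x| <= M) ->
  sq D f -> sq D (fun x => g x * f x).
move=> mD mg hg [f1 f2]; split; first exact: mfM.
apply: (@ig_le _ _ _ (fun x => M ^+ 2 * f x ^+ 2)) => //.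
- by apply: mfX; exact: mfM.
- exact: igZ.
move=> x Dx; rewrite normrX normrM exprMn !normK2 // ler_wpM2r ?sqr_ge0 //.
by rewrite -normK2 // lerXn2r ?nnegrE // ?hg // (le_trans _ (hg x Dx)).
Qed.

Lemma sq_ae D f g : ms D -> sq D f -> mf g -> {ae leb R, forall x, f x = g x} -> sq D g.
move=> mD [f1 f2] g1 h; split=> //; apply: ig_ae f2 => //; [exact: mfX|exact: mfX|].
by apply: ae_imp h => x ->.
Qed.

Lemma I_CS D f g : ms D -> sq D f -> sq D g ->
  I D (fun x => f x * g x) ^+ 2 <= I D (fun x => f x ^+ 2) * I D (fun x => g x ^+ 2).
move=> mD hf hg; apply: quad_disc; try by apply: I_ge0 => x _; exact: sqr_ge0.
move=> t; have -> : I D (fun x => f x ^+ 2) * t ^+ 2 + 2 * I D (fun x => f x * g x) * t +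
    I D (fun x => g x ^+ 2) = I D (fun x => (t * f x + g x) ^+ 2).
  transitivity (I D (fun x => (t ^+ 2 * f x ^+ 2 + (2 * t) * (f x * g x)) + g x ^+ 2)).
    have i := sqM mD hf hg; have [_ f2] := hf; have [_ g2] := hg.
    rewrite I_D //; last by apply: igD => //; exact: igZ.
    rewrite I_D //; [|exact: igZ|exact: igZ].
    by rewrite !I_Z //; ring.
  by apply: I_eq => x _; ring.
by apply: I_ge0 => x _; exact: sqr_ge0.
Qed.

Lemma L2norm_sq D u : ms D -> L2norm D u ^+ 2 = I D (fun x => u x ^+ 2).
move=> mD; rewrite -powR_mulrn ?fine_ge0 ?Lnorm_ge0 // -fine_poweR poweR_Lnorm ?gt_eqF //.
rewrite /I Rintegral_mkcond /Rintegral; congr fine; apply: eq_integral => x _ /=.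
congr EFin; rewrite powR_mulrn // normK2 //.
by rewrite !patchE; case: ifP; rewrite ?expr0n.
Qed.

Lemma L2_sq D u : ms D -> mf u -> L2 D u <-> sq D u.
move=> mD mu; have mp : mf (u \_ D).
  by apply/(measurable_restrictT u mD); exact: measurable_funS mu.
have E : (fun x => (u \_ D) x ^+ 2) = (fun x => u x ^+ 2) \_ D.
  by apply/funext => x; rewrite !patchE; case: ifP; rewrite ?expr0n.
have P : ig D (fun x => u x ^+ 2) <-> ig setT (fun x => (u \_ D) x ^+ 2).
  rewrite E /ig -restrict_EFin; split=> h.
    by apply/(integrable_restrict _ mD) => //; rewrite setTI.
  by move/(integrable_restrict _ mD) : h; rewrite setTI; apply.
split=> [h|[_ /P h]].
  by split=> //; apply/P; exact: Lfun2_integrable_sqr.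
rewrite /L2 inE; apply/andP; split; first by rewrite inE.
rewrite inE /= /finite_norm unlock /=; apply: poweR_lty.
have := integrable_lty ms_T h; congr (_ < _)%E; apply: eq_integral => x _ /=.
by rewrite powR_mulrn // normK2.
Qed.

Lemma sq_cont a b f : continuous f -> sq `[a, b] f.
by move=> cf; split; [exact: mf_cont|apply: ig_itv_cont => x; apply: cvgM; exact: cf]. Qed.

(* Along a fast subsequence the weighted sum of the squared increments is
   integrable, so that the subsequence converges pointwise a.e. *)
Lemma riesz_fischer D (f : nat -> R -> R) : ms D -> (forall n, sq D (f n)) ->
  (forall e : R, 0 < e -> exists N, forall m n, (N <= m)%N -> (N <= n)%N ->
     I D (fun x => (f m x - f n x) ^+ 2) <= e) ->
  exists g, [/\ sq D g, (forall x y, (forall n, f n x = f n y) -> g x = g y),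
    (forall x (l : R), f n x @[n --> \oo] --> l -> g x = l) &
    forall e : R, 0 < e -> exists N, forall n, (N <= n)%N ->
      I D (fun x => (f n x - g x) ^+ 2) <= e].
move=> mD sf cf; have e16 k : 0 < 16^-1 ^+ k :> R by rewrite exprn_gt0.
have [N0 HN0] : exists N0 : nat -> nat, forall k m n, (N0 k <= m)%N -> (N0 k <= n)%N ->
     I D (fun x => (f m x - f n x) ^+ 2) <= 16^-1 ^+ k.
  suff h : forall k, exists N, forall m n, (N <= m)%N -> (N <= n)%N ->
      I D (fun x => (f m x - f n x) ^+ 2) <= 16^-1 ^+ k.
    by have [N HN] := choice h; exists N.
  by move=> k; exact: cf.
pose phi k := (\sum_(j < k.+1) N0 j + k)%N.
have phiS k : (phi k <= phi k.+1)%N by rewrite /phi [in leqRHS]big_ord_recr /= -addnA leq_add2l (leq_trans (leqnSn k)) // leq_addl.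
have phi_mono j k : (j <= k)%N -> (phi j <= phi k)%N.
  by elim: k => [|k IH]; [rewrite leqn0 => /eqP ->|rewrite leq_eqVlt => /orP [/eqP -> //|/IH h]; exact: leq_trans h (phiS k)].
have phi_ge k : (N0 k <= phi k)%N by rewrite /phi big_ord_recr /= addnAC leq_addl.
pose h k := f (phi k).
(* The squared increments have integral at most [16^-k], so the weighted ones sum like [4^-k]; where
   the sum is finite the increments are of order [2^-k]. *)
pose G k x := (4 ^+ k * (h k.+1 x - h k x) ^+ 2)%:E.
have sh k : sq D (fun x => h k.+1 x - h k x) by exact: (sqB mD (sf _) (sf _)).
have iG k : ig D (fun x => 4 ^+ k * (h k.+1 x - h k x) ^+ 2).
  by apply: igZ => //; case: (sh k).
have mG k : measurable_fun D (G k) by exact: (measurable_int (leb R) (iG k)).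
have G0 k x : (0 <= G k x)%E by rewrite lee_fin mulr_ge0 ?sqr_ge0 // exprn_ge0.
have intG : (\int[leb R]_(x in D) \big[+%E/0%E]_(0 <= k <oo) G k x < +oo)%E.
  rewrite integral_nneseries //.
  apply: (@le_lt_trans _ _ (\big[+%E/0%E]_(0 <= k <oo) (geometric 1 4^-1 k)%:E)%E); last first.
    apply: (@le_lt_trans _ _ 2%:E); last by rewrite ltry.
    apply: lime_le; first by apply: is_cvg_nneseries => k _ _; rewrite lee_fin /geometric /= mul1r exprn_ge0.
    apply: nearW => n; rewrite sumEFin lee_fin; apply: (@le_trans _ _ (2 - 2 * 4^-1 ^+ n)); last first.
      by rewrite gerBl mulr_ge0 // exprn_ge0.
    elim: n => [|n IH]; first by rewrite big_geq // expr0; lra.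
    have p0 : 0 < 4^-1 ^+ n :> R by rewrite exprn_gt0.
    rewrite big_nat_recr //=; move: IH; set S := \sum_(_ <= _ < _) _; rewrite /geometric /= mul1r exprS; lra.
  apply: lee_nneseries => [k|k _]; first by move=> _ _; apply: integral_ge0 => x _; exact: G0.
  have -> : (\int[leb R]_(x in D) G k x = (I D (fun x => 4 ^+ k * (h k.+1 x - h k x) ^+ 2))%:E)%E.
    by rewrite /I /Rintegral fineK //; exact: (integrable_fin_num mD (iG k)).
  rewrite lee_fin I_Z //; last by case: (sh k).
  rewrite /geometric /= mul1r; have -> : 4^-1 ^+ k = 4 ^+ k * 16^-1 ^+ k :> R.
    by rewrite -exprMn; congr (_ ^+ _); field.
  by rewrite ler_pM2l ?exprn_gt0 // HN0 // (leq_trans (phi_ge k)) // phiS.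
have aeC : {ae leb R, forall x, D x -> exists C : R, 0 < C /\ forall k, `|h k.+1 x - h k x| <= C * 2^-1 ^+ k}.
  have ii : (leb R).-integrable D (fun x => \big[+%E/0%E]_(0 <= k <oo) G k x)%E.
    apply/integrableP; split; first by apply: (ge0_emeasurable_sum (P := xpredT)) => [k x _ _|k _]; [exact: G0|exact: mG].
    under eq_integral do rewrite gee0_abs ?nneseries_ge0 //.
    done.
  have := integrable_ae mD ii; apply: ae_imp => x hx Dx; have {hx} := hx Dx.
  set S := (X in X \is a fin_num) => Sf.
  have S0 : (0 <= S)%E by exact: nneseries_ge0.
  have B k : 4 ^+ k * (h k.+1 x - h k x) ^+ 2 <= fine S.
    rewrite -lee_fin fineK // -/(G k x).
    apply: le_trans (@nneseries_lim_ge R (fun k => G k x) xpredT 0 k.+1 _); last by move=> n _ _; exact: G0.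
    by rewrite big_nat_recr //= leeDr // sume_ge0.
  exists (fine S + 1); split; first by rewrite ltr_wpDl ?fine_ge0.
  move=> k; have f0 := fine_ge0 S0; have k2 : 0 < 2^-1 ^+ k :> R by rewrite exprn_gt0.
  apply: sqr_le; first by rewrite mulr_ge0 ?addr_ge0 // ltW.
  rewrite normK2 // exprMn -[_ ^+ k ^+ 2]exprM mulnC exprM.
  have -> : (2^-1 ^+ 2) ^+ k = (4 ^+ k)^-1 :> R by rewrite -exprVn; congr (_ ^+ _); field.
  rewrite ler_pdivlMr ?exprn_gt0 // mulrC; apply: le_trans (B k) _; nra.
have conv x (C : R) : 0 < C -> (forall k, `|h k.+1 x - h k x| <= C * 2^-1 ^+ k) ->
    exists l : R, h k x @[k --> \oo] --> l.
  move=> C0 hC; have [||l hl] := @dominated_cauchy R (fun k => h k x) (fun k => (2 * C) * 2^-1 ^+ k).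
  - by move=> e e0; exact: expr_half_small.
  - move=> k m; elim: m => [|m IH].
      by rewrite leqn0 => /eqP ->; rewrite subrr normr0 mulr_ge0 ?exprn_ge0 // mulr_ge0 // ltW.
    rewrite leq_eqVlt => /orP [/eqP <-|km].
      by rewrite subrr normr0 mulr_ge0 ?exprn_ge0 // mulr_ge0 // ltW.
    suff H p : `|h (k + p)%N x - h k x| <= (2 * C) * (2^-1 ^+ k - 2^-1 ^+ (k + p)).
      have := H (m.+1 - k)%N; rewrite subnKC ?(ltnW km) // => /le_trans; apply.
      by rewrite ler_pM2l ?mulr_gt0 // gerBl exprn_ge0.
    elim: p => [|p IHp]; first by rewrite addn0 !subrr normr0 mulr0.
    rewrite addnS (_ : _ - _ = (h (k + p).+1 x - h (k + p)%N x) + (h (k + p)%N x - h k x)); last by ring.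
    apply: le_trans (ler_normD _ _) _; have := hC (k + p)%N; rewrite exprS; move: IHp.
    have -> (z w : R) : 2 * C * (z - w) = 2 * (C * z) - 2 * (C * w) by ring.
    have -> (z w : R) : 2 * C * (z - 2^-1 * w) = 2 * (C * z) - C * w by field.
    lra.
  exists l; apply/cvgrPdist_lt => e e0.
  have [N HN] := @expr_half_small R (2 * C) e e0; exists N => // k /= /HN.
  by apply: le_lt_trans.
(* The upper limit is defined at every point from the values of the sequence alone: periodicity and
   pointwise limits of the sequence are inherited everywhere, not just almost everywhere. *)
pose g x := fine (limn_esup (fun k => (h k x)%:E)).
have gE x (l : R) : h k x @[k --> \oo] --> l -> g x = l.
  move=> hl; rewrite /g (cvg_limn_einf_sup (l := l%:E)) //.
  by apply: cvg_comp hl _; exact: cvg_refl.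
have mg : mf g.
  apply: measurableT_comp; first exact: fine_measurable.
  apply: measurable_fun_limn_esup => k; apply/measurable_EFinP; by case: (sf (phi k)).
(* Fatou's lemma along the subsequence bounds the distance of each [f n] to the limit. *)
have key (e : R) (n N : nat) : (forall m, (N <= m)%N -> I D (fun x => (f n x - f m x) ^+ 2) <= e) ->
    (\int[leb R]_(x in D) ((f n x - g x) ^+ 2)%:E <= e%:E)%E.
  move=> hN; pose F k x := ((f n x - h (k + N)%N x) ^+ 2)%:E.
  have iF k : ig D (fun x => (f n x - h (k + N)%N x) ^+ 2).
    by case: (sqB mD (sf n) (sf (phi (k + N)))).
  have F1 : (\int[leb R]_(x in D) ((f n x - g x) ^+ 2)%:E = \int[leb R]_(x in D) limn_einf (F^~ x))%E.
    apply: ae_eq_integral => //.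
    - apply/measurable_EFinP; apply: (@measurable_funS _ _ _ _ setT) => //; apply: mfX; apply: mfB => //.
      by case: (sf n).
    - rewrite (_ : (fun x => _) = (-%E \o fun x => limn_esup (fun k => - F k x))%E); last first.
        by apply/funext => x /=; rewrite -[LHS]oppeK -limn_esupN.
      apply: measurableT_comp => //; apply: measurable_fun_limn_esup => k.
      by apply: measurableT_comp => //; exact: (measurable_int (leb R) (iF k)).
    apply: ae_imp aeC => x hx Dx; have [C [C0 /(conv x C C0) [l hl]]] := hx Dx.
    rewrite (gE x l hl); symmetry; apply: (cvg_limn_einf_sup _).1.
    have hl' : h (k + N)%N x @[k --> \oo] --> l by rewrite (cvg_shiftn N (fun k => h k x)).
    have hF : (f n x - h (k + N)%N x) ^+ 2 @[k --> \oo] --> (f n x - l) ^+ 2.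
      by apply: (@cvgM _ _ _ _ _ _ (f n x - l) (f n x - l)); apply: cvgB => //; exact: cvg_cst.
    by apply: cvg_comp hF _; exact: cvg_refl.
  rewrite F1; apply: le_trans (fatou (leb R) mD _ _) _.
  - by move=> k; exact: (measurable_int (leb R) (iF k)).
  - by move=> k x _; rewrite lee_fin sqr_ge0.
  rewrite limn_einf_lim; apply: lime_le; first exact: is_cvg_einfs.
  apply: nearW => k; apply: le_trans (_ : (\int[leb R]_(x in D) F k x <= _)%E).
    by apply: ereal_inf_lbound; exists k => //=.
  have -> : (\int[leb R]_(x in D) F k x = (I D (fun x => (f n x - h (k + N)%N x) ^+ 2))%:E)%E.
    by rewrite /I /Rintegral fineK //; exact: (integrable_fin_num mD (iF k)).
  by rewrite lee_fin hN // /phi addnA leq_addl.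
have sg (e : R) n : (\int[leb R]_(x in D) ((f n x - g x) ^+ 2)%:E <= e%:E)%E ->
    sq D (fun x => f n x - g x) /\ I D (fun x => (f n x - g x) ^+ 2) <= e.
  move=> h1; have mn : mf (fun x => f n x - g x) by apply: mfB => //; case: (sf n).
  have i1 : ig D (fun x => (f n x - g x) ^+ 2).
    apply/integrableP; split.
      by apply/measurable_EFinP; apply: (@measurable_funS _ _ _ _ setT) => //; exact: mfX.
    apply: le_lt_trans (_ : e%:E < +oo)%E; last exact: ltry.
    by apply: le_trans h1; rewrite le_eqVlt; apply/orP; left; apply/eqP; apply: eq_integral => x _ /=;
      rewrite ger0_norm // sqr_ge0.
  split; first by split.
  rewrite -lee_fin /I /Rintegral fineK //; exact: (integrable_fin_num mD i1).
exists g; split.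
- have [N HN] := cf 1 ltr01; have [s1 _] := sg _ N (key 1 N N (fun m hm => HN N m (leqnn N) hm)).
  have := sqB mD (sf N) s1; congr (sq D _); apply/funext => x; ring.
- move=> x y hxy; rewrite /g; congr (fine (limn_esup _)); apply/funext => k; by rewrite /h hxy.
- move=> x l hl; apply: gE; apply: cvg_comp hl => A [N _ HN]; exists N => // k /= Nk; apply: HN => /=.
  by apply: leq_trans Nk _; rewrite /phi leq_addl.
move=> e e0; have [N HN] := cf e e0; exists N => n hn.
by have [] := sg _ n (key e n N (fun m hm => HN n m hn hm)).
Qed.

End SquareIntegrable.

(** * The first-order Sobolev space on the line and on a period *)

Section Space.
Context {R : realType}.
Implicit Types (p : (R -> R) * (R -> R)) (D : set R) (L x y a b c : R) (f g q : R -> R).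

(* First-order Sobolev functions, given by an absolutely continuous function
   together with its derivative.  [L] is a period; the value [L = 0] yields no
   constraint and serves for the line. *)
Definition hp D L p := [/\ AC p.1 p.2, sq D p.1, sq D p.2,
  forall x, p.1 (x + L) = p.1 x & forall x, p.2 (x + L) = p.2 x].

(** What the line and a period share. [dm_seg] moves any point by periodicity into a segment of
    length [ell] inside [D], for the sup bound; [dm_loc] bounds square integrals over arbitrary
    segments by the one over [D]. *)
Record domain D L (ell : R) : Prop := Domain {
  dm_ms : ms D;
  dm_ell : 0 < ell;
  dm_seg : forall x, exists a y, [/\ a <= y <= a + ell, `[a, a + ell] `<=` D &
     forall f, (forall z, f (z + L) = f z) -> f x = f y];
  dm_loc : forall a b, exists2 C : R, 0 < C & forall f, (forall z, f (z + L) = f z) ->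
     sq D f -> ig `[a, b] (fun x => f x ^+ 2) /\
     I `[a, b] (fun x => f x ^+ 2) <= C * I D (fun x => f x ^+ 2) }.

(** Measurability of [D] is a premise inside the predicate, so that closure under linear
    combinations, hence the module structure, holds for every [D]. *)
Definition hpred D L : {pred (R -> R) * (R -> R)} := [pred p | `[< ms D -> hp D L p >]].

Lemma hpred_submod D L : submod_closed (hpred D L).
split=> [|c p q]; rewrite ?unfold_in /=.
  by apply/asboolP => mD; split=> //; [exact: AC_cst|exact: sq0|exact: sq0].
move=> /asboolP hp' /asboolP hq'; apply/asboolP => mD.
have [p1 p2 p3 p4 p5] := hp' mD; have [q1 q2 q3 q4 q5] := hq' mD; split.
- exact: (ACD (ACZ c p1) q1).
- exact: (sqD mD (sqZ c mD p2) q2).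
- exact: (sqD mD (sqZ c mD p3) q3).
- by move=> x; congr (c * _ + _).
- by move=> x; congr (c * _ + _).
Qed.
HB.instance Definition _ D L := GRing.isSubmodClosed.Build R _ (hpred D L) (hpred_submod D L).

Definition H1 D L := {p : ((R -> R) * (R -> R))%type | p \in hpred D L}.
HB.instance Definition _ D L := Choice.on (H1 D L).
HB.instance Definition _ D L := SubType.on (H1 D L).
HB.instance Definition _ D L := [SubChoice_isSubLmodule of (H1 D L) by <:].

Definition fn D L (u : H1 D L) : R -> R := (val u).1.
Definition dv D L (u : H1 D L) : R -> R := (val u).2.

Lemma H1P D L (u : H1 D L) : ms D -> hp D L (fn u, dv u).
by move=> mD; have := valP u; rewrite unfold_in /= => /asboolP /(_ mD) [h1 h2 h3 h4 h5]; split.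
Qed.

Lemma hp_pred D L p : hp D L p -> p \in hpred D L.
by move=> h; rewrite unfold_in /=; apply/asboolP. Qed.

Definition H1_mk D L p (h : hp D L p) : H1 D L := exist _ p (hp_pred h).

Lemma fnD D L (u v : H1 D L) : fn (u + v) = fun x => fn u x + fn v x. by []. Qed.
Lemma dvD D L (u v : H1 D L) : dv (u + v) = fun x => dv u x + dv v x. by []. Qed.
Lemma fnZ D L c (u : H1 D L) : fn (c *: u) = fun x => c * fn u x. by []. Qed.
Lemma dvZ D L c (u : H1 D L) : dv (c *: u) = fun x => c * dv u x. by []. Qed.
Lemma fnB D L (u v : H1 D L) : fn (u - v) = fun x => fn u x - fn v x. by []. Qed.
Lemma dvB D L (u v : H1 D L) : dv (u - v) = fun x => dv u x - dv v x. by []. Qed.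
Lemma fn_sum D L (J : Type) (s : seq J) (F : J -> H1 D L) x : fn (\sum_(j <- s) F j) x = \sum_(j <- s) fn (F j) x.
by elim: s => [|j s IH]; rewrite ?big_nil // !big_cons fnD IH. Qed.

Lemma H1_ext D L (u v : H1 D L) : fn u =1 fn v -> dv u =1 dv v -> u = v.
move=> /funext h1 /funext h2; apply: val_inj; move: h1 h2; rewrite /fn /dv.
by case: (val u) => ? ?; case: (val v) => ? ? /= -> ->.
Qed.

Section Fixed.
Variables (D : set R) (L ell : R).
Hypothesis dm : domain D L ell.
Notation E := (H1 D L).
Implicit Types (u v w z : E).
Let mD : ms D := dm_ms dm.
Let ell0 := dm_ell dm.

Lemma fn_AC u : AC (fn u) (dv u). by case: (H1P u mD). Qed.
Lemma fn_sq u : sq D (fn u). by case: (H1P u mD). Qed.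
Lemma dv_sq u : sq D (dv u). by case: (H1P u mD). Qed.
Lemma fn_per u x : fn u (x + L) = fn u x. by have [_ _ _ h _] := H1P u mD; exact: h. Qed.
Lemma dv_per u x : dv u (x + L) = dv u x. by have [_ _ _ _ h] := H1P u mD; exact: h. Qed.
Lemma fn_cont u : continuous (fn u). exact: AC_cont (fn_AC u). Qed.
Lemma fn_mf u : mf (fn u). by case: (fn_sq u). Qed.

Definition l0 u v := I D (fun x => fn u x * fn v x).
Definition d0 u v := I D (fun x => dv u x * dv v x).
Definition wf (q : R -> R) u v := I D (fun x => q x * (fn u x * fn v x)).
Definition n0 u v := l0 u v + d0 u v.
Definition qf (q : R -> R) u v := d0 u v + wf q u v.
Definition bdd (q : R -> R) := mf q /\ exists2 M : R, 0 < M & forall x, `|q x| <= M.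

Lemma ig_fn u v : ig D (fun x => fn u x * fn v x).
by apply: sqM => //; exact: fn_sq. Qed.
Lemma ig_dv u v : ig D (fun x => dv u x * dv v x).
by apply: sqM => //; exact: dv_sq. Qed.
Lemma ig_wf q u v : bdd q -> ig D (fun x => q x * (fn u x * fn v x)).
move=> [mq [M M0 HM]]; have -> : (fun x => q x * (fn u x * fn v x)) = (fun x => (q x * fn u x) * fn v x).
  by apply/funext => x; rewrite mulrA.
by apply: sqM => //; [apply: (sq_bounded mD mq (M := M)) => //|]; exact: fn_sq.
Qed.

Lemma bform_l0 : bform l0.
split=> [u v w|c u w|u v].
- rewrite /l0 -I_D ?ig_fn //; apply: I_eq => x _; rewrite fnD; ring.
- rewrite /l0 -I_Z ?ig_fn //; apply: I_eq => x _; rewrite fnZ; ring.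
- by apply: I_eq => x _; rewrite mulrC.
Qed.
Lemma bform_d0 : bform d0.
split=> [u v w|c u w|u v].
- rewrite /d0 -I_D ?ig_dv //; apply: I_eq => x _; rewrite dvD; ring.
- rewrite /d0 -I_Z ?ig_dv //; apply: I_eq => x _; rewrite dvZ; ring.
- by apply: I_eq => x _; rewrite mulrC.
Qed.
Lemma bform_wf q : bdd q -> bform (wf q).
move=> hq; split=> [u v w|c u w|u v].
- rewrite /wf -I_D ?ig_wf //; apply: I_eq => x _; rewrite fnD; ring.
- rewrite /wf -I_Z ?ig_wf //; apply: I_eq => x _; rewrite fnZ; ring.
- by apply: I_eq => x _; rewrite [fn u x * _]mulrC.
Qed.
Lemma bform_n0 : bform n0. exact: bformD bform_l0 bform_d0. Qed.
Lemma bform_qf q : bdd q -> bform (qf q).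
by move=> hq; exact: bformD bform_d0 (bform_wf hq). Qed.

Lemma l0_ge0 : nneg l0.
by move=> u; apply: I_ge0 => x _; rewrite -expr2 sqr_ge0. Qed.
Lemma d0_ge0 : nneg d0.
by move=> u; apply: I_ge0 => x _; rewrite -expr2 sqr_ge0. Qed.
Lemma n0_ge0 : nneg n0.
by move=> u; rewrite addr_ge0 ?l0_ge0 ?d0_ge0. Qed.
Lemma l0_le_n0 u : l0 u u <= n0 u u. by rewrite lerDl d0_ge0. Qed.
Lemma d0_le_n0 u : d0 u u <= n0 u u. by rewrite lerDr l0_ge0. Qed.
Lemma l0E u : l0 u u = I D (fun x => fn u x ^+ 2).
by apply: I_eq => x _; rewrite expr2. Qed.
Lemma d0E u : d0 u u = I D (fun x => dv u x ^+ 2).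
by apply: I_eq => x _; rewrite expr2. Qed.

Lemma wf_le q M u : mf q -> (forall x, `|q x| <= M) -> `|wf q u u| <= M * l0 u u.
move=> mq hM; have M0 : 0 <= M by exact: le_trans (hM 0).
have hq : bdd q by split=> //; exists (M + 1); [rewrite ltr_wpDl|move=> x; apply: le_trans (hM x) _; rewrite lerDl].
rewrite /l0 -I_Z ?ig_fn //; apply: I_abs_le => //; [exact: ig_wf|by apply: igZ => //; exact: ig_fn|].
by move=> x _; rewrite normrM -expr2 normrX normK2 // ler_wpM2r // sqr_ge0.
Qed.

Lemma qf_bbound q : bdd q -> bbound (qf q) n0.
move=> [mq [M M0 HM]]; exists (M + 1); first exact: addr_gt0.
move=> u; apply: le_trans (ler_normD _ _) _; rewrite (ger0_norm (d0_ge0 u)).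
have := wf_le u mq HM; have := l0_ge0 u; have := d0_ge0 u; rewrite /n0; nra.
Qed.

(** Agmon's bound for [u^2]: its mean over a segment of length [ell] plus its variation there, at
    most twice the product of the two norms. *)
Definition sup2 u := ell^-1 * l0 u u + 2 * Num.sqrt (l0 u u * d0 u u).

Lemma sup2_ge0 u : 0 <= sup2 u.
by rewrite addr_ge0 ?mulr_ge0 ?sqrtr_ge0 ?l0_ge0 ?invr_ge0 // ltW. Qed.

Lemma fn_sup u x : fn u x ^+ 2 <= sup2 u.
have [a [y [/andP [ay ya] aD uxy]]] := dm_seg dm x.
rewrite (uxy _ (fn_per u)).
have A2 := ACM (fn_AC u) (fn_AC u).
set c := 2 * Num.sqrt (l0 u u * d0 u u).
have sabs f : sq D f -> sq D (fun x => `|f x|).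
  move=> [f1 f2]; split; first exact: mf_abs.
  by apply: (ig_eq _ f2) => // t _; rewrite normK2.
have iab : ig D (fun t => `|fn u t| * `|dv u t|).
  by apply: sqM => //; apply: sabs; [exact: fn_sq|exact: dv_sq].
have h1 s t : a <= s -> s <= t -> t <= a + ell -> `|fn u t ^+ 2 - fn u s ^+ 2| <= c.
  move=> as' st ta; have [lo /(_ s t st)] := A2; rewrite !expr2 => ->.
  have sub : `[s, t] `<=` D.
    by move=> r hr; apply: aD; move: hr; rewrite /= !in_itv /=; lra.
  apply: (@le_trans _ _ (I `[s, t] (fun r : R => 2 * (`|fn u r| * `|dv u r|)) : R)).
    apply: I_abs_le => //; [exact: lo.2|by apply: igZ => //; exact: (ig_sub mD _ sub)|].
    move=> r _; apply: le_trans (ler_normD _ _) _; rewrite !normrM.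
    by rewrite [`|dv u r| * _]mulrC mulr2n mulrDl mul1r.
  rewrite I_Z //; last exact: (ig_sub mD _ sub).
  rewrite ler_pM2l //; apply: le_trans (_ : I D (fun t => `|fn u t| * `|dv u t|) <= _).
    by apply: I_subset => // r _; rewrite mulr_ge0.
  apply: sqr_le; first exact: sqrtr_ge0.
  rewrite sqr_sqrtr ?mulr_ge0 ?l0_ge0 ?d0_ge0 //.
  apply: le_trans (I_CS mD (sabs _ (fn_sq u)) (sabs _ (dv_sq u))) _.
  rewrite l0E d0E (@I_eq _ _ (fun x => `|fn u x| ^+ 2) (fun x => fn u x ^+ 2)) ?(@I_eq _ _ (fun x => `|dv u x| ^+ 2) (fun x => dv u x ^+ 2)) //;
  by move=> r _; rewrite normK2.
have h2 r : a <= r <= a + ell -> fn u y ^+ 2 - c <= fn u r ^+ 2.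
  move=> /andP [r1 r2]; have [yr|ry] := leP y r.
    by have := h1 y r ay yr r2; rewrite ler_norml; lra.
  by have := h1 r y r1 (ltW ry) ya; rewrite ler_norml; lra.
have := @I_cst R a (a + ell) (fn u y ^+ 2 - c); rewrite lerDl (ltW ell0) => /(_ isT).
rewrite [a + ell]addrC addrK addrC => E.
have : (fn u y ^+ 2 - c) * ell <= l0 u u.
  rewrite -E l0E; apply: le_trans (_ : I `[a, a + ell] (fun x => fn u x ^+ 2) <= _).
    have i1 : ig `[a, a + ell] (fun=> fn u y ^+ 2 - c) by apply: ig_itv_cont => t; exact: cst_continuous.
    have i2 : ig `[a, a + ell] (fun x => fn u x ^+ 2) by apply: (ig_sub mD _ aD) => //; case: (fn_sq u).
    by apply: (I_le (ms_itv _) i1 i2) => r /=; rewrite in_itv /=; exact: h2.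
  apply: I_subset => //; first by case: (fn_sq u).
  by move=> r _; exact: sqr_ge0.
by rewrite -ler_pdivlMr // [_ / ell]mulrC lerBlDr.
Qed.

Lemma sup2_le u : sup2 u <= (ell^-1 + 2) * n0 u u.
have -> : (ell^-1 + 2) * n0 u u = ell^-1 * n0 u u + 2 * n0 u u by ring.
apply: lerD.
  by rewrite ler_pM2l ?invr_gt0 // l0_le_n0.
rewrite ler_pM2l //; apply: sqr_le; first exact: n0_ge0.
rewrite sqr_sqrtr ?mulr_ge0 ?l0_ge0 ?d0_ge0 // expr2.
by apply: ler_pM; rewrite ?l0_ge0 ?d0_ge0 ?l0_le_n0 ?d0_le_n0.
Qed.

Lemma eval_lform x : lform (fun u : E => fn u x).
by split. Qed.
Lemma eval_fbound x : fbound (fun u : E => fn u x) n0.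
exists (ell^-1 + 2); first by rewrite addr_gt0 ?invr_gt0.
by move=> u; apply: le_trans (fn_sup u x) (sup2_le u).
Qed.

Lemma sq_loc g : (forall z : R, g (z + L) = g z) -> sq D g -> loc g.
move=> pg sg; split=> [|a b]; first by case: sg.
have [C _ HC] := dm_loc dm a b; have [i _] := HC g pg sg.
apply: (@ig_le _ _ _ (fun x => 1 + g x ^+ 2)) => //; first by case: sg.
  by apply: igD => //; apply: ig_itv_cont => x; exact: cst_continuous.
by move=> x _; rewrite -normK2 //; have := sqr_ge0 (`|g x| - 1); have := normr_ge0 (g x); nra.
Qed.

(** Functions and derivatives have square integrable limits. The sup bound makes the functions
    converge at every point, so that the integral relation between function and derivative passes to
    the limit. *)
Lemma complete_n0 : complete_form n0.
move=> w hw.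
have cf : forall e : R, 0 < e -> exists N, forall m n, (N <= m)%N -> (N <= n)%N ->
     I D (fun x => (fn (w m) x - fn (w n) x) ^+ 2) <= e.
  move=> e e0; have [N HN] := hw e e0; exists N => m n hm hn.
  by have := l0_le_n0 (w m - w n); rewrite l0E fnB => /le_trans; apply; exact: ltW (HN m n hm hn).
have cd : forall e : R, 0 < e -> exists N, forall m n, (N <= m)%N -> (N <= n)%N ->
     I D (fun x => (dv (w m) x - dv (w n) x) ^+ 2) <= e.
  move=> e e0; have [N HN] := hw e e0; exists N => m n hm hn.
  by have := d0_le_n0 (w m - w n); rewrite d0E dvB => /le_trans; apply; exact: ltW (HN m n hm hn).
have [f [sf pf fE fc]] := riesz_fischer mD (fun n => fn_sq (w n)) cf.
have [g [sg pg _ gc]] := riesz_fischer mD (fun n => dv_sq (w n)) cd.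
have perg (z : R) : g (z + L) = g z by apply: pg => n; exact: dv_per.
have perf (z : R) : f (z + L) = f z by apply: pf => n; exact: fn_per.
pose K := ell^-1 + 2; have K0 : 0 < K by rewrite addr_gt0 ?invr_gt0.
have pw x : fn (w n) x @[n --> \oo] --> f x.
  have : cvg (fn (w n) x @[n --> \oo]).
    apply/cauchy_cvgP/cauchy_exP => e e0.
    have [N HN] := hw (e ^+ 2 / K) (divr_gt0 (exprn_gt0 _ e0) K0).
    exists (fn (w N) x); exists N => // n /= hn; rewrite /ball /=.
    have := fn_sup (w N - w n) x; rewrite fnB => h.
    have {h} h : (fn (w N) x - fn (w n) x) ^+ 2 < e ^+ 2.
      apply: le_lt_trans h _; apply: le_lt_trans (sup2_le _) _.
      by rewrite mulrC -ltr_pdivlMr // HN.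
    by rewrite -(@ltr_pXn2r _ 2) ?nnegrE ?(ltW e0) // normK2.
  move=> /cvg_ex [l hl]; by rewrite (fE x l hl).
have A : AC f g.
  have lg := sq_loc perg sg; split=> // a b ab.
  apply/eqP; rewrite -subr_eq0 -normr_le0; apply/ler_addgt0Pr => e e0; rewrite add0r.
  have e3 : 0 < e / 3 by rewrite divr_gt0.
  have [C C0 HC] := dm_loc dm a b.
  have bC : 0 < (b - a + 1) * C by rewrite mulr_gt0 // ltr_wpDl // subr_ge0.
  have /cvgrPdist_lt /(_ _ e3) [N1 _ H1'] := pw a; have /cvgrPdist_lt /(_ _ e3) [N2 _ H2] := pw b.
  have [N3 H3] := gc ((e / 3) ^+ 2 / ((b - a + 1) * C)) (divr_gt0 (exprn_gt0 _ e3) bC).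
  pose n := (N1 + N2 + N3)%N.
  have {H1'} := H1' n; rewrite /= => /(_ (leq_trans (leq_addr _ _) (leq_addr _ _))) h1.
  have {H2} := H2 n; rewrite /= => /(_ (leq_trans (leq_addl _ _) (leq_addr _ _))) h2.
  have {H3} h3 := H3 n (leq_addl _ _).
  have [lw /(_ a b ab) hAC] := fn_AC (w n).
  have sgn : sq D (fun x => dv (w n) x - g x) by apply: sqB => //; exact: dv_sq.
  have pgn (z : R) : dv (w n) (z + L) - g (z + L) = dv (w n) z - g z by rewrite dv_per perg.
  have [i4 h4] := HC _ pgn sgn.
  have h5 : `|I `[a, b] (dv (w n)) - I `[a, b] g| <= e / 3.
    apply: sqr_le; first exact: ltW.
    rewrite normK2 // -I_B //; [|exact: lw.2|exact: lg.2].
    have s1 : sq `[a, b] (fun=> 1 : R).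
      by split; [exact: mfC|apply: ig_itv_cont => x; exact: cst_continuous].
    have s2 : sq `[a, b] (fun x => dv (w n) x - g x) by split=> //; case: sgn.
    have := I_CS (ms_itv _) s1 s2; have -> : I `[a, b] (fun x => 1 * (dv (w n) x - g x)) = I `[a, b] (fun x => dv (w n) x - g x).
      by apply: I_eq => x _; rewrite mul1r.
    rewrite I_cst // expr1n mul1r => h; apply: le_trans h _.
    have q0 : 0 <= I D (fun x => (dv (w n) x - g x) ^+ 2) by apply: I_ge0 => x _; exact: sqr_ge0.
    apply: le_trans (_ : (b - a + 1) * C * I D (fun x => (dv (w n) x - g x) ^+ 2) <= _).
      have : 0 <= b - a by rewrite subr_ge0.
      have : 0 <= I `[a, b] (fun x => (dv (w n) x - g x) ^+ 2) by apply: I_ge0 => x _; exact: sqr_ge0.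
      move: h4; rewrite -mulrA; set X := I D _; set Y := I _ _ => *.
      by apply: ler_pM => //; lra.
    by rewrite mulrC -ler_pdivlMr.
  move: h1 h2 h5; rewrite -hAC !ltr_norml !ler_norml; lra.
have hw' : hp D L (f, g) by split.
exists (H1_mk hw') => e e0; have e4 : 0 < e / 4 by rewrite divr_gt0.
have [N1 h1] := fc _ e4; have [N2 h2] := gc _ e4; exists (N1 + N2)%N => n hn.
have := h1 n (leq_trans (leq_addr _ _) hn); have := h2 n (leq_trans (leq_addl _ _) hn).
by rewrite /n0 l0E d0E fnB dvB /=; lra.
Qed.

Lemma fn_abs u x : `|fn u x| <= sup2 u + 1.
have := fn_sup u x; rewrite ler_norml; have := sup2_ge0 u; nra. Qed.

Lemma bdd_sq u : bdd (fun x => fn u x ^+ 2).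
split; first by apply: mfX; exact: fn_mf.
exists (sup2 u + 1); first by rewrite ltr_wpDl ?sup2_ge0.
by move=> x; rewrite ger0_norm ?sqr_ge0 //; apply: le_trans (fn_sup u x) _; rewrite lerDl.
Qed.

Lemma qfBk q (k : R) f u v : bdd q -> bdd f -> qf (fun x => q x - k * f x) u v = qf q u v - k * wf f u v.
move=> hq hf; have i1 := ig_wf u v hq; have i2 := ig_wf u v hf.
rewrite /qf -addrA; congr (_ + _); rewrite /wf -(I_Z k mD i2) -(I_B mD i1 (igZ k mD i2)).
by apply: I_eq => x _; ring.
Qed.

Lemma sq_mul2 u v f : sq D f -> sq D (fun x => fn u x * (fn v x * f x)).
move=> sf; apply: (sq_bounded mD (fn_mf u) (fun x _ => fn_abs u x)).
exact: (sq_bounded mD (fn_mf v) (fun x _ => fn_abs v x)) sf.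
Qed.

Lemma mul_hp u v w : hp D L (fun x => fn u x * fn v x * fn w x,
   fun x => dv u x * fn v x * fn w x + fn u x * dv v x * fn w x + fn u x * fn v x * dv w x).
have A : AC (fun x => fn u x * fn v x * fn w x)
   (fun x => dv u x * fn v x * fn w x + fn u x * dv v x * fn w x + fn u x * fn v x * dv w x).
  apply: AC_ext (ACM (ACM (fn_AC u) (fn_AC v)) (fn_AC w)) _ _ => // x; ring.
have sb := sq_mul2.
split=> //=.
- by have := sb u v _ (fn_sq w); congr (sq D _); apply/funext => x; ring.
- have := sqD mD (sqD mD (sb v w _ (dv_sq u)) (sb u w _ (dv_sq v))) (sb u v _ (dv_sq w)).
  by congr (sq D _); apply/funext => x; ring.
- by move=> x; rewrite !fn_per.
- by move=> x; rewrite !fn_per !dv_per.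
Qed.

Definition mul3 u v w : E := H1_mk (mul_hp u v w).

Lemma fn_mul3 u v w : fn (mul3 u v w) = fun x => fn u x * fn v x * fn w x. by []. Qed.
Lemma dv_mul3 u v w : dv (mul3 u v w) =
  fun x => dv u x * fn v x * fn w x + fn u x * dv v x * fn w x + fn u x * fn v x * dv w x.
by []. Qed.

Lemma mul3_D u u' v w : mul3 (u + u') v w = mul3 u v w + mul3 u' v w.
by apply: H1_ext => x; rewrite !(fn_mul3, dv_mul3, fnD, dvD); ring. Qed.
Lemma mul3_Z c u v w : mul3 (c *: u) v w = c *: mul3 u v w.
by apply: H1_ext => x; rewrite !(fn_mul3, dv_mul3, fnZ, dvZ); ring. Qed.
Lemma mul3_12 u v w : mul3 u v w = mul3 v u w.
by apply: H1_ext => x; rewrite !(fn_mul3, dv_mul3); ring. Qed.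
Lemma mul3_23 u v w : mul3 u v w = mul3 u w v.
by apply: H1_ext => x; rewrite !(fn_mul3, dv_mul3); ring. Qed.
Lemma mul3_T u v w z : l0 (mul3 u v w) z = l0 (mul3 u v z) w.
by apply: I_eq => x _; rewrite !fn_mul3; ring. Qed.

Lemma I2_le (f g h k : R -> R) (A B : R) : sq D f -> sq D k -> (forall x, g x ^+ 2 <= A) -> (forall x, h x ^+ 2 <= B) ->
  (forall x, k x = g x * h x * f x) -> 0 <= A ->
  I D (fun x => k x ^+ 2) <= A * B * I D (fun x => f x ^+ 2).
move=> [_ sf] [_ sk] gA hB kE A0; rewrite -I_Z //; apply: I_le => //; first exact: igZ.
move=> x _; rewrite kE !exprMn; apply: ler_wpM2r; first exact: sqr_ge0.
by apply: ler_pM; rewrite ?sqr_ge0.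
Qed.

Lemma l0_mul3 u v w : l0 (mul3 u v w) (mul3 u v w) <= sup2 u * sup2 v * l0 w w.
rewrite !l0E; apply: I2_le (fn_sup u) (fn_sup v) _ (sup2_ge0 u) => //; exact: fn_sq.
Qed.

Lemma n0_mul3 : exists2 C : R, 0 < C & forall u v w,
  n0 (mul3 u v w) (mul3 u v w) <= C * (n0 u u * n0 v v * n0 w w).
pose K := ell^-1 + 2; have K0 : 0 < K by rewrite addr_gt0 ?invr_gt0.
(* One for the function and nine for its derivative: three Leibniz terms, and the factor 3 from
   squaring a sum of three. *)
exists (10 * K ^+ 2); first by rewrite mulr_gt0 // exprn_gt0.
have term u v w : [/\ sq D (fun x => fn u x * (fn v x * dv w x)) &
    I D (fun x => (fn u x * (fn v x * dv w x)) ^+ 2) <= K ^+ 2 * (n0 u u * n0 v v * n0 w w)].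
  have s1 := sq_mul2 u v (dv_sq w); split=> //.
  apply: le_trans (I2_le (dv_sq w) s1 (fn_sup u) (fn_sup v) _ (sup2_ge0 u)) _.
    by move=> x; rewrite mulrA.
  rewrite -d0E; have -> : K ^+ 2 * (n0 u u * n0 v v * n0 w w) = (K * n0 u u) * (K * n0 v v) * n0 w w by ring.
  by apply: ler_pM; rewrite ?mulr_ge0 ?sup2_ge0 ?d0_ge0 ?d0_le_n0 // ler_pM ?sup2_ge0 ?sup2_le.
move=> u v w; have h0 := l0_mul3 u v w.
have {}h0 : l0 (mul3 u v w) (mul3 u v w) <= K ^+ 2 * (n0 u u * n0 v v * n0 w w).
  apply: le_trans h0 _; have -> : K ^+ 2 * (n0 u u * n0 v v * n0 w w) = (K * n0 u u) * (K * n0 v v) * n0 w w by ring.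
  by apply: ler_pM; rewrite ?mulr_ge0 ?sup2_ge0 ?l0_ge0 ?l0_le_n0 // ler_pM ?sup2_ge0 ?sup2_le.
have [s1 b1] := term v w u; have [s2 b2] := term u w v; have [s3 b3] := term u v w.
set t1 := fun x => fn v x * _ in s1 b1; set t2 := fun x => fn u x * (fn w x * _) in s2 b2.
set t3 := fun x => fn u x * (fn v x * _) in s3 b3.
have h1 : d0 (mul3 u v w) (mul3 u v w) <=
    3 * (I D (fun x => t1 x ^+ 2) + I D (fun x => t2 x ^+ 2) + I D (fun x => t3 x ^+ 2)).
  have i1 := s1.2; have i2 := s2.2; have i3 := s3.2.
  rewrite d0E -I_D // -I_D //; last exact: igD.
  rewrite -I_Z; [|exact: mD|by apply: igD => //; exact: igD].
  apply: I_le => //; [by case: (dv_sq (mul3 u v w))|by apply: igZ => //; apply: igD => //; exact: igD|].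
  move=> x _; rewrite dv_mul3.
  have -> : dv u x * fn v x * fn w x + fn u x * dv v x * fn w x + fn u x * fn v x * dv w x =
    t1 x + t2 x + t3 x by rewrite /t1 /t2 /t3; ring.
  have := sqr_ge0 (t1 x - t2 x); have := sqr_ge0 (t1 x - t3 x); have := sqr_ge0 (t2 x - t3 x); nra.
move: h0 h1; rewrite [n0 (mul3 _ _ _) _]/n0.
have {}b1 : I D (fun x => t1 x ^+ 2) <= K ^+ 2 * (n0 v v * n0 w w * n0 u u) := b1.
have {}b2 : I D (fun x => t2 x ^+ 2) <= K ^+ 2 * (n0 u u * n0 w w * n0 v v) := b2.
have {}b3 : I D (fun x => t3 x ^+ 2) <= K ^+ 2 * (n0 u u * n0 v v * n0 w w) := b3.
move: b1 b2 b3; have -> : n0 v v * n0 w w * n0 u u = n0 u u * n0 v v * n0 w w by ring.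
have -> : n0 u u * n0 w w * n0 v v = n0 u u * n0 v v * n0 w w by ring.
set Y := n0 u u * n0 v v * n0 w w; have -> : 10 * K ^+ 2 * Y = 10 * (K ^+ 2 * Y) by ring.
set X := K ^+ 2 * Y; lra.
Qed.

(* Splitting a segment into short pieces and using the values at their left end
   points as functionals. *)
Lemma seg_compact (a b e : R) : a <= b -> `[a, b] `<=` D -> 0 < e -> exists ls : seq (E -> R),
  (forall i, (i < size ls)%N -> lform (nth 0 ls i) /\ fbound (nth 0 ls i) n0) /\
  forall u, I `[a, b] (fun x => fn u x ^+ 2) <= e * n0 u u + \sum_(i < size ls) nth 0 ls i u ^+ 2.
move=> ab sub e0.
have short u s t : s <= t -> `[s, t] `<=` `[a, b] ->
    I `[s, t] (fun x => fn u x ^+ 2) <= 2 * (t - s) * fn u s ^+ 2 + 2 * (t - s) ^+ 2 * I `[s, t] (fun x => dv u x ^+ 2).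
  move=> st sst; have sD := subset_trans sst sub.
  have s2 : sq `[s, t] (dv u) by split; [case: (dv_sq u)|apply: (ig_sub mD _ sD) => //; case: (dv_sq u)].
  set G := I _ (fun x => dv u x ^+ 2).
  have pt x : s <= x <= t -> fn u x ^+ 2 <= 2 * fn u s ^+ 2 + 2 * (t - s) * G.
    move=> /andP [sx xt]; have [_ /(_ s x sx) hx] := fn_AC u.
    have s1 : sq `[s, x] (fun=> 1 : R).
      by split; [exact: mfC|apply: ig_itv_cont => r; exact: cst_continuous].
    have sxt : `[s, x] `<=` `[s, t] by move=> r; rewrite /= !in_itv /=; lra.
    have s3 : sq `[s, x] (dv u) by split; [case: s2|apply: (ig_sub (ms_itv _) (ms_itv _) sxt); case: s2].
    have := I_CS (ms_itv _) s1 s3; rewrite (@I_eq _ _ _ (dv u)); last by move=> r _; rewrite mul1r.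
    rewrite -hx I_cst // expr1n mul1r => h.
    have h2 : I `[s, x] (fun x => dv u x ^+ 2) <= G.
      by apply: I_subset => //; [case: s2|move=> r _; exact: sqr_ge0].
    have G0 : 0 <= I `[s, x] (fun x => dv u x ^+ 2) by apply: I_ge0 => r _; exact: sqr_ge0.
    have h3 : (x - s) * I `[s, x] (fun x => dv u x ^+ 2) <= (t - s) * G.
      by apply: ler_pM => //; lra.
    have := sqr_ge0 (fn u x - 2 * fn u s); move: h h3; set Y := (x - s) * _; set Z := (t - s) * G.
    have -> : 2 * (t - s) * G = 2 * Z by rewrite /Z; ring.
    rewrite !sqrrB; set p := fn u x; set q := fn u s; nra.
  apply: le_trans (_ : I `[s, t] (fun=> 2 * fn u s ^+ 2 + 2 * (t - s) * G) <= _).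
    have i1 : ig `[s, t] (fun=> 2 * fn u s ^+ 2 + 2 * (t - s) * G) by apply: ig_itv_cont => r; exact: cst_continuous.
    have i2 : ig `[s, t] (fun x => fn u x ^+ 2) by apply: (ig_sub mD _ sD) => //; case: (fn_sq u).
    by apply: (I_le (ms_itv _) i2 i1) => x /=; rewrite in_itv /=; exact: pt.
  rewrite I_cst // le_eqVlt; apply/orP; left; apply/eqP; ring.
(* Enough pieces that their length [h] satisfies [2 h^2 <= e]. *)
have [N hN] : exists N : nat, 2 * (b - a) ^+ 2 <= e * N.+1%:R ^+ 2.
  have := archi_boundP (divr_ge0 (mulr_ge0 (ler0n R 2) (sqr_ge0 (b - a))) (ltW e0)).
  set N := Num.bound _; rewrite ltr_pdivrMr // mulrC => hN; exists N; apply: le_trans (ltW hN) _.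
  rewrite [leLHS]mulrC ler_pM2l // -natrX ler_nat; apply: leq_trans (leqnSn N) _.
  by rewrite expnS expn1 leq_pmulr.
pose h := (b - a) / N.+1%:R; have N0 : 0 < N.+1%:R :> R by rewrite ltr0n.
have h0 : 0 <= h by rewrite divr_ge0 ?subr_ge0 // ltW.
have pieces u k : (k <= N.+1)%N -> I `[a, a + h * k%:R] (fun x => fn u x ^+ 2) <=
    \sum_(i < k) 2 * h * fn u (a + h * i%:R) ^+ 2 + 2 * h ^+ 2 * I `[a, a + h * k%:R] (fun x => dv u x ^+ 2).
  elim: k => [|k IH] hk.
    by rewrite mulr0 addr0 big_ord0 /I set_itv1 !Rintegral_set1 mulr0 addr0.
  have hab : a + h * k.+1%:R <= b.
    rewrite -lerBrDl; apply: le_trans (_ : h * N.+1%:R <= _); first by rewrite ler_wpM2l // ler_nat.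
    by rewrite /h divfK // gt_eqF.
  have st : a + h * k%:R <= a + h * k.+1%:R by rewrite lerD2l ler_wpM2l // ler_nat.
  have a1 : a <= a + h * k%:R by rewrite lerDl mulr_ge0.
  have aD : `[a, a + h * k.+1%:R] `<=` D.
    by apply: subset_trans sub => r; rewrite /= !in_itv /=; lra.
  have i1 : ig `[a, a + h * k.+1%:R] (fun x => fn u x ^+ 2) by apply: (ig_sub mD _ aD) => //; case: (fn_sq u).
  have i2 : ig `[a, a + h * k.+1%:R] (fun x => dv u x ^+ 2) by apply: (ig_sub mD _ aD) => //; case: (dv_sq u).
  rewrite (I_cat a1 st i1) (I_cat a1 st i2) big_ord_recr /=.
  have := short u _ _ st; have -> : a + h * k.+1%:R - (a + h * k%:R) = h by rewrite -natr1; ring.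
  have sb : `[a + h * k%:R, a + h * k.+1%:R] `<=` `[a, b].
    by move=> r; rewrite /= !in_itv /=; lra.
  move=> /(_ sb); have := IH (ltnW hk); rewrite mulrDr; lra.
have NE : a + h * N.+1%:R = b by rewrite /h divfK ?gt_eqF // addrC subrK.
exists [seq (fun u : E => Num.sqrt (2 * h) * fn u (a + h * i%:R)) | i <- iota 0 N.+1].
have nE i : (i < N.+1)%N -> nth 0 [seq (fun u : E => Num.sqrt (2 * h) * fn u (a + h * i%:R)) | i <- iota 0 N.+1] i =
    fun u : E => Num.sqrt (2 * h) * fn u (a + h * i%:R).
  by move=> hi; rewrite (nth_map 0%N) ?size_iota // nth_iota.
have h2 : 0 <= 2 * h by rewrite mulr_ge0.
rewrite size_map size_iota; split=> [i hi|u].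
  rewrite nE //; split; first exact: lformZ (eval_lform _).
  have [M M0 HM] := eval_fbound (a + h * i%:R); exists ((2 * h + 1) * M).
    by rewrite mulr_gt0 // ltr_wpDl.
  move=> u; rewrite exprMn sqr_sqrtr // -[leRHS]mulrA; apply: ler_pM => //; first exact: sqr_ge0.
  by rewrite lerDl.
have := pieces u N.+1 (leqnn _); rewrite NE => /le_trans; apply.
rewrite addrC; apply: lerD.
  apply: ler_pM; first by rewrite mulr_ge0 // sqr_ge0.
  - by apply: I_ge0 => x _; exact: sqr_ge0.
  - by rewrite /h expr_div_n mulrA ler_pdivrMr // exprn_gt0.
  apply: le_trans (d0_le_n0 u); rewrite d0E; apply: I_subset => //; first by case: (dv_sq u).
  by move=> x _; exact: sqr_ge0.
by apply: ler_sum => i _; rewrite nE // exprMn sqr_sqrtr.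
Qed.

End Fixed.
End Space.

(** * Translations and periodic functions *)

Section Periodic.
Context {R : realType}.
Implicit Types (f g u : R -> R) (D : set R) (L x y a b c : R).

Lemma mf_addr c : @measurable_fun _ _ (measurableTypeR R) (measurableTypeR R) setT (fun x => x + c).
by apply: mf_cont => x; apply: cvgD; [exact: cvg_id|exact: cvg_cst]. Qed.

Lemma leb_shift c (A : set R) : ms A ->
  pushforward (leb R) ((fun x => x + c) : _ -> measurableTypeR R) A = leb R A.
have mc := mf_addr c.
move=> mA; apply/esym/lebesgue_measure_unique => //= _ [[a b]] _ <-.
rewrite /pushforward.
have -> : (fun x => x + c) @^-1` `]a, b] = [set` `]a - c, b - c]] :> set R.
  by apply/seteqP; split=> x /=; rewrite !in_itv /= ltrBlDr lerBrDr.
rewrite !lebesgue_measure_itv /= !lte_fin ltrD2r; case: ifP => // _.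
by rewrite -!EFinB; congr EFin; ring.
Qed.

Lemma ge0_integral_shift c (f : R -> \bar R) (A : set R) : ms A -> measurable_fun [set: R] f ->
  (forall x, 0 <= f x)%E -> (\int[leb R]_(x in A) f x = \int[leb R]_(x in (fun x => (x + c)%R) @^-1` A) f (x + c)%R)%E.
move=> mA mf f0.
have mc := mf_addr c.
rewrite -(@ge0_integral_pushforward _ _ (measurableTypeR R) (measurableTypeR R) R _ mc (leb R) A f mA) //; last exact: measurable_funS mf.
by apply: eq_measure_integral => B mB _; exact/esym/leb_shift.
Qed.

Lemma preim_shift c a b : (fun x => x + c) @^-1` [set` `[a + c, b + c]] = [set` `[a, b]] :> set R.
by apply/seteqP; split=> x /=; rewrite !in_itv /= !lerD2r. Qed.

Lemma ig_shift c a b f : mf f -> ig `[a + c, b + c] f -> ig `[a, b] (fun x => f (x + c)).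
move=> mf' /integrableP [_ h]; apply/integrableP; split.
  by apply/measurable_EFinP; apply: (@measurable_funS _ _ _ _ setT) => //; exact: mf_shift.
move: h; rewrite (@ge0_integral_shift c) ?preim_shift //.
by apply/measurable_EFinP; exact: mf_abs.
Qed.

Lemma I_shift c a b f : mf f -> ig `[a + c, b + c] f -> I `[a + c, b + c] f = I `[a, b] (fun x => f (x + c)).
move=> mf' hi; have ge0 g : mf g -> (forall x, 0 <= g x) -> I `[a + c, b + c] g = I `[a, b] (fun x => g (x + c)).
  move=> mg g0; rewrite /I /Rintegral (@ge0_integral_shift c) ?preim_shift //.
  exact/measurable_EFinP.
have i2 := ig_shift mf' hi; have ia := ig_abs (ms_itv _) hi; have ia2 := ig_abs (ms_itv _) i2.
have p0 x : 0 <= f x + `|f x| by have := ler_norm (- f x); rewrite normrN; lra.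
have e1 : I `[a + c, b + c] f = I `[a + c, b + c] (fun x => f x + `|f x|) - I `[a + c, b + c] (fun x => `|f x|).
  by rewrite I_D //; ring.
have e2 : I `[a, b] (fun x => f (x + c)) =
    I `[a, b] (fun x => f (x + c) + `|f (x + c)|) - I `[a, b] (fun x => `|f (x + c)|).
  by rewrite I_D //; ring.
rewrite e1 e2 (ge0 _ (mfD mf' (mf_abs mf')) p0).
by rewrite (ge0 _ (mf_abs mf')).
Qed.

Lemma ig_cat a b c f : mf f -> ig `[a, b] f -> ig `[b, c] f -> ig `[a, c] f.
move=> mf' h1 h2; have P d e : ig `[d, e] f -> ig setT (fun x => `|(f \_ `[d, e]) x|).
  move=> h; apply: ig_abs => //; rewrite /ig -restrict_EFin.
  by apply/(integrable_restrict _ (ms_itv _)) => //; rewrite setTI.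
apply: (@ig_le _ _ _ (fun x => `|(f \_ `[a, b]) x| + `|(f \_ `[b, c]) x|)) => //.
  by apply: igD => //; apply: (ig_sub ms_T) => //; exact: P.
move=> x; rewrite /= in_itv /= !patchE => /andP [ax xc].
have [xb|bx] := leP x b.
  by rewrite mem_set ?lerDl //= in_itv /= ax xb.
by rewrite [X in _ <= _ + `|X|](_ : _ = f x) ?lerDr // mem_set //= in_itv /= xc ltW.
Qed.

Lemma per_nat f L : (forall x, f (x + L) = f x) -> forall k x, f (x + L * k%:R) = f x.
move=> h; elim=> [|k IH] x; first by rewrite mulr0 addr0.
by rewrite -natr1 mulrDr mulr1 addrA h.
Qed.

Lemma per_rep L x : 0 < L -> exists2 y : R, 0 <= y <= L &
  forall f, (forall z, f (z + L) = f z) -> f x = f y.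
move=> L0; exists (x - L * (Num.floor (x / L))%:~R).
  have := floor_itv (x / L) ; rewrite ler_pdivlMr // ltr_pdivrMr // intrD mulrDl mul1r mulrC; lra.
move=> f pf; case: (Num.floor (x / L)) => k.
  rewrite -[in LHS](subrK (L * k%:R) x) (per_nat pf) //.
by rewrite NegzE mulrNz mulrN opprK -pmulrn (per_nat pf).
Qed.

Lemma domain_line : domain [set: R] 0 1.
split=> //; first by move=> x; exists x, x; split=> //; lra.
move=> a b; exists 1 => // f _ [f1 f2]; split; first exact: (ig_sub ms_T).
by rewrite mul1r; apply: I_subset => // x _; exact: sqr_ge0.
Qed.

Lemma per_shift L f : mf f -> (forall x, f (x + L) = f x) -> ig `[0, L] f -> forall k : nat,
  (ig `[L * k%:R, L * k.+1%:R] f /\ I `[L * k%:R, L * k.+1%:R] f = I `[0, L] f) /\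
  (ig `[- (L * k.+1%:R), - (L * k%:R)] f /\ I `[- (L * k.+1%:R), - (L * k%:R)] f = I `[0, L] f).
move=> mf' pf i0 k; have pk := per_nat pf k; have pk1 := per_nat pf k.+1.
have key c : (forall x, f (x + c) = f x) -> ig `[c, L + c] f /\ I `[c, L + c] f = I `[0, L] f.
  move=> pc; have pc' x : f (x - c) = f x by rewrite -[in RHS](subrK c x) pc.
  have i1 : ig `[c, L + c] f.
    have := @ig_shift (- c) c (L + c) f mf'; rewrite subrr addrK => /(_ i0).
    by move=> h; apply: ig_eq h _ => // x _.
  split=> //; have := @I_shift c 0 L f mf'; rewrite add0r => /(_ i1) ->.
  exact: I_eq.
split.
  by have := key (L * k%:R) pk; have -> : L + L * k%:R = L * k.+1%:R by rewrite -natr1; ring.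
have := key (- (L * k.+1%:R)) _; have -> : L + - (L * k.+1%:R) = - (L * k%:R) by rewrite -natr1; ring.
by apply => x; rewrite -(pk1 (x - _)) subrK.
Qed.

Lemma domain_per L : 0 < L -> domain `[0, L] L L.
move=> L0; split=> //.
  move=> x; have [y hy hf] := per_rep x L0; exists 0, y; split=> //; rewrite add0r //.
move=> a b.
have [n hn] : exists n : nat, - (L * n%:R) <= a /\ b <= L * n%:R.
  have K0 : 0 <= (`|a| + `|b|) / L by rewrite divr_ge0 // ?ltW // addr_ge0.
  have := archi_boundP K0; set n := Num.bound _; rewrite ltr_pdivrMr // mulrC => h.
  by exists n; have := ler_norm (- a); have := ler_norm b; have := normr_ge0 a; have := normr_ge0 b; rewrite normrN; lra.
exists (2 * n%:R + 1); first by rewrite ltr_wpDl // mulr_ge0.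
move=> f pf [f1 f2]; pose F x := f x ^+ 2.
have mF : mf F by exact: mfX.
have pF x : F (x + L) = F x by rewrite /F pf.
have key k : ig `[- (L * k%:R), L * k%:R] F /\ I `[- (L * k%:R), L * k%:R] F = 2 * k%:R * I `[0, L] F.
  elim: k => [|k [IH1 IH2]].
    rewrite mulr0 oppr0 mulr0 mul0r /I set_itv1 Rintegral_set1; split=> //.
    by rewrite -set_itv1; apply: (ig_sub (ms_itv `[0, L])) => // x; rewrite /= !in_itv /=; lra.
  have [[i1 e1] [i2 e2]] := per_shift mF pF f2 k.
  have kk : L * k%:R <= L * k.+1%:R by rewrite ler_pM2l // ler_nat.
  have k0 : 0 <= L * k%:R by rewrite mulr_ge0 // ltW.
  have j1 : ig `[- (L * k.+1%:R), L * k%:R] F by apply: ig_cat i2 IH1.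
  have j2 : ig `[- (L * k.+1%:R), L * k.+1%:R] F by apply: ig_cat j1 i1.
  split=> //; rewrite (@I_cat _ _ (L * k%:R)) //; last lra.
  rewrite (@I_cat _ _ (- (L * k%:R))) //; [|lra|lra].
  by rewrite IH2 e1 e2 -natr1; ring.
have [i1 e1] := key n; have sub : `[a, b] `<=` `[- (L * n%:R), L * n%:R].
  by move=> x; rewrite /= !in_itv /=; case: hn; lra.
split; first exact: (ig_sub (ms_itv _) (ms_itv _) sub i1).
apply: le_trans (I_subset (ms_itv _) (ms_itv _) sub i1 _) _; first by move=> x _; exact: sqr_ge0.
by rewrite e1 ler_wpM2r ?lerDl //; apply: I_ge0 => x _; exact: sqr_ge0.
Qed.

Lemma I_period f L a : 0 < L -> loc f -> (forall x, f (x + L) = f x) -> I `[a, a + L] f = I `[0, L] f.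
move=> L0 [mf' lf] pf; have [_ HP] := prim_AC (conj mf' lf).
have Q b c : b <= c -> prim f (c + L) - prim f (b + L) = prim f c - prim f b.
  move=> bc; rewrite !HP ?lerD2r // (I_shift mf' (lf _ _)).
  exact: I_eq.
have h0 : prim f L - prim f 0 = I `[0, L] f by apply: HP; exact: ltW.
rewrite -h0 -HP; last by rewrite lerDl ltW.
have := Q a 0; have := Q 0 a; rewrite add0r; move: (prim f (a + L)) (prim f L) (prim f a) (prim f 0) => p q r s.
by case/orP: (le_total a 0) => h h1 h2; [have := h2 h|have := h1 h]; lra.
Qed.

(** The space asks the derivative to be periodic everywhere, whereas a given one is so only almost
    everywhere. The upper limit of difference quotients depends on [u] alone and inherits its
    period. *)
Lemma AC_per_rep u g L : AC u g -> (forall x, u (x + L) = u x) ->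
  exists g', [/\ AC u g', {ae leb R, forall x, g x = g' x} & forall x, g' (x + L) = g' x].
move=> ug pu; pose d n x := n.+1%:R * (u (x + n.+1%:R^-1) - u x).
pose g' x := fine (limn_esup (fun n => (d n x)%:E)).
have md n : mf (d n).
  have mu := mf_cont (AC_cont ug).
  by apply: mfM; [exact: mfC|apply: mfB => //; exact: mf_shift].
have mg' : mf g'.
  apply: measurableT_comp; first exact: fine_measurable.
  by apply: measurable_fun_limn_esup => k; apply/measurable_EFinP; exact: md.
have gg' : {ae leb R, forall x, g x = g' x}.
  have [lg _] := ug; have /loc_intP /lebesgue_differentiation := lg.
  apply: ae_imp => x /(AC_deriv_leb ug) /is_derive1_epsP H.
  have hl : d n x @[n --> \oo] --> g x.
    apply/cvgrPdist_le => e e0; have [r r0 Hr] := H e e0; have [N hN] := ltr_add_invr r0.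
    exists N => // n /= hn; have n0 : 0 < n.+1%:R :> R by rewrite ltr0n.
    have nr : `|n.+1%:R^-1| < r :> R.
      rewrite gtr0_norm ?invr_gt0 //; apply: le_lt_trans hN; rewrite add0r lef_pV2 ?posrE ?ltr0n //.
      by rewrite ler_nat.
    have := Hr _ nr; rewrite (gtr0_norm (x := _^-1)) ?invr_gt0 // -(ler_pM2l n0).
    rewrite mulrCA divff ?gt_eqF // mulr1 -{1}(gtr0_norm n0) -normrM distrC.
    by congr (`|_| <= _); rewrite /d; field; rewrite gt_eqF.
  rewrite /g' (cvg_limn_einf_sup (l := (g x)%:E)) //.
  by apply: cvg_comp hl _; exact: cvg_refl.
exists g'; split=> //.
  have [[mg lg] H] := ug; split.
    by split=> // a b; apply: ig_ae gg' (lg a b).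
  by move=> a b ab; rewrite H //; apply: I_ae.
move=> x; rewrite /g'; congr (fine (limn_esup _)); apply/funext => n.
by rewrite /d pu -addrA [L + _]addrC addrA pu.
Qed.

End Periodic.

(** * From weakly differentiable functions to elements of the space *)

Section Bridge.
Context {R : realType}.
Implicit Types (f g u U : R -> R) (D : set R) (L x y a b c : R).

Lemma wD1_spec u g : weak_deriv u g -> weak_deriv u (wD 1 u) /\ {ae leb R, forall x, wD 1 u x = g x}.
move=> h; have h1 : weak_deriv u (wD 1 u) by exact: (xgetPex (fun=> 0) (ex_intro _ g h)).
by split=> //; apply: weak_uniq h1 h _; apply: aeW.
Qed.

Lemma wDS k u : wD k.+1 u = wD 1 (wD k u). by []. Qed.

Lemma weak_mf u g : weak_deriv u g -> mf u /\ mf g.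
by case=> /loc_intP [h1 _] /loc_intP [h2 _] _. Qed.

Lemma AC_weak_ae u U g g' : AC U g -> mf u -> mf g' -> {ae leb R, forall x, u x = U x} ->
  {ae leb R, forall x, g x = g' x} -> weak_deriv u g'.
move=> UG mu mg' h h'; have [[mg lg] _] := UG; have lU := loc_cont (AC_cont UG).
have wU := AC_weak UG; apply: (weak_ae wU _ _ _ h').
- split=> // a b; apply: ig_ae _ (lU.2 a b) => //; first by case: lU.
  by apply: ae_imp h => x ->.
- by split=> // a b; exact: (ig_ae (ms_itv _) mg mg' h' (lg a b)).
- by apply: ae_imp h => x ->.
Qed.

Lemma weak_line u g : weak_deriv u g -> sq setT u -> sq setT g ->
  exists p : H1 setT 0, {ae leb R, forall x, u x = fn p x} /\ dv p = g.
move=> w su sg; have [U UG hU] := weak_AC w.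
have h : hp setT 0 (U, g).
  by split=> //= [|x|x]; rewrite ?addr0 //; apply: sq_ae hU => //; exact: mf_cont (AC_cont UG).
by exists (H1_mk h).
Qed.

Lemma ae_shift (P : R -> Prop) c : {ae leb R, forall t, P t} -> {ae leb R, forall t, P (t + c)}.
move=> [N [mN N0 sN]]; exists ((fun t => t + c) @^-1` N); split.
- by have mc := mf_addr c; rewrite -[X in measurable X]setTI; exact: mc.
- by rewrite -(leb_shift c mN) in N0.
- by move=> t ht; apply: sN.
Qed.

(** Continuity makes the representative periodic at every point, and [AC_per_rep] then supplies a
    periodic derivative. *)
Lemma weak_per L u g : 0 < L -> {ae leb R, forall x, u (x + L) = u x} -> weak_deriv u g ->
  sq `[0, L] g ->
  exists p : H1 `[0, L] L, {ae leb R, forall x, u x = fn p x} /\ {ae leb R, forall x, g x = dv p x}.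
move=> L0 pu w sg; have [U UG hU] := weak_AC w.
have Uc := AC_cont UG.
have hU' := ae_shift L hU.
have pU : forall x, U (x + L) = U x.
  apply: (@cont_ae_eq _ (fun x => U (x + L)) U) => //.
    move=> x; apply: (@continuous_comp _ _ _ (fun x => x + L) U); last exact: Uc.
    by apply: cvgD; [exact: cvg_id|exact: cvg_cst].
  by apply: ae_imp (ae_and pu (ae_and hU hU')) => x [h1 [<- <-]].
have [g' [UG' gg' pg']] := AC_per_rep UG pU.
have h : hp `[0, L] L (U, g').
  split=> //=; first exact: sq_cont.
  by apply: sq_ae gg' => //; case: UG' => [[]].
by exists (H1_mk h).
Qed.

Lemma L2norm_open L u : 0 < L -> mf u -> sq `[0, L] u -> L2norm `]0, L[ u ^+ 2 = I `[0, L] (fun x => u x ^+ 2).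
move=> L0 mu [_ su]; rewrite L2norm_sq //.
have s1 : ig `[0, L[ (fun x => u x ^+ 2) by apply: (ig_sub (ms_itv `[0, L])) => // x; rewrite /= !in_itv /=; lra.
have s2 : ig `]0, L[ (fun x => u x ^+ 2) by apply: (ig_sub (ms_itv `[0, L])) => // x; rewrite /= !in_itv /=; lra.
have := @Rintegral_itv_bndo_bndc R (BLeft 0) L _ s1.
by have := @Rintegral_itv_obnd_cbnd R 0 (BLeft L) _ s2; rewrite /I => -> ->.
Qed.

End Bridge.

(** * Forms and second-order regularity on the line *)

Section Line.
Context {R : realType}.
Notation X := (H1 [set: R] 0).
Implicit Types (u v w p r : X) (f g h q : R -> R) (x a b c e M : R).
Let dm := @domain_line R.
Local Notation n0 := (@n0 R setT 0).
Local Notation l0 := (@l0 R setT 0).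
Local Notation d0 := (@d0 R setT 0).
Local Notation wf := (@wf R setT 0).
Local Notation qf := (@qf R setT 0).

Lemma tail f e : ig setT f -> (forall x, 0 <= f x) -> 0 < e ->
  exists2 M : R, 0 < M & forall a b, a <= - M -> M <= b -> I setT f <= I `[a, b] f + e.
move=> hf f0 e0; have mf' := measurable_int (leb R) hf.
pose F (k : nat) := [set` `[- (k%:R : R), k%:R]].
have nF : nondecreasing_seq F.
  move=> m k mk; rewrite subsetEset => x; rewrite /F /= !in_itv /=.
  have : m%:R <= k%:R :> R by rewrite ler_nat.
  lra.
have FT : \bigcup_k F k = setT.
  rewrite -subTset => x _; have := archi_boundP (normr_ge0 x); set N := Num.bound _ => hN.
  by exists N => //=; rewrite /F /= in_itv /= -ler_norml ltW.
have mF k : measurable_fun (F k) (EFin \o f) by exact: measurable_funS mf'.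
have cv := @ge0_nondecreasing_set_cvg_integral _ (measurableTypeR R) R F (EFin \o f) (leb R) nF (fun k => ms_itv _) mF (fun k x _ => f0 x : (0 <= (f x)%:E)%E).
have ifn A : ms A -> (\int[leb R]_(x in A) (f x)%:E = (I A f)%:E)%E.
  move=> mA; rewrite /I /Rintegral fineK //; apply: integrable_fin_num => //.
  exact: (ig_sub ms_T mA).
move: cv; rewrite FT ifn // => /fine_cvgP [_ /cvgrPdist_lt /(_ e e0) [N _ HN]].
exists N.+1%:R; first by rewrite ltr0n.
have := HN N.+1 (leqnSn N); rewrite /= (ifn (F N.+1) (ms_itv _)) => h a b ha hb.
have : I (F N.+1) f <= I `[a, b] f.
  apply: (I_subset (ms_itv _) (ms_itv _) _ (ig_sub ms_T (ms_itv _) (@subsetT _ _) hf)) => //.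
  by move=> x; rewrite /F /= !in_itv /=; lra.
by move: h; rewrite ltr_norml [fine _]/=; lra.
Qed.

Lemma tail_itv f e : ig setT f -> (forall x, 0 <= f x) -> 0 < e ->
  exists2 M : R, 0 < M & forall a b, a <= b -> (M <= a) || (b <= - M) -> I `[a, b] f <= e.
move=> hf f0 e0; have [M M0 HM] := tail hf f0 e0; exists M => // a b ab.
have i c d : ig `[c, d] f by exact: (ig_sub ms_T).
have sT c d : I `[c, d] f <= I setT f by exact: I_subset.
case/orP => h.
  have := HM (- M) a (lexx _) h; have := sT (- M) b; rewrite (@I_cat _ (- M) a b) //; lra.
have := HM b M h (lexx _); have := sT a M; rewrite (@I_cat _ a b M) //; lra.
Qed.

(** Far out every unit interval contains a point where [u^2] is small, its integral being small, and
    the variation of [u^2] from there is small as well. *)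
Lemma vanish u e : 0 < e -> exists2 M : R, 0 < M & forall x, M <= `|x| -> `|fn u x| <= e.
move=> e0; have e4 : 0 < e ^+ 2 / 4 by rewrite divr_gt0 // exprn_gt0.
have A2 := ACM (fn_AC dm u) (fn_AC dm u); pose g x := dv u x * fn u x + fn u x * dv u x.
have ig2 : ig setT (fun x => `|g x|).
  by apply: ig_abs => //; apply: igD => //; apply: sqM => //; (exact: (dv_sq dm) || exact: (fn_sq dm)).
have [M1 M10 H1'] := tail_itv ig2 (fun x => normr_ge0 _) e4.
have [M2 M20 H2] := tail_itv (fn_sq dm u).2 (fun x => sqr_ge0 _) e4.
have key x y : x <= y -> (M1 <= x) || (y <= - M1) -> `|fn u y ^+ 2 - fn u x ^+ 2| <= e ^+ 2 / 4.
  move=> xy h; have [lo /(_ x y xy)] := A2; rewrite !expr2 => ->.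
  by apply: le_trans (I_abs (ms_itv _) (lo.2 _ _)) (H1' x y xy h).
have pt y : M2 + 1 <= `|y| -> (y <= 0 -> exists2 z, y - 1 <= z <= y & fn u z ^+ 2 <= e ^+ 2 / 2) /\
   (0 <= y -> exists2 z, y <= z <= y + 1 & fn u z ^+ 2 <= e ^+ 2 / 2).
  have gen a : (M2 <= a) || (a + 1 <= - M2) -> exists2 z, a <= z <= a + 1 & fn u z ^+ 2 <= e ^+ 2 / 2.
    move=> ha; apply/not_exists2P => hn.
    have a1 : a <= a + 1 by lra.
    have := H2 a (a + 1) a1 ha; apply/negP; rewrite -ltNge.
    apply: lt_le_trans (_ : I `[a, a + 1] (fun=> e ^+ 2 / 2) <= _).
      by rewrite I_cst // [a + 1]addrC addrK mulr1; nra.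
    apply: I_le => //; [by apply: ig_itv_cont => x; exact: cst_continuous|exact: (ig_sub ms_T _ _ (fn_sq dm u).2)|].
    move=> z /=; rewrite in_itv /= => hz; case: (hn z) => [/negP|/negP]; first by rewrite hz.
    by rewrite -ltNge => /ltW.
  move=> hy; split=> y0.
    have [|z hz1 hz2] := gen (y - 1); first by apply/orP; right; move: hy; rewrite ler0_norm //; lra.
    by exists z => //; lra.
  have [|z hz1 hz2] := gen y; first by apply/orP; left; move: hy; rewrite ger0_norm //; lra.
  by exists z.
exists (M1 + M2 + 1); first lra.
move=> x hx; apply: sqr_le; first exact: ltW.
rewrite normK2 //; have xM : M2 + 1 <= `|x| by lra.
have [p1 p2] := pt x xM; have [x0|x0] := leP x 0.
  have [z /andP [z1 z2] z3] := p1 x0; rewrite ler0_norm // in hx.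
  by have := key z x z2; rewrite (_ : x <= - M1) ?orbT; [move=> /(_ isT); rewrite ler_norml; nra|lra].
have [z /andP [z1 z2] z3] := p2 (ltW x0); rewrite gtr0_norm // in hx.
by have := key x z z1; rewrite (_ : M1 <= x) //; [move=> /(_ isT); rewrite ler_norml; nra|lra].
Qed.

Lemma line_parts r v : I setT (fun x => dv r x * fn v x) + I setT (fun x => fn r x * dv v x) = 0.
have i1 : ig setT (fun x => dv r x * fn v x) by apply: sqM => //; [exact: (dv_sq dm)|exact: (fn_sq dm)].
have i2 : ig setT (fun x => fn r x * dv v x) by apply: sqM => //; [exact: (fn_sq dm)|exact: (dv_sq dm)].
rewrite -I_D //; set F := fun x => _; have iF : ig setT F by exact: igD.
apply/eqP; rewrite -normr_le0; apply/ler_addgt0Pr => e e0; rewrite add0r.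
have e4 : 0 < e / 4 by rewrite divr_gt0.
have [M1 M10 H1'] := tail (ig_abs ms_T iF) (fun x => normr_ge0 _) e4.
have e1 : 0 < Num.min 1 (e / 4) by rewrite lt_min ltr01.
have [M2 M20 H2] := vanish r e1; have [M3 M30 H3] := vanish v e1.
pose M := M1 + M2 + M3; have M0 : 0 < M by rewrite !addr_gt0.
have hM : - M <= M by lra.
have iM : ig `[- M, M] F by exact: (ig_sub ms_T).
have [_ /(_ _ _ hM)] := ACM (fn_AC dm r) (fn_AC dm v); rewrite -/F => E.
have small x : M <= `|x| -> `|fn r x * fn v x| <= e / 4.
  move=> hx; have h2 : `|fn r x| <= Num.min 1 (e / 4) by apply: H2; rewrite /M in hx; lra.
  have h3 : `|fn v x| <= Num.min 1 (e / 4) by apply: H3; rewrite /M in hx; lra.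
  rewrite normrM -[e / 4]mul1r; apply: ler_pM => //; [apply: le_trans h2 _|apply: le_trans h3 _];
  by rewrite ge_min lexx ?orbT.
have s1 := small M; have s2 := small (- M); rewrite normrN (gtr0_norm M0) in s1 s2.
have {s1 s2} h1 : `|I `[- M, M] F| <= e / 2.
  rewrite -E; have := s1 (lexx _); have := s2 (lexx _); rewrite !ler_norml; lra.
have h2 : `|I setT F - I `[- M, M] F| <= e / 4.
  have FP : ig setT (fun x => F x + `|F x|) by apply: igD => //; exact: ig_abs.
  have FN : ig setT (fun x => `|F x| - F x) by apply: igB => //; exact: ig_abs.
  have iaM := ig_abs (ms_itv _) iM; have iaT := ig_abs ms_T iF.
  have P0 x : 0 <= F x + `|F x| by have := ler_norm (- F x); rewrite normrN; lra.
  have N0 x : 0 <= `|F x| - F x by rewrite subr_ge0 ler_norm.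
  have := @I_subset _ setT `[- M, M] _ ms_T (ms_itv _) (@subsetT _ _) FP (fun x _ => P0 x).
  have := @I_subset _ setT `[- M, M] _ ms_T (ms_itv _) (@subsetT _ _) FN (fun x _ => N0 x).
  rewrite (I_B ms_T iaT iF) (I_B (ms_itv _) iaM iM) (I_D ms_T iF iaT) (I_D (ms_itv _) iM iaM).
  have : I setT (fun x => `|F x|) <= I `[- M, M] (fun x => `|F x|) + e / 4 by apply: H1'; rewrite /M; lra.
  by rewrite ler_norml; lra.
by move: h1 h2; rewrite !ler_norml; lra.
Qed.

(* Bump functions being test functions of the form, a weak solution of the
   form equation has a second derivative. *)
Lemma weak_H2 u f : sq setT f -> (forall v, d0 u v = - I setT (fun x => f x * fn v x)) ->
  exists r, {ae leb R, forall x, dv u x = fn r x} /\ dv r = f.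
move=> sf H; apply: weak_line => //; last exact: (dv_sq dm).
split.
- apply/loc_intP; exact: (sq_loc dm (dv_per dm u) (dv_sq dm u)).
- by apply/loc_intP; apply: (sq_loc dm _ sf) => x; rewrite addr0.
move=> phi tp; have ap := test_AC tp; have [M M0 HM] := test_supp tp.
have cp := AC_cont ap.
have cp' : continuous (derive1 phi).
  move=> x; apply: differentiable_continuous; apply/derivable1_diffP.
  by have [sm _] := tp; have := sm 1%N x; rewrite derive1n1.
have sc k : continuous k -> (forall x, M < `|x| -> k x = 0) -> sq setT k.
  move=> ck hk; split; first exact: mf_cont.
  have E : (fun x => k x ^+ 2) = (fun x => k x ^+ 2) \_ `[- M, M].
    apply/funext => x; rewrite patchE; case: ifPn => //; rewrite notin_setE /= in_itv /= => /negP.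
    by rewrite -ler_norml -ltNge => /hk ->; rewrite expr0n.
  rewrite E /ig -restrict_EFin; apply/(integrable_restrict _ (ms_itv _)) => //; rewrite setTI.
  by apply: ig_itv_cont => x; apply: cvgM; exact: ck.
have h : hp setT 0 (phi, derive1 phi).
  by split=> //= [||x|x]; rewrite ?addr0 //; apply: sc => // x /HM [].
by have := H (H1_mk h); rewrite /d0 /I /=.
Qed.

Lemma line_form_uniq u v : fn u =1 fn v -> {ae leb R, forall x, dv u x = dv v x}.
by move=> h; apply: AC_uniq (fn_AC dm u) _; apply: AC_ext (fn_AC dm v) _ _ => // x.
Qed.

(* An element of the second-order space: [fn r] is the derivative of [fn p]. *)
Definition h2 p r := dv p = fn r.

(** [h2] is an equality of functions, while weak equations give it almost everywhere; only the
    stored derivative has to be exchanged. *)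
Lemma h2_mk p r : {ae leb R, forall x, dv p x = fn r x} -> exists2 p', fn p' = fn p & h2 p' r.
move=> h; have [l H] := fn_AC dm p; have [mr lr] := loc_cont (@fn_cont R setT 0 1 dm r).
have A : AC (fn p) (fn r).
  split; first exact: loc_cont (@fn_cont R setT 0 1 dm r).
  by move=> a b ab; rewrite H //; apply: I_ae => //; case: l.
have hh : hp setT 0 (fn p, fn r).
  by split=> //= [||x|x]; rewrite ?addr0 //; exact: (fn_sq dm).
by exists (H1_mk hh).
Qed.

Lemma Hline2_rep f : Hline 2 f -> exists p r, [/\ {ae leb R, forall x, f x = fn p x}, h2 p r,
  {ae leb R, forall x, wD 2 f x = dv r x} & n0 p p <= Hnorm setT 2 f ^+ 2].
move=> [hw hl].
have w0 := hw 0%N isT; have w1 := hw 1%N isT.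
have [m0 m1] := weak_mf w0; have [_ m2] := weak_mf w1.
have s0 := (L2_sq ms_T m0).1 (hl 0%N isT); have s1 := (L2_sq ms_T m1).1 (hl 1%N isT).
have s2 := (L2_sq ms_T m2).1 (hl 2%N isT).
have [p [fp dp]] := weak_line w0 s0 s1; have [r [fr dr]] := weak_line w1 s1 s2.
have [|p' fp' hp'] := @h2_mk p r; first by rewrite dp.
exists p', r; split=> //; [by rewrite fp'|by apply: aeW => x; rewrite dr|].
rewrite sqr_sqrtr; last by apply: sumr_ge0 => i _; exact: sqr_ge0.
rewrite !big_ord_recl big_ord0 /= addr0 !(L2norm_sq _ ms_T) /n0 l0E d0E fp' hp'.
have -> : I setT (fun x => fn p x ^+ 2) = I setT (fun x => wD 0 f x ^+ 2).
  apply: I_ae => //; [by apply: mfX; exact: (fn_mf dm)|exact: mfX|].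
  by apply: ae_imp fp => x <-.
have -> : I setT (fun x => fn r x ^+ 2) = I setT (fun x => wD 1 f x ^+ 2).
  apply: I_ae => //; [by apply: mfX; exact: (fn_mf dm)|exact: mfX|].
  by apply: ae_imp fr => x <-.
by rewrite /bump /= addrA lerDl; apply: I_ge0 => x _; exact: sqr_ge0.
Qed.

Lemma rep_Hline2 f p r : mf f -> {ae leb R, forall x, f x = fn p x} -> h2 p r ->
  Hline 2 f /\ {ae leb R, forall x, wD 2 f x = dv r x}.
move=> mf' hf hpr.
have mr := fn_mf dm r; have mdr : mf (dv r) by case: (dv_sq dm r).
have w0 : weak_deriv f (fn r).
  by apply: (AC_weak_ae (fn_AC dm p)) => //; apply: aeW => x; rewrite hpr.
have [w0' e0] := wD1_spec w0; have [_ mw1] := weak_mf w0'.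
have w1 : weak_deriv (wD 1 f) (dv r) by apply: (AC_weak_ae (fn_AC dm r)) => //; exact: aeW.
have [w1' e1] := wD1_spec w1; have [_ mw2] := weak_mf w1'.
rewrite -(wDS 1 f) in w1' e1 mw2; split; last exact: e1.
split; first by case=> [_|[_|k hk]]; [exact: w0'|exact: w1'|exfalso].
case=> [|[|[|k]]] hk; [apply/(L2_sq ms_T mf')|apply/(L2_sq ms_T mw1)|apply/(L2_sq ms_T mw2)|by []].
- by apply: (sq_ae ms_T (fn_sq dm p)) => //; apply: ae_imp hf => x ->.
- by apply: (sq_ae ms_T (fn_sq dm r)) => //; apply: ae_imp e0 => x ->.
- by apply: (sq_ae ms_T (dv_sq dm r)) => //; apply: ae_imp e1 => x ->.
Qed.

Lemma qf_strong q p r v : bdd q -> h2 p r -> qf q p v = I setT (fun x => (- dv r x + q x * fn p x) * fn v x).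
move=> hq hpr; have i1 : ig setT (fun x => dv r x * fn v x) by apply: sqM => //; [exact: (dv_sq dm)|exact: (fn_sq dm)].
have i2 := ig_wf dm p v hq.
have := line_parts r v; rewrite /qf /d0 /wf hpr => E.
transitivity (I setT (fun x => q x * (fn p x * fn v x)) - I setT (fun x => dv r x * fn v x)); first lra.
by rewrite -I_B //; apply: I_eq => x _; ring.
Qed.

Lemma qf_weak q p f : bdd q -> sq setT f -> (forall v, qf q p v = I setT (fun x => f x * fn v x)) ->
  exists p' r, [/\ fn p' = fn p, h2 p' r & dv r = fun x => q x * fn p x - f x].
move=> hq sf H; have sqp : sq setT (fun x => q x * fn p x).
  by case: hq => mq [M _ HM]; apply: (sq_bounded ms_T mq (fun x _ => HM x)); exact: (fn_sq dm).
have [||r [h1 h2']] := @weak_H2 p (fun x => q x * fn p x - f x); first exact: sqB.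
  move=> v; have := H v; rewrite /qf /wf => E.
  have i1 := ig_wf dm p v hq; have i2 : ig setT (fun x => f x * fn v x) by apply: sqM => //; exact: (fn_sq dm).
  have -> : d0 p v = - (I setT (fun x => q x * (fn p x * fn v x)) - I setT (fun x => f x * fn v x)) by lra.
  by rewrite -I_B //; congr (- _); apply: I_eq => x _; ring.
have [p' fp' hp'] := h2_mk h1; by exists p', r.
Qed.

(** With [q] bounded by [M], [n0 <= qf q + (M + 1) l0], and the last term is at most [(M + 1) / k]
    times [qf q]. *)
Lemma coerc_up q (k : R) : bdd q -> 0 < k -> (forall u, k * l0 u u <= qf q u u) -> coercive (qf q) n0.
move=> [mq [M M0 HM]] k0 H; pose c := 1 + (M + 1) / k; have c0 : 0 < c by rewrite addr_gt0 // divr_gt0 // addr_gt0.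
exists c^-1; first by rewrite invr_gt0.
move=> u; rewrite mulrC ler_pdivrMr // /c mulrDr mulr1 [qf q u u * _]mulrC.
have h1 : (M + 1) * l0 u u <= (M + 1) / k * qf q u u.
  rewrite -mulrA ler_pM2l ?addr_gt0 // mulrC ler_pdivlMr // mulrC; exact: H.
have := wf_le dm u mq HM; rewrite ler_norml => h2; move: h1; rewrite /n0 /qf; lra.
Qed.

(** A decaying potential is relatively compact: outside a segment it is small, inside it
    [seg_compact] provides the functionals, scaled by the root of the bound of [q]. *)
Lemma wf_compact q e : bdd q -> (forall e : R, 0 < e -> exists2 M : R, 0 < M & forall x, M <= `|x| -> `|q x| <= e) ->
  0 < e -> exists ls : seq (X -> R),
  (forall i, (i < size ls)%N -> lform (nth 0 ls i) /\ fbound (nth 0 ls i) n0) /\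
  forall u, wf q u u <= e * n0 u u + \sum_(i < size ls) nth 0 ls i u * nth 0 ls i u.
move=> hq q0 e0; have [mq [B B0 HB]] := hq; have e2 : 0 < e / 2 by rewrite divr_gt0.
have [M M0 HM] := q0 _ e2; have MM : - M <= M by lra.
have eB : 0 < e / 2 / B by rewrite divr_gt0.
have [ls [hls H]] := seg_compact dm MM (@subsetT _ _) eB.
pose c := Num.sqrt B; have cB : c ^+ 2 = B by rewrite sqr_sqrtr // ltW.
exists [seq (fun u : X => c * f u) | f : X -> R <- ls].
have nE i : (i < size ls)%N -> nth 0 [seq (fun u : X => c * f u) | f : X -> R <- ls] i = fun u : X => c * nth 0 ls i u.
  by move=> hi; rewrite (nth_map 0).
rewrite size_map; split=> [i hi|u].
  have [h1 [K K0 HK]] := hls i hi; rewrite nE //; split; first exact: lformZ.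
  by exists (B * K); [exact: mulr_gt0|move=> u; rewrite exprMn cB -mulrA ler_pM2l].
have -> : \sum_(i < size ls) nth 0 [seq (fun u : X => c * f u) | f : X -> R <- ls] i u *
   nth 0 [seq (fun u : X => c * f u) | f : X -> R <- ls] i u = B * \sum_(i < size ls) nth 0 ls i u ^+ 2.
  by rewrite big_distrr; apply: eq_bigr => i _; rewrite nE // -expr2 exprMn cB.
have iw := ig_wf dm u u hq; have iu := (fn_sq dm u).2.
pose J x := fn u x ^+ 2 * \1_`[- M, M] x.
have iJ : ig setT J.
  have -> : J = (fun x => fn u x ^+ 2) \_ `[- M, M].
    by apply/funext => x; rewrite /J patchE indicE; case: ifP => _; rewrite ?mulr1 ?mulr0.
  rewrite /ig -restrict_EFin; apply/(integrable_restrict _ (ms_itv _)) => //; rewrite setTI.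
  exact: (ig_sub ms_T).
have JE : I setT J = I `[- M, M] (fun x => fn u x ^+ 2).
  rewrite [RHS]/I Rintegral_mkcond; apply: I_eq => x _; rewrite /J patchE indicE.
  by case: ifP => _; rewrite ?mulr1 ?mulr0.
apply: le_trans (_ : e / 2 * l0 u u + B * I setT J <= _); last first.
  rewrite JE; have := H u; rewrite -(ler_pM2l B0).
  have -> : B * (e / 2 / B * n0 u u + \sum_(i < size ls) nth 0 ls i u ^+ 2) =
    e / 2 * n0 u u + B * \sum_(i < size ls) nth 0 ls i u ^+ 2 by field; rewrite gt_eqF.
  have : e / 2 * l0 u u <= e / 2 * n0 u u by rewrite ler_pM2l // l0_le_n0.
  by set t1 := e / 2 * _; set t2 := e / 2 * _; rewrite (_ : e * n0 u u = t2 + t2); [lra|rewrite /t2; field].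
rewrite l0E -!I_Z // -I_D //; try exact: igZ.
apply: I_le => //; first by apply: igD => //; exact: igZ.
move=> x _; rewrite -expr2 /J indicE; have s0 := sqr_ge0 (fn u x).
have [_|hx] := boolP (x \in [set` `[- M, M]]); first by have := HB x; rewrite ler_norml mulr1; nra.
rewrite mulr0 mulr0 addr0 ler_wpM2r //; apply: le_trans (ler_norm _) (HM x _).
by move: hx; rewrite notin_setE /= in_itv /= -ler_norml => /negP; rewrite -ltNge => /ltW.
Qed.

End Line.

(** * Reading the complex spectral hypotheses on real functions *)

Section Complexified.
Local Open Scope complex_scope.
Context {R : realType}.
Notation X := (H1 [set: R] 0).
Implicit Types (p r : X) (f W : R -> R) (u : R -> R[i]) (a x : R).
Let dm := @domain_line R.

Definition genop W u : R -> R[i] := fun x => - cwD 2 u x + (W x)%:C * u x.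

Lemma cplx_eq (A B C D : R) : A +i* B = C +i* D <-> A = C /\ B = D.
by split=> [[-> ->]|[-> ->]]. Qed.

Lemma genopE W u x : genop W u x =
  (- wD 2 (cRe u) x + W x * cRe u x) +i* (- wD 2 (cIm u) x + W x * cIm u x).
rewrite /genop /cwD; have -> : u x = cRe u x +i* cIm u x by rewrite /cRe /cIm; case: (u x).
by apply/eqP; rewrite eq_complex /=; apply/andP; split; apply/eqP; ring.
Qed.

Lemma eig_parts W u a x : genop W u x = a%:C * u x <->
  - wD 2 (cRe u) x + W x * cRe u x = a * cRe u x /\ - wD 2 (cIm u) x + W x * cIm u x = a * cIm u x.
rewrite genopE; have -> : a%:C * u x = (a * cRe u x) +i* (a * cIm u x).
  by rewrite /cRe /cIm; case: (u x) => b c; apply/eqP; rewrite eq_complex /=; apply/andP; split; apply/eqP; ring.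
exact: cplx_eq.
Qed.

Definition cx f : R -> R[i] := fun x => f x +i* 0.

Lemma Hline2_0 : Hline 2 (fun=> 0 : R) /\ {ae leb R, forall x : R, wD 2 (fun=> 0 : R) x = 0}.
by apply: (@rep_Hline2 _ _ (0 : X) 0) => //; [exact: mfC|exact: aeW]. Qed.

Lemma cH2_cx p r : h2 p r -> cH2 (cx (fn p)).
move=> h; split; last exact: Hline2_0.1.
by have [] := @rep_Hline2 _ (fn p) p r (fn_mf dm p) (aeW (fun _ => erefl)) h.
Qed.

Lemma genop_cx W p r a : h2 p r -> {ae leb R, forall x, - dv r x + W x * fn p x = a * fn p x} ->
  aeq (genop W (cx (fn p))) (fun x => a%:C * cx (fn p) x).
move=> h e; have [_ e2] := @rep_Hline2 _ (fn p) p r (fn_mf dm p) (aeW (fun _ => erefl)) h.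
apply: ae_imp (ae_and e (ae_and e2 Hline2_0.2)) => x [h1 [h3 h4]].
have eR : cRe (cx (fn p)) = fn p by [].
have eI : cIm (cx (fn p)) = fun=> 0 by [].
by apply/eig_parts; rewrite eR eI h3 h4 !mulr0 oppr0 addr0.
Qed.

Lemma cx_ae0 p : aeq (cx (fn p)) (fun=> 0) -> fn p =1 fun=> 0.
move=> h; apply: cont_ae0; first exact: (fn_cont dm).
by apply: ae_imp h => x [].
Qed.

Lemma eig_rep W f a : Hline 2 f -> {ae leb R, forall x, - wD 2 f x + W x * f x = a * f x} ->
  exists p r, [/\ {ae leb R, forall x, f x = fn p x}, h2 p r &
    {ae leb R, forall x, - dv r x + W x * fn p x = a * fn p x}].
move=> hf e; have [p [r [fp hpr fr _]]] := Hline2_rep hf; exists p, r; split=> //.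
by apply: ae_imp (ae_and e (ae_and fp fr)) => x [h1 [<- <-]].
Qed.

Lemma inj_of_invertible W p r : invertible_H2_L2 (genop W) -> h2 p r ->
  {ae leb R, forall x, - dv r x + W x * fn p x = 0} -> fn p =1 fun=> 0.
move=> [_ inj _] h e; apply: cx_ae0; apply: inj; first exact: cH2_cx h.
have e0 : {ae leb R, forall x, - dv r x + W x * fn p x = 0 * fn p x}.
  by apply: ae_imp e => x ->; rewrite mul0r.
by apply: ae_imp (genop_cx h e0) => x ->; rewrite mul0r.
Qed.

Lemma inj_of_no_negative W p r a : no_negative_eigenvalue (genop W) -> a < 0 -> h2 p r ->
  {ae leb R, forall x, - dv r x + W x * fn p x = a * fn p x} -> fn p =1 fun=> 0.
move=> H a0 h e; apply: cx_ae0; apply: contrapT => n; apply: (H a a0).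
by exists (cx (fn p)); split=> //; [exact: cH2_cx h|exact: genop_cx h e].
Qed.

(** Applying [A - z] repeatedly, the last vector of the chain that is not null is an eigenvector. *)
Lemma gen_eig (A : (R -> R[i]) -> R -> R[i]) z k u : ~ aeq u (fun=> 0) -> gen_kernel A z k u -> Defs.eigenvalue A z.
elim: k u => [|k IH] u n /=; first by move=> /n.
move=> [hu hk]; have [e|n'] := pselect (aeq (opshift A z u) (fun=> 0)); last exact: IH n' hk.
by exists u; split=> //; apply: ae_imp e => x /eqP; rewrite /opshift subr_eq0 => /eqP.
Qed.

(** The real or the imaginary part of a complex eigenfunction is a real one, and simplicity makes
    every real eigenfunction to a negative eigenvalue a real multiple of it. *)
Lemma one_negative_rep W : one_negative_eigenvalue (genop W) -> exists a (p : X),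
  [/\ a < 0, exists2 r, h2 p r & {ae leb R, forall x, - dv r x + W x * fn p x = a * fn p x},
      ~ (fn p =1 fun=> 0) &
   forall b p' r', b < 0 -> h2 p' r' -> {ae leb R, forall x, - dv r' x + W x * fn p' x = b * fn p' x} ->
     exists c : R, fn p' =1 fun x => c * fn p x].
move=> [a [a0 [b [gb ib sb]] uniq]].
have nb : ~ aeq (b ord0) (fun=> 0).
  move=> h; have h1 : aeq (fun x => \sum_i 1 * b i x) (fun=> 0).
    by apply: ae_imp h => x E; rewrite big_ord1 E mulr0.
  by have /eqP := ib (fun=> 1) h1 ord0; rewrite oner_eq0.
have ev : Defs.eigenvalue (genop W) a%:C by case: (gb ord0) => k [_ hk]; exact: gen_eig nb hk.
have real_eig f : Hline 2 f -> {ae leb R, forall x, - wD 2 f x + W x * f x = a * f x} ->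
   ~ {ae leb R, forall x, f x = 0} -> exists2 p : X, ~ (fn p =1 fun=> 0) &
   exists2 r, h2 p r & {ae leb R, forall x, - dv r x + W x * fn p x = a * fn p x}.
  move=> hf e n; have [p [r [fp hpr er]]] := eig_rep hf e; exists p; last by exists r.
  by move=> z; apply: n; apply: ae_imp fp => x ->; rewrite z.
have [p np [r hpr er]] : exists2 p : X, ~ (fn p =1 fun=> 0) &
   exists2 r, h2 p r & {ae leb R, forall x, - dv r x + W x * fn p x = a * fn p x}.
  have [u [[hu1 hu2] nu eu]] := ev.
  have [z1|n1] := pselect {ae leb R, forall x, cRe u x = 0}; last first.
    by apply: real_eig hu1 _ n1; apply: ae_imp eu => x /eig_parts [].
  have [z2|n2] := pselect {ae leb R, forall x, cIm u x = 0}; last first.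
    by apply: real_eig hu2 _ n2; apply: ae_imp eu => x /eig_parts [].
  case: nu; apply: ae_imp (ae_and z1 z2) => x; rewrite /cRe /cIm.
  by case: (u x) => c d /= [-> ->].
exists a, p; split=> //; first by exists r.
move=> b' p' r' b0 hp' e'.
have [z|n'] := pselect (fn p' =1 fun=> 0).
  by exists 0 => x; rewrite z mul0r.
have ba : b' = a.
  apply: uniq => //; exists (cx (fn p')); split; [exact: cH2_cx hp'| |exact: genop_cx hp' e'].
  by move=> h; apply: n'; exact: cx_ae0.
have ge q s : h2 q s -> {ae leb R, forall x, - dv s x + W x * fn q x = a * fn q x} ->
    exists c : R[i], {ae leb R, forall x, cx (fn q) x = c * b ord0 x}.
  move=> hq eq; have [|c hc] := sb (cx (fn q)).
    exists 1%N; split; first exact: cH2_cx hq.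
    split; first exact: cH2_cx hq.
    by apply: ae_imp (genop_cx hq eq) => x E; rewrite /opshift E subrr.
  by exists (c ord0); apply: ae_imp hc => x ->; rewrite big_ord1.
rewrite ba in e'; have [c1 h1] := ge p r hpr er; have [c2 h2'] := ge p' r' hp' e'.
have c10 : c1 != 0.
  apply/eqP => z; apply: np; apply: cx_ae0; apply: ae_imp h1 => x ->.
  by rewrite z mul0r.
(* Both functions are real, so the real part of the complex ratio is the real ratio. *)
exists (complex.Re (c2 / c1)); apply: cont_ae_eq.
- exact: (fn_cont dm).
- by move=> x; apply: cvgM; [exact: cvg_cst|exact: (fn_cont dm)].
apply: ae_imp (ae_and h1 h2') => x [E1 E2].
have E : cx (fn p') x = (c2 / c1) * cx (fn p) x by rewrite E1 E2 mulrA divfK.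
have := congr1 (@complex.Re R) E; case: (c2 / c1) => s t /=; rewrite mulr0 subr0 => ->.
by [].
Qed.

(** The real part of the complex solution for a real right-hand side; the constant is squared
    because [n0] is a squared norm. *)
Lemma resolvent_rep mu V z : mf V -> invertible_H2_L2 (opshift (dxx_minus_muV mu V) z%:C) ->
  exists2 C : R, 0 <= C & forall f, sq setT f -> exists p r,
   [/\ h2 p r, {ae leb R, forall x, dv r x - (mu * V x + z) * fn p x = f x} &
    n0 p p <= C * I setT (fun x => f x ^+ 2)].
move=> mV [ex _ [C HC]]; exists (C ^+ 2); first exact: sqr_ge0.
move=> f sf; have [mf' _] := sf.
have L2z : L2 setT (fun=> 0 : R) by apply/L2_sq => //; [exact: mfC|exact: sq0].
have [|u hu eu] := ex (cx f); first by split=> //=; apply/L2_sq.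
have [p [r [fp hpr fr np]]] := Hline2_rep hu.1; exists p, r; split=> //.
  apply: ae_imp (ae_and eu (ae_and fp fr)) => x [E [<- <-]].
  have := congr1 (@complex.Re R) E; rewrite /opshift /dxx_minus_muV /cwD /cRe /=.
  by case: (u x) => c d /= <-; ring.
have parts : (cRe (opshift (dxx_minus_muV mu V) z%:C u) = fun x => wD 2 (cRe u) x - mu * V x * cRe u x - z * cRe u x) /\
    (cIm (opshift (dxx_minus_muV mu V) z%:C u) = fun x => wD 2 (cIm u) x - mu * V x * cIm u x - z * cIm u x).
  by split; apply/funext => x; rewrite /opshift /dxx_minus_muV /cwD /cRe /cIm /=;
    case: (u x) => c d /=; ring.
have mm g : Hline 2 g -> mf (fun x => wD 2 g x - mu * V x * g x - z * g x).
  move=> [hw _]; have [mg _] := weak_mf (hw 0%N isT); have [_ m2] := weak_mf (hw 1%N isT).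
  have m1 : mf (fun x => mu * V x) by apply: mfM => //; exact: mfC.
  have m3 : mf (fun x => z * g x) by apply: mfM => //; exact: mfC.
  exact: (mfB (mfB m2 (mfM m1 mg)) m3).
have eR : L2norm setT (cRe (opshift (dxx_minus_muV mu V) z%:C u)) ^+ 2 = I setT (fun x => f x ^+ 2).
  rewrite L2norm_sq //; apply: I_ae => //; [by rewrite parts.1; apply: mfX; exact: mm hu.1|exact: mfX|].
  by apply: ae_imp eu => x E; rewrite /cRe E.
have eI : L2norm setT (cIm (opshift (dxx_minus_muV mu V) z%:C u)) ^+ 2 = 0.
  rewrite L2norm_sq // -[RHS](I_0 setT); apply: I_ae => //; [by rewrite parts.2; apply: mfX; exact: mm hu.2|exact: mfC|].
  by apply: ae_imp eu => x E; rewrite /cIm E /= expr0n.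
apply: le_trans np _; have := HC u hu; rewrite /cH2norm /cL2norm eR eI addr0 => h.
have h0 : 0 <= cH2norm u by exact: sqrtr_ge0.
have I0 : 0 <= I setT (fun x => f x ^+ 2) by apply: I_ge0 => x _; exact: sqr_ge0.
apply: le_trans (_ : (cH2norm u) ^+ 2 <= _).
  have -> : cH2norm u ^+ 2 = Hnorm setT 2 (cRe u) ^+ 2 + Hnorm setT 2 (cIm u) ^+ 2.
    by apply: sqr_sqrtr; apply: addr_ge0; exact: sqr_ge0.
  by rewrite lerDl sqr_ge0.
rewrite -[X in _ * X](sqr_sqrtr I0) -exprMn lerXn2r ?nnegrE //.
exact: le_trans h0 h.
Qed.

End Complexified.

(** * Coercivity of L- and L+ on the line *)

Section Variational.
Local Open Scope complex_scope.
Context {R : realType}.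
Notation X := (H1 [set: R] 0).
Implicit Types (u v p r e : X) (f h q W V psi : R -> R) (x t a b c M mu om : R).
Let dm := @domain_line R.
Local Notation n0 := (@n0 R setT 0).
Local Notation l0 := (@l0 R setT 0).
Local Notation wf := (@wf R setT 0).
Local Notation qf := (@qf R setT 0).
Let hl := bform_l0 dm.
Let l00 := @l0_ge0 R setT 0.

Lemma bddB q w : bdd q -> bdd w -> bdd (fun x => q x - w x).
move=> [mq [M M0 HM]] [mw [N N0 HN]]; split; first exact: mfB.
exists (M + N); first exact: addr_gt0.
by move=> x; apply: le_trans (ler_normB _ _) _; rewrite lerD.
Qed.
Lemma bddD q w : bdd q -> bdd w -> bdd (fun x => q x + w x).
move=> [mq [M M0 HM]] [mw [N N0 HN]]; split; first exact: mfD.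
exists (M + N); first exact: addr_gt0.
by move=> x; apply: le_trans (ler_normD _ _) _; rewrite lerD.
Qed.
Lemma bdd_cst c : bdd (fun=> c : R).
by split; [exact: mfC|exists (`|c| + 1); [rewrite ltr_wpDl|move=> _; rewrite lerDl]]. Qed.
Lemma bddZ c q : bdd q -> bdd (fun x => c * q x).
move=> [mq [M M0 HM]]; split; first by apply: mfM => //; exact: mfC.
exists ((`|c| + 1) * M); first by rewrite mulr_gt0 // ltr_wpDl.
by move=> x; rewrite normrM; apply: ler_pM => //; rewrite lerDl.
Qed.
Lemma qfD q k u v : bdd q -> qf (fun x => q x + k) u v = qf q u v + k * l0 u v.
move=> hq; rewrite /qf -addrA; congr (_ + _).
have i1 := ig_wf dm u v hq; have i2 := ig_fn dm u v.
rewrite /wf /l0 -(I_Z k ms_T i2) -(I_D ms_T i1 (igZ k ms_T i2)).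
by apply: I_eq => x _; ring.
Qed.
Lemma qfB q w u v : bdd q -> bdd w -> qf (fun x => q x - w x) u v = qf q u v - wf w u v.
move=> hq hw; rewrite /qf -addrA; congr (_ + _).
by rewrite /wf -I_B ?(ig_wf dm) //; apply: I_eq => x _; ring.
Qed.

Section Fixed.
Local Open Scope complex_scope.
Variables (q w : R -> R).
Hypotheses (hq : bdd q) (hw : bdd w) (cq : coercive (qf q) n0).
Hypothesis w0 : forall e : R, 0 < e -> exists2 M : R, 0 < M & forall x, M <= `|x| -> `|w x| <= e.
Let W x := q x - w x.
Let hW : bdd W := bddB hq hw.

(** [w] decays, so it is small up to finitely many functionals against the coercive form of [q], and
    [kernel_alternative] applies. *)
Lemma alternative (k K : R) e : 0 <= k -> 0 <= K ->
  (forall u, 0 <= qf W u u + k * l0 u u + K * l0 u e ^+ 2) ->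
  (exists2 c : R, 0 < c & forall u, c * n0 u u <= qf W u u + k * l0 u u + K * l0 u e ^+ 2) \/
  exists2 r, 0 < l0 r r & forall v, qf W r v + k * l0 r v + K * (l0 r e * l0 v e) = 0.
move=> k0 K0 pos; pose b u v := qf W u v + k * l0 u v + K * (l0 u e * l0 v e).
have le : lform (fun u => l0 u e) by split=> [u v|c u]; rewrite ?(bDl hl) ?(bZl hl).
have hb : bform b.
  by apply: bformD; [apply: bformD; [exact: (bform_qf dm)|exact: bformZ]|apply: bformZ; exact: bform_sq].
have b0 : nneg b by move=> u; rewrite /b -expr2.
have bM : bbound b n0.
  have [M M0 HM] := qf_bbound dm hW; exists (M + k + K * l0 e e + 1).
    by rewrite ltr_wpDl // !addr_ge0 ?mulr_ge0 // ltW.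
  move=> u; rewrite ger0_norm // /b -expr2; have := HM u; rewrite ler_norml => /andP [_ h1].
  have := form_CS hl l00 u e => h2; have nl := l0_le_n0 u; have n00 := n0_ge0 u; have lu := l00 u.
  have le0 := l00 e.
  have h3 : K * l0 u e ^+ 2 <= K * l0 e e * n0 u u.
    apply: le_trans (ler_wpM2l K0 h2) _; rewrite mulrCA [leRHS]mulrC; apply: ler_wpM2r => //.
    by rewrite mulr_ge0.
  have h4 : k * l0 u u <= k * n0 u u by rewrite ler_wpM2l.
  by rewrite !mulrDl; lra.
have [c c0 Hc] := cq; have c2 : 0 < c / 2 by rewrite divr_gt0.
have [ls [hls Hls]] := wf_compact hw w0 c2.
have alt := kernel_alternative (@n0_ge0 R setT 0) (complete_n0 dm) hb b0 bM hls.
case: alt => [|[c' c'0 H]|[r r0 H]].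
- exists (c / 2) => // u; rewrite /b (qfB _ _ hq hw) -expr2.
  have := Hls u; have := Hc u; have := mulr_ge0 k0 (l00 u); have := mulr_ge0 K0 (sqr_ge0 (l0 u e)).
  set S := \sum_(i < _) _; move: (qf q u u) (wf w u u) (k * l0 u u) (K * _) => t1 t2 t3 t4.
  by rewrite (_ : c / 2 * n0 u u = (c * n0 u u) / 2); [lra|field].
- by left; exists c' => // u; have := H u; rewrite /b -expr2.
(* A kernel vector with [l0 r r = 0] would vanish identically, hence also have a null derivative,
   against [0 < n0 r r]. *)
right; exists r => //; rewrite lt_neqAle l00 andbT eq_sym; apply/eqP => lr.
have fr : fn r =1 fun=> 0.
  have : {ae leb R, forall x, setT x -> fn r x ^+ 2 = 0}.
    apply: (I_eq0 ms_T _ (fn_sq dm r).2 (fun x _ => sqr_ge0 _)); first by apply: mfX; exact: (fn_mf dm).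
    by have := l0E r; rewrite lr => <-.
  move=> h; apply: cont_ae_eq; [exact: (fn_cont dm)|by move=> x; exact: cst_continuous|].
  by apply: ae_imp h => x /(_ Logic.I) /eqP; rewrite sqrf_eq0 => /eqP.
have := @line_form_uniq R r 0 fr; move=> dr.
move: r0; rewrite /n0 lr add0r d0E (@I_ae _ setT _ (fun=> 0)) //; first by rewrite I_0 ltxx.
- by apply: mfX; case: (dv_sq dm r).
- exact: mfC.
by apply: ae_imp dr => x ->; rewrite expr0n.
Qed.

(** Take the least shift [k >= 0] that makes the form nonnegative. If it were positive, coercivity
    there would allow a smaller shift, so there is a kernel vector, and the hypothesis on negative
    eigenvalues excludes it. *)
Lemma nonneg_mod (K : R) e : 0 <= K ->
  (forall k r, 0 < k -> (forall v, qf W r v + k * l0 r v + K * (l0 r e * l0 v e) = 0) -> l0 r r = 0) ->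
  forall u, 0 <= qf W u u + K * l0 u e ^+ 2.
move=> K0 H; pose S := [set k : R | 0 <= k /\ forall u, 0 <= qf W u u + k * l0 u u + K * l0 u e ^+ 2].
have hS : has_inf S.
  split; last by exists 0 => k [].
  have [mW [M M0 HM]] := hW; exists M; split=> [|u]; first exact: ltW.
  have := wf_le dm u mW HM; rewrite ler_norml => /andP [h _]; have := d0_ge0 u.
  have := mulr_ge0 K0 (sqr_ge0 (l0 u e)); rewrite /qf; lra.
set k := inf S; have k0 : 0 <= k by apply: lb_le_inf; [case: hS|move=> z []].
have kS u : 0 <= qf W u u + k * l0 u u + K * l0 u e ^+ 2.
  apply/ler_addgt0Pr => d d0'; have d1 : 0 < d / (l0 u u + 1) by rewrite divr_gt0 // ltr_wpDl.
  have [z [z0 zS] zk] := inf_adherent d1 hS; have := zS u.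
  have : z * l0 u u <= (k + d / (l0 u u + 1)) * l0 u u by rewrite ler_wpM2r // ltW.
  have : d / (l0 u u + 1) * l0 u u <= d.
    by rewrite mulrAC ler_pdivrMr ?ltr_wpDl // ler_pM2l // lerDl.
  by rewrite mulrDl; lra.
move: k0; rewrite le_eqVlt => /orP [/eqP k0|k0].
  by move=> u; have := kS u; rewrite -k0 mul0r addr0.
exfalso; have [[c c0 Hc]|[r r0 Hr]] := alternative (ltW k0) K0 kS; last first.
  by move: r0; rewrite (H k r k0 Hr) ltxx.
pose k' := Num.max 0 (k - c).
have : k <= k'.
  apply: ge_inf; first by case: hS.
  split; first by rewrite le_max lexx.
  move=> u; have := Hc u; have := l0_le_n0 u; have := l00 u => h1 h2 h3.
  have : (k - c) * l0 u u <= k' * l0 u u by rewrite ler_wpM2r // le_max lexx orbT.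
  have : c * l0 u u <= c * n0 u u by rewrite ler_pM2l.
  by rewrite mulrBl; lra.
by rewrite le_max leNgt k0 /= lerBrDr gerDl leNgt c0.
Qed.

(** A kernel vector of the form corrected by the square of [l0 u p] is orthogonal to [p] by [nul],
    hence in the kernel of the uncorrected form, where [ker] excludes it. *)
Lemma coercive_mod p : (forall u, 0 <= qf W u u + l0 u p ^+ 2) ->
  (forall r, (forall v, qf W r v = 0) -> l0 r p = 0 -> l0 r r = 0) ->
  (forall r, qf W r r + 1 * l0 r p ^+ 2 = 0 -> l0 r p = 0) ->
  exists2 c : R, 0 < c & exists2 K : R, 0 <= K & forall u, c * n0 u u - K * l0 u p ^+ 2 <= qf W u u.
move=> pos ker nul.
have pos' u : 0 <= qf W u u + 0 * l0 u u + 1 * l0 u p ^+ 2 by rewrite mul0r addr0 mul1r.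
have [[c c0 Hc]|[r r0 Hr]] := alternative (lexx 0) (@ler01 R) pos'.
  by exists c => //; exists 1 => // u; have := Hc u; lra.
have z : l0 r p = 0.
  by apply: nul; have := Hr r; rewrite mul0r addr0 -expr2.
exfalso; move: r0; rewrite ker ?ltxx // => v; have := Hr v.
by rewrite z !mul0r mulr0 !addr0.
Qed.

End Fixed.

(* At the smallest shift for which the form is nonnegative it is not coercive,
   whereas invertibility of the operator there would make it coercive. *)
Lemma coercive_of_spectrum mu V om p0 : bdd (fun x => mu * V x) -> mf V -> 0 < l0 p0 p0 ->
  (spectral_bound (dxx_minus_muV mu V) < om%:E)%E ->
  coercive (qf (fun x => mu * V x + om)) n0.
move=> hV mV p00 hs; pose A z u v := qf (fun x => mu * V x) u v + z * l0 u v.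
have hA z u v : qf (fun x => mu * V x + z) u v = A z u v by exact: qfD.
pose S := [set z : R | forall u, 0 <= A z u u].
have hS : has_inf S.
  split; last first.
    exists (- (qf (fun x => mu * V x) p0 p0 / l0 p0 p0)) => z /(_ p0); rewrite /A => h.
    by rewrite -mulNr ler_pdivrMr //; lra.
  have [mW [M M0 HM]] := hV; exists M => u.
  by have := wf_le dm u mW HM; rewrite ler_norml => /andP [h _]; have := d0_ge0 u; rewrite /A /qf; lra.
set z := inf S.
have zS u : 0 <= A z u u.
  apply/ler_addgt0Pr => d d0'; have d1 : 0 < d / (l0 u u + 1) by rewrite divr_gt0 // ltr_wpDl.
  have [y yS yz] := inf_adherent d1 hS; have := yS u; rewrite /A.
  have : y * l0 u u <= (z + d / (l0 u u + 1)) * l0 u u by rewrite ler_wpM2r // ltW.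
  have : d / (l0 u u + 1) * l0 u u <= d.
    by rewrite mulrAC ler_pdivrMr ?ltr_wpDl // ler_pM2l // lerDl.
  by rewrite mulrDl; lra.
have [zo|oz] := ltP z om.
  apply: (@coerc_up _ _ (om - z)); [by apply: bddD => //; exact: bdd_cst|by rewrite subr_gt0|].
  by move=> u; rewrite hA; have := zS u; rewrite /A; lra.
exfalso; have inv : invertible_H2_L2 (opshift (dxx_minus_muV mu V) z%:C).
  apply: contrapT => n; have : (z%:E <= spectral_bound (dxx_minus_muV mu V))%E.
    by apply: ereal_sup_ubound; exists z%:C.
  by move=> h; have := le_lt_trans h hs; rewrite lte_fin ltNge oz.
have [C C0 HC] := resolvent_rep mV inv.
have C1 : 0 < C + 1 by rewrite ltr_wpDl.
have bA : bform (A z).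
  have hb := bform_qf dm (bddD hV (bdd_cst z)); split=> *; rewrite -!hA;
  [exact: (bDl hb)|exact: (bZl hb)|exact: (bC hb)].
(* Let [p] solve [A z p = v] weakly. Cauchy-Schwarz for the nonnegative form gives
   [(l0 v v)^2 <= l0 v p * A z v v], and the resolvent bound gives [l0 v p <= (C + 1) l0 v v]. *)
have co v : l0 v v <= (C + 1) * A z v v.
  have sv : sq setT (fun x => - fn v x).
    by have := sqZ (-1) ms_T (fn_sq dm v); congr (sq setT _); apply/funext => x; rewrite mulN1r.
  have [p [r [hpr er np]]] := HC _ sv.
  have E u : A z p u = l0 v u.
    rewrite -hA (qf_strong _ _ hpr); last by apply: bddD => //; exact: bdd_cst.
    rewrite /l0; apply: I_ae => //.
    - apply: mfM; last exact: (fn_mf dm).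
      apply: mfD; first by apply: mfN; case: (dv_sq dm r).
      by apply: mfM; [have [] := bddD hV (bdd_cst z)|exact: (fn_mf dm)].
    - by apply: mfM; exact: (fn_mf dm).
    by apply: ae_imp er => x h; congr (_ * _); lra.
  have h1 := form_CS bA zS p v; rewrite !E in h1.
  have h2 : l0 v p ^+ 2 <= l0 v v * (C * l0 v v).
    apply: le_trans (form_CS hl l00 v p) _; apply: ler_wpM2l; first exact: l00.
    apply: le_trans (l0_le_n0 p) _; apply: le_trans np _.
    by rewrite l0E (@I_eq _ _ (fun x => (- fn v x) ^+ 2) (fun x => fn v x ^+ 2)) // => x _; rewrite sqrrN.
  have lv := l00 v; have Av := zS v.
  have h3 : l0 v p <= (C + 1) * l0 v v by apply: sqr_le; rewrite ?mulr_ge0 //; nra.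
  have [->|ln] := eqVneq (l0 v v) 0; first by rewrite mulr_ge0 // ltW.
  have lp : 0 < l0 v v by rewrite lt_neqAle eq_sym ln.
  rewrite -(ler_pM2l lp) -expr2; apply: le_trans h1 _; nra.
(* The form would remain nonnegative for a shift smaller than the least one. *)
have : z <= z - (C + 1)^-1.
  apply: ge_inf; first by case: hS.
  move=> u; have := co u; rewrite -[leLHS]mul1r -ler_pdivrMl // mul1r /A mulrBl; lra.
by rewrite lerBrDr gerDl leNgt invr_gt0 C1.
Qed.

Lemma l0_eq0 u : l0 u u = 0 -> fn u =1 fun=> 0.
move=> lr; have : {ae leb R, forall x, setT x -> fn u x ^+ 2 = 0}.
  apply: (I_eq0 ms_T _ (fn_sq dm u).2 (fun x _ => sqr_ge0 _)); first by apply: mfX; exact: (fn_mf dm).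
  by have := l0E u; rewrite lr => <-.
move=> h; apply: cont_ae0; first exact: (fn_cont dm).
by apply: ae_imp h => x /(_ Logic.I) /eqP; rewrite sqrf_eq0 => /eqP.
Qed.

Lemma l0_zero u : fn u =1 (fun=> 0) -> l0 u u = 0.
by move=> h; transitivity (I setT (fun=> 0 : R)); [apply: I_eq => x _; rewrite h mul0r|exact: I_0].
Qed.

(** Uniqueness for [y'' = h y] by Gronwall: the derivative of [y^2 + z^2] is at most [1 + M] times
    it. *)
Lemma ode_zero_pos y z h M : (forall x, is_derive x 1 y (z x)) -> (forall x, is_derive x 1 z (h x * y x)) ->
  (forall x, `|h x| <= M) -> y 0 = 0 -> z 0 = 0 -> forall t, 0 <= t -> y t = 0.
move=> dy dz hM y0 z0 t t0; have M0 : 0 <= M by exact: le_trans (hM 0).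
pose E x := y x * y x + z x * z x; pose dE x := (y x * z x + y x * z x) + (z x * (h x * y x) + z x * (h x * y x)).
have cE : curve E dE.
  have dd x : is_derive x 1 E (dE x) by apply: is_deriveD; apply: is_deriveM.
  by split=> [x|x _]; [exact: is_derive_cont (dd x)|].
have C0 : 0 < 1 + M by rewrite ltr_pwDl.
have G : forall s, 0 < s -> dE s <= (1 + M) * E s + 0.
  move=> s _; rewrite addr0 /dE /E; have := hM s; rewrite ler_norml => /andP [h1 h2].
  move: (y s) (z s) (h s) h1 h2 => p r k h1 h2; have Mk : 0 <= M + k by lra.
  have e1 : 0 <= (M - k) * (p + r) ^+ 2 by rewrite mulr_ge0 ?sqr_ge0 // subr_ge0.
  have e2 := mulr_ge0 Mk (sqr_ge0 (p - r)); have := sqr_ge0 (p - r).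
  by move: e1 e2; rewrite !sqrrB !sqrrD; nra.
have := gronwall cE C0 t0 G; rewrite mul0r !addr0 {2}/E y0 z0 !mulr0 addr0 mul0r /E => h1.
have : y t ^+ 2 <= 0 by have := sqr_ge0 (z t); rewrite !expr2; lra.
by rewrite real_exprn_even_le0 ?num_real //= => /eqP.
Qed.

Lemma ode_zero y z h M : (forall x, is_derive x 1 y (z x)) -> (forall x, is_derive x 1 z (h x * y x)) ->
  (forall x, `|h x| <= M) -> y 0 = 0 -> z 0 = 0 -> y =1 fun=> 0.
move=> dy dz hM y0 z0 t; have [t0|t0] := leP 0 t; first exact: (ode_zero_pos dy dz hM).
have nt : 0 <= - t by rewrite oppr_ge0 ltW.
have dN x : is_derive x 1 (fun x : R => - x) (- 1) by apply: is_deriveN.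
have := @ode_zero_pos (fun x => y (- x)) (fun x => - z (- x)) (fun x => h (- x)) M _ _ _ _ _ _ nt.
rewrite opprK oppr0; apply => //; last by rewrite z0 oppr0.
- by move=> x; have := is_derive1_comp (dy (- x)) (dN x); rewrite mulrN1.
move=> x; have := is_derive1_comp (dz (- x)) (dN x); rewrite mulrN1 => d.
by rewrite -[X in is_derive _ _ _ X]opprK; apply: is_deriveN.
Qed.

(** The Wronskian of two solutions is constant, and it is integrable over the line as a combination
    of products of square integrable functions; so it vanishes. *)
Lemma wronskian W u p : continuous W -> bdd W -> (forall v, qf W u v = 0) -> (forall v, qf W p v = 0) ->
  0 < l0 p p -> exists c : R, fn u =1 fun x => c * fn p x.
move=> cW bW ku kp pp; have [_ [M M0 HM]] := bW.
have reg u' : (forall v, qf W u' v = 0) -> exists r, [/\ forall x, is_derive x 1 (fn u') (fn r x) &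
    AC (fn r) (fun x => W x * fn u' x)].
  move=> k; have [|u1 [r [fu hr dr]]] := qf_weak bW (sq0 setT) (p := u').
    move=> v; rewrite k; symmetry; transitivity (I setT (fun=> 0 : R)); last exact: I_0.
    by apply: I_eq => x _; rewrite mul0r.
  exists r; split=> [x|].
    have := fn_AC dm u1; rewrite fu hr => h; apply: AC_deriv h _; exact: (fn_cont dm).
  by have := fn_AC dm r; rewrite dr => h; apply: AC_ext h _ _ => // x; rewrite subr0.
have [r [du Ar]] := reg u ku; have [s [dp As]] := reg p kp.
have dd u' r' : AC (fn r') (fun x => W x * fn u' x) -> forall x, is_derive x 1 (fn r') (W x * fn u' x).
  by move=> A x; apply: AC_deriv A _; apply: cvgM; [exact: cW|exact: (fn_cont dm)].
have dr := dd _ _ Ar; have ds := dd _ _ As.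
pose w x := fn r x * fn p x - fn u x * fn s x.
have w0 x : w x = 0.
  have wc : forall a b, w a = w b.
    have dw t : is_derive t 1 w 0.
      have := is_deriveB (is_deriveM (dr t) (dp t)) (is_deriveM (du t) (ds t)).
      by move=> d; apply: is_derive_eq d _; rewrite /GRing.scale /=; ring.
    have A : AC w (fun=> 0) by apply: AC_C1 => // t; exact: cst_continuous.
    move=> a b; case: A => _ A; case/orP: (le_total a b) => ab; have := A _ _ ab; rewrite I_0 => /eqP;
    by rewrite subr_eq0 => /eqP.
  have iw : ig setT w.
    by apply: igB => //; apply: sqM => //; exact: (fn_sq dm).
  apply/eqP; rewrite -normr_le0; apply/ler_addgt0Pr => d d0'; rewrite add0r.
  have [K K0 HK] := tail_itv (ig_abs ms_T iw) (fun x => normr_ge0 _) d0'.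
  have := HK K (K + 1); rewrite lexx /= lerDl ler01 => /(_ isT isT); rewrite (@I_eq _ _ _ (fun=> `|w x|)).
    by rewrite I_cst ?lerDl // [K + 1]addrC addrK mulr1.
  by move=> t _; rewrite (wc t x).
have comb (c : R) : fn u 0 = c * fn p 0 -> fn r 0 = c * fn s 0 -> fn u =1 fun x => c * fn p x.
  move=> e1 e2 x; apply/eqP; rewrite -subr_eq0; apply/eqP.
  have dc (f g : R -> R) (c' x' : R) : is_derive x' 1 f (g x') -> is_derive x' 1 (fun y0 : R => c' * f y0) (c' * g x').
    by move=> d; have := is_deriveZ c' d.
  apply: (@ode_zero (fun x => fn u x - c * fn p x) (fun x => fn r x - c * fn s x) W M) => //.
  - move=> t; rewrite mulrBr (_ : W t * (c * fn p t) = c * (W t * fn p t)); last by ring.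
    by apply: is_deriveB => //; apply: (dc _ (fun t => W t * fn p t)).
  - by rewrite e1 subrr.
  - by rewrite e2 subrr.
have := w0 0; rewrite /w => W0.
(* The ratio is read off at 0 from the value or the derivative of [p], which cannot both vanish. *)
have [p0|p0] := eqVneq (fn p 0) 0; last first.
  exists (fn u 0 / fn p 0); apply: comb; first by rewrite divfK.
  by apply: (mulIf p0); rewrite mulrAC divfK //; lra.
have [s0|s0] := eqVneq (fn s 0) 0; last first.
  exists (fn r 0 / fn s 0); apply: comb; last by rewrite divfK.
  by rewrite p0 mulr0; apply: (mulIf s0); rewrite mul0r; move: W0; rewrite p0; lra.
have : fn p =1 fun=> 0 by apply: (@ode_zero _ (fn s) W M).
by move=> /l0_zero z; move: pp; rewrite z ltxx.
Qed.

Section Coercivity.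
Local Open Scope complex_scope.
Variables (q : R -> R) (P : X).
Hypotheses (hq : bdd q) (qc : continuous q) (cq : coercive (qf q) n0).

Let van (k : R) (e : R) : 0 <= k -> 0 < e -> exists2 M : R, 0 < M & forall x, M <= `|x| -> `|k * fn P x ^+ 2| <= e.
move=> k0 e0; have k1 : 0 < k + 1 by rewrite ltr_wpDl.
have d0' : 0 < Num.min 1 (e / (k + 1)) by rewrite lt_min ltr01 divr_gt0.
have [M M0 HM] := vanish P d0'; exists M => // x /HM h.
have h1 : `|fn P x| <= 1 by apply: le_trans h _; rewrite ge_min lexx.
have h2' : `|fn P x| <= e / (k + 1) by apply: le_trans h _; rewrite ge_min lexx orbT.
rewrite normrM (ger0_norm k0) normrX; apply: (@le_trans _ _ ((k + 1) * `|fn P x|)).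
  have := normr_ge0 (fn P x); move: h1; set n := `|fn P x| => n1 n0'.
  have := mulr_ge0 k0 (mulr_ge0 n0' (_ : 0 <= 1 - n)); rewrite subr_ge0 => /(_ n1); nra.
by rewrite mulrC -ler_pdivlMr.
Qed.

Let hw (k : R) : bdd (fun x => k * fn P x ^+ 2). exact: bddZ (bdd_sq dm P). Qed.

(** No negative eigenvalue makes the form nonnegative, and by the Wronskian its kernel is spanned by
    [P], which the correction term removes. *)
Lemma minus_coercive : (forall v, qf (fun x => q x - 1 * fn P x ^+ 2) P v = 0) -> 0 < l0 P P ->
  (forall k r, 0 < k -> (forall v, qf (fun x => q x - 1 * fn P x ^+ 2) r v + k * l0 r v = 0) -> l0 r r = 0) ->
  exists2 c : R, 0 < c & exists2 K : R, 0 <= K & forall u,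
    c * n0 u u - K * l0 u P ^+ 2 <= qf (fun x => q x - 1 * fn P x ^+ 2) u u.
move=> Pk PP neg; set W := fun x => q x - 1 * _ in Pk neg *.
have nn u : 0 <= qf W u u.
  have := @nonneg_mod q _ hq (hw 1) cq (fun (d : R) d0 => van ler01 d0) 0 0 (lexx 0).
  move=> H; have := H _ u; rewrite mul0r addr0; apply => k r k0 Hr.
  by apply: neg k0 _ => v; have := Hr v; rewrite mul0r addr0.
apply: (@coercive_mod q _ hq (hw 1) cq (fun (d : R) d0 => van ler01 d0)).
- by move=> u; rewrite addr_ge0 ?sqr_ge0.
- move=> r kr rP; have [|c hc] := @wronskian W r P _ (bddB hq (hw 1)) kr Pk PP.
    move=> x; apply: cvgB; first exact: qc.
    apply: cvgM; first exact: cvg_cst.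
    by rewrite expr2; apply: cvgM; exact: (fn_cont dm).
  have E v : l0 r v = c * l0 P v.
    by rewrite -I_Z ?(ig_fn dm) //; apply: I_eq => x _; rewrite hc mulrA.
  have : c * l0 P P = 0 by rewrite -E.
  by move/eqP; rewrite mulf_eq0 [l0 P P == 0]gt_eqF // orbF => /eqP c0; rewrite E c0 mul0r.
move=> r; rewrite mul1r => h; apply/eqP; rewrite -sqrf_eq0; apply/eqP.
by have := nn r; have := sqr_ge0 (l0 r P); lra.
Qed.

(** The form is nonnegative on the complement of the negative eigenfunction [e]. The vector [w],
    with [L+ w = -P], has form value [- l0 w P < 0]. For [u] orthogonal to [P], subtracting the
    multiple of [w] that makes it orthogonal to [e] only lowers the form, so the form is nonnegative
    on the complement of [P]; nondegeneracy removes the kernel. *)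
Lemma plus_coercive (a : R) e w : a < 0 -> 0 < l0 e e ->
  (forall v, qf (fun x => q x - 3 * fn P x ^+ 2) e v = a * l0 e v) ->
  (forall k r, 0 < k -> (forall v, qf (fun x => q x - 3 * fn P x ^+ 2) r v + k * l0 r v = 0) ->
     exists c : R, fn r =1 fun x => c * fn e x) ->
  (forall r, (forall v, qf (fun x => q x - 3 * fn P x ^+ 2) r v = 0) -> l0 r r = 0) ->
  (forall v, qf (fun x => q x - 3 * fn P x ^+ 2) w v = - l0 P v) -> 0 < l0 w P ->
  exists2 c : R, 0 < c & exists2 K : R, 0 <= K & forall u,
    c * n0 u u - K * l0 u P ^+ 2 <= qf (fun x => q x - 3 * fn P x ^+ 2) u u.
move=> a0 ee He uniq nd Hw wP; set W := fun x => q x - 3 * _ in He uniq nd Hw *.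
have hW : bform (qf W) := bform_qf dm (bddB hq (hw 3)).
have vP : forall e : R, 0 < e -> exists2 M : R, 0 < M & forall x, M <= `|x| -> `|3 * fn P x ^+ 2| <= e.
  by move=> d d0'; exact: van.
have nne u : l0 u e = 0 -> 0 <= qf W u u.
  have K0 : 0 <= - a / l0 e e by rewrite divr_ge0 ?oppr_ge0 // ltW.
  have := @nonneg_mod q _ hq (hw 3) cq vP _ e K0; rewrite -/W => H ue.
  have := H _ u; rewrite ue expr0n mulr0 addr0; apply => k r k0 Hr.
  have re : l0 r e = 0.
    have := Hr e; rewrite (bC hW) He (bC hl e) mulrCA divfK ?gt_eqF // => h.
    have : k * l0 r e = 0 by rewrite -[RHS]h; ring.
    by move/eqP; rewrite mulf_eq0 gt_eqF //= => /eqP.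
  have [|c hc] := uniq k r k0; first by move=> v; have := Hr v; rewrite re mul0r mulr0 addr0.
  have E v : l0 r v = c * l0 e v.
    by rewrite -I_Z ?(ig_fn dm) //; apply: I_eq => x _; rewrite hc mulrA.
  by move: re; rewrite E => /eqP; rewrite mulf_eq0 [l0 e e == 0]gt_eqF // orbF => /eqP c0; rewrite E c0 mul0r.
have ex u s : qf W (u - s *: w) (u - s *: w) = qf W u u + 2 * s * l0 u P - s ^+ 2 * l0 w P.
  rewrite bsqB // bsqZ // (bZr hW) (bC hW u) !Hw (bC hl P) (bC hl P w); ring.
have we : l0 w e != 0.
  by apply/eqP => z; have := nne w z; rewrite Hw oppr_ge0 (bC hl P) leNgt wP.
have nnP u : l0 u P = 0 -> 0 <= qf W u u.
  move=> uP; have := nne (u - (l0 u e / l0 w e) *: w).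
  rewrite (bBl hl) (bZl hl) divfK // subrr => /(_ erefl); rewrite ex uP mulr0 addr0.
  by have := mulr_ge0 (sqr_ge0 (l0 u e / l0 w e)) (ltW wP); lra.
set D := l0 w P in wP *.
have lower u : - (D^-1 * l0 u P ^+ 2) <= qf W u u.
  have := nnP (u - (l0 u P / D) *: w); rewrite (bBl hl) (bZl hl) divfK ?gt_eqF // subrr => /(_ erefl).
  rewrite ex -/D; have : 2 * (l0 u P / D) * l0 u P - (l0 u P / D) ^+ 2 * D = D^-1 * l0 u P ^+ 2.
    by field; rewrite gt_eqF.
  by set t1 := 2 * _ * _; set t2 := _ * D; set t3 := D^-1 * _; lra.
(* The weight [1 / D] makes the form nonnegative; twice that weight forces null vectors to be
   orthogonal to [P]. *)
pose s := Num.sqrt (2 / D); have s2 : s ^+ 2 = 2 / D by rewrite sqr_sqrtr // divr_ge0 // ltW.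
have sp u : l0 u (s *: P) ^+ 2 = 2 / D * l0 u P ^+ 2 by rewrite (bZr hl) exprMn s2.
have i0 : 0 < D^-1 by rewrite invr_gt0.
have s0 : s != 0 by apply/eqP => z; move: s2; rewrite z expr0n => /esym/eqP; rewrite mulf_eq0 pnatr_eq0 /= gt_eqF.
have [c c0 [K K0 HK]] : exists2 c : R, 0 < c & exists2 K : R, 0 <= K & forall u,
    c * n0 u u - K * l0 u (s *: P) ^+ 2 <= qf W u u.
  apply: (@coercive_mod q _ hq (hw 3) cq vP).
  - move=> u; rewrite sp; have := lower u; have := mulr_ge0 (ltW i0) (sqr_ge0 (l0 u P)).
    by rewrite -mulrA; set t := D^-1 * _; rewrite -/W; lra.
  - by move=> r Hr _; exact: nd.
  move=> r; rewrite mul1r sp -/W => h; rewrite (bZr hl).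
  have := lower r; have := mulr_ge0 (ltW i0) (sqr_ge0 (l0 r P)); move: h; rewrite -mulrA.
  set t := D^-1 * _ => h h1 h2'; have /eqP : t = 0 by lra.
  by rewrite /t mulf_eq0 gt_eqF //= sqrf_eq0 => /eqP ->; rewrite mulr0.
exists c => //; exists (K * (2 / D)); first by rewrite !mulr_ge0 // ltW.
by move=> u; have := HK u; rewrite sp mulrA.
Qed.

End Coercivity.

(** [bbound] speaks of the diagonal only; Cauchy-Schwarz is applied to the nonnegative form
    [b + M n] instead. *)
Lemma fbound_form (E : lmodType R) (b n : E -> E -> R) (m : E) : bform b -> bform n -> nneg n -> bbound b n -> fbound (b m) n.
move=> hb hn n0' [M M0 HM]; pose G (s t : E) := b s t + M * n s t.
have hG : bform G by apply: bformD => //; exact: bformZ.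
have G0 : nneg G by move=> s; have := HM s; rewrite ler_norml /G; lra.
exists (4 * M * G m m + 2 * M ^+ 2 * n m m + 1).
  by rewrite ltr_wpDl // addr_ge0 // !mulr_ge0 ?sqr_ge0 // ltW.
move=> s; have := form_CS hG G0 m s; have := form_CS hn n0' m s => h1 h2'.
have h3 : G s s <= 2 * M * n s s by have := HM s; rewrite ler_norml /G; lra.
have h4 : G m m * G s s <= G m m * (2 * M * n s s) by rewrite ler_wpM2l.
have h5 : b m s ^+ 2 <= 2 * G m s ^+ 2 + 2 * (M ^+ 2 * n m s ^+ 2).
  have := sqr_ge0 (G m s + M * n m s); rewrite /G; nra.
have h6 : M ^+ 2 * n m s ^+ 2 <= M ^+ 2 * (n m m * n s s) by rewrite ler_wpM2l ?sqr_ge0.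
have := n0' s; have -> : (4 * M * G m m + 2 * M ^+ 2 * n m m + 1) * n s s =
  2 * (G m m * (2 * M * n s s)) + 2 * (M ^+ 2 * (n m m * n s s)) + n s s by ring.
lra.
Qed.

Let hN := bform_n0 dm.
Let n00 := @n0_ge0 R setT 0.
Local Notation mul3 := (mul3 dm).

Lemma n0_ext u v : fn u =1 fn v -> n0 u u = n0 v v.
move=> h; have d := line_form_uniq h; rewrite /n0; congr (_ + _).
  by apply: I_eq => x _; rewrite h.
by apply: I_ae => //; [apply: mfM; case: (dv_sq dm u)|apply: mfM; case: (dv_sq dm v)|apply: ae_imp d => x ->].
Qed.

(** Differentiates the stationary equation in the frequency, in weak form and along a sequence of
    difference quotients. *)
Lemma linearized q p w (pn : nat -> X) (hn : nat -> R) : bdd q -> (forall n, hn n != 0) ->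
  (forall e : R, 0 < e -> exists N, forall n, (N <= n)%N -> `|hn n| < e) ->
  (forall v, qf q p v = l0 (mul3 p p p) v) ->
  (forall n v, qf q (pn n) v + hn n * l0 (pn n) v = l0 (mul3 (pn n) (pn n) (pn n)) v) ->
  (forall e : R, 0 < e -> exists N, forall n, (N <= n)%N ->
     n0 ((hn n)^-1 *: (pn n - p) - w) ((hn n)^-1 *: (pn n - p) - w) < e) ->
  forall v, qf q w v + l0 p v - 3 * l0 (mul3 p p w) v = 0.
move=> hq hn0 hnc wp wn cn v; have hb := bform_qf dm hq; have qM := qf_bbound dm hq.
have [C C0 HC] := n0_mul3 dm.
have Tb u1 u2 u3 : l0 (mul3 u1 u2 u3) v ^+ 2 <= (C * l0 v v) * (n0 u1 u1 * n0 u2 u2 * n0 u3 u3).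
  apply: le_trans (form_CS hl l00 _ _) _.
  have -> (N : R) : C * l0 v v * N = C * N * l0 v v by ring.
  by apply: ler_wpM2r => //; apply: le_trans (l0_le_n0 _) _; exact: HC.
have T_l u1 u2 : lform (fun z => l0 (mul3 z u1 u2) v).
  by split=> [z z'|c z]; rewrite ?mul3_D ?mul3_Z ?(bDl hl) ?(bZl hl).
have perm u1 u2 u3 : mul3 u1 u2 u3 = mul3 u2 u1 u3 by exact: mul3_12.
have perm' u1 u2 u3 : mul3 u1 u2 u3 = mul3 u1 u3 u2 by exact: mul3_23.
pose ell z := - qf q z v + 3 * l0 (mul3 z p p) v.
have lell : lform ell.
  by split=> [z z'|c z]; rewrite /ell ?(fD (T_l p p)) ?(fZ (T_l p p)) ?(bDl hb) ?(bZl hb); ring.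
have [K1 K10 HK1] := fbound_form v hb hN n00 qM.
pose K := 2 * K1 + 18 * (C * l0 v v * (n0 p p * n0 p p)) + 1.
have CL : 0 <= C * l0 v v by rewrite mulr_ge0 // ltW.
have K0 : 0 < K by rewrite /K ltr_wpDl // addr_ge0 ?mulr_ge0 // ltW.
have bell z : ell z ^+ 2 <= K * n0 z z.
  have h1 := HK1 z; have h2 := Tb z p p; rewrite (bC hb) in h1.
  have h3 : ell z ^+ 2 <= 2 * qf q z v ^+ 2 + 18 * l0 (mul3 z p p) v ^+ 2.
    by have := sqr_ge0 (qf q z v + 3 * l0 (mul3 z p p) v); rewrite /ell; nra.
  have -> : K * n0 z z = 2 * (K1 * n0 z z) + 18 * (C * l0 v v * (n0 z z * n0 p p * n0 p p)) + n0 z z.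
    by rewrite /K; ring.
  by have := n00 z; lra.
pose F := qf q w v + l0 p v - 3 * l0 (mul3 p p w) v.
pose d n := (hn n)^-1 *: (pn n - p).
(* Cubic expansion at [p + k D]; after division by [k] everything beyond the linearised equation
   carries a factor [k]. *)
have main n : F = ell (d n - w) + hn n * (- l0 (d n) v + 3 * l0 (mul3 p (d n) (d n)) v +
    hn n * l0 (mul3 (d n) (d n) (d n)) v).
  have pE : pn n = p + hn n *: d n by rewrite /d scalerA divff // scale1r addrC subrK.
  have := wn n v; rewrite pE; set D := d n; set k := hn n.
  rewrite (bDl hb) (bZl hb) wp (bDl hl) (bZl hl).
  have -> : l0 (mul3 (p + k *: D) (p + k *: D) (p + k *: D)) v = l0 (mul3 p p p) v +
      3 * k * l0 (mul3 D p p) v + 3 * k ^+ 2 * l0 (mul3 p D D) v + k ^+ 3 * l0 (mul3 D D D) v.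
    have T2 z1 z3 : l0 (mul3 z1 (p + k *: D) z3) v = l0 (mul3 z1 p z3) v + k * l0 (mul3 z1 D z3) v.
      by rewrite (perm z1 (p + k *: D)) (fD (T_l z1 z3)) (fZ (T_l z1 z3)) (perm p z1) (perm D z1).
    have T3 z1 z2 : l0 (mul3 z1 z2 (p + k *: D)) v = l0 (mul3 z1 z2 p) v + k * l0 (mul3 z1 z2 D) v.
      by rewrite (perm' z1 z2 (p + k *: D)) T2 (perm' z1 z2 p) (perm' z1 z2 D).
    rewrite (fD (T_l _ _)) (fZ (T_l _ _)) !T2 !T3.
    rewrite (perm p D p) (perm' p p D) (perm p D p) (perm' D D p) (perm D p D).
    by ring.
  move=> E; have kn : k != 0 by exact: hn0.
  have : k * (qf q D v + (l0 p v + k * l0 D v) - 3 * l0 (mul3 D p p) v - 3 * k * l0 (mul3 p D D) v - k ^+ 2 * l0 (mul3 D D D) v) = 0.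
    by move/eqP: E; rewrite -subr_eq0 => /eqP E; rewrite -[RHS]E; ring.
  move/eqP; rewrite mulf_eq0 (negbTE kn) /= => /eqP E2.
  rewrite /F /ell (bBl hb) (fB (T_l p p)) (perm' p p w) (perm p w p); lra.
apply/eqP; rewrite -/F -normr_le0; apply/ler_addgt0Pr => e e0; rewrite add0r.
have e2 : 0 < e / 2 by rewrite divr_gt0.
pose B := 2 * n0 w w + 2.
have B0 : 0 < B by rewrite /B ltr_wpDl // mulr_ge0.
have LB : 0 <= l0 v v * B by rewrite mulr_ge0 // ltW.
pose G1 := (l0 v v * B) + 1; pose G2 := (C * l0 v v) * (n0 p p * B * B) + 1; pose G3 := (C * l0 v v) * (B * B * B) + 1.
have G2p : 0 <= (C * l0 v v) * (n0 p p * B * B) by rewrite mulr_ge0 // !mulr_ge0 // ltW.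
have G3p : 0 <= (C * l0 v v) * (B * B * B) by rewrite mulr_ge0 // !mulr_ge0 // ltW.
pose G := G1 + 3 * G2 + G3; have G0 : 0 < G by rewrite /G /G1 /G2 /G3; lra.
have sq1 (y Y : R) : 0 <= Y -> y ^+ 2 <= Y -> `|y| <= Y + 1.
  by move=> Y0 h; apply: sqr_le; [lra|rewrite normK2 //; nra].
have m1 : 0 < Num.min 1 ((e / 2) ^+ 2 / K) by rewrite lt_min ltr01 divr_gt0 // exprn_gt0.
have m2 : 0 < Num.min 1 (e / 2 / G) by rewrite lt_min ltr01 divr_gt0.
have [N1 H1'] := cn _ m1; have [N2 H2] := hnc _ m2.
pose n := (N1 + N2)%N; have := H1' n (leq_addr _ _); have := H2 n (leq_addl _ _).
rewrite !lt_min => /andP [k1 k2] /andP [z1 z2]; rewrite -/(d n) in z1 z2.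
have dB : n0 (d n) (d n) <= B.
  by have := bsqD_le hN n00 (d n - w) w; rewrite subrK /B; lra.
have nd := n00 (d n).
have a1 : `|ell (d n - w)| <= e / 2.
  apply: sqr_le; [exact: ltW|rewrite normK2 //].
  by apply: le_trans (bell _) _; rewrite mulrC -ler_pdivlMr // ltW.
have b1 : `|l0 (d n) v| <= G1.
  apply: sq1 => //; apply: le_trans (form_CS hl l00 _ _) _; rewrite mulrC; apply: ler_wpM2l => //.
  exact: le_trans (l0_le_n0 _) dB.
have b2 : `|l0 (mul3 p (d n) (d n)) v| <= G2.
  apply: sq1 => //; apply: le_trans (Tb _ _ _) _; apply: ler_wpM2l => //.
  by do 2!(apply: ler_pM; rewrite ?mulr_ge0 //).
have b3 : `|l0 (mul3 (d n) (d n) (d n)) v| <= G3.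
  apply: sq1 => //; apply: le_trans (Tb _ _ _) _; apply: ler_wpM2l => //.
  by do 2!(apply: ler_pM; rewrite ?mulr_ge0 //).
rewrite (main n); set s1 := l0 (d n) v in b1 *; set s2 := l0 _ v in b2 *; set s3 := l0 (mul3 (d n) _ _) v in b3 *.
apply: le_trans (ler_normD _ _) _; rewrite (splitr e); apply: lerD => //.
have a2 : `|- s1 + 3 * s2 + hn n * s3| <= G.
  apply: le_trans (ler_normD _ _) _; rewrite /G; apply: lerD.
    by apply: le_trans (ler_normD _ _) _; rewrite normrN normrM ger0_norm //; lra.
  by rewrite normrM; apply: le_trans b3; rewrite ler_piMl // ltW.
rewrite normrM; apply: le_trans (_ : e / 2 / G * G <= _); last by rewrite divfK ?gt_eqF.
by apply: ler_pM => //; exact: ltW.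
Qed.

Lemma qf_ae q p r f v : bdd q -> h2 p r -> mf f -> {ae leb R, forall x, - dv r x + q x * fn p x = f x} ->
  qf q p v = I setT (fun x => f x * fn v x).
move=> hq hpr mf' E; rewrite (qf_strong v hq hpr); apply: I_ae => //.
- apply: mfM; [|exact: (fn_mf dm)]; apply: mfD; first by apply: mfN; case: (dv_sq dm r).
  by apply: mfM; [case: hq|exact: (fn_mf dm)].
- by apply: mfM => //; exact: (fn_mf dm).
- by apply: ae_imp E => x ->.
Qed.

Lemma weak_eig W r k : bdd W -> (forall v, qf W r v + k * l0 r v = 0) ->
  exists p' r', [/\ fn p' = fn r, h2 p' r' & forall x, - dv r' x + W x * fn p' x = - k * fn p' x].
move=> hW H; have [|||p' [r' [e1 h2' e2]]] := @qf_weak R (fun x => W x + k) r (fun=> 0).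
- by apply: bddD => //; exact: bdd_cst.
- exact: sq0.
- move=> v; rewrite qfD // H; transitivity (I setT (fun=> 0 : R)); first by rewrite I_0.
  by apply: I_eq => x _; rewrite mul0r.
by exists p', r'; split=> // x; rewrite e2 e1; ring.
Qed.

Lemma stat_weak mu V om0 (h : R) psi : bdd (fun x => mu * V x + om0) -> Hline 2 psi -> stationary mu V (om0 + h) psi ->
  exists P r, [/\ {ae leb R, forall x, psi x = fn P x}, h2 P r &
   forall v, qf (fun x => mu * V x + om0) P v + h * l0 P v = l0 (mul3 P P P) v].
move=> hq hp sp; have [P [r [h1 h2' h3 _]]] := Hline2_rep hp; exists P, r; split=> // v.
rewrite -qfD //; apply: qf_ae h2' _ _; first by apply: bddD => //; exact: bdd_cst.
  by rewrite fn_mul3; do !apply: mfM; exact: (fn_mf dm).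
apply: ae_imp (ae_and sp (ae_and h1 h3)) => x [E [e1 e3]]; rewrite fn_mul3 -e1 -e3.
move: E; set A := wD 2 psi x; set B := psi x; set Z := mu * V x => E.
by apply/eqP; rewrite -subr_eq0; apply/eqP; rewrite -[RHS]E; ring.
Qed.

Lemma n0_le_Hnorm f p r : mf f -> {ae leb R, forall x, f x = fn p x} -> h2 p r -> n0 p p <= Hnorm setT 2 f ^+ 2.
move=> mf' h hp; have [H _] := rep_Hline2 mf' h hp; have [p' [r' [h1 _ _ le]]] := Hline2_rep H.
suff e : fn p =1 fn p' by rewrite (n0_ext e).
apply: cont_ae_eq; [exact: (fn_cont dm)|exact: (fn_cont dm)|].
by apply: ae_imp (ae_and h h1) => x [<- <-].
Qed.

Lemma l0_pos u : ~ (fn u =1 fun=> 0) -> 0 < l0 u u.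
by move=> h; rewrite lt_def l00 andbT; apply/eqP => /l0_eq0. Qed.

Section Assembly.
Local Open Scope complex_scope.
Variables (mu om0 nu : R) (V psi0 : R -> R) (psit : nat -> R -> R -> R).
Let q x := mu * V x + om0.
Hypotheses (hV : continuous V) (bV : bdd V) (m0 : mf psi0).
Hypotheses (hnd : nondegenerate_solution mu V om0 psi0)
    (hLplus : one_negative_eigenvalue (Lplus mu V om0 psi0))
    (hLminus : no_negative_eigenvalue (Lminus mu V om0 psi0))
    (hcont : continuation mu V om0 psi0 nu psit)
    (hslope : 0 < L2inner (psit 1%N om0) psi0)
    (hspec : (spectral_bound (dxx_minus_muV mu V) < om0%:E)%E).

Let hmV : bdd (fun x => mu * V x). exact: bddZ. Qed.
Let hq : bdd q. by apply: bddD => //; exact: bdd_cst. Qed.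

Let base_pt : `|om0 - om0| < nu. by rewrite subrr normr0; exact: cont_radius hcont. Qed.

(** Identifies the frequency derivative of the continuation as the vector [w] with [L+ w = -P]. *)
Lemma slope_rep P r : {ae leb R, forall x, psit 0%N om0 x = fn P x} -> h2 P r ->
  (forall v, qf q P v = l0 (mul3 P P P) v) ->
  exists2 w : X, {ae leb R, forall x, psit 1%N om0 x = fn w x} &
   forall v, qf (fun x => q x - 3 * fn P x ^+ 2) w v = - l0 P v.
move=> eP hP wP; have nu0 := cont_radius hcont.
have [w [rw [ew hw _ _]]] := Hline2_rep (cont_H2 hcont 1%N base_pt).
exists w => // v; rewrite (qfBk dm _ _ _ hq (bdd_sq dm P)).
have -> : wf (fun x => fn P x ^+ 2) w v = l0 (mul3 P P w) v by apply: I_eq => x _; rewrite fn_mul3; ring.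
(* Halving [nu] keeps every shifted frequency strictly inside the interval of continuation. *)
pose hn (n : nat) := nu / 2 / n.+1%:R.
have hn0 n : 0 < hn n by rewrite !divr_gt0.
have hnu n : hn n < nu.
  have : nu / 2 / n.+1%:R <= nu / 2 by rewrite ler_piMr ?invf_le1 ?ltr0n ?ler1n // divr_ge0 // ltW.
  by rewrite -/(hn n); lra.
have inn n : `|om0 + hn n - om0| < nu by rewrite addrC addKr gtr0_norm.
have rep n := stat_weak hq (cont_H2 hcont 0%N (inn n)) (cont_solves hcont (inn n)).
have [pn Hpn] := choice rep.
have hc (e : R) : 0 < e -> exists N, forall n, (N <= n)%N -> `|hn n| < e.
  move=> e0; have [N HN] := ltr_add_invr (divr_gt0 e0 nu0); exists N => n Nn.
  rewrite gtr0_norm //; apply: (@le_lt_trans _ _ (nu / N.+1%:R)); last first.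
    by move: HN; rewrite add0r ltr_pdivlMr // mulrC.
  rewrite /hn; apply: ler_pM; rewrite ?invr_ge0 ?ler0n //; try lra.
  by rewrite lef_pV2 ?posrE ?ltr0n // ler_nat.
have hd n : exists rn, {ae leb R, forall x, psit 0%N (om0 + hn n) x = fn (pn n) x} /\ h2 (pn n) rn.
  by have [rn [h1 h2' _]] := Hpn n; exists rn.
suff: forall v, qf q w v + l0 P v - 3 * l0 (mul3 P P w) v = 0 by move=> /(_ v); lra.
apply: (@linearized q P w pn hn) => // [n|n v'|e e0]; first by rewrite gt_eqF.
  by have [rn [_ _ ->]] := Hpn n.
have /cvgrPdist_lt := cont_smooth hcont 0%N base_pt.
have e1 : 0 < Num.min 1 e by rewrite lt_min ltr01.
move=> /(_ _ e1) [d /= d0 Hd]; have [N HN] := hc d d0; exists N => n /HN nd.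
have [rn [en hrn]] := hd n.
have := Hd (hn n); rewrite /= sub0r normrN => /(_ nd); rewrite gt_eqF // => /(_ isT).
rewrite sub0r normrN; set f := _ *: _ - _ => hf.
apply: (@le_lt_trans _ _ (Hnorm setT 2 f ^+ 2)).
  apply: (@n0_le_Hnorm f _ ((hn n)^-1 *: (rn - r) - rw)).
  - have mm k om : `|om - om0| < nu -> mf (psit k om).
      by move=> /(cont_H2 hcont k) [/(_ 0%N isT) /weak_mf []].
    apply: mfB; last exact: mm.
    by apply: mfM; [exact: mfC|apply: mfB; exact: mm].
  - apply: ae_imp (ae_and en (ae_and eP ew)) => x [h1 [h2' h3]].
    by rewrite /f fnB fnZ fnB -h1 -h2' -h3.
  - by rewrite /h2 dvB dvZ dvB hrn hP hw.
move: hf; rewrite lt_min => /andP [f1 f2]; have H0 : 0 <= Hnorm setT 2 f by exact: sqrtr_ge0.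
rewrite ger0_norm // in f1 f2; apply: le_lt_trans f2; rewrite expr2 ler_piMl //; exact: ltW.
Qed.

(** The value [k = 1] stands for L- and [k = 3] for L+; the slope hypothesis becomes [0 < l0 w P]
    for the frequency derivative [w]. *)
Lemma pulse_coercive : exists P : X, {ae leb R, forall x, psi0 x = fn P x} /\
  0 < l0 P P /\ coercive (qf q) n0 /\ forall k : R, k = 1 \/ k = 3 -> exists2 c : R, 0 < c & exists2 K : R, 0 <= K &
    forall u, c * n0 u u - K * l0 u P ^+ 2 <= qf (fun x => q x - k * fn P x ^+ 2) u u.
have st := cont_solves hcont base_pt; rewrite -[om0 in stationary _ _ om0 _]addr0 in st.
have [P [r [eP hP wP]]] := stat_weak hq (cont_H2 hcont 0%N base_pt) st.
have {}wP v : qf q P v = l0 (mul3 P P P) v by rewrite -wP mul0r addr0.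
have psi0P : {ae leb R, forall x, psi0 x = fn P x}.
  by apply: ae_imp (ae_and (cont_init hcont) eP) => x [<- <-].
have [w ew ww] := slope_rep eP hP wP.
have wP0 : 0 < l0 w P.
  have m1 : mf (psit 1%N om0) by have [/(_ 0%N isT) /weak_mf [] //] := cont_H2 hcont 1%N base_pt.
  have <- // : L2inner (psit 1%N om0) psi0 = l0 w P.
  apply: I_ae => //; first exact: mfM.
    by apply: mfM; exact: (fn_mf dm).
  by apply: ae_imp (ae_and ew psi0P) => x [<- <-].
have PP : 0 < l0 P P.
  apply: l0_pos => P0; move: wP0; have -> : l0 w P = 0; last by rewrite ltxx.
  transitivity (I setT (fun=> 0 : R)); last exact: I_0.
  by apply: I_eq => x _; rewrite P0 mulr0.
have cq : coercive (qf q) n0 by exact: (coercive_of_spectrum hmV bV.1 PP hspec).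
have qc : continuous q.
  by move=> x; apply: cvgD; [apply: cvgM; [exact: cvg_cst|exact: hV]|exact: cvg_cst].
have hW k : bdd (fun x => q x - k * fn P x ^+ 2) by apply: bddB => //; apply: bddZ; exact: (bdd_sq dm).
(* The operators in the hypotheses are written with [psi0], the forms with its continuous
   representative; the two potentials agree almost everywhere. *)
pose W0 k x := mu * V x + om0 - k * psi0 x ^+ 2.
have aeW0 k p r' (b : R) : {ae leb R, forall x, - dv r' x + (q x - k * fn P x ^+ 2) * fn p x = b * fn p x} <->
    {ae leb R, forall x, - dv r' x + W0 k x * fn p x = b * fn p x}.
  by split=> h; apply: ae_imp (ae_and h psi0P) => x []; rewrite /W0 /q => <- ->.
exists P; do 3!split=> //; move=> k [] ->.
  apply: minus_coercive => //.
    move=> v; rewrite (qfBk dm _ _ _ hq (bdd_sq dm P)) wP mul1r; apply/eqP; rewrite subr_eq0; apply/eqP.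
    by apply: I_eq => x _; rewrite fn_mul3; ring.
  move=> k' r' k0 H; have [p' [r1 [e1 h1 e2]]] := weak_eig (hW 1) H.
  have hm : no_negative_eigenvalue (genop (W0 1)).
    suff <- : Lminus mu V om0 psi0 = genop (W0 1) by [].
    by apply/funext => u; apply/funext => x; rewrite /Lminus /genop /W0 mul1r.
  have k0' : - k' < 0 by rewrite oppr_lt0.
  have := inj_of_no_negative hm k0' h1 ((aeW0 1 p' r1 (- k')).1 (aeW e2)).
  by rewrite e1 => /l0_zero.
have hp : one_negative_eigenvalue (genop (W0 3)) by [].
have [a [e [a0 [re hre ee] en uniq]]] := one_negative_rep hp.
apply: (@plus_coercive q P hq cq a e w) => //; first exact: l0_pos.
- move=> v; have := qf_ae v (hW 3) hre _ ((aeW0 3 e re a).2 ee) => ->; last first.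
    by apply: mfM; [exact: mfC|exact: (fn_mf dm)].
  rewrite /l0 -I_Z //; last exact: (ig_fn dm).
  by apply: I_eq => x _; ring.
- move=> k' r' k0 H; have [p' [r1 [e1 h1 e2]]] := weak_eig (hW 3) H.
  have k0' : - k' < 0 by rewrite oppr_lt0.
  by have := uniq _ _ _ k0' h1 ((aeW0 3 p' r1 (- k')).1 (aeW e2)); rewrite e1.
- move=> r' H; have [|p' [r1 [e1 h1 e2]]] := @weak_eig (fun x => q x - 3 * fn P x ^+ 2) r' 0 (hW 3).
    by move=> v; rewrite H mul0r addr0.
  have hi : invertible_H2_L2 (genop (W0 3)) by [].
  have := inj_of_invertible hi h1 _; rewrite e1 => h; apply: l0_zero; apply: h.
  rewrite -e1; have := ((aeW0 3 p' r1 (- 0)).1 (aeW e2)); apply: ae_imp => x ->; by rewrite oppr0 mul0r.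
Qed.

End Assembly.

End Variational.

(** * Localisation of periodic functions to the line *)

Section Pieces.
Context {R : realType}.
Implicit Types (f g q : R -> R) (D : set R) (x a b c : R).

Lemma I_restrict D f : ms D -> I setT (f \_ D) = I D f.
by move=> mD; rewrite [RHS]/I Rintegral_mkcond. Qed.

Lemma mf_restrict D f : ms D -> mf f -> mf (f \_ D).
by move=> mD hf; apply/(measurable_restrictT f mD); exact: measurable_funS hf. Qed.

Lemma ig_restrict D f : ms D -> ig D f -> ig setT (f \_ D).
by move=> mD h; rewrite /ig -restrict_EFin; apply/(integrable_restrict _ mD); rewrite ?setTI. Qed.

Lemma patch_comp D (F : R -> R) f : F 0 = 0 -> (fun x => F ((f \_ D) x)) = (fun x => F (f x)) \_ D.
by move=> F0; apply/funext => x; rewrite !patchE; case: ifP. Qed.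

Lemma sq_restrict D f : ms D -> sq D f -> sq setT (f \_ D).
move=> mD [h1 h2]; split; first exact: mf_restrict.
rewrite (patch_comp D (F := fun y => y ^+ 2)); first exact: ig_restrict.
by rewrite expr0n.
Qed.

(** Extension by zero of a function vanishing at both ends. *)
Lemma AC_restrict f g a b : a <= b -> AC f g -> f a = 0 -> f b = 0 -> AC (f \_ `[a, b]) (g \_ `[a, b]).
move=> ab [[mg lg] H] fa fb; split.
  split=> [|c d]; first exact: mf_restrict.
  by apply: (ig_sub ms_T) => //; apply: ig_restrict.
(* The extension is [f] composed with the projection onto [[a, b]], since [f] vanishes at the
   ends. *)
pose k x := Num.max a (Num.min x b).
have E x : (f \_ `[a, b]) x = f (k x).
  rewrite patchE /k; case: ifP => [/set_mem /=|]; rewrite ?in_itv /=.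
    by move=> /andP [ax xb]; rewrite min_l // max_r.
  move=> h; have [xa|ax] := leP x a; first by rewrite min_l ?max_l // (le_trans xa).
  have bx : b <= x by rewrite leNgt; apply/negP => xb; move: h; rewrite mem_set //= in_itv /= !ltW.
  by rewrite min_r // max_r // fb.
move=> s t st; rewrite !E [RHS]/I Rintegral_mkcond -/(I _ _).
have -> : ((g \_ `[a, b]) \_ `[s, t]) = g \_ `[Num.max a s, Num.min t b].
  apply/funext => x; rewrite !patchE; symmetry.
  have -> : (x \in [set` `[Num.max a s, Num.min t b]]) = (x \in [set` `[s, t]]) && (x \in [set` `[a, b]]).
    apply/idP/andP; rewrite ?in_setE /= !in_itv /= ?ge_max ?le_min.
      by move=> /andP [/andP [-> ->] /andP [-> ->]].
    by move=> [/andP [-> ->] /andP [-> ->]].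
  by case: (x \in [set` `[s, t]]).
rewrite I_restrict //; have [h|h] := leP (Num.max a s) (Num.min t b).
  rewrite -H //; move: h; rewrite ge_max !le_min /k => /andP [/andP [h1 h2] /andP [h3 h4]].
  by congr (f _ - f _); [rewrite max_r // le_min h1|rewrite (min_l h4)].
rewrite set_itv_ge ?bnd_simp -?ltNge // /I Rintegral_set0; apply/eqP; rewrite subr_eq0; apply/eqP; congr f.
move: h; rewrite /k; case: (leP s b); case: (leP t b); case: (leP a s) => //; case: (leP a t) => //; rewrite /Num.max /Num.min; do ?case: ifP; lra.
Qed.

Section Fixed.
Variables (L : R) (L0 : 0 < L).
Notation E := (H1 `[0, L] L).
Notation X := (H1 [set: R] 0).
Implicit Types (u v w : E) (p : X).
Let dp := domain_per L0.
Let dm := @domain_line R.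

(** A cosine of period [2 L]: it vanishes at the ends of the window of length [L] around [c], so the
    localised function extends by zero, and it changes sign under a shift by [L], so squares stay
    periodic. *)
Definition theta c x := cos (pi / L * (x - c)).
Definition dtheta c x := - (pi / L) * sin (pi / L * (x - c)).

Lemma theta_deriv c x : is_derive x 1 (theta c) (dtheta c x).
have h : is_derive x 1 (fun x => pi / L * (x - c)) (pi / L).
  have E : pi / L = pi / L *: (1 - 0) + (x - c) *: 0 by rewrite scaler0 addr0 subr0 /GRing.scale /= mulr1.
  by rewrite [X in is_derive _ _ _ X]E; apply: (@is_deriveM _ _ (cst (pi / L)) (fun x : R => x - c)).
have -> : dtheta c x = - sin (pi / L * (x - c)) * (pi / L) by rewrite /dtheta; ring.
exact: (is_derive1_comp (is_derive_cos _) h).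
Qed.

Lemma theta_AC c : AC (theta c) (dtheta c).
apply: AC_C1 (theta_deriv c) _ => x; apply: cvgM; first exact: cvg_cst.
apply: (@continuous_comp _ _ _ (fun x => pi / L * (x - c)) sin); last exact: continuous_sin.
by apply: cvgM; [exact: cvg_cst|apply: cvgB; [exact: cvg_id|exact: cvg_cst]].
Qed.

Let shiftE c x : pi / L * (x + L - c) = pi / L * (x - c) + pi.
by field; rewrite gt_eqF. Qed.
Lemma theta_per c x : theta c (x + L) = - theta c x.
by rewrite /theta shiftE cosDpi. Qed.
Lemma dtheta_per c x : dtheta c (x + L) = - dtheta c x.
by rewrite /dtheta shiftE sinDpi mulrN. Qed.
Let halfE x : pi / L * (x - L / 2) = pi / L * (x - 0) - pi / 2.
by field; rewrite gt_eqF. Qed.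
Lemma theta_half x : theta (L / 2) x = sin (pi / L * (x - 0)).
by rewrite /theta halfE cosBpihalf. Qed.
Lemma dtheta_half x : dtheta (L / 2) x = pi / L * theta 0 x.
by rewrite /dtheta halfE sinBpihalf mulrNN. Qed.
Lemma dtheta_0 x : dtheta 0 x = - (pi / L) * theta (L / 2) x.
by rewrite theta_half. Qed.
Lemma theta_pyth x : theta 0 x ^+ 2 + theta (L / 2) x ^+ 2 = 1.
by rewrite theta_half; exact: cos2Dsin2. Qed.
Lemma theta_le1 c x : `|theta c x| <= 1.
by rewrite ler_norml cos_geN1 cos_le1. Qed.
Lemma theta_ends c : theta c (c - L / 2) = 0 /\ theta c (c + L / 2) = 0.
rewrite /theta; have -> : pi / L * (c - L / 2 - c) = - (pi / 2) by field; rewrite gt_eqF.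
have -> : pi / L * (c + L / 2 - c) = pi / 2 by field; rewrite gt_eqF.
by rewrite cosN cos_pihalf.
Qed.

Let win c := [set` `[c - L / 2, c + L / 2]].
Let pf c u x := theta c x * fn u x.
Let pd c u x := dtheta c x * fn u x + theta c x * dv u x.

Let pf_AC c u : AC (pf c u) (pd c u). exact: ACM (theta_AC c) (fn_AC dp u). Qed.

Lemma sq_seg f a b : (forall x, f (x + L) = f x) -> sq `[0, L] f -> sq `[a, b] f.
by move=> pf' sf; split; [case: sf|have [C _ /(_ f pf' sf) []] := dm_loc dp a b]. Qed.

Let sq_pf c u a b : sq `[a, b] (pf c u).
by split; [exact: mf_cont (AC_cont (pf_AC c u))|apply: ig_itv_cont => x; apply: cvgM; exact: AC_cont (pf_AC c u) x]. Qed.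
Let sq_pd c u a b : sq `[a, b] (pd c u).
have [[mt _] _] := theta_AC c.
apply: sqD => //; first apply: (sq_bounded (ms_itv _) mt (M := `|pi / L|)).
- by move=> x _; rewrite normrM normrN ler_piMr // ler_norml sin_geN1 sin_le1.
- by apply: sq_seg; [exact: (fn_per dp)|exact: (fn_sq dp)].
apply: (sq_bounded (ms_itv _) _ (fun x _ => theta_le1 c x)); first exact: mf_cont (AC_cont (theta_AC c)).
by apply: sq_seg; [exact: (dv_per dp)|exact: (dv_sq dp)].
Qed.

Lemma piece_hp c u : hp setT 0 (pf c u \_ (win c), pd c u \_ (win c)).
have [e1 e2] := theta_ends c.
split=> /= [|||x|x]; rewrite ?addr0 //.
- apply: AC_restrict (pf_AC c u) _ _; [have := L0; lra|by rewrite /pf e1 mul0r|by rewrite /pf e2 mul0r].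
- by apply: sq_restrict; [exact: ms_itv|exact: sq_pf].
- by apply: sq_restrict; [exact: ms_itv|exact: sq_pd].
Qed.

Definition piece c u : X := H1_mk (piece_hp c u).

Lemma I_win c f : loc f -> (forall x, f (x + L) = f x) -> I (win c) f = I `[0, L] f.
move=> lf pf'; rewrite /win; have -> : c + L / 2 = c - L / 2 + L by field.
exact: I_period.
Qed.

Lemma wf_piece (Q : R -> R) c u : wf Q (piece c u) (piece c u) = I (win c) (fun x => Q x * (theta c x * fn u x) ^+ 2).
rewrite -I_restrict; last exact: ms_itv. apply: I_eq => x _ /=.
by rewrite /piece /fn /= !patchE; case: ifP => _; rewrite ?mul0r ?mulr0 // -expr2.
Qed.

Lemma l0_piece c u p : l0 (piece c u) p = I (win c) (fun x => theta c x * fn u x * fn p x).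
rewrite -I_restrict; last exact: ms_itv. apply: I_eq => x _ /=.
by rewrite /piece {1}/fn /= !patchE; case: ifP => _; rewrite ?mul0r.
Qed.

Let loc_sq f : (forall a b, sq `[a, b] f) -> loc (fun x => f x ^+ 2).
by move=> h; split=> [|a b]; [apply: mfX; case: (h 0 0)|case: (h a b)]. Qed.

(* The weights [theta 0] and [theta (L / 2)] are a quadratic partition of unity (IMS localisation). *)
Lemma d0_pieces u : d0 (piece 0 u) (piece 0 u) + d0 (piece (L / 2) u) (piece (L / 2) u) =
  d0 u u + (pi / L) ^+ 2 * l0 u u.
have key c : d0 (piece c u) (piece c u) = I `[0, L] (fun x => pd c u x ^+ 2).
  rewrite -(I_win c); last 2 first.
  - exact: loc_sq (sq_pd c u).
  - by move=> x; rewrite /pd dtheta_per theta_per (fn_per dp) (dv_per dp) !mulNr -opprD sqrrN.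
  rewrite -I_restrict; last exact: ms_itv. apply: I_eq => x _.
  by rewrite /piece /dv /= !patchE; case: ifP => _; rewrite ?mul0r // -expr2.
rewrite !key -I_D //; [|by case: (sq_pd 0 u 0 L)|by case: (sq_pd (L / 2) u 0 L)].
rewrite /d0 /l0 -(I_Z _ (ms_itv _) (ig_fn dp u u)) -(I_D (ms_itv _) (ig_dv dp u u)); last first.
  by apply: igZ => //; exact: (ig_fn dp).
apply: I_eq => x _; rewrite /pd dtheta_0 dtheta_half; have := theta_pyth x.
move: (theta 0 x) (theta (L / 2) x) (fn u x) (dv u x) (pi / L) => s t y z k h.
have -> : z * z + k ^+ 2 * (y * y) = (s ^+ 2 + t ^+ 2) * (z * z + k ^+ 2 * (y * y)) by rewrite h mul1r.
by ring.
Qed.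

Lemma wf_pieces (Q : R -> R) u : bdd Q -> (forall x, Q (x + L) = Q x) ->
  wf Q (piece 0 u) (piece 0 u) + wf Q (piece (L / 2) u) (piece (L / 2) u) = wf Q u u.
move=> hQ pQ; have lQ c : loc (fun x => Q x * (theta c x * fn u x) ^+ 2).
  have [mQ [M M0 HM]] := hQ; have [m1 l1] := loc_sq (sq_pf c u).
  split=> [|a b]; first exact: mfM.
  apply: (@ig_le _ _ _ (fun x => M * (pf c u x) ^+ 2)) => //; first exact: mfM.
    by apply: igZ.
  by move=> x _; rewrite normrM [X in _ * X]ger0_norm ?sqr_ge0 // ler_wpM2r ?sqr_ge0.
have key c : wf Q (piece c u) (piece c u) = I `[0, L] (fun x => Q x * (theta c x * fn u x) ^+ 2).
  by rewrite wf_piece I_win // => x; rewrite pQ theta_per (fn_per dp) mulNr sqrrN.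
rewrite !key -I_D //; [|by case: (lQ 0)|by case: (lQ (L / 2))].
apply: I_eq => x _; have := theta_pyth x; move: (theta 0 x) (theta (L / 2) x) (fn u x) (Q x) => s t y z k.
have -> : z * (y * y) = (s ^+ 2 + t ^+ 2) * (z * (y * y)) by rewrite k mul1r.
by ring.
Qed.

End Fixed.
End Pieces.

(** * Carrying coercivity from the line to a long period *)

Section Transfer.
Context {R : realType}.
Notation X := (H1 [set: R] 0).
Implicit Types (f g q : R -> R) (x b c k M : R).
Let dm := @domain_line R.
Local Notation win c L := [set` `[c - L / 2, c + L / 2]].

Lemma wf_piece_le (L : R) (L0 : 0 < L) (Q : R -> R) c k (u : H1 `[0, L] L) : bdd Q ->
  (forall x, win c L x -> Q x * theta L c x ^+ 2 <= k) ->
  wf Q (piece L0 c u) (piece L0 c u) <= k * l0 u u.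
move=> hQ H; have dp := domain_per L0; rewrite wf_piece.
have lu : loc (fun x => fn u x * fn u x) by apply: loc_cont => x; apply: cvgM; exact: (fn_cont dp).
rewrite /l0 -(@I_win R L L0 c) //; last by move=> x; rewrite (fn_per dp).
rewrite -I_Z //; last exact: lu.2.
apply: I_le => //.
- have [mQ [M M0 HM]] := hQ; have ct : continuous (fun x => (theta L c x * fn u x) ^+ 2).
    have h := AC_cont (ACM (theta_AC L c) (fn_AC dp u)); by move=> x; apply: cvgM; exact: h x.
  apply: (@ig_le _ _ _ (fun x => M * (theta L c x * fn u x) ^+ 2)) => //.
  + by apply: mfM => //; exact: mf_cont.
  + by apply: igZ => //; exact: ig_itv_cont.
  + by move=> x _; rewrite normrM [X in _ * X]ger0_norm ?sqr_ge0 // ler_wpM2r ?sqr_ge0.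
- by apply: igZ => //; exact: lu.2.
- move=> x /H h; have -> : Q x * (theta L c x * fn u x) ^+ 2 = Q x * theta L c x ^+ 2 * (fn u x * fn u x) by ring.
  by rewrite ler_wpM2r // -expr2 sqr_ge0.
Qed.

Lemma sin_small e : 0 < e -> exists2 d : R, 0 < d & forall y : R, `|y| < d -> `|sin y| < e.
move=> e0; have /cvgrPdist_lt /(_ _ e0) [d /= d0 H] := @continuous_sin R 0.
by exists d => // y yd; have := H y; rewrite /= sin0 !sub0r !normrN; apply.
Qed.

Variables (q : R -> R) (P : X).
Hypotheses (hq : bdd q) (cq : coercive (qf q) (@n0 R setT 0)).

Section Window.
Variables (eta B M L : R) (L0 : 0 < L) (phi A : H1 `[0, L] L) (chi : R -> R).
Hypotheses (eta0 : 0 < eta) (eta1 : eta <= 1) (B1 : 1 <= B) (HB : forall x, `|fn P x| <= B)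
  (HM : forall x, M <= `|x| -> `|fn P x| <= eta)
  (tM : I setT (fun x => fn P x ^+ 2) <= I `[- M, M] (fun x => fn P x ^+ 2) + eta)
  (sM : forall x, `|x| <= M -> `|theta L (L / 2) x| <= eta / B)
  (ML : 6 * M <= L) (L1 : 1 <= L)
  (chi01 : forall x, 0 <= chi x <= 1) (chi1 : forall x, `|x| <= L / 6 -> chi x = 1)
  (phiE : forall x, `|x| <= L / 2 -> fn phi x = chi x * fn P x + fn A x)
  (Ae : 3 * n0 A A <= eta ^+ 2).
Let dp := domain_per L0.

Let eta2 : eta ^+ 2 <= eta. by rewrite expr2 ler_piMl // ltW. Qed.

Let A_le x : `|fn A x| <= eta.
apply: sqr_le; first exact: ltW.
rewrite normK2 //; apply: le_trans (fn_sup dp A x) _; apply: le_trans (sup2_le dp A) _.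
apply: le_trans Ae; rewrite ler_wpM2r ?n0_ge0 //.
have : L^-1 <= 1 by rewrite invf_le1. by lra.
Qed.

Let A_sq x : fn A x ^+ 2 <= eta.
by rewrite -normK2; apply: le_trans eta2; apply: lerXn2r; rewrite ?nnegrE ?(ltW eta0). Qed.

(** On [[-M, M]] the second weight is at most [eta / B]; elsewhere [P] is at most [eta]. *)
Let P_theta x : fn P x ^+ 2 * theta L (L / 2) x ^+ 2 <= eta.
have th1 := theta_le1 L (L / 2) x.
rewrite -exprMn -[_ ^+ 2]normK2 // normrM; apply: le_trans eta2.
apply: lerXn2r; rewrite ?nnegrE ?mulr_ge0 ?(ltW eta0) //.
have [xM|Mx] := leP `|x| M.
  apply: (@le_trans _ _ (B * (eta / B))); first by apply: ler_pM => //; exact: sM.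
  by rewrite mulrC divfK // gt_eqF // (lt_le_trans ltr01).
by rewrite -[eta]mulr1; apply: ler_pM => //; apply: HM; exact: ltW.
Qed.

Let win0 x : win 0 L x -> `|x| <= L / 2.
by rewrite /= in_itv /= sub0r add0r -ler_norml. Qed.

Let phi_le x : `|x| <= L / 2 -> fn phi x ^+ 2 <= fn P x ^+ 2 + (2 * B + 1) * eta.
move=> /phiE ->; have := A_sq x; have := A_le x; have := HB x; have := chi01 x.
move: (chi x) (fn P x) (fn A x) => z p t /andP [z0 z1] pB te h3.
have h1 : z ^+ 2 * p ^+ 2 <= p ^+ 2.
  by rewrite ler_piMl ?sqr_ge0 // expr_le1.
have h2 : 2 * (z * p * t) <= 2 * B * eta.
  rewrite -[leRHS]mulrA ler_pM2l //; apply: le_trans (ler_norm _) _; rewrite !normrM ger0_norm //.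
  by apply: ler_pM; rewrite ?mulr_ge0 //; apply: le_trans pB; rewrite ler_piMl.
have -> : (z * p + t) ^+ 2 = z ^+ 2 * p ^+ 2 + 2 * (z * p * t) + t ^+ 2 by ring.
lra.
Qed.

(** The window around [L / 2] hardly sees the pulse. The estimate is made on the window around 0 and
    spread by periodicity. *)
Let phi_theta x : fn phi x ^+ 2 * theta L (L / 2) x ^+ 2 <= 4 * eta.
have key y : `|y| <= L / 2 -> fn phi y ^+ 2 * theta L (L / 2) y ^+ 2 <= 4 * eta.
  move=> /phiE ->; have := A_sq y; have := P_theta y; have := theta_le1 L (L / 2) y; have := chi01 y.
  move: (chi y) (fn P y) (fn A y) (theta L (L / 2) y) => z p t s /andP [z0 z1] s1 ps t2.
  have s2 : s ^+ 2 <= 1 by rewrite -normK2 // expr_le1.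
  have a1 : (z * p + t) ^+ 2 * s ^+ 2 <= 2 * (z ^+ 2 * (p ^+ 2 * s ^+ 2)) + 2 * (t ^+ 2 * s ^+ 2).
    rewrite -subr_ge0; have -> : 2 * (z ^+ 2 * (p ^+ 2 * s ^+ 2)) + 2 * (t ^+ 2 * s ^+ 2) - (z * p + t) ^+ 2 * s ^+ 2 = ((z * p - t) * s) ^+ 2 by ring.
    exact: sqr_ge0.
  have a2 : z ^+ 2 * (p ^+ 2 * s ^+ 2) <= eta.
    by apply: le_trans ps; apply: ler_piMl; [rewrite mulr_ge0 ?sqr_ge0|rewrite expr_le1].
  have a3 : t ^+ 2 * s ^+ 2 <= eta by apply: le_trans t2; rewrite ler_piMr ?sqr_ge0.
  lra.
have per y : fn phi (y + L) ^+ 2 * theta L (L / 2) (y + L) ^+ 2 = fn phi y ^+ 2 * theta L (L / 2) y ^+ 2.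
  by rewrite (fn_per dp) theta_per ?sqrrN.
have [y /andP [y0 yL] Hy] := per_rep x L0.
rewrite (Hy (fun x => fn phi x ^+ 2 * theta L (L / 2) x ^+ 2) per).
have [y2|y2] := leP y (L / 2); first by apply: key; rewrite ger0_norm.
by rewrite -(subrK L y) per; apply: key; rewrite ler_norml; lra.
Qed.

Let f2 x := fn P x ^+ 2.
(** On [[-M, M]] the cut-off is 1 and the weight is near 1; outside, [P] has mass at most [eta]; the
    rest [A] is small. *)
Let close : I (win 0 L) (fun x => (theta L 0 x * fn P x - fn phi x) ^+ 2) <= eta * (2 * l0 P P + 4).
have iP : ig setT f2 by case: (fn_sq dm P).
have iW f : ig setT f -> ig (win 0 L) f by exact: ig_sub.
have iP2 : ig setT (f2 \_ `[- M, M]) by apply: ig_restrict => //; exact: (ig_sub ms_T).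
have cA : continuous (fun x => fn A x ^+ 2) by move=> x; apply: cvgM; exact: (fn_cont dp).
have iA : ig (win 0 L) (fun x => fn A x ^+ 2) by exact: ig_itv_cont.
pose h x := 2 * eta * f2 x + (2 * (f2 x - (f2 \_ `[- M, M]) x) + 2 * fn A x ^+ 2).
have i1 : ig (win 0 L) (fun x => 2 * eta * f2 x) by apply: igZ => //; exact: iW.
have i2 : ig (win 0 L) (fun x => 2 * (f2 x - (f2 \_ `[- M, M]) x)) by apply: igZ => //; apply: iW; exact: igB.
have i3 : ig (win 0 L) (fun x => 2 * fn A x ^+ 2) by exact: igZ.
have h0 x : 0 <= f2 x - (f2 \_ `[- M, M]) x.
  by rewrite patchE; case: ifP; rewrite ?subrr // subr0 sqr_ge0.
apply: (@le_trans _ _ (I (win 0 L) h)).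
  apply: I_le => //; last first.
  - move=> x /win0 xL; rewrite (phiE xL) /h.
    have := P_theta x; have := theta_pyth L0 x; have := chi01 x; have := theta_le1 L 0 x.
    have th0 : 0 <= theta L 0 x.
      have pL : 0 <= pi / L by rewrite divr_ge0 ?pi_ge0 // ltW.
      have E : pi / 2 = pi / L * (L / 2) by field; rewrite gt_eqF.
      by apply: cos_ge0_pihalf; rewrite subr0 -ler_norml normrM (ger0_norm pL) E ler_wpM2l.
    have s0 := @sM x; have c1 := @chi1 x; move: th0 s0 c1.
    rewrite patchE /f2; set p := fn P x; set t := fn A x; set z := chi x; set c := theta L 0 x; set s := theta L (L / 2) x.
    move=> c0 s0 zc c1 /andP [z0 z1] cs ps.
    have a1 : (c * p - (z * p + t)) ^+ 2 <= 2 * ((c - z) ^+ 2 * p ^+ 2) + 2 * t ^+ 2.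
      have -> : (c * p - (z * p + t)) ^+ 2 = 2 * ((c - z) ^+ 2 * p ^+ 2) + 2 * t ^+ 2 - ((c - z) * p + t) ^+ 2 by ring.
      by rewrite gerDl oppr_le0 sqr_ge0.
    have p2 := sqr_ge0 p; have e2 : 0 <= 2 * eta * p ^+ 2 by rewrite mulr_ge0 // mulr_ge0 // ltW.
    have c1' : c <= 1 by apply: le_trans c1; exact: ler_norm.
    case: ifP => [/set_mem /=|]; rewrite ?in_itv /= => xM.
      have xM' : `|x| <= M by rewrite ler_norml.
      have z1' : z = 1 by apply: zc; apply: le_trans xM' _; have := ML; lra.
      have a2 : (c - z) ^+ 2 <= eta.
        have : s ^+ 2 <= eta.
          rewrite -normK2 //; apply: (@le_trans _ _ (eta ^+ 2)); last by rewrite expr2 ler_piMl // ltW.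
          apply: lerXn2r; rewrite ?nnegrE ?(ltW eta0) //; apply: le_trans (s0 xM') _.
          by rewrite ler_pdivrMr ?(lt_le_trans ltr01) // ler_peMr // ltW.
        by rewrite z1'; nra.
      have := ler_wpM2r p2 a2; lra.
    have a2 : (c - z) ^+ 2 * p ^+ 2 <= p ^+ 2 by rewrite ler_piMl //; nra.
    rewrite subr0; lra.
  - have i4 := igD (ms_itv _) i1 (igD (ms_itv _) i2 i3); exact: i4.
  - apply: ig_itv_cont => x; apply: cvgM; (apply: cvgB; [apply: cvgM; [exact: AC_cont (theta_AC L 0) x|exact: (fn_cont dm)]|exact: (fn_cont dp)]).
rewrite /h (I_D (ms_itv _) i1 (igD (ms_itv _) i2 i3)) (I_D (ms_itv _) i2 i3) (I_Z _ (ms_itv _) (iW _ iP)).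
rewrite (I_Z _ (ms_itv _) (iW _ (igB ms_T iP iP2))) (I_Z _ (ms_itv _) iA).
have b1 : I (win 0 L) f2 <= l0 P P by rewrite l0E; apply: I_subset => // x _; exact: sqr_ge0.
have b2 : I (win 0 L) (fun x => f2 x - (f2 \_ `[- M, M]) x) <= eta.
  apply: le_trans (I_subset ms_T (ms_itv _) _ (igB ms_T iP iP2) (fun x _ => h0 x)) _ => //.
  by rewrite I_B // I_restrict // /f2; move: tM; lra.
have b3 : I (win 0 L) (fun x => fn A x ^+ 2) <= eta.
  rewrite I_win //; [|exact: loc_cont|by move=> x; rewrite (fn_per dp)].
  rewrite -l0E; have := l0_le_n0 A; have := n0_ge0 A; move: Ae.
  have := eta2; lra.
have := ler_wpM2l (ltW eta0) b1; move: b2 b3; move: (I _ f2) (I _ _) (I _ _) => y1 y2 y3; lra.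
Qed.

(** The piece around 0 is compared with the form of [P], the piece around [L / 2] with that of [q].
    In the error, 1 is the localisation term [(pi / L)^2], [k (2 B + 5)] comes from exchanging [phi]
    and [P] in the potentials, and the last term from exchanging them in the inner product, where
    squaring a sum also doubles [K]. *)
Lemma window_bound (k c K : R) (u : H1 `[0, L] L) : 0 <= k -> 0 <= K ->
  (forall u : X, c * n0 u u - K * l0 u P ^+ 2 <= qf (fun x => q x - k * fn P x ^+ 2) u u) ->
  (forall u : X, c * n0 u u <= qf q u u) -> (forall x, q (x + L) = q x) -> (pi / L) ^+ 2 <= eta -> 0 <= c ->
  c * n0 u u - 2 * K * l0 u phi ^+ 2 - eta * (1 + k * (2 * B + 5) + 2 * K * (2 * l0 P P + 4)) * l0 u u <=
  qf (fun x => q x - k * fn phi x ^+ 2) u u.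
move=> k0 K0 h1 h2 pq hs c0; have hl := bform_l0 dp.
pose p1 := piece L0 0 u; pose p2 := piece L0 (L / 2) u.
have bphi := bdd_sq dp phi; have bP := bdd_sq dm P.
have lu0 : 0 <= l0 u u by exact: l0_ge0.
have w1 : wf (fun x => fn phi x ^+ 2) p1 p1 <= wf (fun x => fn P x ^+ 2) p1 p1 + (2 * B + 1) * eta * l0 u u.
  have -> : wf (fun x => fn phi x ^+ 2) p1 p1 = wf (fun x => fn phi x ^+ 2 - fn P x ^+ 2) p1 p1 + wf (fun x => fn P x ^+ 2) p1 p1.
    rewrite /wf -I_D //; [|exact: (ig_wf dm _ _ (bddB bphi bP))|exact: (ig_wf dm)].
    by apply: I_eq => x _; ring.
  rewrite addrC lerD2l; apply: wf_piece_le; first exact: bddB.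
  move=> x /win0 /phi_le h; have := sqr_ge0 (theta L 0 x).
  have : theta L 0 x ^+ 2 <= 1 by rewrite -normK2 // expr_le1 // theta_le1.
  have : 0 <= (2 * B + 1) * eta by rewrite mulr_ge0 // ?(ltW eta0) //; have := B1; lra.
  move: h; move: (_ * eta) (_ ^+ 2) (_ ^+ 2) (_ ^+ 2) => X1 X2 X3 X4; nra.
have w2 : wf (fun x => fn phi x ^+ 2) p2 p2 <= 4 * eta * l0 u u.
  by apply: wf_piece_le => // x _; exact: phi_theta.
have w12 := wf_pieces L0 u bphi (fun x => congr1 (fun z => z ^+ 2) (fn_per dp phi x)).
have q12 := wf_pieces L0 u hq pq.
have d12 := d0_pieces L0 u.
have one : bdd (fun=> 1 : R) by exact: bdd_cst.
have l12 : l0 p1 p1 + l0 p2 p2 = l0 u u.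
  have := wf_pieces L0 u one (fun=> erefl).
  have e (D : set R) (l : R) (v : H1 D l) : wf (fun=> 1) v v = l0 v v by apply: I_eq => x _; rewrite mul1r.
  by rewrite !e.
have b2 : l0 p1 P ^+ 2 <= 2 * l0 u phi ^+ 2 + 2 * (l0 u u * (eta * (2 * l0 P P + 4))).
  pose g x := theta L 0 x * fn P x - fn phi x.
  have cu : continuous (fn u) by exact: (fn_cont dp).
  have cphi : continuous (fn phi) by exact: (fn_cont dp).
  have cg : continuous g by move=> x; apply: cvgB; [apply: cvgM; [exact: AC_cont (theta_AC L 0) x|exact: (fn_cont dm)]|exact: cphi].
  have mulc f f' : continuous f -> continuous f' -> continuous (fun x => f x * f' x) by move=> c1 c2 x; apply: cvgM; [exact: c1|exact: c2].
  have E : l0 p1 P = l0 u phi + I (win 0 L) (fun x => fn u x * g x).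
    rewrite l0_piece /l0 -(@I_win R L L0 0); [|by apply: loc_cont; exact: mulc|by move=> x; rewrite !(fn_per dp)].
    rewrite -I_D //; try by apply: ig_itv_cont; exact: mulc.
    by apply: I_eq => x _; rewrite /g; ring.
  have cs := @I_CS R (win 0 L) _ _ (ms_itv _) (sq_cont _ _ cu) (sq_cont _ _ cg).
  rewrite (@I_win R L L0 0 (fun x => fn u x ^+ 2)) in cs; last 2 first.
  - by apply: loc_cont; exact: mulc.
  - by move=> x; rewrite (fn_per dp).
  have cl : _ * I (win 0 L) (fun x => g x ^+ 2) <= _ := ler_wpM2l lu0 close.
  rewrite -l0E in cs; move: (le_trans cs cl); rewrite E.
  move: (I _ _) (l0 u phi) (l0 u u * (eta * _)) => y1 y3 y5 h3.
  by have := sqr_ge0 (y3 - y1); rewrite !expr2 in h3 *; nra.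
have := h1 p1; have := h2 p2; rewrite (qfBk dm _ _ _ hq bP) (qfBk dp _ _ _ hq bphi).
have -> : qf q p1 p1 = d0 p1 p1 + wf q p1 p1 by [].
have -> : qf q p2 p2 = d0 p2 p2 + wf q p2 p2 by [].
have -> : qf q u u = d0 u u + wf q u u by [].
rewrite -q12 -w12 /n0.
have kw1 := ler_wpM2l k0 w1; have kw2 := ler_wpM2l k0 w2; have Kb2 := ler_wpM2l K0 b2.
have sl := ler_wpM2r lu0 hs; have cs : 0 <= c * ((pi / L) ^+ 2 * l0 u u) by apply: mulr_ge0 => //; apply: mulr_ge0 => //; exact: sqr_ge0.
move: d12 l12 kw1 kw2 Kb2 sl cs; clear.
set z := (pi / L) ^+ 2; move: z (d0 p1 p1) (d0 p2 p2) (d0 u u) (l0 p1 p1) (l0 p2 p2) (l0 u u) (l0 p1 P) (l0 u phi) (l0 P P)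
  (wf q p1 p1) (wf q p2 p2) (wf _ p1 p1) (wf _ p2 p2) (wf _ p1 p1).
move=> z x1 x2 x3 y1 y2 y3 t1 t2 t3 q1 q2 f1 f2' f3 E1 E0; rewrite -E0 in E1 * => E2 E3 E4 E5 E6 E7 E8.
have -> : x3 = x1 + x2 - z * (y1 + y2) by rewrite E1; ring.
nra.
Qed.

End Window.

(** Fixes [eta] so small that all errors of [window_bound] cost at most half of the coercivity
    constant; the period and the rest are then chosen to meet its hypotheses. *)
Lemma transfer (k c K : R) : 0 <= k -> 0 < c -> 0 <= K ->
  (forall u : X, c * n0 u u - K * l0 u P ^+ 2 <= qf (fun x => q x - k * fn P x ^+ 2) u u) ->
  exists2 e : R, 0 < e & exists2 c' : R, 0 < c' & exists2 L1 : R, 1 <= L1 &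
  forall (L : R) (L0 : 0 < L) (phi A : H1 `[0, L] L) (chi : R -> R), L1 <= L ->
   (forall x, q (x + L) = q x) -> (forall x, 0 <= chi x <= 1) -> (forall x, `|x| <= L / 6 -> chi x = 1) ->
   (forall x, `|x| <= L / 2 -> fn phi x = chi x * fn P x + fn A x) -> n0 A A <= e ->
   forall u, c' * n0 u u - 2 * K * l0 u phi ^+ 2 <= qf (fun x => q x - k * fn phi x ^+ 2) u u.
move=> k0 c0 K0 H1'; have [cq0 cq0p Hq] := cq.
pose cm := Num.min c cq0; have cm0 : 0 < cm by rewrite lt_min c0.
have n00 := @n0_ge0 R setT 0.
have h1 (u : X) : cm * n0 u u - K * l0 u P ^+ 2 <= qf (fun x => q x - k * fn P x ^+ 2) u u.
  by apply: le_trans (H1' u); rewrite lerD2r ler_wpM2r // ge_min lexx.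
have h2' (u : X) : cm * n0 u u <= qf q u u.
  by apply: le_trans (Hq u); rewrite ler_wpM2r // ge_min lexx orbT.
pose B := sup2 1 P + 1; have B1 : 1 <= B by rewrite /B lerDr (sup2_ge0 dm).
have PP := @l0_ge0 R setT 0 P.
pose G := 1 + k * (2 * B + 5) + 2 * K * (2 * l0 P P + 4).
have G1 : 1 <= G.
  rewrite /G -addrA lerDl addr_ge0 //; apply: mulr_ge0; rewrite ?mulr_ge0 //; lra.
have G0 : 0 < G by exact: lt_le_trans G1.
pose eta := Num.min 1 (cm / 2 / G).
have eta0 : 0 < eta by rewrite lt_min ltr01 !divr_gt0.
have eta1 : eta <= 1 by rewrite ge_min lexx.
have etaG : eta * G <= cm / 2 by rewrite -ler_pdivlMr // ge_min lexx orbT.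
have [M1 M10 HM1] := vanish P eta0.
have [M2 M20 HM2] := tail (fn_sq dm P).2 (fun x => sqr_ge0 _) eta0.
pose M := M1 + M2; have M0 : 0 < M by rewrite addr_gt0.
have [d d0 Hd] := sin_small (divr_gt0 eta0 (lt_le_trans ltr01 B1)).
exists (eta ^+ 2 / 3); first by rewrite divr_gt0 // exprn_gt0.
exists (cm / 2); first by rewrite divr_gt0.
have pi0 := @pi_gt0 R.
have q1 : 0 <= pi / eta by rewrite divr_ge0 // ltW.
have q2 : 0 <= pi * M / d by rewrite divr_ge0 ?mulr_ge0 // ?ltW // addr_gt0.
(* In turn: [L >= 1]; the core [[-M, M]] lies where the cut-off is 1; the localisation error
   [pi / L] is at most [eta]; the second weight is small on the core. *)
exists (1 + 6 * M + pi / eta + pi * M / d); first by lra.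
move=> L L0 phi A chi LL pq chi01 chi1 phiE Ae u.
have L1 : 1 <= L by apply: le_trans LL; lra.
apply: le_trans (@window_bound eta B M L L0 phi A chi eta0 eta1 B1 _ _ _ _ _ _ chi01 chi1 phiE _ k cm K u k0 K0 h1 h2' pq _ _).
- rewrite -/G; have := ler_wpM2r (l0_ge0 u) etaG; have := l0_le_n0 u; have : 0 <= cm * (n0 u u - l0 u u).
    by rewrite mulr_ge0 ?(ltW cm0) // subr_ge0 l0_le_n0.
  by move: (n0 u u) (l0 u u) (l0 u phi) (eta * G) => y1 y2 y3 y4; nra.
- by move=> x; apply: le_trans (fn_abs dm P x) _; rewrite lexx.
- by move=> x Mx; apply: HM1; apply: le_trans Mx; rewrite lerDl ltW.
- by apply: HM2; rewrite /M; lra.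
- move=> x xM; rewrite theta_half // subr0; apply: ltW; apply: Hd.
  rewrite normrM ger0_norm; last by rewrite divr_ge0 // ltW.
  apply: (@le_lt_trans _ _ (pi / L * M)); first by rewrite ler_wpM2l // divr_ge0 // ltW.
  rewrite mulrAC ltr_pdivrMr // [ltRHS]mulrC -ltr_pdivrMr //; lra.
- lra.
- exact: L1.
- by move: Ae; rewrite ler_pdivlMr // mulrC.
- have e1 : pi / L <= eta.
    by rewrite ler_pdivrMr // mulrC -ler_pdivrMr //; lra.
  have e0 : 0 <= pi / L by rewrite divr_ge0 // ltW.
  by nra.
- exact: ltW.
Qed.
End Transfer.

(** * The periodic problem as an instance of the abstract equation *)

Section PeriodicSystem.
Context {R : realType}.
Implicit Types (f g q : R -> R) (x y a b c k M : R).

(** Multiplication by the positive part of [(x - a) (b - x)] turns the assumption into one on the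
    whole line. *)
Lemma cont_ae_itv f a b : a < b -> continuous f -> {ae leb R, forall x, a < x < b -> f x = 0} ->
  forall x, a <= x <= b -> f x = 0.
move=> ab cf h; pose k (x : R) := f x * Num.max 0 ((x - a) * (b - x)).
have ck : continuous k.
  move=> x; apply: cvgM; first exact: cf.
  apply: (@continuous_comp _ _ _ (fun x : R => (x - a) * (b - x)) (Num.max 0)).
    by apply: cvgM; apply: cvgB; (exact: cvg_id || exact: cvg_cst).
  by apply: continuous_max => y; [exact: cst_continuous|exact: cvg_id].
have k0 : k =1 fun=> 0.
  apply: cont_ae_eq => //; first by move=> x; exact: cst_continuous.
  apply: ae_imp h => x hx; rewrite /k; have [p0|p0] := leP ((x - a) * (b - x)) 0; first by rewrite mulr0.
  by rewrite hx ?mul0r //; have [xa|ax] := leP x a; have [xb|bx] := leP b x; nra.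
have open x : a < x < b -> f x = 0.
  move=> /andP [ax xb]; have := k0 x; rewrite /k max_r; last by rewrite mulr_ge0 // subr_ge0 ltW.
  have p0 : (x - a) * (b - x) != 0 by rewrite mulf_neq0 // subr_eq0 gt_eqF.
  by move/eqP; rewrite mulf_eq0 (negbTE p0) orbF => /eqP.
move=> x /andP [ax xb]; apply/eqP; rewrite -normr_le0; apply/ler_addgt0Pr => e e0; rewrite add0r.
have /cvgrPdist_lt /(_ _ e0) [d /= d0 Hd] := cf x.
have [r [r0 r1 r2]] : exists r : R, [/\ 0 < r, r <= d / 2 & r <= (b - a) / 4].
  exists (Num.min (d / 2) ((b - a) / 4)); rewrite !ge_min !lexx orbT; split=> //.
  by rewrite lt_min !divr_gt0 // subr_gt0.
pose y := if x < (a + b) / 2 then x + r else x - r.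
have yab : a < y < b by rewrite /y; case: ifP => [h2|/negbT]; rewrite -?leNgt => *; lra.
have {Hd} : `|f x - f y| < e.
  by apply: Hd; rewrite /= /y; case: ifP => _; rewrite ltr_norml; lra.
by rewrite (open y yab) subr0 => /ltW.
Qed.

Section Fixed.
Variables (L : R) (L0 : 0 < L).
Notation E := (H1 `[0, L] L).
Implicit Types (u v w : E).
Let dp := domain_per L0.

Lemma per_l0_eq0 u : l0 u u = 0 -> fn u =1 fun=> 0.
move=> lr; have : {ae leb R, forall x, [set` `[0, L]] x -> fn u x ^+ 2 = 0}.
  apply: (I_eq0 (ms_itv _) _ (fn_sq dp u).2 (fun x _ => sqr_ge0 _)); first by apply: mfX; exact: (fn_mf dp).
  by have := l0E u; rewrite lr => <-.
move=> h x; have [y y0 ->] := per_rep x L0; last exact: (fn_per dp).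
apply: (cont_ae_itv L0) y0; first exact: (fn_cont dp).
by apply: ae_imp h => z hz /andP [z0 zL]; apply/eqP; rewrite -sqrf_eq0 hz //= in_itv /= !ltW.
Qed.

Lemma per_dv0 u : fn u =1 (fun=> 0) -> d0 u u = 0.
move=> h; have h0 : {ae leb R, forall x, dv u x = 0}.
  by apply: AC_uniq (fn_AC dp u) _; apply: AC_ext (AC_cst 0) _ _ => x //; rewrite h.
transitivity (I `[0, L] (fun=> 0 : R)); last exact: I_0.
have [md _] := dv_sq dp u.
by apply: I_ae => //; [exact: mfM|exact: mfC|apply: ae_imp h0 => x ->; rewrite mulr0].
Qed.

Let cosL x := cos (2 * pi / L * x).
Let dcosL x := - (2 * pi / L) * sin (2 * pi / L * x).

Let cos_hp : hp `[0, L] L (cosL, dcosL).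
have sh x : 2 * pi / L * (x + L) = 2 * pi / L * x + pi + pi by field; rewrite gt_eqF.
have cl : continuous (fun x => 2 * pi / L * x) by move=> x; apply: cvgM; [exact: cvg_cst|exact: cvg_id].
have dc x : is_derive x 1 cosL (dcosL x) by exact: is_derive_cosM.
have cc : continuous cosL by move=> x; apply: continuous_comp (cl x) _; exact: continuous_cos.
have cd : continuous dcosL.
  by move=> x; apply: cvgM; [exact: cvg_cst|apply: continuous_comp (cl x) _; exact: continuous_sin].
split=> /= [|||x|x]; [exact: AC_C1|exact: sq_cont|exact: sq_cont|by rewrite /cosL sh !cosDpi opprK|].
by rewrite /dcosL sh !sinDpi opprK.
Qed.
Lemma per_one_hp : hp `[0, L] L (fun=> 1, fun=> 0).
by split=> //=; [exact: AC_cst|apply: sq_cont; exact: cst_continuous|exact: sq0]. Qed.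
Definition per_one : E := H1_mk per_one_hp.
Let h (j : nat) : E := iter j (mul3 dp per_one (H1_mk cos_hp)) per_one.

Let fn_h j x : fn (h j) x = cosL x ^+ j.
by elim: j => // j IH; rewrite /h iterS fn_mul3 exprS -/(h j) IH mul1r. Qed.

(** The powers of one cosine are independent: a vanishing combination is a polynomial of degree
    below [m] with [m] distinct roots. *)
Lemma per_inf_dim m : exists h : 'I_m -> E, forall c : 'I_m -> R,
  (exists i, c i != 0) -> 0 < l0 (\sum_j c j *: h j) (\sum_j c j *: h j).
exists (fun j => h j) => c [i ci]; rewrite lt_def l0_ge0 andbT; apply/eqP => /per_l0_eq0 H.
pose p := \sum_(j < m) c j *: 'X^j : {poly R}.
have pE x : p.[cosL x] = 0.
  rewrite -(H x) fn_sum horner_sum; apply: eq_bigr => j _.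
  by rewrite hornerZ hornerXn fnZ fn_h.
have pc : p`_i = c i.
  rewrite coef_sum (bigD1 i) //= coefZ coefXn eqxx mulr1 big1 ?addr0 // => j ji.
  by rewrite coefZ coefXn; case: eqP => [e|]; rewrite ?mulr0 //; case/eqP: ji; apply/val_inj.
have p0 : p != 0 by apply/eqP => e; move: ci; rewrite -pc e coef0 eqxx.
have sp : (size p <= m)%N.
  apply: leq_trans (size_sum _ _ _) _; apply/bigmax_leqP => j _.
  by apply: leq_trans (size_scale_leq _ _) _; rewrite size_polyXn.
(* Points of half a period, where the cosine is injective. *)
pose t (j : nat) := L / 2 * (j%:R / m%:R).
have m0 : 0 < m%:R :> R by rewrite ltr0n; apply: leq_ltn_trans (ltn_ord i).
pose rs := [seq cosL (t j) | j <- iota 0 m].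
have rr : all (root p) rs by apply/allP => y /mapP [j _ ->]; apply/rootP.
have ur : uniq rs.
  rewrite map_inj_in_uniq ?iota_uniq // => j k; rewrite !mem_iota /= !add0n => jm km.
  have ang n : (n < m)%N -> 2 * pi / L * t n = pi * (n%:R / m%:R) /\ 2 * pi / L * t n \in `[0, pi].
    move=> nm; have E : 2 * pi / L * t n = pi * (n%:R / m%:R) by rewrite /t; field; rewrite !gt_eqF.
    split=> //; rewrite E in_itv /= mulr_ge0 ?pi_ge0 ?divr_ge0 //= ler_piMr ?pi_ge0 //.
    by rewrite ler_pdivrMr // mul1r ler_nat ltnW.
  have [e1 i1] := ang j jm; have [e2 i2] := ang k km.
  rewrite /cosL => /(cos_inj i1 i2); rewrite e1 e2 => /(mulfI (lt0r_neq0 (@pi_gt0 R))).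
  have m1 : m%:R^-1 != 0 :> R by rewrite invr_eq0 gt_eqF.
  by move=> /(mulIf m1) /eqP; rewrite eqr_nat => /eqP.
by have := max_poly_roots p0 rr ur; rewrite size_map size_iota ltnNge sp.
Qed.

Variable q : R -> R.
Hypotheses (hq : bdd q) (cq : coercive (qf q) (@n0 R `[0, L] L)).

(** Compactness over one period gives the eigenbasis; the product bounds and the Gagliardo-Nirenberg
    axiom all come from [fn_sup]. *)
Lemma periodic_nls : exists e lam, nls_space (@l0 R `[0, L] L) (qf q) e lam (mul3 dp).
have hl := bform_l0 dp; have l00 := @l0_ge0 R `[0, L] L; have ha := bform_qf dp hq.
have n00 := @n0_ge0 R `[0, L] L.
have [c c0 Hc] := cq; have [M M0 HM] := qf_bbound dp hq.
have a0 : nneg (qf q : E -> E -> R) by move=> u; apply: le_trans (Hc u); rewrite mulr_ge0 // ltW.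
have na u : n0 u u <= c^-1 * qf q u u by rewrite mulrC ler_pdivlMr // mulrC.
have an u : qf q u u <= M * n0 u u by apply: le_trans (ler_norm _) (HM u).
have ca : complete_form (qf q : E -> E -> R) := complete_equiv (complete_n0 dp) (qf_bbound dp hq) cq.
have ci : 0 < c^-1 by rewrite invr_gt0.
have la u : l0 u u <= c^-1 * qf q u u by apply: le_trans (na u); exact: l0_le_n0.
have bla : bbound (@l0 R `[0, L] L) (qf q) by exists c^-1 => // u; rewrite ger0_norm.
have lc : fcompact (@l0 R `[0, L] L) (qf q).
  move=> e e0; have [ls [H1' H2]] := @seg_compact _ _ _ _ dp 0 L (e * c) (ltW L0) (fun x => id) (mulr_gt0 e0 c0).
  exists ls; split=> [i /H1' [h1 [K K0 HK]]|u].
    split=> //; exists (K * c^-1) => [|u]; first exact: mulr_gt0.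
    by apply: le_trans (HK u) _; rewrite -mulrA ler_pM2l.
  rewrite l0E; apply: le_trans (H2 u) _; rewrite lerD2r -mulrA ler_pM2l //; exact: Hc.
have [e [lam [e1 e2 e3 _ [e5 e6]]]] := eigenbasis hl l00 ha a0 ca bla lc per_inf_dim.
pose k := L^-1 + 2; have k0 : 0 < k by rewrite addr_gt0 ?invr_gt0.
have su u : sup2 L u <= k * c^-1 * qf q u u.
  by apply: le_trans (sup2_le dp u) _; rewrite -mulrA ler_pM2l.
exists e, lam; split.
- split=> //; first by exists c^-1.
  move=> u lu; have u0 := per_l0_eq0 lu; apply/eqP; rewrite eq_le a0 andbT.
  by apply: le_trans (an u) _; rewrite /n0 lu per_dv0 // addr0 mulr0.
- by move=> *; exact: mul3_D.
- by move=> *; exact: mul3_Z.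
- by move=> *; exact: mul3_12.
- by move=> *; exact: mul3_23.
- by move=> *; exact: mul3_T.
- have [C C0 HC] := n0_mul3 dp; exists (M * C * (c^-1 * c^-1 * c^-1)); first by rewrite !mulr_gt0.
  move=> u v w; apply: le_trans (an _) _; rewrite -!mulrA ler_pM2l //; apply: le_trans (HC u v w) _; rewrite ler_pM2l //.
  apply: (@le_trans _ _ ((c^-1 * qf q u u) * (c^-1 * qf q v v) * (c^-1 * qf q w w))).
    by do 2!(apply: ler_pM; rewrite ?mulr_ge0 //).
  by rewrite le_eqVlt; apply/orP; left; apply/eqP; ring.
- exists ((k * c^-1) * (k * c^-1)); first by rewrite !mulr_gt0.
  move=> u v w; apply: le_trans (l0_mul3 dp u v w) _.
  have -> : k * c^-1 * (k * c^-1) * (qf q u u * qf q v v * l0 w w) = (k * c^-1 * qf q u u) * (k * c^-1 * qf q v v) * l0 w w by ring.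
  by rewrite ler_wpM2r //; apply: ler_pM; rewrite ?(sup2_ge0 dp).
exists (k * Num.sqrt c^-1); first by rewrite mulr_gt0 // sqrtr_gt0.
move=> u v; have s1 : sup2 L v <= k * Num.sqrt c^-1 * Num.sqrt (l0 v v * qf q v v).
  have -> : k * Num.sqrt c^-1 * Num.sqrt (l0 v v * qf q v v) = k * Num.sqrt (c^-1 * (l0 v v * qf q v v)).
    by rewrite [X in _ = _ * X]sqrtrM ?(ltW ci) // mulrA.
  rewrite /sup2 /k [leRHS]mulrDl; apply: lerD.
    rewrite ler_pM2l ?invr_gt0 // -[leLHS]ger0_norm // -sqrtr_sqr ler_wsqrtr //.
    by rewrite expr2 mulrCA ler_wpM2l.
  rewrite ler_pM2l // ler_wsqrtr // mulrCA ler_wpM2l //.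
  by apply: le_trans (na v); rewrite /n0 lerDr.
apply: le_trans (_ : sup2 L v * l0 u u <= _); last by rewrite ler_wpM2r.
rewrite /l0 -I_Z //; last exact: (ig_fn dp).
apply: I_le => //; [exact: (ig_fn dp)|by apply: igZ => //; exact: (ig_fn dp)|].
by move=> x _; rewrite fn_mul3 -expr2 -mulrA -!expr2 ler_wpM2r ?sqr_ge0 ?(fn_sup dp).
Qed.

End Fixed.
End PeriodicSystem.

(** * Correspondence between periodic function classes and elements of the space *)

Section Representatives.
Context {R : realType}.
Variables (L : R) (L0 : 0 < L).
Notation E := (H1 `[0, L] L).
Implicit Types (f g : R -> R) (p r u : E) (v w : R -> 'cV[R]_2) (x y : E * E) (t c : R).
Let dp := domain_per L0.

(** Measurability of [f] is kept along, being needed to return to the Sobolev predicates on [f]. *)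
Definition rep1 f p := mf f /\ {ae leb R, forall t, f t = fn p t}.

Lemma rep1_fn p : rep1 (fn p) p. by split; [exact: (fn_mf dp)|exact: aeW]. Qed.
Lemma rep1D f g p r : rep1 f p -> rep1 g r -> rep1 (fun t => f t + g t) (p + r).
by move=> [m1 h1] [m2 h2]; split; [exact: mfD|apply: ae_imp (ae_and h1 h2) => t [-> ->]].
Qed.
Lemma rep1Z c f p : rep1 f p -> rep1 (fun t => c * f t) (c *: p).
by move=> [m1 h1]; split; [apply: mfM => //; exact: mfC|apply: ae_imp h1 => t ->]. Qed.
Lemma rep1_uniq f p r : rep1 f p -> rep1 f r -> fn p =1 fn r.
move=> [_ h1] [_ h2]; apply: cont_ae_eq; [exact: (fn_cont dp)|exact: (fn_cont dp)|].
by apply: ae_imp (ae_and h1 h2) => t [<- <-].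
Qed.

Lemma rep_weak f p : rep1 f p -> weak_deriv f (wD 1 f) /\ {ae leb R, forall t, wD 1 f t = dv p t}.
by move=> [mf' h]; apply: wD1_spec; apply: (AC_weak_ae (fn_AC dp p)) => //; [case: (dv_sq dp p)|exact: aeW].
Qed.

Lemma rep_sq f p M : rep1 f p -> L2 `[- M, M] f /\ L2 `[- M, M] (wD 1 f).
move=> h; have [[mf' hf] [w e]] := (h, rep_weak h); have [_ mw] := weak_mf w; have [md _] := dv_sq dp p.
have s1 := sq_seg L0 (- M) M (fn_per dp p) (fn_sq dp p).
have s2 := sq_seg L0 (- M) M (dv_per dp p) (dv_sq dp p).
by split; apply/L2_sq => //; [apply: (sq_ae _ s1 mf') => //; apply: ae_imp hf|apply: (sq_ae _ s2 mw) => //; apply: ae_imp e] => t.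
Qed.

Lemma wDSr k f : wD k (wD 1 f) = wD k.+1 f. by rewrite /wD [RHS]iterSr. Qed.

(** Peels off one derivative; with its converse it treats all orders up to three uniformly. *)
Lemma Hper_next l f : Hper L l.+1 f -> exists2 p, rep1 f p & Hper L l (wD 1 f).
move=> [pf hw hl]; have w0 := hw 0%N isT; have [m0 m1] := weak_mf w0.
have s1 : sq `[0, L] (wD 1 f).
  have /L2_sq := hl 1%N L isT; move=> /(_ (ms_itv _) m1) [_ i]; split=> //.
  by apply: (ig_sub (ms_itv `[- L, L])) => // t; rewrite /= !in_itv /=; have := L0; lra.
have [p [h1 h2]] := weak_per L0 pf w0 s1; exists p => //; split.
- by apply: ae_imp (ae_and h2 (ae_shift L h2)) => t [-> ->]; rewrite (dv_per dp).
- by move=> k kl; rewrite !wDSr; exact: hw.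
- by move=> k M kl; rewrite wDSr; exact: hl.
Qed.

Lemma Hper_prev l f p : rep1 f p -> Hper L l (wD 1 f) -> Hper L l.+1 f.
move=> h [_ hw hl]; have [[mf' hf] [w e]] := (h, rep_weak h); split.
- by apply: ae_imp (ae_and hf (ae_shift L hf)) => t [-> ->]; rewrite (fn_per dp).
- case=> [|k] kl; first exact: w.
  rewrite -[wD k.+1 f]wDSr -[wD k.+2 f]wDSr; exact: (hw k kl).
- by case=> [|k] M kl; [case: (rep_sq M h)|rewrite -wDSr; exact: hl].
Qed.

Lemma Hper1 f : Hper L 1 f <-> exists p, rep1 f p.
split=> [/Hper_next [p hp _]|[p hp]]; first by exists p.
have [[mf' hf] [w e]] := (hp, rep_weak hp); apply: (Hper_prev hp); split.
- by apply: ae_imp (ae_and e (ae_shift L e)) => t [-> ->]; rewrite (dv_per dp).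
- by move=> k k0; exfalso; move: k0; rewrite ltn0.
- by move=> k M; rewrite leqn0 => /eqP ->; case: (rep_sq M hp).
Qed.

Lemma Hper_norm_sum l f : Hper_norm L l f ^+ 2 = \sum_(k < l.+1) L2norm `]0, L[ (wD k f) ^+ 2.
by rewrite sqr_sqrtr // sumr_ge0 // => k _; exact: sqr_ge0. Qed.

Lemma Hper_norm1 f p : rep1 f p -> Hper_norm L 1 f ^+ 2 = n0 p p.
move=> h; have [[mf' hf] [w e]] := (h, rep_weak h); have [_ mw] := weak_mf w; have [md sd] := dv_sq dp p.
have mp := fn_mf dp p; rewrite Hper_norm_sum big_ord_recr big_ord1 /n0 l0E d0E.
have -> : wD (@ord0 0) f = f by []. have -> : wD (@ord_max 1) f = wD 1 f by [].
rewrite (L2norm_open L0 mf') ?(L2norm_open L0 mw); last 2 first.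
- by apply: (sq_ae _ (dv_sq dp p) mw) => //; apply: ae_imp e => t.
- by apply: (sq_ae _ (fn_sq dp p) mf') => //; apply: ae_imp hf => t.
by congr (_ + _); apply: I_ae => //; try exact: mfX; [apply: ae_imp hf => t ->|apply: ae_imp e => t ->].
Qed.

Lemma Hper_norm2 f p : rep1 f p -> n0 p p <= Hper_norm L 2 f ^+ 2.
by move=> h; rewrite -(Hper_norm1 h) !Hper_norm_sum [leRHS]big_ord_recr /= lerDl sqr_ge0.
Qed.

Let i1 : 'I_2 := lift ord0 ord0.
Lemma ord2P (P : 'I_2 -> Prop) : P ord0 -> P i1 -> forall i, P i.
by move=> h0 h1 i; case: (unliftP ord0 i) => [j ->|->] //; rewrite ord1. Qed.

Definition rep v x := rep1 (vcoord v ord0) x.1 /\ rep1 (vcoord v i1) x.2.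
Definition n2 x := n0 x.1 x.1 + n0 x.2 x.2.
Definition iota x t : 'cV[R]_2 := vec2 (fn x.1 t) (fn x.2 t).
(** A chosen left inverse of [iota], determined up to a change of the stored derivatives. *)
Definition rho v := xget 0 (rep v).

Lemma repD v w x y : rep v x -> rep w y -> rep (v + w) (x + y).
by move=> [a1 a2] [b1 b2]; split; [have := rep1D a1 b1|have := rep1D a2 b2]; congr rep1; apply/funext => t; rewrite /vcoord /= mxE.
Qed.
Lemma repZ c v x : rep v x -> rep (c *: v) (c *: x).
by move=> [a1 a2]; split; [have := rep1Z c a1|have := rep1Z c a2]; congr rep1; apply/funext => t; rewrite /vcoord /= mxE.
Qed.
Lemma repB v w x y : rep v x -> rep w y -> rep (v - w) (x - y).
by move=> h1 h2; rewrite -[- w]scaleN1r -[- y]scaleN1r; apply: repD => //; exact: repZ. Qed.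
Lemma rep_iota x : rep (iota x) x.
by split; [have := rep1_fn x.1|have := rep1_fn x.2]; congr rep1; apply/funext => t; rewrite /vcoord mxE. Qed.
Lemma rep_sum (k : nat) (V : 'I_k -> R -> 'cV[R]_2) (X : 'I_k -> E * E) : (forall i, rep (V i) (X i)) ->
  rep (\sum_i V i) (\sum_i X i).
move=> h; elim/big_ind2: _ => [|v x w y|i _]; [|exact: repD|exact: h].
by have := repZ 0 (rep_iota 0); rewrite !scale0r.
Qed.

Lemma vHper1 v : vHper L 1 v <-> exists x, rep v x.
split=> [h|[x [h0 h1]] i]; last by apply/Hper1; move: i; apply: ord2P; [exists x.1|exists x.2].
have [p hp] := (Hper1 _).1 (h ord0); have [r hr] := (Hper1 _).1 (h i1).
by exists (p, r).
Qed.
Lemma rep_rho v : vHper L 1 v -> rep v (rho v).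
by move=> /vHper1 [x hx]; rewrite /rho; case: xgetP => [z _ //|/(_ x)]. Qed.
Lemma rep_in v x : rep v x -> vHper L 1 v. by move=> h; apply/vHper1; exists x. Qed.

Lemma vnorm_rep v x : rep v x -> vHper_norm L 1 v = Num.sqrt (n2 x).
by move=> [h0 h1]; rewrite /vHper_norm !big_ord_recl big_ord0 addr0 (Hper_norm1 h0) (Hper_norm1 h1). Qed.

Lemma rep_uniq v x y : rep v x -> rep v y -> fn x.1 =1 fn y.1 /\ fn x.2 =1 fn y.2.
by move=> [a1 a2] [b1 b2]; split; [exact: rep1_uniq a1 b1|exact: rep1_uniq a2 b2]. Qed.

Lemma per_parts r u : I `[0, L] (fun t => dv r t * fn u t) + I `[0, L] (fun t => fn r t * dv u t) = 0.
have [_ H] := ACM (fn_AC dp r) (fn_AC dp u); rewrite -I_D //; last 2 first.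
- by apply: sqM => //; [exact: (dv_sq dp)|exact: (fn_sq dp)].
- by apply: sqM => //; [exact: (fn_sq dp)|exact: (dv_sq dp)].
by rewrite -H ?ltW //; have := fn_per dp r 0; have := fn_per dp u 0; rewrite !add0r => -> ->; rewrite subrr.
Qed.

Lemma d0_weak f p r u : rep1 f p -> rep1 (wD 1 f) r -> d0 p u = - I `[0, L] (fun t => dv r t * fn u t).
move=> hf [_ er]; have [_ e1] := rep_weak hf; have := per_parts r u.
have <- : d0 p u = I `[0, L] (fun t => fn r t * dv u t); last by lra.
have [mp _] := dv_sq dp p; have [mu _] := dv_sq dp u; apply: I_ae => //; [exact: mfM|by apply: mfM => //; exact: (fn_mf dp)|].
by apply: ae_imp (ae_and e1 er) => t [<- <-].
Qed.

End Representatives.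

(** * Domain of the linear operator in the energy space *)

Section Generator.
Context {R : realType}.
Variables (L : R) (L0 : 0 < L).
Notation E := (H1 `[0, L] L).
Implicit Types (f : R -> R) (p r u x g v : E) (t c : R).
Let dp := domain_per L0.
Variables (q dq : R -> R).
Hypotheses (hq : bdd q) (hdq : bdd dq) (qAC : AC q dq)
  (pq : forall t, q (t + L) = q t) (pdq : forall t, dq (t + L) = dq t).

Let qmul_hp p : hp `[0, L] L (fun t => q t * fn p t, fun t => dq t * fn p t + q t * dv p t).
have [[mq [M _ HM]] [md [N _ HN]]] := (hq, hdq).
split=> /= [||| t|t]; rewrite ?pq ?pdq ?(fn_per dp) ?(dv_per dp) //.
- exact: ACM qAC (fn_AC dp p).
- by apply: (sq_bounded (ms_itv _) mq (fun t _ => HM t)); exact: (fn_sq dp).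
- apply: sqD => //; first by apply: (sq_bounded (ms_itv _) md (fun t _ => HN t)); exact: (fn_sq dp).
  by apply: (sq_bounded (ms_itv _) mq (fun t _ => HM t)); exact: (dv_sq dp).
Qed.
(** The state space being of first order, the operator must map into it; the differentiability of
    the potential makes multiplication by [q] do so. *)
Definition qmul p : E := H1_mk (qmul_hp p).

Lemma generator_fwd f x : rep1 f x -> Hper L 3 f ->
  exists2 g, rep1 (fun t => - wD 2 f t + q t * f t) g & forall v, qf q x v = l0 g v.
move=> fx /(Hper_next L0) [_ _ /(Hper_next L0) [r hr /(Hper_next L0) [s hs _]]].
have [_ e2] := rep_weak L0 hr; have [ms' es'] := hs; exists (qmul x - s).
  split; first by apply: mfD; [apply: mfN|apply: mfM; [case: hq|case: fx]].
  by case: fx => _ ef; apply: ae_imp (ae_and ef es') => t [a1 a2]; rewrite fnB /qmul {1}/fn /= -a1 -a2 addrC.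
move=> v; have [mdr _] := dv_sq dp r; have mv := fn_mf dp v.
have E2 : I `[0, L] (fun t => dv r t * fn v t) = l0 s v.
  apply: I_ae => //; [exact: mfM|by apply: mfM => //; exact: (fn_mf dp)|].
  by apply: ae_imp (ae_and e2 es') => t [<- <-].
have := d0_weak L0 v fx hr; rewrite E2 (bBl (bform_l0 dp)) => E3.
have -> : l0 (qmul x) v = wf q x v by apply: I_eq => t _; rewrite /qmul {1}/fn /= mulrA.
by rewrite /qf; lra.
Qed.

Let prim_per (G : R -> R) : loc G -> (forall t, G (t + L) = G t) -> I `[0, L] G = 0 -> forall t, prim G (t + L) = prim G t.
move=> lG pG G0 t; apply/eqP; rewrite -subr_eq0; have [_ ->] := prim_AC lG; last by rewrite lerDl ltW.
by rewrite I_period // G0.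
Qed.

(* Testing with a primitive of [x' - W - c], where [W' = q x - g], shows [x' = W + c]. *)
Lemma weak_regular x g : (forall v, qf q x v = l0 g v) ->
  exists r, {ae leb R, forall t, dv x t = fn r t} /\ dv r = fun t => q t * fn x t - fn g t.
move=> H; pose F t := q t * fn x t - fn g t.
have cF : continuous F.
  by move=> t; apply: cvgB; [apply: cvgM; [exact: AC_cont qAC t|exact: (fn_cont dp)]|exact: (fn_cont dp)].
have pF t : F (t + L) = F t by rewrite /F pq !(fn_per dp).
have lF := loc_cont cF.
have F0 : I `[0, L] F = 0.
  have := H (per_one L); rewrite /qf.
  have -> : d0 x (per_one L) = 0.
    by transitivity (I `[0, L] (fun=> 0 : R)); [apply: I_eq => t _; rewrite mulr0|exact: I_0].
  rewrite add0r => h; transitivity (wf q x (per_one L) - l0 g (per_one L)); last by rewrite h subrr.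
  rewrite /wf /l0 -(I_B (ms_itv _) (ig_wf dp _ _ hq) (ig_fn dp _ _)).
  by apply: I_eq => t _; rewrite /= /F mulr1 mulr1.
pose W := prim F; have AW : AC W F := prim_AC lF; have cW := AC_cont AW.
have pW : forall t, W (t + L) = W t by exact: prim_per.
have ldx : loc (dv x) by case: (fn_AC dp x).
pose c := L^-1 * I `[0, L] (fun t => dv x t - W t).
have cWc : continuous (fun t => W t + c) by move=> t; apply: cvgD; [exact: cW|exact: cvg_cst].
pose G t := dv x t - (W t + c).
have lG : loc G by apply: locB => //; exact: loc_cont.
have pG t : G (t + L) = G t by rewrite /G pW (dv_per dp).
have G0 : I `[0, L] G = 0.
  have i1 : ig `[0, L] (fun t => dv x t - W t) by apply: igB => //; [case: ldx|exact: ig_itv_cont].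
  transitivity (I `[0, L] (fun t => dv x t - W t) - I `[0, L] (fun=> c)).
    rewrite -I_B //; last by apply: ig_itv_cont => t; exact: cst_continuous.
    by apply: I_eq => t _; rewrite /G; ring.
  by rewrite I_cst ?ltW // subr0 /c mulrAC mulVf ?mul1r ?subrr ?gt_eqF.
have sG : sq `[0, L] G by apply: sqB => //; [exact: (dv_sq dp)|exact: sq_cont].
have AZ := prim_AC lG; have pZ := prim_per lG pG G0.
have zh : hp `[0, L] L (prim G, G) by split=> //=; apply: sq_cont; exact: AC_cont AZ.
have rh : hp `[0, L] L (fun t => W t + c, F).
  split=> //= [|||t]; [|exact: sq_cont|exact: sq_cont|by rewrite pW].
  by apply: AC_ext (ACD AW (AC_cst c)) _ _ => // t; rewrite addr0.
pose z : E := H1_mk zh; pose r : E := H1_mk rh; exists r; split=> //.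
have GG : I `[0, L] (fun t => G t ^+ 2) = 0.
  have i1 := ig_dv dp x z; have i2 : ig `[0, L] (fun t => fn r t * dv z t).
    exact: (sqM (ms_itv _) (fn_sq dp r) (dv_sq dp z)).
  transitivity (d0 x z - I `[0, L] (fun t => fn r t * dv z t)).
    by rewrite -I_B //; apply: I_eq => t _; have -> : dv z t = G t by []; have -> : fn r t = W t + c by []; rewrite /G; ring.
  have := per_parts L0 r z; have := H z; rewrite /qf.
  have -> : I `[0, L] (fun t => dv r t * fn z t) = wf q x z - l0 g z.
    rewrite /wf /l0 -(I_B (ms_itv _) (ig_wf dp _ _ hq) (ig_fn dp _ _)).
    by apply: I_eq => t _; rewrite /r {1}/dv /= /F; ring.
  lra.
have Zc : {ae leb R, forall t, G t = 0}.
  apply: AC_uniq (AZ) _; apply: AC_ext (AC_cst (prim G 0)) _ _ => // t.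
  have step a b : a <= b -> prim G b - prim G a = 0.
    move=> ab; rewrite AZ.2 //; have [C C0 HC] := dm_loc dp a b; have [i1 le1] := HC _ pG sG.
    have s1 : sq `[a, b] (fun=> 1 : R) by apply: sq_cont; exact: cst_continuous.
    have := I_CS (ms_itv _) s1 (conj lG.1 i1).
    have -> : I `[a, b] (fun t => G t ^+ 2) = 0.
      by apply: le_anti; rewrite I_ge0 ?andbT => [|s _]; [rewrite GG mulr0 in le1|exact: sqr_ge0].
    rewrite mulr0 => h; apply/eqP; rewrite -sqrf_eq0 eq_le sqr_ge0 andbT; apply: le_trans h.
    by rewrite le_eqVlt; apply/orP; left; apply/eqP; congr (_ ^+ 2); apply: I_eq => s _; rewrite mul1r.
  have [t0|t0] := leP 0 t; [have := step _ _ t0|have := step _ _ (ltW t0)]; lra.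
by apply: ae_imp Zc => t /eqP; rewrite subr_eq0 => /eqP.
Qed.

(** Elliptic regularity: a weak equation with right-hand side of first order puts [f] into the
    third-order space. *)
Lemma generator_bwd f x g : rep1 f x -> (forall v, qf q x v = l0 g v) ->
  Hper L 3 f /\ {ae leb R, forall t, - wD 2 f t + q t * f t = fn g t}.
move=> fx /weak_regular [r [e1 dr]]; have [w1 h1] := rep_weak L0 fx; have [_ m1] := weak_mf w1.
have r1 : rep1 (wD 1 f) r by split=> //; apply: ae_imp (ae_and h1 e1) => t [-> ->].
have [w2 h2] := rep_weak L0 r1; have [_ m2] := weak_mf w2.
have r2 : rep1 (wD 2 f) (qmul x - g).
  by split=> //; apply: ae_imp h2 => t; rewrite dr.
split; last first.
  by case: r2 => _ h3; case: fx => _ h0; apply: ae_imp (ae_and h3 h0) => t [-> ->]; rewrite fnB /qmul {1}/fn /=; ring.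
apply: (Hper_prev L0 fx); apply: (Hper_prev L0 r1); apply/(Hper1 L0).
by exists (qmul x - g).
Qed.

Variables (e : nat -> E) (lam : nat -> R).
Hypothesis NS : nls_space (@l0 R `[0, L] L) (qf q) e lam (mul3 dp).
Let HE := ns_es NS.

(** The residual functional has a Riesz representative with respect to [qf q]; all coordinates of
    the representative vanish, so it is a null vector. *)
Lemma spectral_weak x g : (forall i, crd (@l0 R `[0, L] L) e g i = lam i * crd (@l0 R `[0, L] L) e x i) ->
  forall v, qf q x v = l0 g v.
move=> h v; have ha := es_a HE; have hl := es_l HE; have a0 := es_a0 HE.
have [r Hr] : exists r, forall v, qf q r v = qf q x v - l0 g v.
  apply: riesz => //; [exact: (es_complete HE)|by split=> [u w|c u]; rewrite ?(bDr ha) ?(bDr hl) ?(bZr ha) ?(bZr hl); ring|].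
  have [M M0 HM] := es_la HE; exists (2 * qf q x x + 2 * (l0 g g * M) + 1).
    by rewrite ltr_wpDl // addr_ge0 ?mulr_ge0 ?l0_ge0 // ltW.
  move=> u; have := form_CS ha a0 x u; have := form_CS hl (es_l0 HE) g u; have := ler_wpM2l (es_l0 HE g) (HM u).
  have := sqr_ge0 (qf q x u + l0 g u); have := a0 u.
  by move: (qf q x u) (l0 g u) (qf q x x) (qf q u u) (l0 g g) (l0 u u) => y1 y2 y3 y4 y5 y6; nra.
have r0 : qf q r r = 0.
  have := coord_inj HE (u := r) (v := 0); rewrite subr0; apply => i.
  have hi := h i; rewrite /crd in hi *; have := Hr (e i).
  rewrite (bC ha r) (bC ha x) !(es_eig HE) (bC hl g) hi subrr => /eqP.
  rewrite mulf_eq0 (gt_eqF (es_pos HE i)) /= => /eqP ->.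
  by rewrite -(scale0r (0 : E)) (bZr hl) mul0r.
by apply/eqP; rewrite -subr_eq0 -Hr (nneg0 v ha a0 r0).
Qed.

Lemma weak_spectral x g i : (forall v, qf q x v = l0 g v) ->
  crd (@l0 R `[0, L] L) e g i = lam i * crd (@l0 R `[0, L] L) e x i.
by move=> h; rewrite /crd -(es_eig HE) (bC (es_a HE)) h (bC (es_l HE)).
Qed.

End Generator.

(** * The semigroup, mild solutions and orbital stability on a period *)

Section MildFlow.
Context {R : realType}.
Variables (L : R) (L0 : 0 < L).
Notation E := (H1 `[0, L] L).
Implicit Types (f : R -> R) (p r g : E) (u v w : R -> 'cV[R]_2) (x y z : E * E) (t s c : R).
Let dp := domain_per L0.
Variables (mu om : R) (V dq : R -> R).
Let q t := mu * V t + om.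
Hypotheses (hq : bdd q) (hdq : bdd dq) (qAC : AC q dq)
  (pq : forall t, q (t + L) = q t) (pdq : forall t, dq (t + L) = dq t).
Hypothesis cq : coercive (qf q) (@n0 R `[0, L] L).
Variables (e : nat -> E) (lam : nat -> R).
Hypothesis NS : nls_space (@l0 R `[0, L] L) (qf q) e lam (mul3 dp).
Let HE := ns_es NS.
Local Notation crd := (crd (@l0 R `[0, L] L) e).
Local Notation a2 := (a2 (qf q : E -> E -> R)).
Local Notation flow := (flow (@l0 R `[0, L] L) e lam).
Local Notation nrm := (vHper_norm L 1).
Local Notation rho := (rho L).
Local Notation nonl := (nonl (mul3 dp)).
Let i1 : 'I_2 := lift ord0 ord0.

Let ceq x y := forall i, crd x.1 i = crd y.1 i /\ crd x.2 i = crd y.2 i.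

(** [flow] chooses from a set that depends on the coordinates of its argument only, so this is an
    equality of elements, not merely up to null vectors. *)
Let flow_ceq t x y : ceq x y -> flow t x = flow t y.
move=> c; rewrite /flow; congr (xget 0 _); apply/funext => z; apply/propext.
by split=> h i; have [] := h i; have [-> ->] := c i.
Qed.

Let ceq_rep v x y : rep v x -> rep v y -> ceq x y.
move=> h1 h2 i; have [e1 e2] := rep_uniq L0 h1 h2.
by split; apply: I_eq => t _; [rewrite e1|rewrite e2].
Qed.

Let n2_a2 : exists2 C : R, 0 < C & forall x, n2 x <= C * a2 x x.
have [c c0 Hc] := cq; exists c^-1; first by rewrite invr_gt0.
by move=> x; rewrite mulrC ler_pdivlMr // mulrC /n2 /a2 mulrDr lerD.
Qed.
Let a2_n2 : exists2 C : R, 0 < C & forall x, a2 x x <= C * n2 x.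
have [M M0 HM] := qf_bbound dp hq; exists M => // x.
by rewrite /n2 /a2 mulrDr lerD //; apply: le_trans (ler_norm _) (HM _).
Qed.
Let n2_ge0 x : 0 <= n2 x. by rewrite addr_ge0 ?n0_ge0. Qed.
Let a2_ge0 x : 0 <= a2 x x. by rewrite addr_ge0 ?(es_a0 HE). Qed.

Let nrm_sq v x : rep v x -> nrm v ^+ 2 = n2 x.
by move=> h; rewrite (vnorm_rep L0 h) sqr_sqrtr. Qed.
Let nrm_ge0 v : 0 <= nrm v. exact: sqrtr_ge0. Qed.

Let nrm_a2 v x : rep v x -> a2 x x = 0 -> nrm v = 0.
move=> h h0; have [C C0 HC] := n2_a2; apply/eqP; rewrite -sqrf_eq0 (nrm_sq h) eq_le n2_ge0 andbT.
by apply: le_trans (HC x) _; rewrite h0 mulr0.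
Qed.
Let nrm_ceq v x : rep v x -> ceq x 0 -> nrm v = 0.
by move=> h /(coord2_inj HE); rewrite subr0; exact: nrm_a2. Qed.
Let nrm_lt d : 0 < d -> exists2 d1 : R, 0 < d1 & forall v x, rep v x -> a2 x x < d1 -> nrm v < d.
move=> d0; have [C C0 HC] := n2_a2; exists (d ^+ 2 / C) => [|v x h]; first by rewrite divr_gt0 // exprn_gt0.
rewrite ltr_pdivlMr // => h1; rewrite (vnorm_rep L0 h) -(ger0_norm (ltW d0)) -sqrtr_sqr ltr_sqrt ?exprn_gt0 //.
by apply: le_lt_trans (HC _) _; rewrite mulrC.
Qed.
Let nrm0_a2 v x : rep v x -> nrm v = 0 -> a2 x x = 0.
move=> h h0; have [C C0 HC] := a2_n2; apply/eqP; rewrite eq_le a2_ge0 andbT.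
by apply: le_trans (HC x) _; rewrite -(nrm_sq h) h0 expr0n mulr0.
Qed.

Let cB p r i : crd (p - r) i = crd p i - crd r i. exact: (crdB HE). Qed.
Let cD p r i : crd (p + r) i = crd p i + crd r i. exact: (crdD HE). Qed.
Let cZ c p i : crd (c *: p) i = c * crd p i. exact: (crdZ HE). Qed.
Let c0' i : crd 0 i = 0. by rewrite -(scale0r (0 : E)) cZ mul0r. Qed.

Let rep_cvg (F : set_system R) (FF : Filter F) (v : R -> R -> 'cV[R]_2) (z : R -> E * E) :
  (forall t, rep (v t) (z t)) ->
  (a2 (z t) (z t) @[t --> F] --> (0 : R)) <-> (nrm (v t) @[t --> F] --> (0 : R)).
move=> h; split=> /cvgrPdist_lt H; apply/cvgrPdist_lt => d d0.
  have [d1 d10 Hd] := nrm_lt d0; apply: filterS (H _ d10) => t.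
  by rewrite !sub0r !normrN !ger0_norm ?a2_ge0 //; exact: Hd.
have [C C0 HC] := a2_n2; have d1 : 0 < Num.min 1 (d / C) by rewrite lt_min ltr01 divr_gt0.
apply: filterS (H _ d1) => t; rewrite !sub0r !normrN !ger0_norm ?a2_ge0 // lt_min => /andP [h1 h2].
apply: le_lt_trans (HC _) _; rewrite -(nrm_sq (h t)) mulrC -ltr_pdivlMr //; apply: le_lt_trans h2.
by rewrite expr2 ler_piMr // ltW.
Qed.

Let lin_rep v g g' : rep1 (fun t => - wD 2 (vcoord v ord0) t + q t * vcoord v ord0 t) g ->
  rep1 (fun t => - wD 2 (vcoord v i1) t + q t * vcoord v i1 t) g' -> rep (lin mu V om v) (g', - g).
move=> h1 h2; have h3 := rep1Z (-1) h1; rewrite scaleN1r in h3.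
have J0 (w : 'cV[R]_2) : (Jmx *m w) ord0 0 = w i1 0.
  by rewrite !mxE !big_ord_recl big_ord0 !mxE /= mul0r mul1r add0r addr0.
have J1 (w : 'cV[R]_2) : (Jmx *m w) i1 0 = - w ord0 0.
  by rewrite !mxE !big_ord_recl big_ord0 !mxE /= mul0r mulN1r !addr0.
split; [have := h2|have := h3]; congr rep1; apply/funext => t; rewrite /vcoord /lin /= ?J0 ?J1 /vwD !mxE /vcoord /q /=.
  by move: (xget _ _ t) (v t i1 0) => a b; ring.
by move: (xget _ _ t) (v t ord0 0) => a b; ring.
Qed.

Lemma nonlin_rep x : rep (nonlin (iota x)) (nonl x).
have h : rep (iota (nonl x)) (nonl x) := rep_iota L0 _; have -> // : nonlin (iota x) = iota (nonl x).
apply/funext => t; apply/matrixP => i j; rewrite ord1 {j}; move: i.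
have e1 : fn (nonl x).1 t = - (fn x.1 t * fn x.1 t * fn x.2 t + fn x.2 t * fn x.2 t * fn x.2 t) by [].
have e2 : fn (nonl x).2 t = fn x.1 t * fn x.1 t * fn x.1 t + fn x.2 t * fn x.2 t * fn x.1 t by [].
by apply: ord2P; rewrite /nonlin /iota /vec2 !mxE !big_ord_recl big_ord0 !mxE /sqnorm !big_ord_recl big_ord0 !mxE ?e1 ?e2 /=; ring.
Qed.

Definition semigroup t v : R -> 'cV[R]_2 := iota (flow t (rho v)).
Let rep_S t v : rep (semigroup t v) (flow t (rho v)). exact: rep_iota. Qed.

(** For the generator: convergence of the quotient fixes the coordinates of its limit, hence a weak
    equation, and regularity places [u] in the third-order space; conversely the coordinates of the
    operator there are [lam i] times those of [u]. *)
Lemma semigroup_C0 : C0_semigroup (vHper L 1) nrm (vHper L 3) (lin mu V om) semigroup.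
have rr v : vHper L 1 v -> rep v (rho v) by exact: rep_rho.
split.
- by move=> t u _ _; exact: (rep_in L0 (rep_S t u)).
- move=> t c u v _ hu hv; have hc : rep (c *: u + v) (c *: rho u + rho v) by apply: repD; [exact: repZ (rr _ hu)|exact: rr].
  have E1 := ceq_rep (rr _ (rep_in L0 hc)) hc.
  apply: nrm_a2 (repB (rep_S t _) (repD (repZ c (rep_S t u)) (rep_S t v))) _.
  by rewrite (flow_ceq t E1); exact: (flow_linear HE).
- move=> t _; have [C C0 HC] := n2_a2; have [M M0 HM] := a2_n2; exists (Num.sqrt (C * M)) => u hu.
  rewrite (vnorm_rep L0 (rep_S t u)) (vnorm_rep L0 (rr _ hu)) -sqrtrM ?mulr_ge0 ?(ltW C0) ?(ltW M0) //; apply: ler_wsqrtr.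
  apply: le_trans (HC _) _; rewrite -mulrA ler_pM2l //; apply: le_trans (flow_le HE _ _) (HM _).
- by move=> u hu; apply: nrm_a2 (repB (rep_S 0 u) (rr _ hu)) _; exact: (flow0 HE).
- move=> s t u _ _ hu; have E1 := ceq_rep (rr _ (rep_in L0 (rep_S t u))) (rep_S t u).
  apply: nrm_a2 (repB (rep_S (s + t) u) (rep_S s (semigroup t u))) _.
  by rewrite (flow_ceq s E1); exact: (flowD HE).
- move=> u hu; apply/(rep_cvg _ (z := fun t => flow t (rho u) - rho u)).
    by move=> t; exact: repB (rep_S t u) (rr _ hu).
  exact: cvg_at_right_filter (flow_cvg HE (rho u)).
move=> u f hu hf; set x := rho u; set y := rho f.
have hx : rep u x := rr _ hu; have hy : rep f y := rr _ hf.
have rc : forall h, rep (h^-1 *: (semigroup h u - u) - f) (h^-1 *: (flow h x - x) - y).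
  by move=> h; apply: repB hy => //; apply: repZ; exact: repB (rep_S h u) hx.
have fwd : vHper L 3 u -> exists g g', [/\ rep (lin mu V om u) (g', - g),
    forall i, crd g i = lam i * crd x.1 i & forall i, crd g' i = lam i * crd x.2 i].
  move=> h3; have [g h1 h2] := generator_fwd L0 hq hdq qAC pq pdq hx.1 (h3 ord0).
  have [g' h1' h2'] := generator_fwd L0 hq hdq qAC pq pdq hx.2 (h3 i1).
  by exists g, g'; split; [exact: lin_rep|move=> i; exact: (weak_spectral NS)|move=> i; exact: (weak_spectral NS)].
have RC := @rep_cvg (0^'+) (at_right_proper_filter 0) _ _ rc.
split=> [H0|[h3 h0]].
  have H := RC.2 H0.
  have hi := flow_generator_inv HE H.
  have w1 : forall p, qf q x.1 p = l0 (- y.2) p.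
    by apply: (spectral_weak NS) => i; rewrite -scaleN1r cZ (hi i).2; ring.
  have w2 : forall p, qf q x.2 p = l0 y.1 p by apply: (spectral_weak NS) => i; exact: (hi i).1.
  have h3 : vHper L 3 u.
    apply: ord2P.
      by have [] := generator_bwd L0 hq hdq qAC pq pdq hx.1 w1.
    by have [] := generator_bwd L0 hq hdq qAC pq pdq hx.2 w2.
  split=> //; have [g [g' [hr c1 c2]]] := fwd h3.
  apply: nrm_ceq (repB hr hy) _ => i; rewrite /= !cB !c0' (hi i).1 (hi i).2 c2.
  by rewrite -[- g]scaleN1r cZ c1; split; ring.
have [g [g' [hr c1 c2]]] := fwd h3; apply: RC.1.
have := @flow_generator _ _ _ _ _ _ HE x (g, g') (fun i => conj (c1 i) (c2 i)).
have d0 := nrm0_a2 (repB hr hy) h0.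
have E1 h : a2 (h^-1 *: (flow h x - x) - (g', - g)) (h^-1 *: (flow h x - x) - (g', - g)) =
   a2 (h^-1 *: (flow h x - x) - y) (h^-1 *: (flow h x - x) - y).
  apply/esym/(a2_eq0 HE); rewrite opprB addrC addrA subrK; exact: d0.
by rewrite (funext E1).
Qed.

Section Solution.
Variables (x : R -> E * E) (A : R).
Hypothesis xA : forall t, 0 <= t -> a2 (x t) (x t) <= A.
Hypothesis xc : forall i, curve (fun t => crd (x t).1 i) (fun t => (fld (@l0 R `[0, L] L) e lam (mul3 dp) (x t) i).1) /\
  curve (fun t => crd (x t).2 i) (fun t => (fld (@l0 R `[0, L] L) e lam (mul3 dp) (x t) i).2).

(** The integral is taken to be [psi t] minus the linear evolution of [psi 0], so the formula is
    immediate and the convergence of Riemann sums is [duhamel]. *)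
Lemma mild_solution : NLS_mild mu V om L (fun t => iota (x t)).
have ri := rep_iota L0; split.
  split=> [t _|t t0 d d0]; first exact: (rep_in L0 (ri _)).
  have [d1 d10 Hd] := nrm_lt d0; have [r r0 Hr] := x_continuous NS xc xA t0 d10; exists r => // s s0 st.
  exact: Hd (repB (ri (x s)) (ri (x t))) (Hr s s0 st).
exists semigroup; first exact: semigroup_C0.
move=> t t0; pose ps s := iota (x s); exists (ps t - semigroup t (ps 0)).
have E0 : flow t (rho (ps 0)) = flow t (x 0) by apply: flow_ceq; exact: ceq_rep (rep_rho L0 (rep_in L0 (ri _))) (ri _).
have rI : rep (ps t - semigroup t (ps 0)) (x t - flow t (x 0)).
  by apply: repB (ri _) _ => //; rewrite -E0; exact: rep_S.
split; [exact: (rep_in L0 rI)| |].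
  move=> d d0; have [d1 d10 Hd] := nrm_lt d0.
  have [r rp Hr] := duhamel NS xc xA t0 d10; exists r => // m p tag p0 pm hp'.
  have rs : rep (\sum_(i < m) (p i.+1 - p i) *: semigroup (t - tag i) (nonlin (ps (tag i))))
      (\sum_(i < m) (p i.+1 - p i) *: flow (t - tag i) (nonl (x (tag i)))).
    apply: (rep_sum L0) => i; apply: repZ.
    have <- : flow (t - tag i) (rho (nonlin (ps (tag i)))) = flow (t - tag i) (nonl (x (tag i))).
      by apply: flow_ceq; exact: ceq_rep (rep_rho L0 (rep_in L0 (nonlin_rep _))) (nonlin_rep _).
    exact: rep_S.
  exact: Hd (repB rs rI) (Hr m p tag p0 pm hp').
rewrite [X in _ - X]addrC subrK subrr.
have := repZ 0 (ri 0); rewrite !scale0r => /nrm_ceq -> // i.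
Qed.
End Solution.

Lemma orbital_stability f phi c K : rep1 f phi ->
  (forall p, qf q phi p = l0 (mul3 dp phi phi phi) p) -> 0 < c -> 0 <= K ->
  (forall p, c * qf q p p - K * l0 p phi ^+ 2 <= qf q p p - 3 * l0 (mul3 dp phi phi p) p) ->
  (forall p, c * qf q p p - K * l0 p phi ^+ 2 <= qf q p p - l0 (mul3 dp phi phi p) p) ->
  0 < l0 phi phi -> orbitally_stable mu V om L (fun t => vec2 (f t) 0).
move=> hf pE c0 K0 cP cM pp d d0.
have [d1 d10 Hd] := nrm_lt d0; have [M M0 HM] := a2_n2.
have [s s0 Hs] := stability NS pE c0 K0 cP cM pp d10.
(* [s] bounds a value of [a2], which is at most [M] times the squared Sobolev norm. *)
exists (Num.sqrt (s / M)); first by rewrite sqrtr_gt0 divr_gt0.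
move=> v0 hv; have r0 := rep_rho L0 hv; rewrite (vnorm_rep L0 r0) ltr_sqrt ?divr_gt0 // => hv0.
have ph : rep (fun t => vec2 (f t) 0) (phi, 0).
  have h0 := rep1Z 0 hf; rewrite scale0r in h0.
  by split; [have := hf|have := h0]; congr rep1; apply/funext => t; rewrite /vcoord mxE //= mul0r.
have [x [A [x0 xA xl xe xc]]] := weak_flow NS ((phi, 0) + rho v0).
exists (fun t => iota (x t)); split; first exact: (mild_solution xA xc).
  have [h1 h2] := repD ph r0; case: h1 => _ h1; case: h2 => _ h2.
  apply: ae_imp (ae_and h1 h2) => t [a1 b1]; apply/matrixP => i j; rewrite ord1 {j}; move: i.
  by apply: ord2P; rewrite x0 !mxE /=; [rewrite -a1|rewrite -b1]; rewrite /vcoord /= !mxE.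
move=> t t0; have xk := x_continuous NS xc xA.
have [|g Hg] := Hs ((phi, 0) + rho v0) _ x x0 xl xe xk t t0.
  rewrite addrAC subrr add0r; apply: le_lt_trans (HM _) _; by rewrite mulrC -ltr_pdivlMr.
set S := (X in inf X < _).
have Sg : S (vHper_norm L 1 (fun s => iota (x t) s - Rot g *m vec2 (f s) 0)) by exists g.
have Sb : has_lbound S by exists 0 => _ [g' _ <-].
apply: le_lt_trans (ge_inf Sb Sg) _.
have rg : rep (fun s => Rot g *m vec2 (f s) 0) (rot g (phi, 0)).
  have h1 := rep1Z (cos g) hf; have h2 := rep1Z (- sin g) hf; rewrite /rot /= !scaler0 !addr0.
  by split; [have := h1|have := h2]; congr rep1; apply/funext => r;
    rewrite /vcoord !mxE !big_ord_recl big_ord0 !mxE /= mulr0 !addr0.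
exact: Hd (repB (rep_iota L0 _) rg : rep (fun s => iota (x t) s - Rot g *m vec2 (f s) 0) _) Hg.
Qed.

End MildFlow.

(** * The periodic pulses satisfy the assumptions of the stability criterion *)

Section Assembly.
Context {R : realType}.
Implicit Types (f g q V : R -> R) (t x M : R).

Lemma cont_per_bdd f (T : R) : 0 < T -> continuous f -> (forall x, f (x + T) = f x) -> bdd f.
move=> T0 cf pf; split; first exact: mf_cont.
have [M M0 HM] := cont_bounded 0 T cf; exists M => // x.
by have [y y0 ->] := per_rep x T0; [exact: HM|].
Qed.

Lemma derive1_per f (T : R) : (forall x, derivable f x 1) -> (forall x, f (x + T) = f x) ->
  forall x, derive1 f (x + T) = derive1 f x.
move=> df pf x; have d1 (y : R) : is_derive y 1 f (derive1 f y).
  by rewrite derive1E; apply: DeriveDef.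
have h : is_derive x 1 (fun s : R => s + T) 1.
  by rewrite -[X in is_derive _ _ _ X]addr0; apply: is_deriveD.
have := @is_derive1_comp _ f (fun s : R => s + T) x _ _ (d1 (x + T)) h; rewrite mulr1.
have -> : f \o (fun s => s + T) = f by apply/funext => s /=.
by move=> d2; have [_ e1] := d1 x; have [_ <-] := d2; rewrite -e1.
Qed.

Section Periodic.
Variables (L : R) (L0 : 0 < L).
Notation E := (H1 `[0, L] L).
Implicit Types (phi r u v : E).
Let dp := domain_per L0.

Lemma stationary_weak mu V om f phi : bdd (fun t => mu * V t + om) -> Hper L 2 f -> stationary mu V om f -> rep1 f phi ->
  forall v, qf (fun t => mu * V t + om) phi v = l0 (mul3 dp phi phi phi) v.
move=> hq /(Hper_next L0) [_ _ /(Hper_next L0) [r hr _]] st hf v.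
have [_ e2] := rep_weak L0 hr; have [mf' ef] := hf; pose q t := mu * V t + om.
have mq : mf q by case: hq.
have [mdr _] := dv_sq dp r; have mv := fn_mf dp v; have mp := fn_mf dp phi.
have i1 : ig `[0, L] (fun t => dv r t * fn v t) := sqM (ms_itv _) (dv_sq dp r) (fn_sq dp v).
transitivity (wf q phi v - I `[0, L] (fun t => dv r t * fn v t)); first by rewrite /qf (d0_weak L0 v hf hr) addrC.
rewrite /wf -(I_B (ms_itv _) (ig_wf dp phi v hq) i1) /l0 fn_mul3; apply: I_ae => //.
- by apply: mfB; [apply: mfM => //; exact: mfM|exact: mfM].
- by do !apply: mfM.
apply: ae_imp (ae_and st (ae_and ef e2)) => t [s1 [a1 a2]]; move: s1; rewrite a1 (a2 : wD 2 f t = _) /q.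
move: (dv r t) (fn phi t) (fn v t) (mu * V t) => z p w k s1.
by apply/eqP; rewrite -subr_eq0; apply/eqP; transitivity ((- z + k * p + om * p - p ^+ 3) * w); [ring|rewrite s1 mul0r].
Qed.

Lemma qf_sq q (k : R) phi u : bdd q -> qf (fun x => q x - k * fn phi x ^+ 2) u u = qf q u u - k * l0 (mul3 dp phi phi u) u.
move=> hq; rewrite (qfBk dp _ _ _ hq (bdd_sq dp phi)); congr (_ - _ * _).
by apply: I_eq => x _; rewrite fn_mul3; ring.
Qed.

(** If [phi] vanished, [P] would equal [- A] on [[-L/6, L/6]]; but [P] has at least half of its mass
    there and [A] at most a quarter of it. *)
Lemma pulse_nonzero (P : H1 [set: R] 0) phi (A : E) (chi : R -> R) :
  I setT (fun x => fn P x ^+ 2) <= I `[- (L / 6), L / 6] (fun x => fn P x ^+ 2) + l0 P P / 2 ->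
  (forall x, `|x| <= L / 6 -> chi x = 1) -> (forall x, `|x| <= L / 2 -> fn phi x = chi x * fn P x + fn A x) ->
  0 < l0 P P -> n0 A A <= l0 P P / 4 -> 0 < l0 phi phi.
move=> tM chi1 phiE PP Ae; rewrite lt_def l0_ge0 andbT; apply/eqP => /(per_l0_eq0 L0) phi0.
have cA : continuous (fun x => fn A x ^+ 2) by move=> x; apply: cvgM; exact: (fn_cont dp).
have L6 : L / 6 <= L / 2 by have := L0; lra.
have E1 : I `[- (L / 6), L / 6] (fun x => fn P x ^+ 2) = I `[- (L / 6), L / 6] (fun x => fn A x ^+ 2).
  apply: I_eq => x; rewrite /= in_itv /= -ler_norml => x6; have := phiE x (le_trans x6 L6).
  rewrite phi0 chi1 // mul1r /= => h; have -> : fn P x = - fn A x by lra.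
  by rewrite sqrrN.
have h1 : I `[- (L / 6), L / 6] (fun x => fn A x ^+ 2) <= I `[0 - L / 2, 0 + L / 2] (fun x => fn A x ^+ 2).
  apply: I_subset => //; [|exact: ig_itv_cont|by move=> x _; exact: sqr_ge0].
  by move=> x; rewrite /= !in_itv /= sub0r add0r; lra.
rewrite (I_win L0 0) -?l0E in h1; [|exact: loc_cont|by move=> x; rewrite (fn_per dp)].
by move: tM h1; rewrite E1 -l0E; have := l0_le_n0 A; lra.
Qed.

End Periodic.
End Assembly.

Theorem corollary8p21 (R : realType) (T mu om0 : R) (V psi0 : R -> R)
    (nu : R) (psit : nat -> R -> R -> R)
    (N0 : nat) (chi a psi_per : nat -> R -> R)
    (hT : 0 < T)
    (hV : C1 V) (hVper : forall x : R, V (x + T) = V x)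
    (hpsi0 : Hline 2 psi0)
    (hpsi0_sol : stationary mu V om0 psi0)
    (hpsi0_nd : nondegenerate_solution mu V om0 psi0)
    (hLplus : one_negative_eigenvalue (Lplus mu V om0 psi0))
    (hLminus : no_negative_eigenvalue (Lminus mu V om0 psi0))
    (hcont : continuation mu V om0 psi0 nu psit)
    (hslope : 0 < L2inner (psit 1%N om0) psi0)
    (hspec : (spectral_bound (dxx_minus_muV mu V) < om0%:E)%E)
    (hpulse : periodic_pulses T mu V om0 psi0 N0 chi a psi_per) :
  exists2 N : nat, (N0 <= N)%N &
    forall n : nat, (N <= n)%N ->
      orbitally_stable mu V om0 (n%:R * T) (fun x => vec2 (psi_per n x) 0).
have [dV cV'] := hV; have cV : continuous V by move=> x; apply: differentiable_continuous; apply/derivable1_diffP.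
have bV := cont_per_bdd hT cV hVper; have pV' := derive1_per dV hVper.
pose q x := mu * V x + om0; pose dq x := mu * derive1 V x.
have hq : bdd q by apply: bddD; [exact: bddZ|exact: bdd_cst].
have hdq : bdd dq by apply: bddZ; exact: cont_per_bdd hT cV' pV'.
have qAC : AC q dq.
  have AV : AC V (derive1 V) by apply: AC_C1 => // x; rewrite derive1E; apply: DeriveDef.
  by apply: AC_ext (ACD (ACZ mu AV) (AC_cst om0)) _ _ => // x; rewrite addr0.
have m0 : mf psi0 by case: hpsi0 => /(_ 0%N isT) /weak_mf [].
have [P [psi0P [PP [cq HP]]]] := pulse_coercive cV bV m0 hpsi0_nd hLplus hLminus hcont hslope hspec.
have [c0 c00 Hc0] := cq.
(* The case [k = K = 0] carries the coercivity of -d^2 + mu V + omega0 itself to the period, where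
   it becomes the energy inner product. *)
have Hk0 u : c0 * n0 u u - 0 * l0 u P ^+ 2 <= qf (fun x => q x - 0 * fn P x ^+ 2) u u.
  rewrite mul0r subr0; have -> // : (fun x => q x - 0 * fn P x ^+ 2) = q by apply/funext => x; rewrite mul0r subr0.
have [e0 e00 [C0 C00 [L0 L01 H0]]] := transfer hq cq (lexx 0) c00 (lexx 0) Hk0.
have [c1 c10 [k1 k10 Hk1]] := HP 1 (or_introl erefl); have [c3 c30 [k3 k30 Hk3]] := HP 3 (or_intror erefl).
have [e1 e10 [C1 C10 [L1 L11 H1']]] := transfer hq cq ler01 c10 k10 Hk1.
have [e3 e30 [C3 C30 [L3 L31 H3]]] := transfer hq cq (ler0n _ 3) c30 k30 Hk3.
have [M M0 HM] := tail (fn_sq (@domain_line R) P).2 (fun x => sqr_ge0 _) (divr_gt0 PP (ltr0n R 2)).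
(* Bound on the squared norm of the rest: three thresholds from [transfer], and the quarter of the
   mass of [P] for [pulse_nonzero]. *)
pose em := Num.min (Num.min e0 e1) (Num.min e3 (l0 P P / 4)).
have em0 : 0 < em by rewrite !lt_min e00 e10 e30 divr_gt0.
have ema : [/\ em <= e0, em <= e1, em <= e3 & em <= l0 P P / 4].
  by rewrite !ge_min !lexx !orbT.
have r0 : 0 < Num.min 1 em by rewrite lt_min ltr01.
have /cvgrPdist_lt /(_ _ r0) [N1 _ HN1] := pulse_rest_cvg hpulse.
have [N2 _ HN2] := pulse_cutoff hpulse.
(* Lower bound for the period; [6 * M] places the bulk of the mass of [P] in [[-L/6, L/6]]. *)
pose Lm := L0 + L1 + L3 + 6 * M.
have Lm0 : 0 <= Lm / T by rewrite divr_ge0 ?(ltW hT) // /Lm; lra.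
exists (N0 + N1 + N2 + Num.bound (Lm / T))%N; first by rewrite -!addnA leq_addr.
move=> n Nn.
have [n0' n1 n2 n3] : [/\ (N0 <= n)%N, (N1 <= n)%N, (N2 <= n)%N & (Num.bound (Lm / T) <= n)%N].
  split; apply: leq_trans Nn; [|rewrite -!addnA addnCA|rewrite -addnA addnCA|exact: leq_addl]; last exact: leq_addr.
    by rewrite -!addnA leq_addr.
  exact: leq_addr.
pose L := n%:R * T; have LLm : Lm <= L.
  have := archi_boundP Lm0; rewrite ltr_pdivrMr // => h; apply: ltW; apply: lt_le_trans h _.
  by rewrite ler_pM2r // ler_nat.
have Lp : 0 < L by move: LLm; rewrite /Lm; lra.
have pL f (x : R) : (forall x : R, f (x + T) = f x) -> f (x + L) = f x :> R.
  by move=> pf; rewrite /L mulrC per_nat.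
have pq x : q (x + L) = q x by rewrite /q (pL V).
have pdq x : dq (x + L) = dq x by rewrite /dq (pL (derive1 V)).
have hper := pulse_H2 hpulse n0'; have [phi hphi _] := Hper_next Lp hper.
have [A hA _] := Hper_next Lp (pulse_rest_H2 hpulse n0').
have hc := HN2 n n2.
have Aem : n0 A A <= em.
  apply: le_trans (Hper_norm2 Lp hA) _; have := HN1 n n1; rewrite /= sub0r normrN.
  have hh := sqrtr_ge0 (\sum_(k < 3) L2norm `]0, L[ (wD k (a n)) ^+ 2); rewrite -/(Hper_norm L 2 (a n)) in hh.
  rewrite ger0_norm // lt_min => /andP [h1 h2]; apply: ltW; apply: le_lt_trans h2.
  by rewrite expr2 ler_piMl // ltW.
have chi01 := cutoff_range hc.
have chi1 (x : R) : `|x| <= L / 6 -> chi n x = 1.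
  by move=> h; apply: (cutoff_one hc); rewrite in_itv /= -ler_norml.
(* The decomposition is given almost everywhere on a half-open interval; continuity extends it to
   every point of the closed one. *)
have phiE (x : R) : `|x| <= L / 2 -> fn phi x = chi n x * fn P x + fn A x.
  rewrite ler_norml => xL; apply/eqP; rewrite -subr_eq0; apply/eqP.
  apply: (@cont_ae_itv R (fun x => fn phi x - (chi n x * fn P x + fn A x)) (- (L / 2)) (L / 2)) xL; first by lra.
    have dp := domain_per Lp; move=> y; apply: cvgB; first exact: (fn_cont dp).
    apply: cvgD; last exact: (fn_cont dp).
    apply: cvgM; last exact: (fn_cont (@domain_line R)).
    have sm : smooth (chi n) := cutoff_smooth hc.
    by have := sm 0%N y => /= /derivable1_diffP /differentiable_continuous.
  have [[_ h1] [_ h2]] := (hphi, hA).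
  apply: ae_imp (ae_and (pulse_form hpulse n0') (ae_and psi0P (ae_and h1 h2))) => y [b1 [b2 [b3 b4]]] /andP [y1 y2].
  rewrite -b3 b1 ?b2 ?b4 ?subrr // in_itv /=; have -> : n%:R / 2 * T = L / 2 by rewrite /L; field.
  by rewrite y2 ltW.
have [em_0 em_1 em_3 em_4] := ema.
have [hL0 hL1 hL3] : [/\ L0 <= L, L1 <= L & L3 <= L] by rewrite /Lm in LLm; clear -LLm M0 L01 L11 L31; split; lra.
have g0 := H0 L Lp phi A (chi n) hL0 pq chi01 chi1 phiE (le_trans Aem em_0).
have g1 := H1' L Lp phi A (chi n) hL1 pq chi01 chi1 phiE (le_trans Aem em_1).
have g3 := H3 L Lp phi A (chi n) hL3 pq chi01 chi1 phiE (le_trans Aem em_3).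
have dp := domain_per Lp; have [B B0 HB] := qf_bbound dp hq.
have cqL : coercive (qf q) (@n0 R `[0, L] L).
  by exists C0 => // u; have := g0 u; rewrite (qf_sq Lp _ _ _ hq) mulr0 !mul0r !subr0.
have [e [lam NS]] := periodic_nls Lp hq cqL.
(* The stability criterion measures coercivity by [qf q] rather than [n0], hence the division by
   [B]; [K] serves L- and L+ at once. *)
pose c := Num.min C1 C3 / B; pose K := 2 * k1 + 2 * k3.
have cB (u : H1 `[0, L] L) : c * qf q u u <= Num.min C1 C3 * n0 u u.
  rewrite /c mulrAC ler_pdivrMr // -mulrA [n0 u u * _]mulrC ler_pM2l ?lt_min ?C10 //.
  exact: le_trans (ler_norm _) (HB u).
apply: (orbital_stability hq hdq qAC pq pdq cqL NS hphi (c := c) (K := K)).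
- exact: (stationary_weak Lp hq hper (pulse_solves hpulse n0') hphi).
- by rewrite divr_gt0 // lt_min C10.
- by rewrite addr_ge0 // mulr_ge0.
- move=> u; have := g3 u; rewrite (qf_sq Lp _ _ _ hq) => h; apply: le_trans h; apply: lerB.
    by apply: le_trans (cB u) _; rewrite ler_wpM2r ?n0_ge0 // ge_min lexx orbT.
  by rewrite ler_wpM2r ?sqr_ge0 // lerDr mulr_ge0.
- move=> u; have := g1 u; rewrite (qf_sq Lp _ _ _ hq) mul1r => h; apply: le_trans h; apply: lerB.
    by apply: le_trans (cB u) _; rewrite ler_wpM2r ?n0_ge0 // ge_min lexx.
  by rewrite ler_wpM2r ?sqr_ge0 // lerDl mulr_ge0.
apply: (@pulse_nonzero R L Lp P phi A (chi n)) => //; last exact: le_trans em_4.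
by rewrite l0E in HM *; apply: HM; move: LLm; rewrite /Lm; lra.
Qed.
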